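(* For every integer $d\geq 4$ there exists a sticky Cantor set in $\mathbb{R}^d$; that is, there exists a (tamely or wildly) embedded Cantor set $C\subset\mathbb{R}^d$ and a number $\epsilon>0$ such that there is no ambient isotopy $h_t\colon\mathbb{R}^d\to\mathbb{R}^d$, $t\in[0,1]$, with $h_0=\mathrm{id}$, $|h_t(x)-x|<\epsilon$ for all $x\in\mathbb{R}^d$ and $t\in[0,1]$, and $h_1(C)\cap C=\emptyset$.
   Context: A Cantor set in $\mathbb{R}^d$ is a subset homeomorphic to the standard middle-thirds Cantor set. A subset $C\subset\mathbb{R}^d$ is called sticky if it cannot be isotoped off of itself by any sufficiently small ambient isotopy, i.e. there is $\epsilon>0$ such that no ambient isotopy of $\mathbb{R}^d$ starting at the identity and moving every point by less than $\epsilon$ at all times ends at a homeomorphism $h_1$ with $h_1(C)\cap C=\emptyset$. *)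

(* Defs.v *)
From HB Require Import structures.
From mathcomp Require Import all_boot all_order all_algebra.
From mathcomp Require Import all_classical all_reals all_analysis.
Set Implicit Arguments. Unset Strict Implicit. Unset Printing Implicit Defensive.
Import Order.TTheory GRing.Theory Num.Theory.
Import numFieldNormedType.Exports.
Local Open Scope classical_set_scope.
Local Open Scope ring_scope.

Definition enorm {R : realType} {d : nat} (v : 'rV[R]_d) : R :=
  Num.sqrt (\sum_(i < d) (v ord0 i) ^+ 2).

Fixpoint cantor_stage {R : realType} (n : nat) : set R :=
  match n with
  | 0%N => `[0, 1]%classic
  | n'.+1 => ((fun x : R => x / 3) @` cantor_stage n')
             `|` ((fun x : R => 2 / 3 + x / 3) @` cantor_stage n')
  end.

Definition middle_thirds_cantor {R : realType} : set R :=
  [set x | forall n, cantor_stage n x].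

Definition homeomorphic_sets {T U : topologicalType} (A : set T) (B : set U) : Prop :=
  exists (f : T -> U) (g : U -> T),
    f @` A = B /\ g @` B = A /\
    (forall x, A x -> g (f x) = x) /\ (forall y, B y -> f (g y) = y) /\
    {within A, continuous f} /\ {within B, continuous g}.

Definition is_cantor_set {R : realType} {d : nat} (C : set 'rV[R]_d) : Prop :=
  homeomorphic_sets (@middle_thirds_cantor R) C.

Definition ambient_isotopy {R : realType} {d : nat} (H : R -> 'rV[R]_d -> 'rV[R]_d) : Prop :=
  {within (`[0, 1]%classic `*` [set: 'rV[R]_d]),
     continuous (fun p : R * 'rV[R]_d => H p.1 p.2)} /\
  (forall x, H 0 x = x) /\
  (forall t, 0 <= t <= 1 ->
     exists g : 'rV[R]_d -> 'rV[R]_d,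
       continuous (H t) /\ continuous g /\ cancel (H t) g /\ cancel g (H t)).

Definition sticky {R : realType} {d : nat} (C : set 'rV[R]_d) : Prop :=
  exists eps : R, 0 < eps /\
    ~ exists H : R -> 'rV[R]_d -> 'rV[R]_d,
        ambient_isotopy H /\
        (forall t x, 0 <= t <= 1 -> enorm (H t x - x) < eps) /\
        (H 1 @` C) `&` C = set0.

(* Main.v *)
Require Import Defs.
From HB Require Import structures.
From mathcomp Require Import all_boot all_order all_fingroup all_algebra.
From mathcomp Require Import all_classical all_reals all_analysis ring lra zify.
Set Implicit Arguments. Unset Strict Implicit. Unset Printing Implicit Defensive.
Import Order.TTheory GRing.Theory Num.Theory.
Import numFieldNormedType.Exports.
Local Open Scope classical_set_scope.
Local Open Scope ring_scope.

(* All coefficients are in F_2.  A set [A] detects a loop if some unitriangular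
   local system on the complement of [A] has the corner matrix 1 + E_(0,n) as its
   monodromy along the loop ([Det]).  If [A] and [B] are separated and H^2 of their
   complements vanishes ([Good]), and [A] detects [k] while [B] detects [l], then
   [A `|` B] detects the commutator of [k] and [l]: arrange the two systems as
   diagonal blocks sharing one index; the obstruction to filling in the other entries
   is an H^2 class, and the commutator of the monodromies is again a corner matrix.

   A frame (a thickened (d-2)-sphere) detects its meridian.  It contains two clasped
   frames, as in Bing doubling, such that the meridian of the large frame is conjugate
   to the commutator of the meridians of the small ones.  Hence the meridian stays
   detected when the construction is iterated, and with suitable hooks the pieces
   shrink to points.  The limit is a Cantor set X all of whose stages A_n detect
   the loop [mu s t].  Let Y, with stages B_n, be a second copy of X for two further
   coordinates, which exist since d >= 4, and let C be the union of X and Y.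

   If a small homeomorphism h moved C off itself, then h(A_n) and B_n would be
   separated for some n, and their union would detect the commutator of the two
   meridians.  But the torus swept out by the two meridians avoids h(A_n) and B_n,
   so that this commutator is trivial. *)

(** * Cochains on small simplices *)

(** Commutators vanish in homology, and fundamental groups of complements would call for van Kampen
    arguments; unitriangular systems, recorded on pairs of nearby points, see iterated commutators
    by plain matrix algebra, with matrices that grow at each step. Apart from the count of
    coordinates, d >= 4 enters through H^2: one Mayer-Vietoris piece of the complement of a frame is
    the outside of a box, a (d-1)-sphere up to homotopy. Clasped children alone still reach from end
    to end of their parent, so iteration would shrink nothing. The hooks act on a frame of length 20
    + N in one direction: each child misses one unit at one end, and after N generations all pieces
    have length at most 20. This is done for all directions but [s] and [t], and one very thin
    generation then makes the pieces small in [s] and [t] too. Both sets are stretched by 100 in the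
    directions outside their own meridian plane. Near the torus, whose coordinates are at most 3,
    only the walls near |x_s| = 1 remain of a set, and the meridian of the other set keeps x_s =
    0. *)

Section Coboundary.
Context {T : Type}.
Implicit Types (f g : seq T -> bool) (s : seq T).

Definition lsub (r s : seq T) := forall x, List.In x r -> List.In x s.

(** Over F_2 the alternating sum over the faces loses its signs. A sequence is a simplex with
    ordered vertices, and a cochain is a function on all sequences. The empty sequence is the
    (-1)-simplex, so the resulting cohomology is reduced. *)
Fixpoint cob f s : bool :=
  if s is x :: s' then f s' (+) cob (fun r => f (x :: r)) s' else false.

Lemma cob_congr f g s :
  (forall r, size r = (size s).-1 -> lsub r s -> f r = g r) -> cob f s = cob g s.
Proof.
elim: s f g => // x s IH f g fg /=.
rewrite (fg s) //; last by move=> y ys; right.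
case: s IH fg => // z s IH fg.
congr (_ (+) _); apply: IH => r rs rsub; apply: fg; first by rewrite /= rs.
by move=> y [->|/rsub]; [left|right].
Qed.

Lemma cobD f g s : cob (fun r => f r (+) g r) s = cob f s (+) cob g s.
Proof.
elim: s f g => // x s IH f g /=.
by rewrite IH addbACA.
Qed.

Lemma cob_cob f s : cob (cob f) s = false.
Proof.
elim: s f => // x s IH f /=.
by rewrite cobD IH addbF addbb.
Qed.

Lemma cob_false s : cob (fun=> false) s = false.
Proof. by elim: s => // x s IH /=; rewrite IH. Qed.

Lemma cob_map f (h : T -> T) s : cob (fun r => f (map h r)) s = cob f (map h s).
Proof. by elim: s f => // x s IH f /=; rewrite (IH (fun r => f (h x :: r))). Qed.

(** The classical prism operator: [f] is summed over the simplices g0 x_0, ..., g0 x_i, g1 x_i, ...,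
    g1 x_n. [prismP] is the chain homotopy identity. *)
Fixpoint prism (g0 g1 : T -> T) f s : bool :=
  if s is x :: s' then
    f (g0 x :: map g1 s) (+) prism g0 g1 (fun r => f (g0 x :: r)) s'
  else false.

Lemma prismD (g0 g1 : T -> T) f g s :
  prism g0 g1 (fun r => f r (+) g r) s = prism g0 g1 f s (+) prism g0 g1 g s.
Proof.
elim: s f g => // x s IH f g /=.
by rewrite IH addbACA.
Qed.

Lemma prismP (g0 g1 : T -> T) f s :
  cob (prism g0 g1 f) s (+) prism g0 g1 (cob f) s = f (map g0 s) (+) f (map g1 s).
Proof.
elim: s f => [|x s IH] f /=; first by rewrite addbb.
rewrite cobD prismD (cob_map (fun r => f (g0 x :: g1 x :: r))).
have /= := IH (fun r => f (g0 x :: r)).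
set a := cob (prism _ _ _) s; set b := prism _ _ (cob _) s.
set c := f (g0 x :: map g0 s); set d := f (g0 x :: map g1 s).
set e := prism _ _ _ s; set k := cob _ (map g1 s); set l := f _.
by case: a; case: b; case: c; case: d; case: e; case: k; case: l.
Qed.

Lemma prism_false (g0 g1 : T -> T) f s :
  (forall r, size r = (size s).+1 ->
     lsub r (map g0 s ++ map g1 s) -> f r = false) -> prism g0 g1 f s = false.
Proof.
elim: s f => // x s IH f H /=.
rewrite H /=; last 2 first.
- by rewrite size_map.
- move=> y /= [->|[->|ys]]; [by left | |]; right; apply: List.in_or_app; right.
    by left.
  by right.
rewrite IH // => r rs rsub; apply: H; first by rewrite /= rs.
move=> y [<-|/rsub]; [by left|].
move=> /(@List.in_app_or _ _ _ _)[yin|yin]; right; apply: List.in_or_app.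
  by left.
by right; right.
Qed.

End Coboundary.

(** * Cohomology of small simplices: homotopy invariance and Mayer-Vietoris *)

Section Vanishing.
Context {R : realType} {d : nat}.
Notation T := 'rV[R]_d.
Implicit Types (Z : set T) (e : R) (s : seq T) (f u : seq T -> bool).

Definition cl e (x y : T) := forall k, `|x ord0 k - y ord0 k| < e.

Lemma clC e x y : cl e x y -> cl e y x.
Proof. by move=> H k; rewrite distrC. Qed.

Lemma cl_le e e' x y : e <= e' -> cl e x y -> cl e' x y.
Proof. by move=> le H k; apply: lt_le_trans (H k) le. Qed.

Lemma cl_refl e x : 0 < e -> cl e x x.
Proof. by move=> e0 k; rewrite subrr normr0. Qed.

Lemma cl_trans e e' x y z : cl e x y -> cl e' y z -> cl (e + e') x z.
Proof.
move=> H H' k; apply: le_lt_trans (ler_distD (y ord0 k) _ _) _.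
exact: ltrD.
Qed.

(** Simplices of the Vietoris-Rips complex of [Z] at scale [e], with repeated vertices allowed. As
    in Alexander-Spanier cohomology only the behaviour as the scale tends to 0 counts, so a
    primitive may be valid at a smaller scale than its cocycle. *)
Definition small e Z s :=
  (forall x, List.In x s -> Z x) /\
  (forall x y, List.In x s -> List.In y s -> cl e x y).

Lemma small_sub e Z r s : lsub r s -> small e Z s -> small e Z r.
Proof. by move=> rs [H1 H2]; split=> [x /rs|x y /rs xs /rs]; [exact: H1|exact: H2]. Qed.

Lemma small_le e e' Z Z' s : e <= e' -> Z `<=` Z' -> small e Z s -> small e' Z' s.
Proof.
move=> le ZZ' [H1 H2]; split=> [x xs|x y xs ys]; first exact: ZZ' (H1 x xs).
exact: cl_le le (H2 x y xs ys).
Qed.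

Definition coc k Z e f := forall s, size s = k.+1 -> small e Z s -> cob f s = false.
Definition cbd k Z e f u := forall s, size s = k -> small e Z s -> f s = cob u s.

(* Degree [k] counts vertices: [van 3] is the vanishing of reduced H^2. *)
Definition van k Z Z' := forall f e, 0 < e -> coc k Z e f ->
  exists u e', 0 < e' /\ cbd k Z' e' f u.

Lemma van_sub k (Z Z0 Z' Z0' : set T) :
  Z `<=` Z0 -> Z0' `<=` Z' -> van k Z Z' -> van k Z0 Z0'.
Proof.
move=> s1 s2 H f e e0 cf.
case: (H f e e0); first by move=> s ss sm; apply: cf => //; exact: small_le sm.
move=> u [e' [e'0 Hu]]; exists u, e'; split=> // s ss sm; apply: Hu => //.
exact: small_le sm.
Qed.

Lemma van0 k Z : (forall x, ~ Z x) -> van k.+1 Z Z.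
Proof.
move=> Z0 f e e0 _; exists (fun=> false), 1; split=> // -[|x s] // _ [H _].
by case: (Z0 x); apply: H; left.
Qed.

Lemma van_nonempty Z x : Z x -> van 0 Z Z.
Proof.
move=> Zx f e e0 cf; exists (fun=> false), 1; split=> // -[|//] _ _ /=.
have := cf [:: x] erefl; rewrite /= addbF; apply; split.
  by move=> y [<-|[]].
by move=> y z [<-|[]] [<-|[]]; exact: cl_refl.
Qed.

(** When [g0] and [g1] are close, the prism over a small simplex consists of small simplices. The
    cocycle condition removes one term of the prism identity and leaves a coboundary. *)
Lemma homotopy_step Z (g0 g1 : T -> T) k f e e' : coc k Z e f ->
  (forall x, Z x -> Z (g0 x)) -> (forall x, Z x -> Z (g1 x)) ->
  (forall x y, Z x -> Z y -> cl e' x y ->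
     [/\ cl e (g0 x) (g0 y), cl e (g0 x) (g1 y) & cl e (g1 x) (g1 y)]) ->
  forall s, size s = k -> small e' Z s ->
  f (map g0 s) (+) f (map g1 s) = cob (prism g0 g1 f) s.
Proof.
move=> cf Zg0 Zg1 H s ss [sZ scl].
rewrite -prismP prism_false ?addbF // => r rs rsub.
apply: cf; first by rewrite rs ss.
have inr x : List.In x r -> exists2 y, List.In y s & x = g0 y \/ x = g1 y.
  move=> /rsub /(@List.in_app_or _ _ _ _)[].
    by move=> /List.in_map_iff[y [<- ys]]; exists y => //; left.
  by move=> /List.in_map_iff[y [<- ys]]; exists y => //; right.
split=> [x /inr[y /sZ Zy [->|->]]|x y /inr[x' xs xE] /inr[y' ys yE]].
- exact: Zg0.
- exact: Zg1.
- have [A B C] := H _ _ (sZ _ xs) (sZ _ ys) (scl _ _ xs ys).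
  have [A' B' C'] := H _ _ (sZ _ ys) (sZ _ xs) (scl _ _ ys xs).
  by case: xE yE => [->|->] [->|->] //; exact: clC.
Qed.

Definition deforms Z (F : R -> T -> T) (C : R) :=
  [/\ 0 < C, forall x, Z x -> F 0 x = x,
      forall (a : R) x, 0 <= a <= 1 -> Z x -> Z (F a x),
      forall (a e : R) x y, 0 <= a <= 1 -> 0 < e -> Z x -> Z y -> cl e x y ->
        cl (C * e) (F a x) (F a y) &
      forall (a b : R) x (e : R), 0 <= a <= 1 -> 0 <= b <= 1 -> Z x -> `|a - b| < e ->
        cl (C * e) (F a x) (F b x)].

Lemma homotopy Z F C k f e : deforms Z F C -> 0 < e -> coc k Z e f ->
  exists u e', 0 < e' /\ forall s, size s = k -> small e' Z s ->
    f s = f (map (F 1) s) (+) cob u s.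
Proof.
move=> [C0 F0 FZ Fx Ft] e0 cf.
(* With mesh and time step below [c], two consecutive stages of the homotopy span simplices of size
   at most 2 C c = e. *)
pose c := e / (C * 2).
have c0 : 0 < c by rewrite divr_gt0 // mulr_gt0.
have Cc : C * c + C * c = e by rewrite /c; field; rewrite gt_eqF.
have [N [N0 HN]] : exists N : nat, (0 < N)%N /\ N%:R^-1 < c.
  exists (Num.truncn c^-1).+1; split=> //.
  rewrite invf_plt ?posrE ?ltr0n //.
  exact: truncnS_gt.
have step a b : 0 <= a <= 1 -> 0 <= b <= 1 -> `|a - b| < c ->
    forall s, size s = k -> small c Z s ->
    f (map (F a) s) (+) f (map (F b) s) = cob (prism (F a) (F b) f) s.
  move=> a01 b01 ab s ss sm; apply: homotopy_step cf _ _ _ s ss sm.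
  - by move=> x; exact: FZ.
  - by move=> x; exact: FZ.
  - move=> x y Zx Zy xy; split.
    + apply: cl_le (Fx _ _ _ _ a01 c0 Zx Zy xy).
      by rewrite -Cc lerDl ltW // mulr_gt0.
    + rewrite -Cc; apply: cl_trans (Fx _ _ _ _ a01 c0 Zx Zy xy) _.
      exact: Ft.
    + apply: cl_le (Fx _ _ _ _ b01 c0 Zx Zy xy).
      by rewrite -Cc lerDl ltW // mulr_gt0.
have ind n : (n <= N)%N -> exists u, forall s, size s = k -> small c Z s ->
    f s = f (map (F (n%:R / N%:R)) s) (+) cob u s.
  elim: n => [|n IH] nN.
    exists (fun=> false) => s ss [sZ _]; rewrite mul0r cob_false addbF.
    congr (f _); elim: s {ss} sZ => //= x s IHs sZ.
    rewrite F0; last by apply: sZ; left.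
    by congr (_ :: _); apply: IHs => y ys; apply: sZ; right.
  case: IH => [|u Hu]; first exact: ltnW.
  exists (fun r => u r (+) prism (F (n%:R / N%:R)) (F (n.+1%:R / N%:R)) f r) => s ss sm.
  have in01 m : (m <= N)%N -> 0 <= (m%:R / N%:R : R) <= 1.
    by move=> mN; rewrite divr_ge0 ?ler0n // ler_pdivrMr ?ltr0n // mul1r ler_nat.
  rewrite cobD -step //; [|exact: in01 (ltnW _)|exact: in01|].
    rewrite (Hu s ss sm).
    by case: (f _); case: (cob _ _); case: (f _).
  rewrite -mulrBl -addn1 natrD opprD addrA subrr sub0r mulN1r normrN.
  by rewrite ger0_norm ?invr_ge0 ?ler0n.
have [//|u Hu] := ind N.
exists u, c; split=> // s ss sm; rewrite {1}(Hu s ss sm) divff //.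
by rewrite pnatr_eq0 -lt0n.
Qed.

Lemma van_deform Z Z1 F C k : deforms Z F C -> (forall x, Z x -> Z1 (F 1 x)) ->
  Z1 `<=` Z -> van k Z1 Z1 -> van k Z Z.
Proof.
move=> dF FZ1 Z1Z v1 f e e0 cf.
have [u [e1 [e10 Hu]]] := homotopy dF e0 cf.
have [u' [e2 [e20 Hu']]] := v1 f e e0 (fun s ss sm => cf s ss (small_le (lexx _) Z1Z sm)).
case: dF => C0 _ FZ Fx _.
exists (fun r => u r (+) u' (map (F 1) r)), (Num.min e1 (e2 / C)); split.
  by rewrite lt_min e10 divr_gt0.
move=> s ss sm; rewrite cobD cob_map addbC.
rewrite (Hu s ss); last by apply: small_le sm => //; rewrite ge_min lexx.
rewrite Hu' ?size_map //.
case: sm => sZ scl; split.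
  by move=> x /List.in_map_iff[y [<- /sZ]]; exact: FZ1.
move=> x y /List.in_map_iff[x' [<- xs]] /List.in_map_iff[y' [<- ys]].
have -> : e2 = C * (e2 / C) by field; rewrite gt_eqF.
apply: Fx; rewrite ?ler01 ?lexx ?divr_gt0 //; [exact: sZ|exact: sZ|].
by apply: cl_le (scl _ _ xs ys); rewrite ge_min lexx orbT.
Qed.

Lemma van_point (c : T) k : van k [set c] [set c].
Proof.
move=> f e e0 cf; exists (fun r => f (c :: r)), 1; split=> // s ss [sZ scl].
have cs x : List.In x (c :: s) -> x = c by case=> [//|/sZ].
have : small e [set c] (c :: s) by split=> [x /cs //|x y /cs -> /cs ->]; exact: cl_refl.
move=> /(cf (c :: s)); rewrite /= ss => /(_ erefl).
by case: (f s); case: (cob _ _).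
Qed.

(* Mayer-Vietoris: primitives on the two pieces differ by a cocycle on the intersection. *)
Lemma van_union k Z Z1 Z2 e0 : 0 < e0 ->
  Z1 `<=` Z -> Z2 `<=` Z ->
  (forall s, small e0 Z s -> (forall x, List.In x s -> Z1 x) \/ (forall x, List.In x s -> Z2 x)) ->
  van k.+1 Z1 Z1 -> van k.+1 Z2 Z2 -> van k (Z1 `&` Z2) (Z1 `&` Z2) -> van k.+1 Z Z.
Proof.
move=> e0p Z1Z Z2Z exc v1 v2 v12 f e ep cf.
have [u1 [e1 [e1p H1]]] := v1 f e ep (fun s ss sm => cf s ss (small_le (lexx _) Z1Z sm)).
have [u2 [e2 [e2p H2]]] := v2 f e ep (fun s ss sm => cf s ss (small_le (lexx _) Z2Z sm)).
have [||w [e3 [e3p H3]]] := v12 (fun r => u1 r (+) u2 r) (Num.min e1 e2).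
- by rewrite lt_min e1p.
- move=> s ss sm; rewrite cobD -H1 ?ss // -?H2 ?ss ?addbb //.
    by apply: small_le sm; [rewrite ge_min lexx orbT|move=> x []].
  by apply: small_le sm; [rewrite ge_min lexx|move=> x []].
pose in1 r := `[< forall x, List.In x r -> Z1 x >].
(* Since [w] is a primitive of the difference, [u2'] agrees with [u1] on small simplices of the
   intersection, and the two can be glued. The correction is a coboundary and does not change
   [cob u2]. *)
pose u2' r := u2 r (+) cob w r.
pose u r := if in1 r then u1 r else u2' r.
pose em := Num.min (Num.min e0 e1) (Num.min e2 e3).
have lem : [/\ em <= e0, em <= e1, em <= e2 & em <= e3].
  by rewrite /em; split; rewrite !ge_min ?lexx ?orbT.
case: lem => l0 l1 l2 l3.
exists u, em; split; first by rewrite !lt_min e0p e1p e2p.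
move=> s ss sm.
have [in1s|in2s] := exc s (small_le l0 (@subset_refl _ _) sm).
  rewrite (H1 s ss); last by split=> //; case: (small_le l1 (@subset_refl _ _) sm).
  apply: cob_congr => r _ rs; rewrite /u; case: ifPn => // /negP[].
  by apply/asboolP => x /rs; exact: in1s.
rewrite (H2 s ss); last by split=> //; case: (small_le l2 (@subset_refl _ _) sm).
have -> : cob u2 s = cob u2' s by rewrite cobD cob_cob addbF.
apply: cob_congr => r rsz rs; rewrite /u; case: ifPn => // /asboolP in1r.
rewrite /u2' -H3; first by rewrite addbC -addbA addbb addbF.
  by rewrite rsz ss.
split; first by move=> x xr; split; [exact: in1r|apply: in2s; exact: rs].
by case: (small_sub rs (small_le l3 (@subset_refl _ _) sm)).
Qed.

(* Mayer-Vietoris: the complements of separated sets cover [D] up to small simplices. *)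
Lemma van_complU k (D D1 A B : set T) e0 : 0 < e0 -> D1 `<=` D ->
  (forall x y, A x -> B y -> ~ cl e0 x y) ->
  van k.+1 D D -> van k (D `\` A) (D1 `\` A) -> van k (D `\` B) (D1 `\` B) ->
  van k (D `\` (A `|` B)) (D1 `\` (A `|` B)).
Proof.
move=> e0p D1D sep vD vA vB f e ep cf.
pose off (K : set T) r := `[< forall x, List.In x r -> ~ K x >].
have off_sub K r s : lsub r s -> off K s -> off K r.
  by move=> rs /asboolP H; apply/asboolP => x /rs; exact: H.
(* The connecting homomorphism: [f'] is [f] cut off on simplices that touch B, and [g] is its
   coboundary cut off at A. A small simplex cannot touch both sets, so [g] is a cocycle on all of D.
   If [v] is a primitive of [g], then [f'] + [v] is a cocycle off A, [v] is one off B, and off both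
   sets they add up to [f]. *)
pose f' r := if off B r then f r else false.
pose g r := if off A r then cob f' r else false.
have offAB s : small e0 D s -> off A s \/ off B s.
  move=> [_ scl]; have [|/negP oA] := boolP (off A s); first by left.
  right; apply/asboolP => y ys By; apply: oA; apply/asboolP => x xs Ax.
  exact: sep Ax By (scl _ _ xs ys).
have cobf' r : off B r -> cob f' r = cob f r.
  by move=> oB; apply: cob_congr => q _ qr; rewrite /f' (off_sub _ _ _ qr oB).
have g0 r : size r = k.+1 -> small e D r -> off B r -> g r = false.
  move=> rs rsm oB; rewrite /g; case: ifPn => // oA; rewrite cobf' // cf //.
  split; last by case: rsm.
  move=> x xr; split; first by case: rsm => + _; exact.
  by case; move: xr; [move/asboolP: oA|move/asboolP: oB]; exact.
pose em := Num.min e e0.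
have [lee lee0] : em <= e /\ em <= e0 by rewrite /em !ge_min !lexx orbT.
have emp : 0 < em by rewrite lt_min ep.
have [|v [e1 [e1p Hv]]] := vD g em emp.
  move=> s ss sm; case: (offAB s (small_le lee0 (@subset_refl _ _) sm)) => o.
    rewrite -(cob_cob f' s).
    by apply: cob_congr => r _ rs; rewrite /g (off_sub _ _ _ rs o).
  rewrite -(cob_false s).
  apply: cob_congr => r rsz rs; apply: g0; first by rewrite rsz ss.
    exact: small_le lee (@subset_refl _ _) (small_sub rs sm).
  exact: off_sub rs o.
pose ea := Num.min e1 em.
have eap : 0 < ea by rewrite lt_min e1p.
have [lea lea'] : ea <= e1 /\ ea <= em by split; rewrite /ea ge_min lexx ?orbT.
have [|uA [e2 [e2p HA]]] := vA (fun r => f' r (+) v r) ea eap.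
  move=> s ss [sDA scl]; have oA : off A s by apply/asboolP => x /sDA[].
  rewrite cobD -Hv //; first by rewrite /g oA addbb.
  by split=> [x /sDA[]//|x y xs ys]; apply: cl_le lea (scl _ _ xs ys).
have [|uB [e3 [e3p HB]]] := vB v ea eap.
  move=> s ss [sDB scl]; have oB : off B s by apply/asboolP => x /sDB[].
  rewrite -Hv //.
    apply: g0 => //; split=> [x /sDB[]//|x y xs ys].
    exact: cl_le (le_trans lea' lee) (scl _ _ xs ys).
  by split=> [x /sDB[]//|x y xs ys]; apply: cl_le lea (scl _ _ xs ys).
exists (fun r => uA r (+) uB r), (Num.min e2 e3); split; first by rewrite lt_min e2p.
move=> s ss [sZ scl]; rewrite cobD -HA // -?HB //.
- have oB : off B s by apply/asboolP => x /sZ[_ +] Bx; apply; right.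
  by rewrite /f' oB -addbA addbb addbF.
- split=> [x /sZ[D1x nx]|x y xs ys]; first by split=> // Bx; apply: nx; right.
  by apply: cl_le (scl _ _ xs ys); rewrite ge_min lexx orbT.
- split=> [x /sZ[D1x nx]|x y xs ys]; first by split=> // Ax; apply: nx; left.
  by apply: cl_le (scl _ _ xs ys); rewrite ge_min lexx.
Qed.

End Vanishing.

(** * Homeomorphisms and complements of frames *)

Section Homeomorphisms.
Context {R : realType} {d : nat}.
Notation T := 'rV[R]_d.

Definition cube (r : R) : set T := [set x | forall k, `|x ord0 k| <= r].

Lemma cube_le r r' : r <= r' -> cube r `<=` cube r'.
Proof. by move=> le x H k; apply: le_trans (H k) le. Qed.

(* On R^d this is just continuity, in the form that the combinatorial arguments use. *)
Definition ucb (p : T -> T) :=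
  (forall r e, 0 < e -> exists dl, 0 < dl /\ forall x y, cube r x -> cube r y ->
     cl dl x y -> cl e (p x) (p y)) /\
  (forall r, exists r', forall x, cube r x -> cube r' (p x)).

Record hom := Hom { hf :> T -> T; hi : T -> T;
  hfu : ucb hf; hiu : ucb hi; hfK : cancel hf hi; hiK : cancel hi hf }.

Lemma ucb_comp p q : ucb p -> ucb q -> ucb (p \o q).
Proof.
move=> [pu pb] [qu qb]; split=> [r e e0|r].
  have [r' Hr'] := qb r; have [d1 [d10 H1]] := pu r' e e0.
  have [d2 [d20 H2]] := qu r d1 d10.
  exists d2; split=> // x y xr yr xy; apply: H1; [exact: Hr'|exact: Hr'|exact: H2].
have [r' Hr'] := qb r; have [r2 H2] := pb r'.
by exists r2 => x /Hr' /H2.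
Qed.

Lemma ucb_id : ucb id.
Proof. by split=> [r e e0|r]; [exists e|exists r]. Qed.

Definition hom_id : hom := Hom ucb_id ucb_id (fun=> erefl) (fun=> erefl).

Definition hom_inv (p : hom) : hom := Hom (hiu p) (hfu p) (@hiK p) (@hfK p).

Definition hcomp (p q : hom) : hom :=
  Hom (ucb_comp (hfu p) (hfu q)) (ucb_comp (hiu q) (hiu p))
      (can_comp (@hfK p) (@hfK q)) (can_comp (@hiK q) (@hiK p)).

Definition im (p : hom) (A : set T) : set T := [set x | A (hi p x)].

Lemma im_f (p : hom) A x : A x -> im p A (p x).
Proof. by rewrite /im /= hfK. Qed.

Lemma imP (p : hom) A x : im p A x -> exists2 y, A y & x = p y.
Proof. by move=> H; exists (hi p x) => //; rewrite hiK. Qed.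

Lemma imS (p : hom) A B : A `<=` B -> im p A `<=` im p B.
Proof. by move=> AB x /AB. Qed.

(** Cubes exhaust the space. The loss from [r'] to [r] is what makes the property invariant under
    homeomorphisms, which do not map cubes to cubes. *)
Definition Good (A : set T) :=
  forall r, exists r', van 3 (cube r' `\` A) (cube r `\` A).

Lemma small_map (p : T -> T) (Z Z' : set T) e e' s :
  (forall x, Z x -> Z' (p x)) ->
  (forall x y, Z x -> Z y -> cl e x y -> cl e' (p x) (p y)) ->
  small e Z s -> small e' Z' (map p s).
Proof.
move=> H1 H2 [sZ scl]; split.
  by move=> x /List.in_map_iff[y [<- /sZ]]; exact: H1.
move=> x y /List.in_map_iff[x' [<- xs]] /List.in_map_iff[y' [<- ys]].
by apply: H2; [exact: sZ|exact: sZ|exact: scl].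
Qed.

Lemma Good_im (p : hom) A : Good A -> Good (im p A).
Proof.
move=> gA r.
have [r1 H1] := (hiu p).2 r.
have [r2 v2] := gA r1.
have [r3 H3] := (hfu p).2 r2.
exists r3 => f e e0 cf.
have [e1 [e10 He1]] := (hfu p).1 r2 e e0.
have [|u [e2 [e20 Hu]]] := v2 (fun s => f (map p s)) e1 e10.
  move=> s ss sm; rewrite cob_map; apply: cf; first by rewrite size_map.
  apply: small_map sm => [x [xr nx]|x y [xr _] [yr _]]; last exact: He1.
  by split; [exact: H3|rewrite /im /= hfK].
have [e3 [e30 He3]] := (hiu p).1 r e2 e20.
exists (fun s => u (map (hi p) s)), e3; split=> // s ss sm.
rewrite cob_map -Hu ?size_map //.
  rewrite -map_comp -[LHS]/(f s); congr f.
  by rewrite -[LHS]map_id; apply: eq_map => x /=; rewrite hiK.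
apply: small_map sm => [x [xr nx]|x y [xr _] [yr _]]; last exact: He3.
by split; [exact: H1|].
Qed.

Lemma van_lin (Z Z1 : set T) (g : T -> T) (C r : R) k :
  1 <= C -> Z `<=` cube r -> (forall x, Z x -> cube r (g x)) ->
  (forall (a : R) (x : T), 0 <= a <= 1 -> Z x -> Z ((1 - a) *: x + a *: g x)) ->
  (forall (e : R) (x y : T), 0 < e -> Z x -> Z y -> cl e x y -> cl (C * e) (g x) (g y)) ->
  (forall x, Z x -> Z1 (g x)) -> Z1 `<=` Z -> van k Z1 Z1 -> van k Z Z.
Proof.
move=> C1 Zr gr gZ gl gZ1 Z1Z v1.
pose F (a : R) (x : T) : T := (1 - a) *: x + a *: g x.
case: (pselect (exists z, Z z)) => [[z0 Zz0]|noz]; last first.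
  case: k v1 => [|k] v1; last by apply: van0 => x Zx; apply: noz; exists x.
  move=> f e e0 cf; have [|u [e' [e'0 Hu]]] := v1 f e e0.
    by move=> s ss sm; apply: cf => //; apply: small_le sm.
  exists u, e'; split=> // -[|//] _ _; apply: Hu => //.
(* [D] has to bound the Lipschitz constant in space, which is at most [C], and the speed of the
   points, which is at most the side of the cube. *)
pose D : R := C + (`|r| + `|r|) + 1.
have r0 := normr_ge0 r; have rr := ler_norm r.
have CD : C <= D by rewrite /D; lra.
have D0 : 0 < D by lra.
apply: (@van_deform _ _ Z Z1 F D) => //; last first.
  by move=> x Zx; rewrite /F subrr scale0r add0r scale1r; exact: gZ1.
split=> //.
- by move=> x _; rewrite /F subr0 scale1r scale0r addr0.
- move=> a e x y a01 e0 Zx Zy xy k'; rewrite /F !mxE.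
  have H1 := xy k'; have H2 := gl e x y e0 Zx Zy xy k'.
  rewrite (_ : _ - _ = (1 - a) * (x ord0 k' - y ord0 k') + a * (g x ord0 k' - g y ord0 k')); last by ring.
  apply: le_lt_trans (ler_normD _ _) _; rewrite !normrM.
  rewrite (ger0_norm (_ : 0 <= 1 - a)) ?(ger0_norm (_ : 0 <= a)); [|lra|lra].
  apply: lt_le_trans (_ : C * e <= _); last by rewrite ler_wpM2r // ltW.
  have H3 : `|x ord0 k' - y ord0 k'| < C * e.
    by apply: lt_le_trans H1 _; rewrite ler_peMl // ltW.
  have : (1 - a) * (C * e) + a * (C * e) = C * e by ring.
  have : 0 <= a * (C * e - `|g x ord0 k' - g y ord0 k'|) by apply: mulr_ge0; lra.
  have : 0 <= (1 - a) * (C * e - `|x ord0 k' - y ord0 k'|) by apply: mulr_ge0; lra.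
  case: (ltP a 1) => a1.
    have : 0 < (1 - a) * (C * e - `|x ord0 k' - y ord0 k'|) by apply: mulr_gt0; lra.
    rewrite !mulrBr; lra.
  have -> : a = 1 by lra.
  rewrite subrr !mul0r !mul1r; lra.
- move=> a b x e a01 b01 Zx ab k'; rewrite /F !mxE.
  rewrite (_ : _ - _ = (a - b) * (g x ord0 k' - x ord0 k')); last by ring.
  rewrite normrM; have e0 : 0 < e by apply: le_lt_trans ab.
  have H : `|g x ord0 k' - x ord0 k'| <= D.
    apply: le_trans (ler_normB _ _) _.
    have := gr _ Zx k'; have := Zr _ Zx k'; rewrite /D; lra.
  apply: le_lt_trans (_ : `|a - b| * D < _).
    by rewrite ler_wpM2l.
  by rewrite mulrC ltr_pM2l.
Qed.

Lemma van_star (Z : set T) (c : T) r k : Z `<=` cube r -> Z c ->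
  (forall (a : R) (x : T), 0 <= a <= 1 -> Z x -> Z ((1 - a) *: x + a *: c)) -> van k Z Z.
Proof.
move=> Zr Zc H; apply: (@van_lin Z [set c] (fun=> c) 1 r) => //.
- by move=> x _; exact: Zr.
- by move=> e x y e0 _ _ _; rewrite mul1r; exact: cl_refl.
- by move=> x ->.
- exact: van_point.
Qed.

Lemma conv_le (a b c x : R) : 0 <= a <= 1 -> `|b| <= x -> `|c| <= x ->
  `|(1 - a) * b + a * c| <= x.
Proof.
rewrite !ler_norml => /andP[a0 a1] /andP[b1 b2] /andP[c1 c2].
have := mulr_ge0 a0 (_ : 0 <= x - c); have := mulr_ge0 a0 (_ : 0 <= x + c).
have a1' : 0 <= 1 - a by lra.
have := mulr_ge0 a1' (_ : 0 <= x - b); have := mulr_ge0 a1' (_ : 0 <= x + b).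
move=> /(_ ltac:(lra)) A1 /(_ ltac:(lra)) A2 /(_ ltac:(lra)) A3 /(_ ltac:(lra)) A4.
by apply/andP; split; lra.
Qed.

Lemma van_cube r k : 0 <= r -> van k (cube r) (cube r).
Proof.
move=> r0; apply: (@van_star _ 0 r) => //.
  by move=> k'; rewrite mxE normr0.
move=> a x a01 xr k'; rewrite !mxE; apply: conv_le; [by []|exact: xr|by rewrite normr0].
Qed.

Lemma GoodU (A B : set T) (e0 : R) : 0 < e0 -> (forall x y, A x -> B y -> ~ cl e0 x y) ->
  Good A -> Good B -> Good (A `|` B).
Proof.
move=> e0p sep gA gB r.
have [r1 v1] := gA r; have [r2 v2] := gB r.
pose r' := Num.max (Num.max r r1) (Num.max r2 0).
have [l0 l1 l2 l3] : [/\ r <= r', r1 <= r', r2 <= r' & 0 <= r'].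
  by rewrite /r'; split; rewrite !le_max lexx ?orbT.
exists r'; apply: van_complU e0p _ sep _ _ _.
- exact: cube_le.
- exact: van_cube.
- by apply: van_sub v1 => // x [xr nx]; split=> //; exact: cube_le xr.
- by apply: van_sub v2 => // x [xr nx]; split=> //; exact: cube_le xr.
Qed.

Definition upd (x : T) i (v : R) : T := \row_k (if k == i then v else x ord0 k).

(** * The complement of a frame *)

Section Frames.
Context (t : 'I_d) (l h : 'I_d -> R).

(* A thickened (d-2)-sphere: a box with a hole in the direction [t]. *)
Definition Fr : set T :=
  [set x | (forall k, `|x ord0 k| <= l k) /\ ~ (forall k, k != t -> `|x ord0 k| < h k)].

Context (hl : forall k, 0 < h k < l k).
Context (r : R) (lr : forall k, l k < r).

Let r0 : 0 < r. Proof. by have := hl t; have := lr t; lra. Qed.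
Let l0 k : 0 < l k. Proof. by have := hl k; lra. Qed.

Definition half (i : 'I_d) (b : bool) : set T := [set x | cube r x /\ l i < (-1) ^+ b * x ord0 i].

Definition outside (S : seq 'I_d) : set T :=
  [set x | cube r x /\ exists2 k, k \in S & l k < `|x ord0 k|].

Let face (i : 'I_d) (b : bool) : T := \row_k (if k == i then (-1) ^+ b * r else 0).

Lemma signM1 (b : bool) : (-1) ^+ b * (-1) ^+ b = 1 :> R.
Proof. by case: b; rewrite ?expr0 ?expr1 ?mulrNN mulr1. Qed.

Lemma norm_signM (b : bool) (x : R) : `|(-1) ^+ b * x| = `|x|.
Proof. by rewrite normrM normrX normrN1 expr1n mul1r. Qed.

(** Moving the coordinate [i] to its extreme value deforms [Z] into a face of the cube, which is
    star-shaped. A point already in the half space stays there; any other may move along the axis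
    freely. *)
Lemma van_push (Z : set T) i b k : Z `<=` cube r -> half i b `<=` Z ->
  (forall (x : T) (v : R), Z x -> ~ half i b x -> `|v| <= r -> Z (upd x i v)) -> van k Z Z.
Proof.
move=> Zr hZ Zu.
have rr : `|(-1) ^+ b * r| = r by rewrite norm_signM gtr0_norm.
have updc x v : cube r x -> `|v| <= r -> cube r (upd x i v).
  by move=> xr vr k'; rewrite mxE; case: ifP.
have comb (a : R) (x : T) : (1 - a) *: x + a *: upd x i ((-1) ^+ b * r) =
    upd x i ((1 - a) * x ord0 i + a * ((-1) ^+ b * r)).
  by apply/rowP => k'; rewrite !mxE; case: eqP => [->//|_]; ring.
apply: (@van_lin Z (half i b `&` [set x | x ord0 i = (-1) ^+ b * r])
          (fun x => upd x i ((-1) ^+ b * r)) 1 r) => //.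
- by move=> x Zx; apply: updc; [exact: Zr|rewrite rr].
- move=> a x a01 Zx; rewrite comb.
  have vr : `|(1 - a) * x ord0 i + a * ((-1) ^+ b * r)| <= r.
    by apply: conv_le; [by []|exact: Zr|rewrite rr].
  case: (pselect (half i b x)) => [[xr xi]|nx]; last exact: Zu.
  apply: hZ; split; first exact: updc.
  rewrite mxE eqxx mulrDr [_ * (a * _)]mulrCA mulrA [(-1) ^+ b * (1 - a)]mulrC.
  rewrite -mulrA [(-1) ^+ b * ((-1) ^+ b * r)]mulrA signM1 mul1r.
  have := lr i; move: ((-1) ^+ b * x ord0 i) xi => y ly lri.
  have : 0 <= a * (r - l i) by apply: mulr_ge0; lra.
  have : 0 <= (1 - a) * (y - l i) by apply: mulr_ge0; lra.
  case: (ltP a 1) => a1.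
    have : 0 < (1 - a) * (y - l i) by apply: mulr_gt0; lra.
    rewrite !mulrBr; lra.
  have -> : a = 1 by lra.
  lra.
- move=> e x y e0 _ _ xy k'; rewrite !mxE mul1r; case: ifP => // _.
  by rewrite subrr normr0.
- move=> x Zx; split; last by rewrite /= mxE eqxx.
  split; first by apply: updc; [exact: Zr|rewrite rr].
  by rewrite mxE eqxx mulrA signM1 mul1r.
- by move=> x [/hZ].
- apply: (@van_star _ (face i b) r) => [x [[]]//| |a x a01 [[xr xi] xE]].
    split; last by rewrite /= mxE eqxx.
    split; last by rewrite mxE eqxx mulrA signM1 mul1r.
    by move=> k'; rewrite mxE; case: ifP; rewrite ?rr // normr0 ltW.
  have E : ((1 - a) *: x + a *: face i b) ord0 i = (-1) ^+ b * r.
    by rewrite !mxE eqxx xE; ring.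
  split=> //; split; last by rewrite E mulrA signM1 mul1r.
  move=> k'; rewrite !mxE; apply: conv_le; [by []|exact: xr|].
  by case: ifP; rewrite ?rr // normr0 ltW.
Qed.

Lemma half_disj i x : half i false x -> half i true x -> False.
Proof. by move=> [_]; rewrite expr0 mul1r => A [_]; rewrite expr1 mulN1r; have := l0 i; lra. Qed.

Lemma half_outside i (x : T) : l i < `|x ord0 i| -> cube r x -> half i false x \/ half i true x.
Proof.
move=> li xr; case: (lerP 0 (x ord0 i)) => x0.
  by left; split=> //; rewrite expr0 mul1r; rewrite ger0_norm in li.
by right; split=> //; rewrite expr1 mulN1r; rewrite ltr0_norm in li.
Qed.

(* Adding the two opposite half-spaces of a new coordinate is a suspension. *)
Lemma van_suspension (W Z : set T) i k : W `<=` cube r ->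
  (forall (x : T) (v : R), W x -> `|v| <= r -> W (upd x i v)) ->
  (forall x, Z x <-> W x \/ (half i false x \/ half i true x)) ->
  van k W W -> van k.+1 Z Z.
Proof.
move=> Wr Wu ZE vW.
pose Z1 b : set T := W `|` half i b.
have Z1Z b : Z1 b `<=` Z.
  by move=> x [Wx|hx]; apply/ZE; [left|right; case: b hx; [right|left]].
have v1 b : van k.+1 (Z1 b) (Z1 b).
  apply: (@van_push _ i b) => [x [/Wr//|[]//]|x hx|x v [Wx|hx] nh vr].
  - by right.
  - by left; exact: Wu.
  - by [].
apply: (@van_union _ _ k Z (Z1 false) (Z1 true) (l i)) => //.
  move=> s [sZ scl].
  case: (pselect (exists2 x, List.In x s & ~ Z1 false x)) => [[x xs nx]|H]; last first.
    by left => x xs; apply: contrapT => nx; apply: H; exists x.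
  right => y ys; have /ZE[Wy|[hy|hy]] := sZ _ ys; [by left| |by right].
  have /ZE[Wx|[hx|hx]] := sZ _ xs; [by case: nx; left|by case: nx; right|].
  have /ltr_normlP[A B] := scl _ _ xs ys i.
  case: hy hx => [_ hy] [_ hx]; move: hx hy A B; rewrite expr0 expr1 mul1r mulN1r.
  have := l0 i; lra.
apply: van_sub vW => x; first by move=> Wx; split; left.
by move=> [[//|hx] [//|hx']]; case: (half_disj hx hx').
Qed.

(** Up to homotopy this is a sphere of dimension size S - 1, obtained from the empty set by one
    suspension for each coordinate. Counted by vertices, its only nonzero degree is size S. *)
Lemma van_outside S k : uniq S -> k != size S -> van k (outside S) (outside S).
Proof.
elim: S k => [|i S IH] k /=.
  move=> _; case: k => // k _; apply: van0 => x [_ [k' ]]; by rewrite in_nil.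
move=> /andP[iS uS]; case: k => [|k] kS.
  apply: (@van_nonempty _ _ _ (face i false)); split.
    move=> k'; rewrite mxE; case: ifP; last by rewrite normr0 ltW.
    by rewrite expr0 mul1r gtr0_norm.
  by exists i; rewrite ?inE ?eqxx // mxE eqxx expr0 mul1r gtr0_norm.
apply: (@van_suspension (outside S) _ i); last by apply: IH.
- by move=> x [].
- move=> x v [xr [k' k'S lk]] vr; split.
    by move=> m; rewrite mxE; case: ifP.
  exists k' => //; rewrite mxE; case: eqP k'S => // ->; by rewrite (negbTE iS).
- move=> x; split.
    move=> [xr [k']]; rewrite inE => /orP[/eqP->|k'S] lk; last by left; split=> //; exists k'.
    by right; exact: half_outside.
  case=> [[xr [k' k'S lk]]|H].
    by split=> //; exists k' => //; rewrite inE k'S orbT.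
  have [xr lx] : cube r x /\ l i < `|x ord0 i|.
    case: H => -[xr]; rewrite ?expr0 ?expr1 ?mul1r ?mulN1r => lx; split=> //.
      by apply: lt_le_trans lx (ler_norm _).
    by rewrite -normrN; apply: lt_le_trans lx (ler_norm _).
  by split=> //; exists i => //; rewrite inE eqxx.
Qed.

Definition core : set T := [set x | cube r x /\ forall k, k != t -> `|x ord0 k| < h k].

Lemma van_core k : van k core core.
Proof.
apply: (@van_star _ 0 r) => [x []//| |a x a01 [xr xh]].
  by split=> [k'|k' _]; rewrite mxE normr0; [exact: ltW|have := hl k'; lra].
split=> [k'|k' k't]; rewrite !mxE mulr0 addr0.
  rewrite -[_ * _]addr0 -(mulr0 a); apply: conv_le; [by []|exact: xr|].
  by rewrite normr0 ltW.
rewrite normrM ger0_norm; last lra.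
apply: le_lt_trans (xh k' k't); rewrite -[leRHS]mul1r ler_wpM2r //; lra.
Qed.

Lemma van_core_half k : van k.+1 (core `|` outside [:: t]) (core `|` outside [:: t]).
Proof.
apply: (@van_suspension core _ t); last exact: van_core.
- by move=> x [].
- move=> x v [xr xh] vr; split=> [k'|k' k't]; rewrite mxE.
    by case: ifP => // _; exact: xr.
  by rewrite (negbTE k't); exact: xh.
- move=> x; split.
    move=> [?|[xr [k']]]; [by left|rewrite inE => /eqP -> lk; right].
    exact: half_outside.
  case=> [|H]; [by left|right].
  have [xr lx] : cube r x /\ l t < `|x ord0 t|.
    case: H => -[xr]; rewrite ?expr0 ?expr1 ?mul1r ?mulN1r => lx; split=> //.
      by apply: lt_le_trans lx (ler_norm _).
    by rewrite -normrN; apply: lt_le_trans lx (ler_norm _).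
  by split=> //; exists t => //; rewrite inE.
Qed.

(** Mayer-Vietoris for the outside of the box, a (d-1)-sphere, and the contractible set formed by
    the column through the hole and the two half spaces in the direction [t]. They meet in a
    0-sphere up to homotopy. In dimension 3 the first piece would carry H^2. *)
Lemma van_frame : (4 <= d)%N -> van 3 (cube r `\` Fr) (cube r `\` Fr).
Proof.
move=> d4.
(* A simplex smaller than the thickness of the walls cannot reach through a wall from the hole to
   the outside. *)
pose e0 := \big[Num.min/1]_k (l k - h k).
have e0p : 0 < e0.
  rewrite /e0; elim/big_ind: _ => // [x y x0 y0|k _]; first by rewrite lt_min x0.
  by have := hl k; lra.
have e0l k : e0 <= l k - h k by rewrite /e0; exact: bigmin_le_cond.
pose Z1 := outside (enum 'I_d); pose Z2 := core `|` outside [:: t].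
have outE (x : T) : outside (enum 'I_d) x <-> cube r x /\ exists k, l k < `|x ord0 k|.
  split=> [[xr [k _ lk]]|[xr [k lk]]]; split=> //; exists k => //.
  by rewrite mem_enum.
apply: (@van_union _ _ 2 _ Z1 Z2 e0) => //.
- move=> x /outE[xr [k lk]]; split=> // -[/(_ k)]; by rewrite leNgt lk.
- move=> x [[xr xh]|[xr [k _ lk]]]; split=> //; first by case=> _; apply.
  by case=> /(_ k); rewrite leNgt lk.
- move=> s [sZ scl].
  case: (pselect (exists2 x, List.In x s & ~ Z1 x)) => [[x xs nx]|H]; last first.
    by left => x xs; apply: contrapT => nx; apply: H; exists x.
  have [xr nF] := sZ _ xs.
  have xl k : `|x ord0 k| <= l k.
    by rewrite leNgt; apply/negP => lk; apply: nx; apply/outE; split=> //; exists k.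
  have xh : forall k, k != t -> `|x ord0 k| < h k.
    by apply: contrapT => nh; apply: nF.
  right => y ys; have [yr nFy] := sZ _ ys.
  case: (pselect (forall k, k != t -> `|y ord0 k| < h k)) => [yh|nyh]; first by left.
  right; split=> //.
  have [k lk] : exists k, l k < `|y ord0 k|.
    apply: contrapT => nl; apply: nFy; split=> // k; rewrite leNgt.
    by apply/negP => lk; apply: nl; exists k.
  exists t; rewrite ?inE //; case: (eqVneq k t) => [<-//|kt].
  have := xh _ kt; have := scl _ _ xs ys k; have := e0l k.
  have := ler_normB (x ord0 k) (x ord0 k - y ord0 k).
  rewrite (_ : x ord0 k - (x ord0 k - y ord0 k) = y ord0 k); last by ring.
  lra.
- by apply: van_outside; [exact: enum_uniq|rewrite size_enum_ord neq_ltn d4].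
- exact: van_core_half.
- have : van 2 (outside [:: t]) (outside [:: t]) by apply: van_outside.
  apply: van_sub => [x ox|x].
    split; last by right.
    by case: ox => xr [k _ lk]; apply/outE; split=> //; exists k.
  move=> [/outE[xr [k lk]] [[_ xh]|//]]; split=> //; exists t; rewrite ?inE //.
  case: (eqVneq k t) => [<-//|kt]; have := xh _ kt; have := hl k; lra.
Qed.

End Frames.

Lemma Good_frame t l h : (4 <= d)%N -> (forall k, 0 < h k < l k) -> Good (Fr t l h).
Proof.
move=> d4 hl r.
pose r' := Num.max r (\big[Num.max/0]_k (l k) + 1).
have lr k : l k < r'.
  rewrite lt_max; apply/orP; right.
  apply: le_lt_trans (_ : _ <= \big[Num.max/0]_k l k) _; last by lra.
  exact: le_bigmax.
exists r'; have v := van_frame (t := t) hl lr d4; refine (van_sub _ _ v) => // x [xr nx]; split=> //.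
by apply: cube_le xr; rewrite le_max lexx.
Qed.

End Homeomorphisms.

(** * Unitriangular local systems *)

Section Unitriangular.
Context {n : nat}.
Implicit Types A B U : 'M[bool]_n.+1.

(** [bool] with its ring structure is the field F_2. Matrices have size n + 1, so that the corner
    entry sits at (0, n). *)
Definition ut A := forall i j : 'I_n.+1, A i i = 1 /\ ((j < i)%N -> A i j = 0).

Lemma ut1 : ut 1.
Proof.
move=> i j; rewrite !mxE eqxx; split=> // ji.
by case: eqP ji => // ->; rewrite ltnn.
Qed.

Lemma utM A B : ut A -> ut B -> ut (A * B).
Proof.
move=> uA uB i j; rewrite !mxE; split=> [|ji].
  rewrite (bigD1 i) //= (uA i i).1 (uB i i).1 mulr1 big1 ?addr0 // => k ki.
  case: (ltngtP k i) => [ltki|ltik|/val_inj E]; last by rewrite E eqxx in ki.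
    by rewrite (uA i k).2 ?mul0r.
  by rewrite (uB k i).2 ?mulr0.
rewrite big1 // => k _; case: (ltnP k i) => [ltki|leik].
  by rewrite (uA i k).2 ?mul0r.
by rewrite (uB k j).2 ?mulr0 // (leq_trans ji).
Qed.

Lemma ut_unit A : ut A -> A \is a GRing.unit.
Proof.
move=> uA; rewrite -[A \is a _]/(A \in unitmx) unitmxE -det_tr det_trig.
  by rewrite big1 // => i _; rewrite mxE (uA i i).1.
by apply/is_trig_mxP => i j ij; rewrite mxE (uA j i).2.
Qed.

Lemma ut_idem A : ut A -> A = A * A -> A = 1.
Proof.
move=> uA AA; apply: (mulrI (ut_unit uA)).
by rewrite mulr1 -AA.
Qed.

Definition cornerE : 'M[bool]_n.+1 := delta_mx ord0 ord_max.
Definition corner : 'M[bool]_n.+1 := 1 + cornerE.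

Lemma ut_cornerE U : ut U -> U * cornerE = cornerE.
Proof.
move=> uU; apply/matrixP => i j; rewrite !mxE (bigD1 ord0) //= big1; last first.
  by move=> k k0; rewrite mxE (negbTE k0) mulr0.
rewrite !mxE eqxx /= addr0; case: (eqVneq i ord0) => [->|i0].
  by rewrite (uU ord0 ord0).1 mul1r.
by rewrite (uU i ord0).2 ?mul0r // lt0n.
Qed.

Lemma cornerE_ut U : ut U -> cornerE * U = cornerE.
Proof.
move=> uU; apply/matrixP => i j; rewrite !mxE (bigD1 ord_max) //= big1; last first.
  by move=> k k0; rewrite mxE (negbTE k0) andbF mul0r.
rewrite !mxE eqxx andbT addr0; case: (eqVneq j ord_max) => [->|j0].
  by rewrite (uU ord_max ord_max).1 mulr1 andbT.
rewrite (uU ord_max j).2 ?mulr0 ?andbF // ltn_neqAle -ltnS ltn_ord andbT.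
by apply: contraNneq j0 => E; apply/eqP/val_inj.
Qed.

Lemma corner_central U : ut U -> U * corner = corner * U.
Proof. by move=> uU; rewrite mulrDr mulrDl mulr1 mul1r ut_cornerE ?cornerE_ut. Qed.

Lemma cornerE_sq : (0 < n)%N -> cornerE * cornerE = 0.
Proof.
move=> n0; rewrite /cornerE; apply/matrixP => i j; rewrite !mxE big1 // => k _; rewrite !mxE.
case: (eqVneq k ord_max) => [->|]; last by rewrite andbF mul0r.
have -> : (ord_max == ord0 :> 'I_n.+1) = false by apply/eqP => /(congr1 val) /= E; rewrite E in n0.
by rewrite mulr0.
Qed.

End Unitriangular.
Arguments corner n : clear implicits.
Arguments cornerE n : clear implicits.

(** * Discrete local systems and their holonomy *)

Section Holonomy.
Context {R : realType} {d : nat}.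
Notation T := 'rV[R]_d.
Notation M n := 'M[bool]_n.+1.

(* A local system on [Z], read on pairs of [e]-close points. *)
Definition rep n (Z : set T) (e : R) (P : T -> T -> M n) :=
  (forall x y, ut (P x y)) /\
  (forall x y z, Z x -> Z y -> Z z -> cl e x y -> cl e y z -> cl e x z ->
     P x z = P x y * P y z).

Lemma rep_id n Z e (P : T -> T -> M n) x : 0 < e -> rep Z e P -> Z x -> P x x = 1.
Proof. by move=> e0 [uP mP] Zx; apply: ut_idem => //; apply: mP => //; exact: cl_refl. Qed.

Lemma rep_sub n (Z Z' : set T) e e' (P : T -> T -> M n) :
  Z' `<=` Z -> e' <= e -> rep Z e P -> rep Z' e' P.
Proof.
move=> ZZ ee [uP mP]; split=> // x y z Zx Zy Zz xy yz xz.
by apply: mP; try exact: ZZ; apply: cl_le ee _.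
Qed.

Lemma rep_pull n (Z Z' : set T) e e' (P : T -> T -> M n) (p : T -> T) :
  (forall x, Z' x -> Z (p x)) ->
  (forall x y, Z' x -> Z' y -> cl e' x y -> cl e (p x) (p y)) ->
  rep Z e P -> rep Z' e' (fun x y => P (p x) (p y)).
Proof. by move=> pZ pc [uP mP]; split=> // x y z Zx Zy Zz xy yz xz; apply: mP; auto. Qed.

(** The product is meaningful once the mesh of the N + 1 sample points is below the scale of [P]. No
    limit is taken: later statements hold for all [N] from some [N0] on. *)
Definition hol n (P : T -> T -> M n) (N : nat) (g : R -> T) : M n :=
  \prod_(k < N) P (g (k%:R / N%:R)) (g (k.+1%:R / N%:R)).

Lemma ut_prod n (I : Type) (r : seq I) (F : I -> M n) :
  (forall i, ut (F i)) -> ut (\prod_(i <- r) F i).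
Proof. by move=> H; elim/big_ind: _ => //; [exact: ut1|exact: utM]. Qed.

Lemma hol_ut n (P : T -> T -> M n) N g : (forall x y, ut (P x y)) -> ut (hol P N g).
Proof. by move=> H; apply: ut_prod. Qed.

Lemma hol_ext n (P : T -> T -> M n) N g g' :
  (forall u, 0 <= u <= 1 -> g u = g' u) -> hol P N g = hol P N g'.
Proof.
move=> E; apply: eq_bigr => k _.
have in01 m : (m <= N)%N -> 0 <= (m%:R / N%:R : R) <= 1.
  case: N k => [[]//|N] _ mN.
  by rewrite divr_ge0 ?ler0n // ler_pdivrMr ?ltr0n // mul1r ler_nat.
by rewrite !E // in01 // ltnW.
Qed.

(** The diagonal from f i to g (i + 1) cuts each cell of the strip into two small triangles, on
    which [P] is multiplicative; the rungs between the cells telescope. *)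
Lemma grid_strip n (Z : set T) e (P : T -> T -> M n) N (f g : nat -> T) : 0 < e ->
  rep Z e P ->
  (forall i, (i <= N)%N -> Z (f i) /\ Z (g i)) ->
  (forall i, (i <= N)%N -> cl e (f i) (g i)) ->
  (forall i, (i < N)%N -> [/\ cl e (f i) (f i.+1), cl e (g i) (g i.+1) & cl e (f i) (g i.+1)]) ->
  (\prod_(i < N) P (f i) (f i.+1)) * P (f N) (g N) =
  P (f 0%N) (g 0%N) * \prod_(i < N) P (g i) (g i.+1).
Proof.
move=> e0 [uP mP]; elim: N => [|N IH] HZ Hfg Hc; first by rewrite !big_ord0 mulr1 mul1r.
rewrite !big_ord_recr /= mulrA -IH; last 3 first.
- by move=> i iN; apply: HZ; rewrite ltnW.
- by move=> i iN; apply: Hfg; rewrite ltnW.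
- by move=> i iN; apply: Hc; rewrite ltnW.
rewrite -!mulrA; congr (_ * _).
have [Zf Zg] := HZ N (leqnSn _); have [Zf' Zg'] := HZ N.+1 (leqnn _).
have [c1 c2 c3] := Hc N (leqnn _).
rewrite -mP // -?mP //; first exact: Hfg.
exact: Hfg.
Qed.

Lemma grid_square n (Z : set T) e (P : T -> T -> M n) N L (G : nat -> nat -> T) : 0 < e ->
  rep Z e P ->
  (forall i j, (i <= N)%N -> (j <= L)%N -> Z (G i j)) ->
  (forall i j i' j', (i <= i' <= i.+1)%N -> (i' <= N)%N -> (j <= j' <= j.+1)%N -> (j' <= L)%N ->
     cl e (G i j) (G i' j')) ->
  (\prod_(i < N) P (G i 0%N) (G i.+1 0%N)) * (\prod_(j < L) P (G N j) (G N j.+1)) =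
  (\prod_(j < L) P (G 0%N j) (G 0%N j.+1)) * (\prod_(i < N) P (G i L) (G i.+1 L)).
Proof.
move=> e0 rP; elim: L => [|L IH] HZ Hc; first by rewrite !big_ord0 mulr1 mul1r.
rewrite !big_ord_recr /= mulrA IH; last 2 first.
- by move=> i j iN jL; apply: HZ => //; rewrite ltnW.
- by move=> i j i' j' ? ? ? jL; apply: Hc => //; rewrite ltnW.
rewrite -!mulrA; congr (_ * _).
apply: (@grid_strip n Z e P N (G^~ L) (G^~ L.+1)) => //.
- by move=> i iN; split; apply: HZ.
- by move=> i iN; apply: Hc; rewrite ?leqnn ?leqnSn.
- by move=> i iN; split; apply: Hc; rewrite ?leqnn ?leqnSn.
Qed.

Lemma square_hol n (Z : set T) e (P : T -> T -> M n) (F : R -> R -> T) dl N : 0 < e -> 0 < dl ->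
  rep Z e P ->
  (forall u v, 0 <= u <= 1 -> 0 <= v <= 1 -> Z (F u v)) ->
  (forall u v u' v', 0 <= u <= 1 -> 0 <= v <= 1 -> 0 <= u' <= 1 -> 0 <= v' <= 1 ->
     `|u - u'| < dl -> `|v - v'| < dl -> cl e (F u v) (F u' v')) ->
  dl^-1 < N%:R ->
  hol P N (F^~ 0) * hol P N (F 1) = hol P N (F 0) * hol P N (F^~ 1).
Proof.
move=> e0 dl0 rP FZ Fc HN.
have N0 : (0 < N)%N by rewrite -(ltr0n R); apply: lt_trans HN; rewrite invr_gt0.
have N0R : 0 < N%:R :> R by rewrite ltr0n.
have Nd : N%:R^-1 < dl by rewrite invf_plt ?posrE.
have in01 m : (m <= N)%N -> 0 <= (m%:R / N%:R : R) <= 1.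
  by move=> mN; rewrite divr_ge0 ?ler0n // ler_pdivrMr // mul1r ler_nat.
have dif i i' : (i <= i' <= i.+1)%N -> `|i%:R / N%:R - i'%:R / N%:R| < dl :> R.
  move=> /andP[ii]; rewrite leq_eqVlt ltnS => /orP[/eqP->|i'i].
    rewrite -mulrBl -addn1 natrD opprD addrA subrr sub0r mulN1r normrN.
    by rewrite ger0_norm // invr_ge0 ltW.
  by have -> : i' = i; [apply/eqP; rewrite eqn_leq ii i'i|rewrite subrr normr0].
have := @grid_square n Z e P N N (fun i j => F (i%:R / N%:R) (j%:R / N%:R)) e0 rP.
rewrite /hol divff ?gt_eqF // mul0r; apply.
  by move=> i j iN jN; apply: FZ; exact: in01.
move=> i j i' j' ii i'N jj j'N; have /andP[ii' _] := ii; have /andP[jj' _] := jj.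
by apply: Fc; [exact: in01 (leq_trans ii' i'N)|exact: in01 (leq_trans jj' j'N)|exact: in01|exact: in01|exact: dif|exact: dif].
Qed.

Definition seg (x y : T) (u : R) : T := (1 - u) *: x + u *: y.
Definition quad (a b c c' : T) (u v : R) : T := seg (seg a b u) (seg c c' u) v.

(* [qf Z r S]: [S] behaves like parallel transport along segments in [Z]. *)
Definition qf n (Z : set T) (r : R) (S : T -> T -> M n) :=
  [/\ forall a b, ut (S a b),
      forall a, Z a -> cube r a -> S a a = 1,
      forall a b, (forall u, 0 <= u <= 1 -> Z (seg a b u)) -> cube r a -> cube r b ->
        S a b * S b a = 1 &
      forall a b c c', cube r a -> cube r b -> cube r c -> cube r c' ->
        (forall u v, 0 <= u <= 1 -> 0 <= v <= 1 -> Z (quad a b c c' u v)) ->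
        S a b * S b c' = S a c * S c c'].

Lemma seg_cl a b r u u' (e : R) : cube r a -> cube r b ->
  `|u - u'| * (r + r) < e -> cl e (seg a b u) (seg a b u').
Proof.
move=> ra rb H k; rewrite /seg !mxE.
rewrite (_ : _ - _ = (u - u') * (b ord0 k - a ord0 k)); last by ring.
apply: le_lt_trans H; rewrite normrM ler_wpM2l //.
by apply: le_trans (ler_normB _ _) _; apply: lerD.
Qed.

Lemma seg_cube a b r u : 0 <= u <= 1 -> cube r a -> cube r b -> cube r (seg a b u).
Proof. by move=> u01 ra rb k; rewrite /seg !mxE; apply: conv_le. Qed.

Lemma seg_mono (a b a' b' : T) e u : 0 <= u <= 1 -> 0 < e -> cl e a a' -> cl e b b' ->
  cl e (seg a b u) (seg a' b' u).
Proof.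
move=> u01 e0 aa bb k; rewrite /seg !mxE.
rewrite (_ : _ - _ = (1 - u) * (a ord0 k - a' ord0 k) + u * (b ord0 k - b' ord0 k)); last by ring.
have := aa k; have := bb k; rewrite !ltr_norml => /andP[b1 b2] /andP[a1 a2].
move: (a ord0 k - _) (b ord0 k - _) b1 b2 a1 a2 => x y b1 b2 a1 a2.
have u1 : 0 <= 1 - u by lra.
have u0 : 0 <= u by lra.
case: (ltP u 1) => u1'.
  have A1 : 0 < (1 - u) * (e - x) by apply: mulr_gt0; lra.
  have A2 : 0 < (1 - u) * (e + x) by apply: mulr_gt0; lra.
  have A3 : 0 <= u * (e - y) by apply: mulr_ge0; lra.
  have A4 : 0 <= u * (e + y) by apply: mulr_ge0; lra.
  by apply/andP; split; lra.
have -> : u = 1 by lra.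
by apply/andP; split; lra.
Qed.

Lemma seg0 a b : seg a b 0 = a.
Proof. by rewrite /seg subr0 scale1r scale0r addr0. Qed.
Lemma seg1 a b : seg a b 1 = b.
Proof. by rewrite /seg subrr scale1r scale0r add0r. Qed.
Lemma segxx a u : seg a a u = a.
Proof. by rewrite /seg -scalerDl subrK scale1r. Qed.

(** This allows homotopies to be handled through polygons and the bilinear quadrilaterals between
    them, without fine subdivisions. One bound on [N] serves all segments in a cube, because their
    speed is bounded. *)
Lemma hol_qf n (Z : set T) e (P : T -> T -> M n) r : 0 < e -> rep Z e P ->
  exists N0, forall N, (N0 <= N)%N -> qf Z r (fun a b => hol P N (seg a b)).
Proof.
move=> e0 rP.
have [C [C0 rC]] : exists C : R, 0 < C /\ r + r <= C.
  by exists (`|r| + `|r| + 1); have := normr_ge0 r; have := ler_norm r; lra.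
pose dl := e / (C + C).
have dl0 : 0 < dl by rewrite divr_gt0 // addr_gt0.
have dlC (u : R) : `|u| < dl -> `|u| * (r + r) < e / 2.
  move=> H; apply: le_lt_trans (_ : `|u| * C < _).
    by rewrite ler_wpM2l.
  have -> : e / 2 = dl * C by rewrite /dl; field; apply: lt0r_neq0; lra.
  by rewrite ltr_pM2r.
exists (Num.truncn dl^-1).+1 => N HN.
have HNR : dl^-1 < N%:R.
  by apply: lt_le_trans (truncnS_gt _) _; rewrite ler_nat.
have e2 : 0 < e / 2 by rewrite divr_gt0.
have sq (F : R -> R -> T) : (forall u v, 0 <= u <= 1 -> 0 <= v <= 1 -> Z (F u v)) ->
  (forall u v u' v', 0 <= u <= 1 -> 0 <= v <= 1 -> 0 <= u' <= 1 -> 0 <= v' <= 1 ->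
     `|u - u'| < dl -> `|v - v'| < dl -> cl e (F u v) (F u' v')) ->
  hol P N (F^~ 0) * hol P N (F 1) = hol P N (F 0) * hol P N (F^~ 1).
  by move=> H1 H2; apply: (@square_hol n Z e P F dl N) => //.
have cst a : Z a -> hol P N (fun=> a) = 1.
  by move=> Za; rewrite /hol big1 // => k _; rewrite (rep_id e0 rP).
split=> [a b|a Za ra|a b ab ra rb|a b c c' ra rb rc rc' Zq].
- exact: hol_ut rP.1.
- by rewrite (_ : seg a a = fun=> a) ?cst //; apply/funext => u; rewrite segxx.
- have Za : Z a by have := ab 0; rewrite seg0; apply; rewrite lexx ler01.
  (* The four sides of this square are the segment, its reverse, and two constant paths at [a]. *)
  have := sq (fun u v => seg a b (u * (1 - v))).
  rewrite (_ : (fun u : R => seg a b (u * (1 - 0))) = seg a b); last first.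
    by apply/funext => u; rewrite subr0 mulr1.
  rewrite (_ : (fun v : R => seg a b (1 * (1 - v))) = seg b a); last first.
    by apply/funext => v; rewrite mul1r /seg subKr addrC.
  rewrite (_ : (fun v : R => seg a b (0 * (1 - v))) = fun=> a); last first.
    by apply/funext => v; rewrite mul0r seg0.
  rewrite (_ : (fun u : R => seg a b (u * (1 - 1))) = fun=> a); last first.
    by apply/funext => u; rewrite subrr mulr0 seg0.
  rewrite (cst _ Za) mulr1; apply => [u v u01 v01|u v u' v' u01 v01 u01' v01' uu vv].
    by apply: ab; rewrite mulr_ge0 ?mulr_ile1; lra.
  apply: seg_cl ra rb _.
  rewrite (_ : u * _ - _ = (u - u') * (1 - v) - u' * (v - v')); last by ring.
  have A1 := dlC _ uu; have A2 := dlC _ vv.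
  case: (lerP 0 (r + r)) => r0; last first.
    apply: le_lt_trans (_ : 0 < _); last by [].
    by rewrite mulr_ge0_le0 // ltW.
  apply: le_lt_trans (_ : (`|u - u'| + `|v - v'|) * (r + r) < _); last by rewrite mulrDl; lra.
  rewrite ler_wpM2r //; apply: le_trans (ler_normB _ _) _; rewrite !normrM.
  apply: lerD.
    by rewrite -[leRHS]mulr1 ler_wpM2l // ger0_norm; lra.
  by rewrite -[leRHS]mul1r ler_wpM2r // ger0_norm; lra.
- have := sq (quad a b c c').
  rewrite (_ : (quad a b c c')^~ 0 = seg a b); last by apply/funext => u; rewrite /quad seg0.
  rewrite (_ : (quad a b c c')^~ 1 = seg c c'); last by apply/funext => u; rewrite /quad seg1.
  rewrite (_ : quad a b c c' 1 = seg b c'); last by apply/funext => v; rewrite /quad !seg1.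
  rewrite (_ : quad a b c c' 0 = seg a c); last by apply/funext => v; rewrite /quad !seg0.
  apply=> // u v u' v' u01 v01 u01' v01' uu vv.
  apply: cl_le (_ : e / 2 + e / 2 <= e) _; first by lra.
  apply: (@cl_trans _ _ _ _ _ (quad a b c c' u' v)).
    by apply: seg_mono => //; [exact: seg_cl ra rb (dlC _ uu)|exact: seg_cl rc rc' (dlC _ uu)].
  by apply: (@seg_cl _ _ r); [exact: seg_cube|exact: seg_cube|exact: dlC].
Qed.

Fixpoint tr n (S : T -> T -> M n) a (s : seq T) : M n :=
  if s is b :: s' then S a b * tr S b s' else 1.

Lemma tr_ut n (S : T -> T -> M n) a s : (forall a b, ut (S a b)) -> ut (tr S a s).
Proof. by move=> H; elim: s a => [|b s IH] a; [exact: ut1|exact: utM]. Qed.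

Lemma tr_cat n (S : T -> T -> M n) a s s' :
  tr S a (s ++ s') = tr S a s * tr S (last a s) s'.
Proof. by elim: s a => [|b s IH] a /=; rewrite ?mul1r // IH mulrA. Qed.

End Holonomy.

(** * Gluing two local systems *)

Section Blocks.
Context {n1 n2 : nat}.
Notation n := (n1 + n2)%N.
Implicit Types A B X Y : 'M[bool]_n.+1.

Lemma tl_subproof : (n1.+1 <= n.+1)%N. Proof. lia. Qed.
Definition tl_ord (i : 'I_n1.+1) : 'I_n.+1 := widen_ord tl_subproof i.
Lemma br_subproof (i : 'I_n2.+1) : (n1 + i < n.+1)%N. Proof. have := ltn_ord i; lia. Qed.
Definition br_ord (i : 'I_n2.+1) : 'I_n.+1 := Ordinal (br_subproof i).

Definition TL A : 'M[bool]_n1.+1 := mxsub tl_ord tl_ord A.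
Definition BR A : 'M[bool]_n2.+1 := mxsub br_ord br_ord A.

(** Triangularity removes the terms that would pass through an index outside the block. The index
    [n1] belongs to both blocks, as the last of one and the first of the other. *)
Lemma TL_M A B : ut A -> ut B -> TL (A * B) = TL A * TL B.
Proof.
move=> uA uB; apply/matrixP => i j; rewrite !mxE (bigID (fun k : 'I_n.+1 => (k < n1.+1)%N)) /=.
rewrite [X in _ + X]big1 ?addr0; last first.
  move=> k; rewrite -leqNgt => k1; rewrite (uB k (tl_ord j)).2 ?mulr0 //=.
  by have := ltn_ord j; lia.
rewrite (big_ord_narrow tl_subproof); apply: eq_bigr => k _.
by rewrite !mxE.
Qed.

Lemma BR_M A B : ut A -> ut B -> BR (A * B) = BR A * BR B.
Proof.
move=> uA uB; apply/matrixP => i j; rewrite !mxE (bigID (fun k : 'I_n.+1 => (n1 <= k)%N)) /=.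
rewrite [X in _ + X]big1 ?addr0; last first.
  by move=> k; rewrite -ltnNge => k1; rewrite (uA (br_ord i) k).2 ?mul0r //=; lia.
rewrite (reindex_onto br_ord (fun k => inord (k - n1))) /=; last first.
  move=> k n1k; apply: val_inj => /=; rewrite inordK; last by have := ltn_ord k; lia.
  by lia.
apply: eq_big => [k|k _]; last by rewrite !mxE.
rewrite leq_addr /=; apply/eqP/val_inj => /=; rewrite inordK; first by lia.
by have := ltn_ord k; lia.
Qed.

Lemma TL_1 : TL 1 = 1.
Proof. by apply/matrixP => i j; rewrite !mxE. Qed.

Lemma BR_1 : BR 1 = 1.
Proof.
by apply/matrixP => i j; rewrite !mxE -!(inj_eq val_inj) /= eqn_add2l.
Qed.

Lemma TL_prod (I : Type) (r : seq I) (F : I -> 'M[bool]_n.+1) : (forall i, ut (F i)) ->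
  TL (\prod_(i <- r) F i) = \prod_(i <- r) TL (F i).
Proof.
move=> uF; elim: r => [|i r IH]; rewrite ?big_nil ?TL_1 // !big_cons TL_M ?IH //.
exact: ut_prod.
Qed.

Lemma BR_prod (I : Type) (r : seq I) (F : I -> 'M[bool]_n.+1) : (forall i, ut (F i)) ->
  BR (\prod_(i <- r) F i) = \prod_(i <- r) BR (F i).
Proof.
move=> uF; elim: r => [|i r IH]; rewrite ?big_nil ?BR_1 // !big_cons BR_M ?IH //.
exact: ut_prod.
Qed.

(** Let X = 1 + X' and Y = 1 + Y'. The rows of X' from [n1] on and its columns before [n1] vanish,
    and its column [n1] is the first unit vector. The row [n1] of Y' is the last unit vector, its
    later rows vanish, and so does its first block. Hence X' Y' is the corner unit and Y' X' = 0,
    whatever was filled into the upper right part. *)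
Lemma blocks_commutator X Y : ut X -> ut Y -> (0 < n1)%N -> (0 < n2)%N ->
  TL X = corner n1 -> BR X = 1 -> TL Y = 1 -> BR Y = corner n2 ->
  X * Y = Y * X + cornerE n.
Proof.
move=> uX uY n10 n20 tX bX tY bY.
pose X' : 'M[bool]_n.+1 := X - 1; pose Y' : 'M[bool]_n.+1 := Y - 1.
have tlE (Z : 'M[bool]_n.+1) (i j : 'I_n.+1) (li : (i <= n1)%N) (lj : (j <= n1)%N) :
    Z i j = TL Z (Ordinal (li : (i < n1.+1)%N)) (Ordinal (lj : (j < n1.+1)%N)).
  by rewrite mxE; congr (Z _ _); apply: val_inj.
have brE (Z : 'M[bool]_n.+1) (i j : 'I_n.+1) : (n1 <= i)%N -> (n1 <= j)%N ->
    exists (i' j' : 'I_n2.+1), [/\ (i = n1 + i' :> nat)%N, (j = n1 + j' :> nat)%N & Z i j = BR Z i' j'].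
  move=> li lj; have Hi : (i - n1 < n2.+1)%N by have := ltn_ord i; lia.
  have Hj : (j - n1 < n2.+1)%N by have := ltn_ord j; lia.
  exists (Ordinal Hi), (Ordinal Hj); split => /=; [lia|lia|].
  by rewrite mxE; congr (Z _ _); apply: val_inj => /=; lia.
have X0 (i k : 'I_n.+1) : (n1 <= i)%N -> X' i k = 0.
  move=> li; rewrite /X'; case: (ltnP k n1) => lk.
    have ki : (k < i)%N by lia.
    rewrite !mxE (uX i k).2 //; case: eqP ki => [->|//]; by rewrite ltnn.
  have [i' [k' [Ei Ek ->]]] := brE X' i k li lk.
  have := congr1 (fun M : 'M[bool]__ => M i' k') bX; rewrite /X' /BR !mxE => ->.
  by rewrite -!(inj_eq val_inj) /= eqn_add2l subrr.
have X1 (i k : 'I_n.+1) : (k < n1)%N -> X' i k = 0.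
  move=> lk; case: (ltnP n1 i) => li; first by apply: X0; lia.
  have lk' : (k <= n1)%N by lia.
  rewrite (tlE X' i k li lk') /X' /TL !mxE.
  have := congr1 (fun M : 'M[bool]__ => M (Ordinal (li : (i < n1.+1)%N)) (Ordinal (lk' : (k < n1.+1)%N))) tX.
  rewrite !mxE => ->.
  have -> : (Ordinal (lk' : (k < n1.+1)%N) == ord_max) = false.
    by apply/eqP => /(congr1 val) /= E; lia.
  by rewrite andbF addr0 -!(inj_eq val_inj) /= subrr.
have X2 (i : 'I_n.+1) (k : 'I_n.+1) : k = n1 :> nat -> X' i k = (i == ord0).
  move=> lk; case: (ltnP n1 i) => li.
    rewrite X0; last by lia.
    by case: eqP => // E; rewrite E in li.
  have lk' : (k <= n1)%N by lia.
  rewrite (tlE X' i k li lk') /X' /TL !mxE.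
  have := congr1 (fun M : 'M[bool]__ => M (Ordinal (li : (i < n1.+1)%N)) (Ordinal (lk' : (k < n1.+1)%N))) tX.
  rewrite !mxE => ->.
  have -> : (Ordinal (lk' : (k < n1.+1)%N) == ord_max) by apply/eqP/val_inj.
  rewrite andbT -!(inj_eq val_inj) /= addrAC subrr add0r.
  by case: (_ == _).
have Y0 (k j : 'I_n.+1) : (k <= n1)%N -> (j <= n1)%N -> Y' k j = 0.
  move=> lk lj; rewrite (tlE Y' k j lk lj) /Y' /TL !mxE.
  have := congr1 (fun M : 'M[bool]__ => M (Ordinal (lk : (k < n1.+1)%N)) (Ordinal (lj : (j < n1.+1)%N))) tY.
  by rewrite !mxE => ->; rewrite -!(inj_eq val_inj) /= subrr.
have Y1 (k j : 'I_n.+1) : (n1 <= k)%N -> Y' k j = ((k == n1 :> nat) && (j == ord_max)).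
  move=> lk; case: (ltnP j n1) => lj.
    rewrite /Y' !mxE (uY k j).2; last by lia.
    have -> : (k == j) = false by apply/eqP => E; rewrite E in lk; lia.
    have -> : (j == ord_max) = false by apply/eqP => E; rewrite E /= in lj; lia.
    by rewrite andbF.
  have [k' [j' [Ek Ej E]]] := brE Y' k j lk lj; rewrite E /Y' /BR !mxE.
  have := congr1 (fun M : 'M[bool]__ => M k' j') bY; rewrite !mxE => ->.
  rewrite -!(inj_eq val_inj) /= Ek Ej !eqn_add2l.
  have -> : (n1 + k' == n1)%N = (k' == 0%N :> nat) by apply/eqP/eqP; lia.
  rewrite addrAC subrr add0r.
  by case: (_ && _).
have XE : X = 1 + X' by rewrite /X' addrC subrK.
have YE : Y = 1 + Y' by rewrite /Y' addrC subrK.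
have A1 : X' * Y' = cornerE n.
  apply/matrixP => i j; rewrite !mxE.
  have Hn : (n1 < n.+1)%N by lia.
  rewrite (bigD1 (Ordinal Hn)) //= big1 ?addr0; last first.
    move=> k kn; have kn' : k != n1 :> nat by apply: contraNneq kn => E; apply/eqP/val_inj.
    case: (ltnP k n1) => lk; first by rewrite X1 ?mul0r.
    by rewrite Y1 // (negbTE kn') mulr0.
  rewrite X2 // Y1 //= eqxx /=.
  by case: (_ == _); case: (_ == _).
have A2 : Y' * X' = 0.
  apply/matrixP => i j; rewrite !mxE big1 // => k _.
  case: (ltnP k n1) => lk; last by rewrite X0 ?mulr0.
  case: (leqP i n1) => li; first by rewrite Y0 ?mul0r // ltnW.
  rewrite Y1; last by lia.
  have -> : (k == ord_max) = false by apply/eqP => E; rewrite E /= in lk; lia.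
  by rewrite andbF mul0r.
clear - XE YE A1 A2; clearbody X' Y'.
rewrite XE YE !mulrDl !mulrDr !mulr1 !mul1r A1 A2 addr0.
by rewrite -!addrA; congr (_ + _); rewrite !addrA [X' + Y']addrC.
Qed.

End Blocks.

(** * Filling the missing entries: obstruction theory *)

Section Filling.
Context {R : realType} {d : nat}.
Notation T := 'rV[R]_d.

Lemma ordpair_neq n (a b i j : 'I_n) : (a <> i :> nat) \/ (b <> j :> nat) -> (a, b) != (i, j).
Proof. by move=> H; apply/eqP => -[Ea Eb]; case: H; rewrite ?Ea ?Eb. Qed.

Definition me n (Z : set T) (e : R) (P : T -> T -> 'M[bool]_n.+1) i j :=
  forall x y z, Z x -> Z y -> Z z -> cl e x y -> cl e y z -> cl e x z ->
    P x z i j = (P x y * P y z) i j.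

Lemma me_sub n (Z Z' : set T) e e' (P : T -> T -> 'M[bool]_n.+1) i j :
  Z' `<=` Z -> e' <= e -> me Z e P i j -> me Z' e' P i j.
Proof.
move=> ZZ ee mP x y z Zx Zy Zz xy yz xz.
by apply: mP; try exact: ZZ; apply: cl_le ee _.
Qed.

Lemma me_low n Z e (P : T -> T -> 'M[bool]_n.+1) (i j : 'I_n.+1) :
  (forall x y, ut (P x y)) -> (j <= i)%N -> me Z e P i j.
Proof.
move=> uP; rewrite leq_eqVlt => /orP[/eqP/val_inj -> x y z *|ji x y z *].
  by rewrite (uP x z i i).1 (utM (uP x y) (uP y z) i i).1.
by rewrite (uP x z i j).2 // (utM (uP x y) (uP y z) i j).2.
Qed.

(** [Q] is [P] with the entry (i, j) erased, so [f] sums the products of the entries (i, k) and (k,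
    j) over i < k < j, the cochain of a Massey product. It is a cocycle because those entries are
    already multiplicative, and a primitive of it is the new entry. *)
Lemma fill_entry n (Z Z' : set T) e (P : T -> T -> 'M[bool]_n.+1) (i j : 'I_n.+1) :
  0 < e -> (forall x y, ut (P x y)) -> (i < j)%N -> van 3 Z' Z ->
  (forall k : 'I_n.+1, (k < j)%N -> me Z' e P i k) ->
  (forall k : 'I_n.+1, (i < k)%N -> me Z' e P k j) ->
  exists e' (c : T -> T -> bool), [/\ 0 < e', e' <= e &
    me Z e' (fun x y => P x y + c x y *: delta_mx i j) i j].
Proof.
move=> e0 uP ij vZ mi mj.
pose Q x y : 'M[bool]_n.+1 := P x y + P x y i j *: delta_mx i j.
have Qij x y : Q x y i j = 0 by rewrite /Q !mxE !eqxx /= mulr1; case: (P x y i j).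
have QE x y a b : (a, b) != (i, j) -> Q x y a b = P x y a b.
  move=> H; rewrite /Q !mxE (_ : (a == i) && (b == j) = false) ?mulr0 ?addr0 //.
  by apply: contraNF H => /andP[/eqP-> /eqP->].
have uQ x y : ut (Q x y).
  move=> a b; split.
    rewrite QE ?(uP x y a a).1 //; apply: ordpair_neq; lia.
  move=> ba; rewrite QE ?(uP x y a b).2 //; apply: ordpair_neq; lia.
have subE (A B : 'M[bool]_n.+1) a b : (A - B) a b = A a b - B a b by rewrite !mxE.
pose f (s : seq T) := if s is [:: x; y; z] then (Q x y * Q y z) i j else false.
have PQ x y z (a b : 'I_n.+1) : (a = i /\ (b < j)%N) \/ (b = j /\ (i < a)%N) ->
    (P x y * P y z) a b = (Q x y * Q y z) a b.
  move=> H; rewrite !mxE; apply: eq_bigr => k _.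
  case: H => -[-> H].
    case: (ltngtP k j) => kj.
    - by rewrite !QE //; apply: ordpair_neq; lia.
    - by rewrite (uP y z k b).2 ?(uQ y z k b).2 ?mulr0 //; lia.
    - by rewrite (uP y z k b).2 ?(uQ y z k b).2 ?mulr0 //; lia.
  case: (ltngtP k i) => ki.
  - by rewrite (uP x y a k).2 ?(uQ x y a k).2 ?mul0r //; lia.
  - by rewrite !QE //; apply: ordpair_neq; lia.
  - by rewrite (uP x y a k).2 ?(uQ x y a k).2 ?mul0r //; lia.
have [|u [e1 [e10 Hu]]] := vZ f e e0.
  move=> [|x [|y [|z [|w []]]]] // _ [sZ scl].
  have Zx : Z' x by apply: sZ; left.
  have Zy : Z' y by apply: sZ; right; left.
  have Zz : Z' z by apply: sZ; do 2 right; left.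
  have Zw : Z' w by apply: sZ; do 3 right; left.
  have sc a b : List.In a [:: x; y; z; w] -> List.In b [:: x; y; z; w] -> cl e a b by exact: scl.
  (* [H1] and [H2] expand the same entry of the triple product for its two bracketings; comparing
     them gives the cocycle condition. *)
  have H1 : (Q x y * Q y z * Q z w) i j = (Q x z * Q z w) i j + (Q x y * Q y z) i j.
    rewrite -[Q x y * Q y z](subrK (Q x z)) mulrDl mxE addrC; congr (_ + _).
    rewrite mxE (bigD1 j) //= big1 ?addr0; last first.
      move=> k kj; case: (ltngtP k j) => lkj.
      - rewrite subE -PQ; last by left.
        have <- : P x z i k = (P x y * P y z) i k.
          by apply: mi => //; apply: sc; simpl; tauto.
        by rewrite QE ?subrr ?mul0r //; apply: ordpair_neq; lia.
      - by rewrite (uQ z w k j).2 ?mulr0.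
      - by move/val_inj: lkj => E; rewrite E eqxx in kj.
    rewrite (uQ z w j j).1 mulr1 subE Qij subr0.
    by rewrite addrNK.
  have H2 : (Q x y * (Q y z * Q z w)) i j = (Q x y * Q y w) i j + (Q y z * Q z w) i j.
    rewrite -[Q y z * Q z w](subrK (Q y w)) mulrDr mxE addrC; congr (_ + _).
    rewrite mxE (bigD1 i) //= big1 ?addr0; last first.
      move=> k ki; case: (ltngtP k i) => lki.
      - by rewrite (uQ x y i k).2 ?mul0r.
      - rewrite subE -PQ; last by right.
        have <- : P y w k j = (P y z * P z w) k j.
          by apply: mj => //; apply: sc; simpl; tauto.
        by rewrite [Q y w k j]QE ?subrr ?mulr0 //; apply: ordpair_neq; lia.
      - by move/val_inj: lki => E; rewrite E eqxx in ki.
    rewrite (uQ x y i i).1 mul1r subE Qij subr0.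
    by rewrite addrNK.
  move: H1 H2; rewrite /cob /f -mulrA => -> .
  rewrite -!/(addb _ _).
  move: ((Q x z * Q z w) i j) ((Q x y * Q y z) i j) ((Q x y * Q y w) i j) ((Q y z * Q z w) i j).
  by do 4 case.
exists (Num.min e1 e), (fun x y => P x y i j + u [:: x; y]); split.
- by rewrite lt_min e10.
- by rewrite ge_min lexx orbT.
have PE x y : P x y + (P x y i j + u [:: x; y]) *: delta_mx i j = Q x y + u [:: x; y] *: delta_mx i j.
  by rewrite /Q scalerDl addrA.
move=> x y z Zx Zy Zz xy yz xz; rewrite !PE.
have sm : small e1 Z [:: x; y; z].
  have le1 : Num.min e1 e <= e1 by rewrite ge_min lexx.
  split=> [w /= [<-|[<-|[<-|[]]]]//|v w].
  move: xy yz xz => /(cl_le le1) xy /(cl_le le1) yz /(cl_le le1) xz.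
  by move=> /= [<-|[<-|[<-|[]]]] [<-|[<-|[<-|[]]]]; try exact: cl_refl; try done; exact: clC.
have := Hu [:: x; y; z] erefl sm; rewrite /f /= => E.
clearbody Q; rewrite mulrDl !mulrDr.
have D1 (B : 'M[bool]_n.+1) (c : bool) : ut B -> (B * (c *: delta_mx i j)) i j = c.
  move=> uB; rewrite -scalerAr mxE mxE (bigD1 i) //= big1 ?addr0; last first.
    by move=> k ki; rewrite !mxE (negbTE ki) mulr0.
  by rewrite mxE !eqxx (uB i i).1 /= !mulr1.
have D2 (B : 'M[bool]_n.+1) (c : bool) : ut B -> ((c *: delta_mx i j) * B) i j = c.
  move=> uB; rewrite -scalerAl mxE mxE (bigD1 j) //= big1 ?addr0; last first.
    by move=> k ki; rewrite !mxE (negbTE ki) andbF mul0r.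
  by rewrite mxE !eqxx (uB j j).1 /= !mulr1.
have D3 (c c' : bool) : ((c *: delta_mx i j) * (c' *: delta_mx i j) : 'M[bool]_n.+1) i j = 0.
  rewrite -scalerAl -scalerAr !mxE big1 ?mulr0 // => k _; rewrite !mxE !eqxx /=.
  case: (eqVneq k j) => [->|]; last by rewrite mul0r.
  by rewrite (_ : (j == i) = false) ?mulr0 //; apply/eqP => E2; rewrite E2 ltnn in ij.
have addE (A B : 'M[bool]_n.+1) : (A + B) i j = A i j + B i j by rewrite !mxE.
have dE (c : bool) : (c *: delta_mx i j : 'M[bool]_n.+1) i j = c.
  by rewrite !mxE !eqxx /= mulr1.
rewrite !addE D1 // D2 // D3 dE Qij E.
by move: (u [:: y; z]) (u [:: x; z]) (u [:: x; y]) => [] [] [].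
Qed.

End Filling.

Section FillAll.
Context {R : realType} {d : nat} {n1 n2 : nat}.
Notation T := 'rV[R]_d.
Notation n := (n1 + n2)%N.

Definition catm (A : 'M[bool]_n1.+1) (B : 'M[bool]_n2.+1) : 'M[bool]_n.+1 :=
  \matrix_(a, b) if (b <= n1)%N then (if (a <= n1)%N then A (inord a) (inord b) else 0)
    else if (n1 <= a)%N then B (inord (a - n1)) (inord (b - n1)) else 0.

Lemma catm_ut A B : ut A -> ut B -> ut (catm A B).
Proof.
move=> uA uB a b; rewrite !mxE; split.
  case: (leqP a n1) => [_|/ltnW ->]; first by rewrite (uA _ (inord 0)).1.
  by rewrite (uB _ (inord 0)).1.
have la := ltn_ord a; have lb := ltn_ord b.
move=> ba; case: (leqP b n1) => [bn|nb].
  by case: (leqP a n1) => // an; rewrite (uA _ _).2 // !inordK.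
by case: (leqP n1 a) => // na; rewrite (uB _ _).2 // !inordK; lia.
Qed.

Lemma TL_catm A B : TL (catm A B) = A.
Proof.
apply/matrixP => i j; rewrite !mxE /=.
have li := ltn_ord i; have lj := ltn_ord j.
rewrite -[(j <= n1)%N]ltnS lj -[(i <= n1)%N]ltnS li.
by congr (A _ _); apply: val_inj; rewrite /= inordK.
Qed.

Lemma BR_catm A B : ut A -> ut B -> BR (catm A B) = B.
Proof.
move=> uA uB; apply/matrixP => i j; rewrite !mxE /=.
have li := ltn_ord i; have lj := ltn_ord j.
case: (leqP (n1 + j) n1) => nj.
  have j0 : j = ord0 by apply: val_inj => /=; lia.
  case: (leqP (n1 + i) n1) => ni.
    have i0 : i = ord0 by apply: val_inj => /=; lia.
    by rewrite i0 j0 (uB ord0 ord0).1 addn0 (uA _ (inord 0)).1.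
  by rewrite (uB i j).2 // j0 /=; lia.
rewrite leq_addr; congr (B _ _); apply: val_inj; rewrite /= inordK; lia.
Qed.

Lemma me_TL (Z : set T) e (P : T -> T -> 'M[bool]_n.+1) rho (a b : 'I_n.+1) :
  (forall x y, ut (P x y)) -> (forall x y, TL (P x y) = rho x y) -> rep Z e rho ->
  (a <= n1)%N -> (b <= n1)%N -> me Z e P a b.
Proof.
move=> uP tP [_ mr] la lb x y z Zx Zy Zz xy yz xz.
pose a' : 'I_n1.+1 := Ordinal (la : (a < n1.+1)%N).
pose b' : 'I_n1.+1 := Ordinal (lb : (b < n1.+1)%N).
have E (A : 'M[bool]_n.+1) : A a b = TL A a' b'.
  by rewrite mxE; congr (A _ _); apply: val_inj.
by rewrite !E TL_M // !tP (mr x y z).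
Qed.

Lemma me_BR (Z : set T) e (P : T -> T -> 'M[bool]_n.+1) rho (a b : 'I_n.+1) :
  (forall x y, ut (P x y)) -> (forall x y, BR (P x y) = rho x y) -> rep Z e rho ->
  (n1 <= a)%N -> (n1 <= b)%N -> me Z e P a b.
Proof.
move=> uP tP [_ mr] la lb x y z Zx Zy Zz xy yz xz.
have Ha : (a - n1 < n2.+1)%N by have := ltn_ord a; lia.
have Hb : (b - n1 < n2.+1)%N by have := ltn_ord b; lia.
have E (A : 'M[bool]_n.+1) : A a b = BR A (Ordinal Ha) (Ordinal Hb).
  by rewrite mxE; congr (A _ _); apply: val_inj => /=; lia.
by rewrite !E BR_M // !tP (mr x y z).
Qed.

(** Entries are filled one at a time. Each filling loses radius, so the induction proves the claim
    for all radii at once and starts each step from a system on a larger set. [X] carries along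
    whatever is known about the two given systems. *)
Lemma fill_all (Z : R -> set T)
  (X : (T -> T -> 'M[bool]_n1.+1) -> (T -> T -> 'M[bool]_n2.+1) -> Prop) :
  (forall r r', r <= r' -> Z r `<=` Z r') ->
  (forall r, exists r', r <= r' /\ van 3 (Z r') (Z r)) ->
  (forall r, exists rho1 rho2 e, [/\ 0 < e, rep (Z r) e rho1, rep (Z r) e rho2 & X rho1 rho2]) ->
  forall r, exists rho1 rho2 e (P : T -> T -> 'M[bool]_n.+1),
    [/\ 0 < e, X rho1 rho2, rep (Z r) e P &
        forall x y, TL (P x y) = rho1 x y /\ BR (P x y) = rho2 x y].
Proof.
move=> Zm Zv H0.
(* Rows from the bottom up, each from left to right: when (a, b) is reached, the entries to its left
   and those below it are done, as [fill_entry] requires. *)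
pose idx (a b : nat) := ((n1.-1 - a) * n2 + (b - n1.+1))%N.
have main c : forall r, exists rho1 rho2 e (P : T -> T -> 'M[bool]_n.+1),
    [/\ 0 < e, X rho1 rho2, forall x y, ut (P x y),
        forall x y, TL (P x y) = rho1 x y /\ BR (P x y) = rho2 x y &
        forall a b : 'I_n.+1, (b <= n1)%N \/ (n1 <= a)%N \/ (idx a b < c)%N -> me (Z r) e P a b].
  elim: c => [|c IH] r.
    have [rho1 [rho2 [e [e0 r1 r2 x12]]]] := H0 r.
    exists rho1, rho2, e, (fun x y => catm (rho1 x y) (rho2 x y)).
    have uP x y : ut (catm (rho1 x y) (rho2 x y)) by apply: catm_ut; [exact: (proj1 r1)|exact: (proj1 r2)].
    split=> //.
      by move=> x y; rewrite TL_catm BR_catm //; [exact: (proj1 r1)|exact: (proj1 r2)].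
    move=> a b [bn|[na|//]].
      case: (leqP a n1) => an; last by apply: me_low => //; lia.
      by apply: me_TL r1 _ _ => // x y; rewrite TL_catm.
    case: (leqP n1 b) => bn; last by apply: me_low => //; lia.
    by apply: (me_BR uP _ r2) => // x y; rewrite BR_catm //; [exact: (proj1 r1)|exact: (proj1 r2)].
  have [r' [rr' v]] := Zv r.
  have [rho1 [rho2 [e [P [e0 x12 uP blk mP]]]]] := IH r'.
  case: (leqP (n1 * n2) c) => cn.
    exists rho1, rho2, e, P; split=> // a b H.
    apply: me_sub (Zm _ _ rr') (lexx _) _; apply: mP.
    case: H => [|[|]]; [by left|by right; left|move=> _].
    have la := ltn_ord a; have lb := ltn_ord b.
    case: (leqP b n1) => bn; first by left.
    case: (leqP n1 a) => an; first by right; left.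
    right; right; apply: leq_trans cn; rewrite /idx.
    have H1 : (b - n1.+1 < n2)%N by lia.
    have H2 : (n1.-1 - a < n1)%N by lia.
    nia.
  have n20 : (0 < n2)%N by case: n2 cn => //; rewrite muln0.
  have cd : (c %/ n2 < n1)%N by rewrite ltn_divLR.
  have cm : (c %% n2 < n2)%N by rewrite ltn_mod.
  have cE := divn_eq c n2.
  move: (c %/ n2)%N (c %% n2)%N cd cm cE => q m qn mn cE.
  have Ha : (n1.-1 - q < n.+1)%N by lia.
  have Hb : (n1.+1 + m < n.+1)%N by lia.
  pose a : 'I_n.+1 := Ordinal Ha; pose b : 'I_n.+1 := Ordinal Hb.
  have ab : (a < b)%N by rewrite /=; lia.
  have [||e1 [w [e10 ee1 mw]]] := fill_entry e0 uP ab v.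
  - move=> k kb; apply: mP; case: (leqP k n1) => kn; first by left.
    right; right; rewrite /idx cE /=; rewrite /= in kb.
    have -> : (n1.-1 - (n1.-1 - q) = q)%N by lia.
    lia.
  - move=> k ak; apply: mP; case: (leqP n1 k) => kn; first by right; left.
    right; right; rewrite /idx cE /=; rewrite /= in ak.
    have -> : (n1.+1 + m - n1.+1 = m)%N by lia.
    have : (n1.-1 - k < q)%N by lia.
    nia.
  exists rho1, rho2, e1, (fun x y => P x y + w x y *: delta_mx a b).
  have D (x y : T) (a' b' : 'I_n.+1) : (a' <> a :> nat) \/ (b' <> b :> nat) ->
      (P x y + w x y *: delta_mx a b) a' b' = P x y a' b'.
    move=> /ordpair_neq H; rewrite !mxE (_ : (a' == a) && (b' == b) = false) ?mulr0 ?addr0 //.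
    by apply: contraNF H => /andP[/eqP-> /eqP->].
  split=> //.
  - move=> x y a' b'; split; first by rewrite D ?(uP x y a' a').1 //; lia.
    by move=> ba; rewrite D ?(uP x y a' b').2 //; lia.
  - move=> x y; have [<- <-] := blk x y; split; apply/matrixP => i j; rewrite [LHS]mxE [RHS]mxE D //=.
      by have := ltn_ord j; lia.
    by lia.
  - move=> a' b' H; case: (pselect ((a', b') = (a, b))) => [[-> ->]//|ne].
    have Hd : (b' <= n1)%N \/ (n1 <= a')%N \/ (idx a' b' < c)%N.
      case: H => [|[|]]; [by left|by right; left|].
      have la := ltn_ord a'; have lb := ltn_ord b'.
      case: (leqP b' n1) => bn; first by left.
      case: (leqP n1 a') => an; first by right; left.
      rewrite ltnS leq_eqVlt => /orP[/eqP E|]; last by right; right.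
      case: ne; move: E; rewrite /idx cE => E.
      have H1 : (b' - n1.+1 < n2)%N by lia.
      have E1 : (n1.-1 - a' = q)%N by nia.
      have E2 : (b' - n1.+1 = m)%N by rewrite E1 in E; lia.
      by congr (_, _); apply: val_inj => /=; lia.
    (* Changing the entry (a, b) does no harm to the entries done before: in the product formula for
       (a', b') it is only ever multiplied by an entry below the diagonal. *)
    have pres : (a' <> a :> nat) \/ (b' < b)%N.
      case: Hd => [|[|]] /=; [lia|lia|move=> Hi].
      case: (eqVneq (a' : nat) (n1.-1 - q)%N) => [E|/eqP]; last by left.
      right; move: Hi; rewrite /idx cE E (_ : (n1.-1 - (n1.-1 - q) = q)%N); last lia.
      lia.
    have pres' : (b' <> b :> nat) \/ (a < a')%N.
      case: Hd => [|[|]] /=; [lia|lia|move=> Hi].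
      case: (eqVneq (b' : nat) (n1.+1 + m)%N) => [E|/eqP]; last by left.
      right; move: Hi; rewrite /idx cE E (_ : (n1.+1 + m - n1.+1 = m)%N); last lia.
      move=> Hi; have : (n1.-1 - a' < q)%N by nia.
      lia.
    have mP' := me_sub (Zm _ _ rr') ee1 (mP a' b' Hd).
    move=> x y z Zx Zy Zz xy yz xz.
    rewrite D; last by case: (pselect (a' = a :> nat)) => [Ea|]; [right => Eb; apply: ne; congr (_, _); exact: val_inj|left].
    rewrite (mP' x y z) //.
    set M1 := P x y + _; set M2 := P y z + _.
    rewrite !mxE; apply: eq_bigr => k _.
    case: (pselect ((a', k) = (a, b))) => [[Ea Ek]|nk].
      case: pres => pres; first by rewrite Ea in pres.
      have Hk : (b' < k)%N by rewrite Ek.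
      have E1 := (uP y z k b').2 Hk.
      have E2 : M2 k b' = 0 by rewrite /M2 D //; right; move: pres; clear; lia.
      by rewrite E1 E2 !mulr0.
    case: (pselect ((k, b') = (a, b))) => [[Ek Eb]|nk'].
      case: pres' => pres'; first by rewrite Eb in pres'.
      have Hk : (k < a')%N by rewrite Ek.
      have E1 := (uP x y a' k).2 Hk.
      have E2 : M1 a' k = 0 by rewrite /M1 D //; left; move: pres'; clear; lia.
      by rewrite E1 E2 !mul0r.
    rewrite /M1 /M2 !D //.
      by case: (pselect (k = a :> nat)) => [Ea|]; [right => Eb; apply: nk'; congr (_, _); exact: val_inj|left].
    by case: (pselect (a' = a :> nat)) => [Ea|]; [right => Eb; apply: nk; congr (_, _); exact: val_inj|left].
move=> r; have [rho1 [rho2 [e [P [e0 x12 uP blk mP]]]]] := main (n1 * n2)%N r.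
exists rho1, rho2, e, P; split=> //; split=> // x y z Zx Zy Zz xy yz xz.
apply/matrixP => a b; apply: (mP a b _ x y z) => //.
have la := ltn_ord a; have lb := ltn_ord b.
case: (leqP b n1) => bn; first by left.
case: (leqP n1 a) => an; first by right; left.
right; right; rewrite /idx.
have H1 : (b - n1.+1 < n2)%N by lia.
have H2 : (n1.-1 - a < n1)%N by lia.
nia.
Qed.

End FillAll.

(** * Detection of loops *)

Section Detection.
Context {R : realType} {d : nat}.
Notation T := 'rV[R]_d.

Definition sgh n (P : T -> T -> 'M[bool]_n.+1) N : T -> T -> 'M[bool]_n.+1 :=
  fun a b => hol P N (seg a b).

(* The loop [a :: s] is detected in the complement of [A] by a unitriangular
   local system whose monodromy along it is the corner matrix. *)
Definition Det (a : T) (s : seq T) (A : set T) := exists n, (0 < n)%N /\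
  forall r, exists e (P : T -> T -> 'M[bool]_n.+1) N0,
    [/\ 0 < e, rep (cube r `\` A) e P &
        forall N, (N0 <= N)%N -> tr (sgh P N) a s = corner n].

Lemma TL_hol n1 n2 (P : T -> T -> 'M[bool]_((n1 + n2).+1)) rho N a s :
  (forall x y, ut (P x y)) -> (forall x y, TL (P x y) = rho x y) ->
  TL (tr (sgh P N) a s) = tr (sgh rho N) a s.
Proof.
move=> uP tP; elim: s a => [|b s IH] a /=; first exact: TL_1.
rewrite TL_M ?IH; last 2 first.
- exact: hol_ut.
- by apply: tr_ut => x y; exact: hol_ut.
congr (_ * _); rewrite /sgh /hol TL_prod //.
by apply: eq_bigr => k _; rewrite tP.
Qed.

Lemma BR_hol n1 n2 (P : T -> T -> 'M[bool]_((n1 + n2).+1)) rho N a s :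
  (forall x y, ut (P x y)) -> (forall x y, BR (P x y) = rho x y) ->
  BR (tr (sgh P N) a s) = tr (sgh rho N) a s.
Proof.
move=> uP tP; elim: s a => [|b s IH] a /=; first exact: BR_1.
rewrite BR_M ?IH; last 2 first.
- exact: hol_ut.
- by apply: tr_ut => x y; exact: hol_ut.
congr (_ * _); rewrite /sgh /hol BR_prod //.
by apply: eq_bigr => k _; rewrite tP.
Qed.

(** In the block construction each of the two loops must be trivial in the block that comes from the
    other set, so triviality along [s'] is recorded for the same system. *)
Definition Det2 (a : T) (s s' : seq T) (A : set T) := exists n, (0 < n)%N /\
  forall r, exists e (P : T -> T -> 'M[bool]_n.+1) N0,
    [/\ 0 < e, rep (cube r `\` A) e P &
        forall N, (N0 <= N)%N -> tr (sgh P N) a s = corner n /\ tr (sgh P N) a s' = 1].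

Lemma comm_detect (A B : set T) (e0 : R) a s s' : 0 < e0 ->
  (forall x y, A x -> B y -> ~ cl e0 x y) -> Good A -> Good B ->
  Det2 a s s' A -> Det2 a s' s B ->
  exists n, (0 < n)%N /\
  forall r, exists e (P : T -> T -> 'M[bool]_n.+1) N0,
    [/\ 0 < e, rep (cube r `\` (A `|` B)) e P &
        forall N, (N0 <= N)%N -> tr (sgh P N) a s * tr (sgh P N) a s' =
          tr (sgh P N) a s' * tr (sgh P N) a s + cornerE n].
Proof.
move=> e0p sep gA gB [n1 [n10 dA]] [n2 [n20 dB]].
exists (n1 + n2)%N; split; first by rewrite addn_gt0 n10.
pose X (rho1 : T -> T -> 'M[bool]_n1.+1) (rho2 : T -> T -> 'M[bool]_n2.+1) :=
  exists N0, forall N, (N0 <= N)%N ->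
    [/\ tr (sgh rho1 N) a s = corner n1, tr (sgh rho1 N) a s' = 1,
        tr (sgh rho2 N) a s' = corner n2 & tr (sgh rho2 N) a s = 1].
suff H : forall r, exists rho1 rho2 e (P : T -> T -> 'M[bool]_((n1 + n2).+1)),
    [/\ 0 < e, X rho1 rho2, rep (cube r `\` (A `|` B)) e P &
        forall x y, TL (P x y) = rho1 x y /\ BR (P x y) = rho2 x y].
  move=> r; have [rho1 [rho2 [e [P [ep [N0 HN] rP blk]]]]] := H r.
  exists e, P, N0; split=> // N /HN[A1 A2 A3 A4].
  have uP := rP.1.
  have uS x y : ut (sgh P N x y) by exact: hol_ut.
  apply: blocks_commutator => //; try exact: tr_ut.
  + by rewrite (TL_hol (rho := rho1)) // => x y; exact: (blk x y).1.
  + by rewrite (BR_hol (rho := rho2)) // => x y; exact: (blk x y).2.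
  + by rewrite (TL_hol (rho := rho1)) // => x y; exact: (blk x y).1.
  + by rewrite (BR_hol (rho := rho2)) // => x y; exact: (blk x y).2.
apply: (@fill_all R d n1 n2 (fun r => cube r `\` (A `|` B)) X).
- by move=> r r' rr x [xr nx]; split=> //; exact: cube_le xr.
- move=> r; have [r' v] := GoodU e0p sep gA gB r.
  exists (Num.max r r'); split; first by rewrite le_max lexx.
  apply: van_sub v => // x [xr nx]; split=> //.
  by apply: cube_le xr; rewrite le_max lexx orbT.
- move=> r.
  have [e1 [P1 [N1 [e10 r1 H1]]]] := dA r.
  have [e2 [P2 [N2 [e20 r2 H2]]]] := dB r.
  exists P1, P2, (Num.min e1 e2); split.
  + by rewrite lt_min e10.
  + apply: rep_sub r1; last by rewrite ge_min lexx.
    by move=> x [xr nx]; split=> // Ax; apply: nx; left.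
  + apply: rep_sub r2; last by rewrite ge_min lexx orbT.
    by move=> x [xr nx]; split=> // Bx; apply: nx; right.
  + exists (maxn N1 N2) => N; rewrite geq_max => /andP[/H1[-> ->] /H2[-> ->]].
    by [].
Qed.

Lemma commutator_corner n (X Y : 'M[bool]_n.+1) : ut X -> ut Y ->
  X * Y = Y * X + cornerE n -> X * Y * X^-1 * Y^-1 = corner n.
Proof.
move=> uX uY E.
have UX := ut_unit uX; have UY := ut_unit uY.
apply: (mulIr UY); rewrite divrK //; apply: (mulIr UX); rewrite divrK // E.
by rewrite /corner mulrDl mul1r mulrDl cornerE_ut // cornerE_ut.
Qed.

(** The last hypothesis is the geometric input: a homotopy in the complement, expressed through
    every abstract transport [S]. The conjugating matrix commutes with the corner matrix, so the
    conjugation disappears. *)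
Lemma comm_Det (A B : set T) (e0 r0 : R) a s s' b m : 0 < e0 ->
  (forall x y, A x -> B y -> ~ cl e0 x y) -> Good A -> Good B ->
  Det2 a s s' A -> Det2 a s' s B ->
  (forall n (S : T -> T -> 'M[bool]_n.+1), qf (cube r0 `\` (A `|` B)) r0 S ->
     exists U, [/\ U \is a GRing.unit, U * corner n = corner n * U & tr S b m =
       U * (tr S a s * tr S a s' * (tr S a s)^-1 * (tr S a s')^-1) * U^-1]) ->
  Det b m (A `|` B).
Proof.
move=> e0p sep gA gB dA dB rel.
have [n [n0 H]] := comm_detect e0p sep gA gB dA dB.
exists n; split=> // r.
pose r' := Num.max r r0.
have [e [P [N0 [ep rP HN]]]] := H r'.
have rP0 : rep (cube r0 `\` (A `|` B)) e P.
  apply: rep_sub rP => // x [xr nx]; split=> //.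
  by apply: cube_le xr; rewrite le_max lexx orbT.
have [N1 H1] := hol_qf r0 ep rP0.
exists e, P, (maxn N0 N1); split=> //.
  apply: rep_sub rP => // x [xr nx]; split=> //.
  by apply: cube_le xr; rewrite le_max lexx.
move=> N; rewrite geq_max => /andP[/HN E /H1 Q].
have [U [uU cU ->]] := rel n _ Q.
have uS x y : ut (sgh P N x y) by apply: hol_ut; exact: rP.1.
rewrite commutator_corner ?cU ?mulrK //; exact: tr_ut.
Qed.

Lemma qf_sub n (Z Z' : set T) r (S : T -> T -> 'M[bool]_n.+1) :
  Z' `<=` Z -> qf Z r S -> qf Z' r S.
Proof.
move=> ZZ [q1 q2 q3 q4]; split=> //.
- by move=> a /ZZ; exact: q2.
- by move=> a b H; apply: q3 => u /H /ZZ.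
- move=> a b c c' ra rb rc rc' H; apply: q4; [exact: ra|exact: rb|exact: rc|exact: rc'|].
  by move=> u v u01 v01; apply: ZZ; exact: H.
Qed.

Definition pt2 (j t : 'I_d) (a b : R) : T :=
  \row_k (if k == j then a else if k == t then b else 0).
(** The meridian: up through the hole, outwards to x_j = -3, down, and back to the axis below the
    frame. The sizes 2 and 3 exceed the half widths of the frames used. *)
Definition mu (j t : 'I_d) : seq T :=
  [:: pt2 j t 0 2; pt2 j t (-3) 2; pt2 j t (-3) (-2); pt2 j t 0 (-2); pt2 j t 0 0].

Lemma pt2_0 j t : pt2 j t 0 0 = 0.
Proof. by apply/rowP => k; rewrite !mxE; case: (_ == j); case: (_ == t). Qed.

(** The system counts crossings of the disc x_t = 0 that spans the frame. A small step off the frame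
    that enters or leaves the column takes place where |x_t| > l_t and cannot change the sign of
    x_t, so the count is multiplicative. The meridian crosses once, on its first edge, because x_t =
    0 counts as the lower side. *)
Lemma Det_frame (j t : 'I_d) (l h : 'I_d -> R) : j != t -> (forall k, 0 < h k < l k) ->
  l j < 3 -> l t < 2 -> Det 0 (mu j t) (Fr t l h).
Proof.
move=> jt hl lj lt; exists 1%N; split=> // r.
pose e0 := \big[Num.min/l t]_k (l k - h k).
have lt0 : 0 < l t by have := hl t; lra.
have e0p : 0 < e0.
  rewrite /e0; elim/big_ind: _ => // [x y x0 y0|k _]; first by rewrite lt_min x0.
  by have := hl k; lra.
have e0l k : e0 <= l k - h k by rewrite /e0; exact: bigmin_le_cond.
have e0t : e0 <= l t by rewrite /e0; exact: bigmin_le_id.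
pose inC (x : T) := [forall k, (k != t) ==> (`|x ord0 k| < l k)].
pose sg (x : T) := 0 < x ord0 t.
pose c x y := [&& inC x, inC y & sg x (+) sg y].
pose P x y : 'M[bool]_2 := 1 + c x y *: cornerE 1.
have EE : cornerE 1 * cornerE 1 = 0 by exact: cornerE_sq.
have M1 (a b : bool) : (1 + a *: cornerE 1) * (1 + b *: cornerE 1) = 1 + (a + b) *: cornerE 1.
  rewrite mulrDl !mulrDr !mulr1 mul1r -scalerAl -scalerAr EE !scaler0 addr0 scalerDl.
  by rewrite -addrA; congr (_ + _); rewrite addrC.
have uP x y : ut (P x y).
  move=> i k; rewrite !mxE eqxx; split.
    rewrite (_ : (i == ord0) && (i == ord_max) = false) ?mulr0 ?addr0 //.
    by case: i => -[|[|]].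
  move=> ki; rewrite (_ : (i == k) = false); last by apply/eqP => E; rewrite E ltnn in ki.
  rewrite (_ : (i == ord0) = false) ?mulr0 ?add0r //.
  by apply/eqP => E; rewrite E in ki.
have inCP (x : T) : reflect (forall k, k != t -> `|x ord0 k| < l k) (inC x).
  apply: (iffP forallP) => H k; first by move=> kt; have := H k; rewrite kt.
  by apply/implyP; exact: H.
have out (x y : T) : ~ Fr t l h x -> inC x -> ~~ inC y -> cl e0 x y -> l t < `|x ord0 t|.
  move=> nx Cx nCy xy.
  have [k [kt lk]] : exists k, k != t /\ l k <= `|y ord0 k|.
    apply: contrapT => H; move/negP: nCy; apply; apply/inCP => k kt.
    by rewrite ltNge; apply/negP => lk; apply: H; exists k.
  have hk : h k <= `|x ord0 k|.
    have := xy k; have := e0l k.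
    have := ler_normB (x ord0 k) (x ord0 k - y ord0 k).
    rewrite (_ : x ord0 k - (x ord0 k - y ord0 k) = y ord0 k); last by ring.
    lra.
  rewrite ltNge; apply/negP => xt; apply: nx; split.
    move=> m; case: (eqVneq m t) => [->//|mt]; apply: ltW; exact: (inCP x Cx).
  by move=> /(_ k kt); rewrite ltNge hk.
have sgE (x y : T) : l t < `|x ord0 t| -> l t < `|y ord0 t| -> cl e0 x y -> sg x = sg y.
  move=> lx ly /(_ t); rewrite ltr_norml /sg => /andP[A B].
  case: (ltrP 0 (x ord0 t)) => x0; case: (ltrP 0 (y ord0 t)) => y0 //.
    by rewrite ger0_norm in lx; [rewrite ler0_norm in ly; lra|lra].
  by rewrite ler0_norm in lx; [rewrite ger0_norm in ly; lra|lra].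
have rP : rep (cube r `\` Fr t l h) e0 P.
  split=> // x y z [_ nx] [_ ny] [_ nz] xy yz xz; rewrite /P M1.
  congr (1 + _ *: _); rewrite /c.
  case Cx: (inC x); case Cy: (inC y); case Cz: (inC z) => //=.
  - by rewrite -[RHS]/(addb _ _) addbA -(addbA (sg x)) addbb addbF.
  - rewrite (sgE x y) ?addbb //; first by apply: (out x z) => //; rewrite Cz.
    by apply: (out y z) => //; rewrite Cz.
  - rewrite (sgE x z) ?addbb //; first by apply: (out x y) => //; rewrite Cy.
    by apply: (out z y) => //; [rewrite Cy|exact: clC].
  - rewrite (sgE y z) ?addbb //; first by apply: (out y x) => //; [rewrite Cx|exact: clC].
    by apply: (out z x) => //; [rewrite Cx|exact: clC].
exists e0, P, 1%N; split=> // N N0.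
have in01 m : (m <= N)%N -> 0 <= (m%:R / N%:R : R) <= 1.
  by move=> mN; rewrite divr_ge0 ?ler0n // ler_pdivrMr ?ltr0n // mul1r ler_nat.
have triv (g : R -> T) : (forall u v, 0 <= u <= 1 -> 0 <= v <= 1 -> c (g u) (g v) = false) -> hol P N g = 1.
  move=> H; rewrite /hol big1 // => k _.
  by rewrite /P H ?scale0r ?addr0 // in01 // ltnW.
have tel (g : R -> T) : (forall u, 0 <= u <= 1 -> inC (g u)) ->
    hol P N g = 1 + (sg (g 0) (+) sg (g 1)) *: cornerE 1.
  move=> H; suff E m : (m <= N)%N ->
      \prod_(k < m) P (g (k%:R / N%:R)) (g (k.+1%:R / N%:R)) =
      1 + (sg (g 0) (+) sg (g (m%:R / N%:R))) *: cornerE 1.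
    by rewrite /hol E // divff // pnatr_eq0 -lt0n.
  elim: m => [|m IH] mN; first by rewrite big_ord0 mul0r addbb scale0r addr0.
  rewrite big_ord_recr /= IH ?(ltnW mN) // /P M1 /c !H ?in01 ?(ltnW mN) //=.
  by rewrite -[X in (X) *: _]/(addb _ _) addbA -(addbA (sg (g 0))) addbb addbF.
have jt' : (t == j) = false by rewrite eq_sym; apply/negbTE.
have st (a a' b b' u : R) : seg (pt2 j t a b) (pt2 j t a' b') u ord0 t = (1 - u) * b + u * b'.
  by rewrite !mxE jt' eqxx.
have sj (a a' b b' u : R) : seg (pt2 j t a b) (pt2 j t a' b') u ord0 j = (1 - u) * a + u * a'.
  by rewrite !mxE eqxx.
have sgE' (b : R) : 0 < b -> sg (pt2 j t 0 b) by move=> b0; rewrite /sg !mxE jt' eqxx.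
have sgN (b : R) : b <= 0 -> sg (pt2 j t 0 b) = false.
  by move=> b0; rewrite /sg !mxE jt' eqxx; apply/negbTE; rewrite -leNgt.
have ct (b b' : R) : hol P N (seg (pt2 j t 0 b) (pt2 j t 0 b')) =
    1 + (sg (pt2 j t 0 b) (+) sg (pt2 j t 0 b')) *: cornerE 1.
  rewrite tel ?seg0 ?seg1 //.
  move=> u u01; apply/inCP => k kt; rewrite !mxE (negbTE kt).
  by case: ifP => _; rewrite !mulr0 addr0 normr0; have := hl k; lra.
have E1 : hol P N (seg (pt2 j t 0 0) (pt2 j t 0 2)) = corner 1.
  by rewrite ct sgN // sgE' ?ltr0n // scale1r.
have E5 : hol P N (seg (pt2 j t 0 (-2)) (pt2 j t 0 0)) = 1.
  by rewrite ct !sgN ?scale0r ?addr0 //; lra.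
have E2 : hol P N (seg (pt2 j t 0 2) (pt2 j t (-3) 2)) = 1.
  apply: triv => u v u01 v01; rewrite /c /sg !st.
  have A (w : R) : 0 < (1 - w) * 2 + w * 2 by rewrite -mulrDl subrK mul1r.
  by rewrite !A addbb !andbF.
have E3 : hol P N (seg (pt2 j t (-3) 2) (pt2 j t (-3) (-2))) = 1.
  apply: triv => u v u01 v01; rewrite /c (_ : inC _ = false) //.
  apply/negbTE/negP => /inCP /(_ j jt); rewrite sj.
  by rewrite (_ : (1 - u) * -3 + u * -3 = -3) ?ler0_norm; [lra|lra|ring].
have E4 : hol P N (seg (pt2 j t (-3) (-2)) (pt2 j t 0 (-2))) = 1.
  apply: triv => u v u01 v01; rewrite /c /sg !st.
  have A (w : R) : 0 < (1 - w) * -2 + w * -2 = false.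
    by rewrite -mulrDl subrK mul1r; apply/negbTE; rewrite -leNgt; lra.
  by rewrite !A addbb !andbF.
by rewrite -(pt2_0 j t) /= /sgh E1 E2 E3 E4 E5 !mulr1.
Qed.

Lemma rep_im n (p : hom) (A : set T) r : exists r', forall e (P : T -> T -> 'M[bool]_n.+1),
  0 < e -> rep (cube r' `\` A) e P ->
  exists e', 0 < e' /\ rep (cube r `\` im p A) e' (fun x y => P (hi p x) (hi p y)).
Proof.
have [r' Hr] := (hiu p).2 r; exists r' => e P e0 rP.
have [e' [e'0 He]] := (hiu p).1 r e e0.
exists e'; split=> //; apply: rep_pull rP => [x [xr nx]|x y [xr _] [yr _]].
  by split; [exact: Hr|].
exact: He.
Qed.

End Detection.

(** * Elementary homeomorphisms *)

Section LipschitzLine.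
Context {R : realType}.

Record lip := Lip { lf :> R -> R; li : R -> R; lC : R; lC0 : 0 < lC;
  lfL : forall a b, `|lf a - lf b| <= lC * `|a - b|;
  liL : forall a b, `|li a - li b| <= lC * `|a - b|;
  lfK : cancel lf li; liK : cancel li lf }.

Lemma lip_max (f : R -> R) (C C' : R) : C <= C' ->
  (forall a b, `|f a - f b| <= C * `|a - b|) -> forall a b, `|f a - f b| <= C' * `|a - b|.
Proof. by move=> CC H a b; apply: le_trans (H a b) _; rewrite ler_wpM2r. Qed.

Lemma lip_comp_bound (f g : R -> R) (C D : R) : 0 <= C ->
  (forall a b, `|f a - f b| <= C * `|a - b|) -> (forall a b, `|g a - g b| <= D * `|a - b|) ->
  forall a b, `|f (g a) - f (g b)| <= C * D * `|a - b|.
Proof.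
by move=> C0 Hf Hg a b; apply: le_trans (Hf _ _) _; rewrite -mulrA ler_wpM2l.
Qed.

Definition lip_id : lip.
Proof. by exists id id 1 => // a b; rewrite mul1r. Defined.

Definition lip_comp (f g : lip) : lip.
Proof.
exists (f \o g) (li g \o li f) (lC f * lC g).
- by rewrite mulr_gt0 ?lC0.
- exact: (lip_comp_bound (ltW (lC0 f)) (@lfL f) (@lfL g)).
- by rewrite mulrC; exact: (lip_comp_bound (ltW (lC0 g)) (@liL g) (@liL f)).
- exact: can_comp (lfK f) (lfK g).
- exact: can_comp (liK g) (liK f).
Defined.

Lemma aff_lip (m c C : R) : `|m| <= C -> forall a b, `|(m * a + c) - (m * b + c)| <= C * `|a - b|.
Proof. by move=> mC a b; rewrite opprD addrACA subrr addr0 -mulrBr normrM ler_wpM2r. Qed.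

Definition lip_aff (m c : R) (m0 : m != 0) : lip.
Proof.
exists (fun x => m * x + c) (fun x => m^-1 * x + - m^-1 * c) (`|m| + `|m^-1|).
- by rewrite ltr_wpDr ?normr_ge0 // normr_gt0.
- by apply: aff_lip; rewrite lerDl.
- by apply: aff_lip; rewrite lerDr.
- by move=> x; field.
- by move=> x; field.
Defined.

Lemma max_lip (a b : R) : `|Num.max 0 a - Num.max 0 b| <= `|a - b|.
Proof.
have [a0|a0] := lerP 0 a; have [b0|b0] := lerP 0 b => //.
- by rewrite subr0 !ger0_norm //; lra.
- by rewrite sub0r normrN ger0_norm // distrC ger0_norm; lra.
- by rewrite subrr normr0.
Qed.

Definition kinkR (p m x : R) := x + (m - 1) * Num.max 0 (x - p).
Definition kinkL (p m x : R) := x + (1 - m) * Num.max 0 (p - x).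

Lemma kinkR_ge (p m x : R) : p <= x -> kinkR p m x = p + m * (x - p).
Proof. by move=> px; rewrite /kinkR max_r; [ring|lra]. Qed.
Lemma kinkR_le (p m x : R) : x <= p -> kinkR p m x = x.
Proof. by move=> px; rewrite /kinkR max_l; [ring|lra]. Qed.
Lemma kinkL_le (p m x : R) : x <= p -> kinkL p m x = p + m * (x - p).
Proof. by move=> px; rewrite /kinkL max_r; [ring|lra]. Qed.
Lemma kinkL_ge (p m x : R) : p <= x -> kinkL p m x = x.
Proof. by move=> px; rewrite /kinkL max_l; [ring|lra]. Qed.

Lemma kinkR_lip (p m a b : R) : `|kinkR p m a - kinkR p m b| <= (1 + `|m - 1|) * `|a - b|.
Proof.
rewrite /kinkR (_ : _ - _ = (a - b) + (m - 1) * (Num.max 0 (a - p) - Num.max 0 (b - p))); last by ring.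
apply: le_trans (ler_normD _ _) _; rewrite [leRHS]mulrDl mul1r lerD2l normrM ler_wpM2l //.
by apply: le_trans (max_lip _ _) _; rewrite (_ : a - p - (b - p) = a - b) //; ring.
Qed.

Lemma kinkL_lip (p m a b : R) : `|kinkL p m a - kinkL p m b| <= (1 + `|m - 1|) * `|a - b|.
Proof.
rewrite /kinkL (_ : _ - _ = (a - b) + (1 - m) * (Num.max 0 (p - a) - Num.max 0 (p - b))); last by ring.
apply: le_trans (ler_normD _ _) _; rewrite [leRHS]mulrDl mul1r lerD2l normrM distrC ler_wpM2l //.
by apply: le_trans (max_lip _ _) _; rewrite (_ : p - a - (p - b) = b - a) 1?distrC //; ring.
Qed.

Lemma kinkRK (p m : R) : 0 < m -> cancel (kinkR p m) (kinkR p m^-1).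
Proof.
move=> m0 x; have [xp|px] := lerP x p; first by rewrite !kinkR_le // kinkR_le.
rewrite (kinkR_ge _ (ltW px)) kinkR_ge; last by rewrite lerDl mulr_ge0 //; lra.
by field; rewrite gt_eqF.
Qed.

Lemma kinkLK (p m : R) : 0 < m -> cancel (kinkL p m) (kinkL p m^-1).
Proof.
move=> m0 x; have [xp|px] := lerP p x; first by rewrite !kinkL_ge // kinkL_ge.
rewrite (kinkL_le _ (ltW px)) kinkL_le; last by rewrite gerDl mulr_ge0_le0 //; lra.
by field; rewrite gt_eqF.
Qed.

Definition lip_kinkR (p m : R) (m0 : 0 < m) : lip.
Proof.
exists (kinkR p m) (kinkR p m^-1) ((1 + `|m - 1|) + (1 + `|m^-1 - 1|)).
- by have := normr_ge0 (m - 1); have := normr_ge0 (m^-1 - 1); lra.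
- by apply: lip_max (kinkR_lip p m); rewrite lerDl addr_ge0.
- by apply: lip_max (kinkR_lip p m^-1); rewrite lerDr addr_ge0.
- exact: kinkRK.
- by move=> x; rewrite -{1}[m]invrK kinkRK // invr_gt0.
Defined.

Definition lip_kinkL (p m : R) (m0 : 0 < m) : lip.
Proof.
exists (kinkL p m) (kinkL p m^-1) ((1 + `|m - 1|) + (1 + `|m^-1 - 1|)).
- by have := normr_ge0 (m - 1); have := normr_ge0 (m^-1 - 1); lra.
- by apply: lip_max (kinkL_lip p m); rewrite lerDl addr_ge0.
- by apply: lip_max (kinkL_lip p m^-1); rewrite lerDr addr_ge0.
- exact: kinkLK.
- by move=> x; rewrite -{1}[m]invrK kinkLK // invr_gt0.
Defined.

End LipschitzLine.

(** * Coordinatewise maps, permutations and shears *)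

Section HomBuilders.
Context {R : realType} {d : nat}.
Notation T := 'rV[R]_d.

Lemma ucb_lip (p : T -> T) (C : R) : 0 < C -> (forall e x y, 0 < e -> cl e x y -> cl (C * e) (p x) (p y)) ->
  ucb p.
Proof.
move=> C0 H; split=> [r e e0|r].
  exists (e / C); split=> [|x y _ _ xy]; first exact: divr_gt0.
  by have := H _ _ _ (divr_gt0 e0 C0) xy; rewrite mulrC divfK // gt_eqF.
have [B HB] : exists B : R, cube B (p 0).
  exists (\big[Num.max/0]_k `|p 0 ord0 k|) => k; exact: le_bigmax.
exists (B + C * (`|r| + 1)) => x xr k.
have : cl (`|r| + 1) x 0.
  by move=> m; rewrite mxE subr0; apply: le_lt_trans (xr m) _; have := ler_norm r; lra.
have r1 : 0 < `|r| + 1 by have := normr_ge0 r; lra.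
move=> /(H _ _ _ r1)/(_ k) E.
have := ler_normD (p 0 ord0 k) (p x ord0 k - p 0 ord0 k); rewrite addrC subrK.
by have := HB k; lra.
Qed.

Definition cmap (f : 'I_d -> R -> R) (x : T) : T := \row_k f k (x ord0 k).

Lemma cmap_ucb (f : 'I_d -> @lip R) (g : 'I_d -> R -> R) :
  (forall k a b, `|g k a - g k b| <= lC (f k) * `|a - b|) -> ucb (cmap g).
Proof.
move=> H; pose C := \big[Num.max/1]_k lC (f k).
have CC k : lC (f k) <= C by rewrite /C; exact: le_bigmax.
have C0 : 0 < C by apply: lt_le_trans ltr01 _; rewrite /C; exact: bigmax_ge_id.
apply: (@ucb_lip _ C) => // e x y e0 xy k; rewrite !mxE.
apply: le_lt_trans (H k _ _) _; apply: le_lt_trans (_ : C * `|x ord0 k - y ord0 k| < _).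
  by rewrite ler_wpM2r.
by rewrite ltr_pM2l.
Qed.

Definition chom (f : 'I_d -> @lip R) : @hom R d.
Proof.
exists (cmap (fun k => f k)) (cmap (fun k => li (f k))).
- by apply: (@cmap_ucb f) => k; exact: lfL.
- by apply: (@cmap_ucb f) => k; exact: liL.
- by move=> x; apply/rowP => k; rewrite !mxE lfK.
- by move=> x; apply/rowP => k; rewrite !mxE liK.
Defined.

Lemma chomE f (x : T) k : chom f x ord0 k = f k (x ord0 k).
Proof. by rewrite mxE. Qed.

Definition pmap (s : 'S_d) (x : T) : T := \row_k x ord0 (s k).

Lemma pmap_ucb s : ucb (pmap s).
Proof. by apply: (@ucb_lip _ 1) => // e x y e0 xy k; rewrite !mxE mul1r. Qed.

Definition phom (s : 'S_d) : @hom R d.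
Proof.
exists (pmap s) (pmap s^-1); try exact: pmap_ucb.
- by move=> x; apply/rowP => k; rewrite !mxE permKV.
- by move=> x; apply/rowP => k; rewrite !mxE permK.
Defined.

Lemma phomE s (x : T) k : phom s x ord0 k = x ord0 (s k).
Proof. by rewrite mxE. Qed.

Section Shear.
Context (s : 'I_d) (g : T -> R) (C : R).
Hypothesis C0 : 0 < C.
Hypothesis gC : forall e x y, 0 < e -> cl e x y -> `|g x - g y| < C * e.
Hypothesis gs : forall x v, g (upd x s v) = g x.

Definition smap (c : R) (x : T) : T := upd x s (x ord0 s + c * g x).

Lemma smap_ucb c : `|c| <= 1 -> ucb (smap c).
Proof.
move=> c1; apply: (@ucb_lip _ (1 + C)) => [|e x y e0 xy k]; first by rewrite addr_gt0.
rewrite !mxE; case: eqP => _.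
  rewrite (_ : _ - _ = (x ord0 s - y ord0 s) + c * (g x - g y)); last by ring.
  apply: le_lt_trans (ler_normD _ _) _; rewrite mulrDl mul1r; apply: ltrD => //.
  rewrite normrM; apply: le_lt_trans (gC e0 xy).
  by rewrite -[leRHS]mul1r ler_wpM2r.
apply: lt_le_trans (xy k) _; rewrite -{1}[e]mul1r; apply: ler_wpM2r; first exact: ltW.
by rewrite lerDl ltW.
Qed.

Lemma smapK (c c' : R) : c + c' = 0 -> cancel (smap c) (smap c').
Proof.
move=> cc x; rewrite /smap gs; apply/rowP => k; rewrite !mxE eqxx; case: eqP => // ->.
by rewrite -addrA -mulrDl cc mul0r addr0.
Qed.

Definition shom : @hom R d.
Proof.
exists (smap 1) (smap (-1)).
- by apply: smap_ucb; rewrite normr1.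
- by apply: smap_ucb; rewrite normrN1.
- by apply: smapK; rewrite subrr.
- by apply: smapK; rewrite addNr.
Defined.

Lemma shomE x k : shom x ord0 k = if k == s then x ord0 s + g x else x ord0 k.
Proof. by rewrite mxE mul1r. Qed.

End Shear.
End HomBuilders.

(** * Turning a half plane *)

Section Turn.
Context {R : realType}.
Implicit Types u v m : R.

Definition supn u v := Num.max `|u| `|v|.

Lemma supnD u v u' v' : supn (u + u') (v + v') <= supn u v + supn u' v'.
Proof.
rewrite /supn ge_max; apply/andP; split; apply: le_trans (ler_normD _ _) _; apply: lerD;
  by rewrite le_max lexx ?orbT.
Qed.

Lemma supnN u v : supn (- u) (- v) = supn u v.
Proof. by rewrite /supn !normrN. Qed.

Lemma supn_dist u v u' v' : `|supn u v - supn u' v'| <= supn (u - u') (v - v').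
Proof.
rewrite ler_norml; apply/andP; split.
  have := supnD u v (u' - u) (v' - v); rewrite -(supnN (u' - u)) !opprB.
  by rewrite [u + _]addrC [v + _]addrC !subrK; lra.
have := supnD u' v' (u - u') (v - v').
by rewrite [u' + _]addrC [v' + _]addrC !subrK; lra.
Qed.

Lemma supnZ c u v : 0 <= c -> supn (c * u) (c * v) = c * supn u v.
Proof. by move=> c0; rewrite /supn !normrM (ger0_norm c0) maxr_pMr. Qed.

Lemma supn_ge0 u v : 0 <= supn u v.
Proof. by rewrite /supn le_max normr_ge0. Qed.

Lemma supn_l u v : `|u| <= supn u v. Proof. by rewrite /supn le_max lexx. Qed.
Lemma supn_r u v : `|v| <= supn u v. Proof. by rewrite /supn le_max lexx orbT. Qed.

Lemma supn_le u v c : (supn u v <= c) = (`|u| <= c) && (`|v| <= c).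
Proof. by rewrite /supn ge_max. Qed.

Lemma supn_eq0 u v : supn u v = 0 -> u = 0 /\ v = 0.
Proof.
move=> E; have := supn_l u v; have := supn_r u v.
by rewrite E !normr_le0 => /eqP -> /eqP ->.
Qed.

(* The shear of the half plane [v < u] parallel to the diagonal. *)
Definition dsh m u v := m * Num.max 0 (u - v).

Lemma dshK m u v : dsh (- m) (u - dsh m u v) (v - dsh m u v) = - dsh m u v.
Proof. by rewrite /dsh mulNr; congr (- (_ * Num.max 0 _)); ring. Qed.

Lemma dshZ m c u v : 0 <= c -> dsh m (c * u) (c * v) = c * dsh m u v.
Proof. by move=> c0; rewrite /dsh -mulrBr -{1}(mulr0 c) -maxr_pMr // mulrCA. Qed.

(** The constant is 1 + 2 * 3, as the shear subtracts at most 3 times a difference of two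
    coordinates. *)
Lemma dsh_lip m u v u' v' : `|m| <= 3 ->
  supn ((u - dsh m u v) - (u' - dsh m u' v')) ((v - dsh m u v) - (v' - dsh m u' v'))
  <= 7 * supn (u - u') (v - v').
Proof.
move=> m3; have H := max_lip (u - v) (u' - v').
have Hu := supn_l (u - u') (v - v'); have Hv := supn_r (u - u') (v - v').
have E : `|dsh m u v - dsh m u' v'| <= 6 * supn (u - u') (v - v').
  rewrite /dsh -mulrBr normrM (_ : 6 = 3 * 2 :> R); last by ring.
  rewrite -mulrA; apply: ler_pM => //; apply: le_trans H _.
  rewrite (_ : u - v - (u' - v') = (u - u') - (v - v')); last by ring.
  by apply: le_trans (ler_normB _ _) _; lra.
rewrite supn_le; apply/andP; split.
  rewrite (_ : _ - _ = (u - u') - (dsh m u v - dsh m u' v')); last by ring.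
  by apply: le_trans (ler_normB _ _) _; lra.
rewrite (_ : _ - _ = (v - v') - (dsh m u v - dsh m u' v')); last by ring.
by apply: le_trans (ler_normB _ _) _; lra.
Qed.

Lemma dsh_bound m u v : `|m| <= 3 -> supn (u - dsh m u v) (v - dsh m u v) <= 7 * supn u v.
Proof.
move=> m3; have := dsh_lip u v 0 0 m3.
by rewrite {2 4}/dsh !subr0 maxxx mulr0 !subr0.
Qed.

Lemma dsh_boundV m u v : `|m| <= 3 -> supn u v <= 7 * supn (u - dsh m u v) (v - dsh m u v).
Proof.
move=> m3; have := @dsh_bound (- m) (u - dsh m u v) (v - dsh m u v).
by rewrite normrN dshK !opprK !subrK; apply.
Qed.

(* Rotation of the half plane [v < u] about the origin preserving squares. *)
Definition turnA m u v := supn u v / supn (u - dsh m u v) (v - dsh m u v).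
Definition turn1 m u v := turnA m u v * (u - dsh m u v).
Definition turn2 m u v := turnA m u v * (v - dsh m u v).

Lemma turnA_ge0 m u v : 0 <= turnA m u v.
Proof. by rewrite divr_ge0 ?supn_ge0. Qed.

Lemma turnA_E m u v : `|m| <= 3 ->
  turnA m u v * supn (u - dsh m u v) (v - dsh m u v) = supn u v.
Proof.
move=> m3; rewrite /turnA; case: (eqVneq (supn (u - dsh m u v) (v - dsh m u v)) 0) => [E|nz].
  have := dsh_boundV u v m3; rewrite E !mulr0 => H.
  by apply/eqP; rewrite eq_le H supn_ge0.
by rewrite divfK.
Qed.

Lemma supn_turn m u v : `|m| <= 3 -> supn (turn1 m u v) (turn2 m u v) = supn u v.
Proof. by move=> m3; rewrite /turn1 /turn2 supnZ ?turnA_ge0 // turnA_E. Qed.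

Lemma turnA_le m u v : `|m| <= 3 -> turnA m u v <= 7.
Proof.
move=> m3; have := dsh_boundV u v m3; rewrite /turnA.
have := supn_ge0 (u - dsh m u v) (v - dsh m u v).
rewrite le_eqVlt => /orP[/eqP <-|n0] H; first by rewrite invr0 mulr0.
by rewrite ler_pdivrMr.
Qed.

Lemma turn_lip_le m u v u' v' : `|m| <= 3 -> supn u' v' <= supn u v ->
  supn (turn1 m u v - turn1 m u' v') (turn2 m u v - turn2 m u' v') <= 147 * supn (u - u') (v - v').
Proof.
move=> m3 le.
have L := dsh_lip u v u' v' m3.
have E' := turnA_E u' v' m3; have EE := turnA_E u v m3.
have A0 := turnA_ge0 m u v; have A7 := turnA_le u v m3; have A0' := turnA_ge0 m u' v'.
have bV := dsh_boundV u v m3; have b' := dsh_bound u' v' m3.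
have sd := supn_dist u v u' v'.
have sd' := supn_dist (u - dsh m u v) (v - dsh m u v) (u' - dsh m u' v') (v' - dsh m u' v').
rewrite /turn1 /turn2.
move: (turnA m u v) (turnA m u' v') E' EE A0 A7 A0' => A A' E' EE A0 A7 A0'.
move: (u - dsh m u v) (v - dsh m u v) (u' - dsh m u' v') (v' - dsh m u' v')
  L E' EE bV b' sd' => q1 q2 q1' q2' L E' EE bV b' sd'.
have -> : A * q1 - A' * q1' = A * (q1 - q1') + (A - A') * q1' by ring.
have -> : A * q2 - A' * q2' = A * (q2 - q2') + (A - A') * q2' by ring.
apply: le_trans (supnD _ _ _ _) _; rewrite supnZ //.
have D0 := supn_ge0 (u - u') (v - v').
have S1 : A * supn (q1 - q1') (q2 - q2') <= 49 * supn (u - u') (v - v').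
  apply: le_trans (_ : 7 * (7 * supn (u - u') (v - v')) <= _); last lra.
  by apply: ler_pM => //; exact: supn_ge0.
suff S2 : supn ((A - A') * q1') ((A - A') * q2') <= 98 * supn (u - u') (v - v') by lra.
have -> : supn ((A - A') * q1') ((A - A') * q2') = `|A - A'| * supn q1' q2'.
  by rewrite -supnZ ?normr_ge0 // /supn !normrM normr_id.
(* Near the origin A - A' alone is not controlled by the distance of the points. Multiplied by the
   norm of q' it is, since A' times this norm is the norm of (u', v'). *)
have -> : `|A - A'| * supn q1' q2' = `|A * supn q1' q2' - supn u' v'|.
  by rewrite -E' -mulrBl normrM (ger0_norm (supn_ge0 _ _)).
have -> : A * supn q1' q2' - supn u' v' =
    A * (supn q1' q2' - supn q1 q2) + (supn u v - supn u' v') by rewrite -EE; ring.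
apply: le_trans (ler_normD _ _) _; rewrite normrM (ger0_norm A0) distrC.
have : A * `|supn q1 q2 - supn q1' q2'| <= 49 * supn (u - u') (v - v').
  apply: le_trans (_ : 7 * (7 * supn (u - u') (v - v')) <= _); last lra.
  by apply: ler_pM => //; apply: le_trans sd' _.
lra.
Qed.

Lemma turn_lip m u v u' v' : `|m| <= 3 ->
  supn (turn1 m u v - turn1 m u' v') (turn2 m u v - turn2 m u' v') <= 147 * supn (u - u') (v - v').
Proof.
move=> m3; case: (lerP (supn u' v') (supn u v)) => [|/ltW] H; first exact: turn_lip_le.
have := turn_lip_le m3 H; rewrite -(supnN (u' - u)) !opprB.
by rewrite -(supnN (turn1 m u' v' - _)) !opprB.
Qed.

Lemma turnK m u v : `|m| <= 3 ->
  turn1 (- m) (turn1 m u v) (turn2 m u v) = u /\ turn2 (- m) (turn1 m u v) (turn2 m u v) = v.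
Proof.
move=> m3; case: (eqVneq (supn u v) 0) => [E|nz].
  have t0 m' : turn1 m' 0 0 = 0 /\ turn2 m' 0 0 = 0.
    by rewrite /turn1 /turn2 /turnA {1 3}/supn !normr0 maxxx !mul0r.
  by have [-> ->] := supn_eq0 E; rewrite (t0 m).1 (t0 m).2.
have E := turnA_E u v m3; have A0 := turnA_ge0 m u v.
have An : turnA m u v != 0 by apply: contraNneq nz => A00; rewrite -E A00 mul0r.
have := supn_turn u v m3; have := dshK m u v.
have -> : turn1 m u v = turnA m u v * (u - dsh m u v) by [].
have -> : turn2 m u v = turnA m u v * (v - dsh m u v) by [].
move: (turnA m u v) (dsh m u v) E A0 An => A D E A0 An DK ST.
rewrite /turn1 /turn2 /turnA dshZ // DK ST -!mulrBr !opprK !subrK supnZ //.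
by split; field; rewrite An nz.
Qed.

Lemma turn_id m u v : `|m| <= 3 -> u <= v -> turn1 m u v = u /\ turn2 m u v = v.
Proof.
move=> m3 uv; have E : dsh m u v = 0 by rewrite /dsh max_l ?mulr0 //; lra.
have := turnA_E u v m3; rewrite /turn1 /turn2 E !subr0 => H.
case: (eqVneq (supn u v) 0) => [/supn_eq0[-> ->]|nz]; first by rewrite !mulr0.
have -> : turnA m u v = 1 by apply: (mulIf nz); rewrite H mul1r.
by rewrite !mul1r.
Qed.

Lemma turn_half m u v : `|m| <= 3 -> v < u -> turn2 m u v < turn1 m u v.
Proof.
move=> m3 vu; have E := turnA_E u v m3; rewrite /turn1 /turn2 -subr_gt0 -mulrBr.
have nz : supn u v != 0 by apply/eqP => /supn_eq0[u0 v0]; lra.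
have A0 := turnA_ge0 m u v.
have An : turnA m u v != 0 by apply: contraNneq nz => A00; rewrite -E A00 mul0r.
apply: mulr_gt0; first by rewrite lt_def An.
lra.
Qed.

Lemma dsh3 u v : v < u -> dsh 3 u v = 3 * (u - v).
Proof. by move=> vu; rewrite /dsh max_r //; lra. Qed.

Lemma turn1_le u v : turn1 3 u v <= u.
Proof.
have m3 : `|3 : R| <= 3 by rewrite ger0_norm.
case: (lerP u v) => [uv|vu]; first by rewrite (turn_id m3 uv).1.
have E := turnA_E u v m3; rewrite /turn1; move: E (turnA_ge0 3 u v).
rewrite dsh3 //; move: (turnA 3 u v) => A E A0.
set p := u - 3 * (u - v); set q := v - 3 * (u - v).
rewrite -/p -/q in E.
have pl := supn_l p q.
case: (lerP `|v| u) => vu'.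
  have uE : supn u v = u.
    have u0 := le_trans (normr_ge0 _) vu'.
    by apply/eqP; rewrite eq_le supn_le (ger0_norm u0) lexx vu' -{1}(ger0_norm u0) supn_l.
  rewrite -[leRHS]uE -E; apply: le_trans (_ : A * `|p| <= _).
    by rewrite ler_wpM2l // ler_norm.
  by rewrite ler_wpM2l.
have v0 : v < 0.
  rewrite ltNge; apply/negP => v0; rewrite ger0_norm in vu'; lra.
rewrite (ltr0_norm v0) in vu'.
have uE : supn u v = - v.
  apply/eqP; rewrite eq_le; apply/andP; split; last by have := supn_r u v; rewrite (ltr0_norm v0).
  by rewrite supn_le (ltr0_norm v0) lexx andbT ler_norml; apply/andP; split; lra.
have qE : supn p q = 3 * u - 4 * v.
  apply/eqP; rewrite eq_le supn_le; apply/andP; split; first apply/andP; first split.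
  - by rewrite /p ler_norml; apply/andP; split; lra.
  - by rewrite /q ler_norml; apply/andP; split; lra.
  - by apply: le_trans (supn_r p q); rewrite ler0_norm /q; lra.
have q0 : 0 < 3 * u - 4 * v by lra.
rewrite -(ler_pM2r q0) -qE mulrAC E uE qE /p.
have : 0 <= 3 * ((u - v) * (u - v)) by apply: mulr_ge0 => //; rewrite -expr2 sqr_ge0.
lra.
Qed.

(** This explains the strength 3 of the turn: u - 3 (u - v) = 3 v - 2 u is at most 3/8 - 2/5 < 0. *)
Lemma turn1_le0 u v : 1 / 5 < u -> v <= 1 / 8 -> turn1 3 u v <= 0.
Proof.
move=> u5 v8; rewrite /turn1 dsh3; last lra.
by apply: mulr_ge0_le0; [exact: turnA_ge0|lra].
Qed.

End Turn.

(** * The turn in a coordinate plane *)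

Section PlaneHom.
Context {R : realType} {d : nat} (i s : 'I_d) (si : s != i).
Notation T := 'rV[R]_d.

Definition turnmap (m : R) (x : T) : T := \row_k
  if k == i then turn1 m (x ord0 i) (x ord0 s) else
  if k == s then turn2 m (x ord0 i) (x ord0 s) else x ord0 k.

Lemma turnmap_ucb m : `|m| <= 3 -> ucb (turnmap m).
Proof.
move=> m3; apply: (@ucb_lip _ _ _ 147) => // e x y e0 xy k.
have H : supn (turn1 m (x ord0 i) (x ord0 s) - turn1 m (y ord0 i) (y ord0 s))
   (turn2 m (x ord0 i) (x ord0 s) - turn2 m (y ord0 i) (y ord0 s)) < 147 * e.
  apply: le_lt_trans (turn_lip _ _ _ _ m3) _.
  by rewrite ltr_pM2l // /supn gt_max !xy.
rewrite !mxE; case: eqP => _; first by apply: le_lt_trans (supn_l _ _) H.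
case: eqP => _; first by apply: le_lt_trans (supn_r _ _) H.
apply: lt_trans (xy k) _; lra.
Qed.

Lemma turnmapK m : `|m| <= 3 -> cancel (turnmap m) (turnmap (- m)).
Proof.
move=> m3 x; have [A B] := turnK (x ord0 i) (x ord0 s) m3.
apply/rowP => k; rewrite !mxE !eqxx (negbTE si) A B.
by case: (eqVneq k i) => [->//|ki]; case: (eqVneq k s) => [->|].
Qed.

Let n3 : `|3 : R| <= 3. Proof. by rewrite ger0_norm. Qed.
Let n3' : `|- 3 : R| <= 3. Proof. by rewrite normrN. Qed.

Lemma turnmapKV : cancel (turnmap (- 3)) (turnmap 3).
Proof. by have := turnmapK n3'; rewrite opprK. Qed.

Definition turnhom : @hom R d :=
  Hom (turnmap_ucb n3) (turnmap_ucb n3') (turnmapK n3) turnmapKV.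

Lemma turnhomE x k : turnhom x ord0 k = if k == i then turn1 3 (x ord0 i) (x ord0 s) else
  if k == s then turn2 3 (x ord0 i) (x ord0 s) else x ord0 k.
Proof. by rewrite mxE. Qed.

End PlaneHom.

(** * Reparametrisation of the intervals *)

Section RhoLine.
Context {R : realType}.
Context (z1 z2 L : R) (z10 : 0 <= z1) (z12 : z1 < z2) (z2b : z2 <= 1 / 16).

Ltac lrz := move: z10 z12 z2b; lra.

Let al := (1 - z2 / 8) / (7 / 8).
Let al0 : 0 < al. Proof. by rewrite /al; apply: divr_gt0; lrz. Qed.
Let alN : al != 0. Proof. by rewrite gt_eqF. Qed.
Let be0 : 0 < z2 - z1. Proof. by lrz. Qed.
Let ba0 : 0 < (z2 - z1) / al. Proof. by rewrite divr_gt0. Qed.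

(** Fits an interval of a child into that of its parent. The rim from 7/8 to 1 goes to the shell
    from 1 - z2/8 to 1 - z1/8, where the bowl function [kap], of slope 8, runs from 1/16 - z2 to
    1/16 - z1. Thus [z1] and [z2] prescribe the height of the rim of the child on the bowl. *)
Definition rhoC : @lip R := lip_comp (lip_aff 0 alN)
  (lip_comp (lip_kinkR (7 / 8) ba0) (lip_kinkL (- (7 / 8)) ba0)).

Lemma rhoC_mid (x : R) : `|x| <= 7 / 8 -> rhoC x = (1 - z2 / 8) / (7 / 8) * x.
Proof.
rewrite ler_norml => /andP[A B].
by rewrite /= (kinkL_ge _ A) kinkR_le // addr0.
Qed.

Lemma rhoC_r (x : R) : 7 / 8 <= x -> rhoC x = 1 - z2 / 8 + (z2 - z1) * (x - 7 / 8).
Proof.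
move=> A; rewrite /= kinkL_ge; last lrz.
rewrite kinkR_ge // addr0 mulrDr; congr (_ + _); first by rewrite /al; field.
by field; exact: alN.
Qed.

Lemma rhoC_l (x : R) : x <= - (7 / 8) -> rhoC x = - (1 - z2 / 8) + (z2 - z1) * (x + 7 / 8).
Proof.
move=> A; rewrite /= kinkL_le //.
have N : (z2 - z1) / al * (x - - (7 / 8)) <= 0 by apply: mulr_ge0_le0; [exact: ltW|lrz].
rewrite kinkR_le; last lrz.
rewrite addr0 mulrDr opprK; congr (_ + _); first by rewrite /al; field.
by field; exact: alN.
Qed.

Lemma rhoC_rim (x : R) : 7 / 8 <= `|x| -> 1 - z2 / 8 <= `|rhoC x|.
Proof.
case: (lerP 0 x) => x0; [rewrite ger0_norm // => A|rewrite ltr0_norm // => A].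
  rewrite rhoC_r //; have : 0 <= (z2 - z1) * (x - 7 / 8) by apply: mulr_ge0; lrz.
  by move=> B; rewrite ger0_norm; lrz.
rewrite rhoC_l; last lrz.
have : (z2 - z1) * (x + 7 / 8) <= 0 by apply: mulr_ge0_le0; lrz.
by move=> B; rewrite ler0_norm; lrz.
Qed.

Lemma rhoC_in (x : R) : `|x| <= 1 -> `|rhoC x| <= 1 - z1 / 8.
Proof.
move=> x1; case: (lerP `|x| (7 / 8)) => H.
  rewrite rhoC_mid // normrM ger0_norm; last by apply: divr_ge0; lrz.
  apply: le_trans (_ : (1 - z2 / 8) / (7 / 8) * (7 / 8) <= _).
    by rewrite ler_wpM2l //; apply: divr_ge0; lrz.
  by rewrite divfK; lrz.
move: H x1; case: (lerP 0 x) => x0; [rewrite ger0_norm // => A x1|rewrite ltr0_norm // => A x1].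
  rewrite rhoC_r; last lrz.
  have : (z2 - z1) * (x - 7 / 8) <= (z2 - z1) * (1 / 8) by apply: ler_wpM2l; lrz.
  have : 0 <= (z2 - z1) * (x - 7 / 8) by apply: mulr_ge0; lrz.
  by move=> B C; rewrite ger0_norm; lrz.
rewrite rhoC_l; last lrz.
have : (z2 - z1) * - (x + 7 / 8) <= (z2 - z1) * (1 / 8) by apply: ler_wpM2l; lrz.
have : (z2 - z1) * (x + 7 / 8) <= 0 by apply: mulr_ge0_le0; lrz.
by rewrite mulrN => B C; rewrite ler0_norm; lrz.
Qed.

(** At 127/128 the bowl function vanishes, 1/16 - 8/128 = 0, so the two bowls cross there. *)
Lemma rhoC_wall : exists x : R, `|x| < 7 / 8 /\ (z2 < 1 / 16 -> rhoC x = 127 / 128).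
Proof.
case: (ltrP z2 (1 / 16)) => H; last by exists 0; rewrite normr0; split=> [|A]; [lrz|exfalso; lrz].
exists (127 / 128 / al); have x0 : 0 < 127 / 128 / al by apply: divr_gt0; [lrz|exact: al0].
have x7 : 127 / 128 / al < 7 / 8.
  by rewrite ltr_pdivrMr // /al [7 / 8 * _]mulrC divfK; lrz.
split=> [|_]; first by rewrite ger0_norm ?ltW.
by rewrite rhoC_mid ?ger0_norm ?(ltW x0) ?(ltW x7) // mulrC divfK.
Qed.

Let aR := (8 / 5 - z2 / 4) / (7 / 20).
Let aL := (1 - z2 / 4) / (3 / 4).
Let aR0 : 0 < aR. Proof. by rewrite /aR; apply: divr_gt0; lrz. Qed.
Let aL0 : 0 < aL. Proof. by rewrite /aL; apply: divr_gt0; lrz. Qed.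
Let bR0 : 0 < (z2 - z1) / aR. Proof. by rewrite divr_gt0. Qed.
Let bL0 : 0 < (z2 - z1) / aL. Proof. by rewrite divr_gt0. Qed.
Let one0 : (1 : R) != 0. Proof. exact: oner_neq0. Qed.
Let L' := L - 1 / 2.

(** The analogue of [rhoC] in the long direction, from half length L' = L - 1/2 to L, with slope 4
    of the bowl. In the middle it is the translation by -1/2, which keeps distances from the left
    end. The additional unit of length is created beyond L' - 3/5, whose image starts at L - 8/5 and
    is turned back by the hook. *)
Definition rhoI : @lip R := lip_comp (lip_aff (- (1 / 2)) one0)
  (lip_comp (lip_comp (lip_kinkR (L' - 3 / 5) aR0) (lip_kinkR (L' - 1 / 4) bR0))
            (lip_comp (lip_kinkL (- L' + 1) aL0) (lip_kinkL (- L' + 1 / 4) bL0))).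

Context (L10 : 4 <= L).
Let LE : L' = L - 1 / 2. Proof. by []. Qed.
Ltac lrL := move: z10 z12 z2b L10 LE; lra.

Lemma rhoI_mid (x : R) : - L' + 1 <= x <= L' - 3 / 5 -> rhoI x = x - 1 / 2.
Proof.
move=> /andP[A B]; rewrite /= [kinkL (- L' + 1 / 4) _ _]kinkL_ge; last lrL.
rewrite [kinkL (- L' + 1) _ _]kinkL_ge // [kinkR (L' - 1 / 4) _ _]kinkR_le; last lrL.
by rewrite [kinkR (L' - 3 / 5) _ _]kinkR_le // mul1r.
Qed.

Lemma rhoI_r1 (x : R) : L' - 3 / 5 <= x <= L' - 1 / 4 -> L - 8 / 5 <= rhoI x <= L - z2 / 4.
Proof.
move=> /andP[A B]; rewrite /= [kinkL (- L' + 1 / 4) _ _]kinkL_ge; last lrL.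
rewrite [kinkL (- L' + 1) _ _]kinkL_ge; last lrL.
rewrite [kinkR (L' - 1 / 4) _ _]kinkR_le // [kinkR (L' - 3 / 5) _ _]kinkR_ge // mul1r.
have : 0 <= aR * (x - (L' - 3 / 5)) by apply: mulr_ge0; [exact: ltW|lrL].
have : aR * (x - (L' - 3 / 5)) <= aR * (7 / 20) by apply: ler_wpM2l; [exact: ltW|lrL].
rewrite {2}/aR divfK; last lrL.
by move=> *; apply/andP; split; lrL.
Qed.

Lemma rhoI_r2 (x : R) : L' - 1 / 4 <= x -> rhoI x = L - z2 / 4 + (z2 - z1) * (x - (L' - 1 / 4)).
Proof.
move=> A; rewrite /= [kinkL (- L' + 1 / 4) _ _]kinkL_ge; last lrL.
rewrite [kinkL (- L' + 1) _ _]kinkL_ge; last lrL.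
rewrite [kinkR (L' - 1 / 4) _ _]kinkR_ge //.
have N : 0 <= (z2 - z1) / aR * (x - (L' - 1 / 4)) by apply: mulr_ge0; [exact: ltW|lrL].
rewrite [kinkR (L' - 3 / 5) _ _]kinkR_ge; last lrL.
have -> : L' - 1 / 4 + (z2 - z1) / aR * (x - (L' - 1 / 4)) - (L' - 3 / 5) =
  7 / 20 + (z2 - z1) / aR * (x - (L' - 1 / 4)) by field; rewrite gt_eqF.
rewrite mul1r mulrDr {1}/aR divfK; last lrL.
have -> : aR * ((z2 - z1) / aR * (x - (L' - 1 / 4))) = (z2 - z1) * (x - (L' - 1 / 4)).
  by field; rewrite gt_eqF.
by rewrite LE; field.
Qed.

Lemma rhoI_l1 (x : R) : - L' + 1 / 4 <= x <= - L' + 1 -> - L + z2 / 4 <= rhoI x <= - L + 1.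
Proof.
move=> /andP[A B]; rewrite /= [kinkL (- L' + 1 / 4) _ _]kinkL_ge // [kinkL (- L' + 1) _ _]kinkL_le //.
have N1 : aL * (x - (- L' + 1)) <= 0 by apply: mulr_ge0_le0; [exact: ltW|lrL].
have N2 : aL * - (x - (- L' + 1)) <= aL * (3 / 4) by apply: ler_wpM2l; [exact: ltW|lrL].
rewrite {2}/aL divfK in N2; last lrL.
rewrite mulrN in N2.
rewrite [kinkR (L' - 1 / 4) _ _]kinkR_le; last lrL.
rewrite [kinkR (L' - 3 / 5) _ _]kinkR_le; last lrL.
by rewrite mul1r; apply/andP; split; lrL.
Qed.

Lemma rhoI_l2 (x : R) : x <= - L' + 1 / 4 -> rhoI x = - L + z2 / 4 + (z2 - z1) * (x - (- L' + 1 / 4)).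
Proof.
move=> A; rewrite /= [kinkL (- L' + 1 / 4) _ _]kinkL_le //.
have N : (z2 - z1) / aL * (x - (- L' + 1 / 4)) <= 0 by apply: mulr_ge0_le0; [exact: ltW|lrL].
rewrite [kinkL (- L' + 1) _ _]kinkL_le; last lrL.
have -> : - L' + 1 / 4 + (z2 - z1) / aL * (x - (- L' + 1 / 4)) - (- L' + 1) =
  - (3 / 4) + (z2 - z1) / aL * (x - (- L' + 1 / 4)) by field; rewrite gt_eqF.
rewrite mul1r mulrDr mulrN {1}/aL divfK; last lrL.
have -> : aL * ((z2 - z1) / aL * (x - (- L' + 1 / 4))) = (z2 - z1) * (x - (- L' + 1 / 4)).
  by field; rewrite gt_eqF.
have N' : (z2 - z1) * (x - (- L' + 1 / 4)) <= 0 by apply: mulr_ge0_le0; lrL.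
rewrite [kinkR (L' - 1 / 4) _ _]kinkR_le; last lrL.
rewrite [kinkR (L' - 3 / 5) _ _]kinkR_le; last lrL.
by rewrite LE; field.
Qed.

Lemma rhoI_rim (x : R) : L' - 1 / 4 <= `|x| -> L - z2 / 4 <= `|rhoI x|.
Proof.
case: (lerP 0 x) => x0; [rewrite ger0_norm // => A|rewrite ltr0_norm // => A].
  rewrite rhoI_r2 //; have : 0 <= (z2 - z1) * (x - (L' - 1 / 4)) by apply: mulr_ge0; lrL.
  by move=> B; rewrite ger0_norm; lrL.
rewrite rhoI_l2; last lrL.
have : (z2 - z1) * (x - (- L' + 1 / 4)) <= 0 by apply: mulr_ge0_le0; lrL.
by move=> B; rewrite ler0_norm; lrL.
Qed.

Lemma rhoI_in (x : R) : `|x| <= L' -> `|rhoI x| <= L - z1 / 4.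
Proof.
rewrite ler_norml => /andP[x1 x2].
have [A|A] := lerP x (- L' + 1 / 4).
  rewrite rhoI_l2 // ler_norml.
  have : (z2 - z1) * - (x - (- L' + 1 / 4)) <= (z2 - z1) * (1 / 4) by apply: ler_wpM2l; lrL.
  have : (z2 - z1) * (x - (- L' + 1 / 4)) <= 0 by apply: mulr_ge0_le0; lrL.
  by rewrite mulrN => B C; apply/andP; split; lrL.
have [B|B] := lerP x (- L' + 1).
  have /andP[] : - L + z2 / 4 <= rhoI x <= - L + 1 by apply: rhoI_l1; apply/andP; split; lrL.
  by move=> C D; rewrite ler_norml; apply/andP; split; lrL.
have [C|C] := lerP x (L' - 3 / 5).
  rewrite rhoI_mid; last by apply/andP; split; lrL.
  by rewrite ler_norml; apply/andP; split; lrL.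
have [D|D] := lerP x (L' - 1 / 4).
  have /andP[] : L - 8 / 5 <= rhoI x <= L - z2 / 4 by apply: rhoI_r1; apply/andP; split; lrL.
  by move=> E F; rewrite ler_norml; apply/andP; split; lrL.
rewrite rhoI_r2 ?(ltW D) // ler_norml.
have : (z2 - z1) * (x - (L' - 1 / 4)) <= (z2 - z1) * (1 / 4) by apply: ler_wpM2l; lrL.
have : 0 <= (z2 - z1) * (x - (L' - 1 / 4)) by apply: mulr_ge0; lrL.
by move=> E F; apply/andP; split; lrL.
Qed.

(** Integrality matters: a positive [a] is at least 1, so [x] is beyond the zone at the left end in
    which distances are not kept. *)
Lemma rhoI_low (x : R) (a : nat) : (0 < a)%N -> `|x| <= L' -> a%:R <= x + L' -> a%:R <= 2 * L - 4 ->
  a%:R <= rhoI x + L.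
Proof.
move=> a0; rewrite ler_norml => /andP[x1 x2] ax aL'.
have a1 : 1 <= a%:R :> R by rewrite ler1n.
have [C|C] := lerP x (L' - 3 / 5).
  by rewrite rhoI_mid; [lrL|apply/andP; split; lrL].
have [D|D] := lerP x (L' - 1 / 4).
  have /andP[] : L - 8 / 5 <= rhoI x <= L - z2 / 4 by apply: rhoI_r1; apply/andP; split; lrL.
  lrL.
rewrite rhoI_r2 ?(ltW D) //.
have : 0 <= (z2 - z1) * (x - (L' - 1 / 4)) by apply: mulr_ge0; lrL.
lrL.
Qed.

Lemma rhoI_up (x : R) : `|x| <= L' -> x <= L' - 3 / 5 -> rhoI x + L <= x + L' \/ rhoI x + L <= 1.
Proof.
rewrite ler_norml => /andP[x1 x2] C.
have [A|A] := lerP x (- L' + 1 / 4).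
  right; rewrite rhoI_l2 //.
  have : (z2 - z1) * (x - (- L' + 1 / 4)) <= 0 by apply: mulr_ge0_le0; lrL.
  lrL.
have [B|B] := lerP x (- L' + 1).
  have /andP[] : - L + z2 / 4 <= rhoI x <= - L + 1 by apply: rhoI_l1; apply/andP; split; lrL.
  by right; lrL.
by left; rewrite rhoI_mid; [lrL|apply/andP; split; lrL].
Qed.

Lemma rhoI_hi (x : R) : L' - 3 / 5 <= x -> L - 8 / 5 <= rhoI x.
Proof.
move=> C; have [D|D] := lerP x (L' - 1 / 4).
  by have /andP[] : L - 8 / 5 <= rhoI x <= L - z2 / 4 by apply: rhoI_r1; apply/andP; split; lrL.
rewrite rhoI_r2 ?(ltW D) //.
have : 0 <= (z2 - z1) * (x - (L' - 1 / 4)) by apply: mulr_ge0; lrL.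
lrL.
Qed.

End RhoLine.

(** * The two children of a frame *)

Section Node.
Context {R : realType} {d : nat} (i s t : 'I_d).
Context (si : s != i) (ti : t != i) (st : s != t).
Notation T := 'rV[R]_d.
Implicit Types (x y : T) (L e : R) (k : 'I_d).

Definition lF (L : R) (k : 'I_d) : R := if k == i then L else 1.
Definition hF (L : R) (k : 'I_d) : R := if k == i then L - 1 / 4 else 7 / 8.
Definition FL (L : R) : set T := Fr t (lF L) (hF L).
(** Reciprocals of the wall thickness of the frame, 1/4 and 1/8: across each wall the corresponding
    term of [kap] rises by 1, from -15/16 to 1/16. *)
Definition cF (k : 'I_d) : R := if k == i then 4 else 8.

Lemma FL_case L x : FL L x -> 7 / 8 <= `|x ord0 s| \/
  exists k, [/\ k != s, k != t & hF L k <= `|x ord0 k|].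
Proof.
move=> [_ H]; case: (lerP (7 / 8) `|x ord0 s|) => A; [by left|right].
apply: contrapT => N; apply: H => k kt; case: (eqVneq k s) => [->|ks].
  by rewrite /hF (negbTE si).
by rewrite ltNge; apply/negP => B; apply: N; exists k.
Qed.

(* The graph [x_s = kap x] is a bowl with bottom [-15/16], which rises to [1/16] at
   the boundary of the box in the coordinates other than [s] and [t]. *)
Definition kap (L : R) (x : T) : R :=
  \big[Num.max/- (15 / 16)]_(k | (k != s) && (k != t)) (1 / 16 + cF k * (`|x ord0 k| - lF L k)).

Lemma kap_ge0 L x : - (15 / 16) <= kap L x.
Proof. exact: bigmax_ge_id. Qed.

Lemma kap_ge L x k : k != s -> k != t -> 1 / 16 + cF k * (`|x ord0 k| - lF L k) <= kap L x.
Proof. by move=> ks kt; apply: (@le_bigmax_cond _ _ _ _ k) => //; rewrite ks kt. Qed.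

Lemma kap_le L x (B : R) : - (15 / 16) <= B ->
  (forall k, k != s -> k != t -> 1 / 16 + cF k * (`|x ord0 k| - lF L k) <= B) -> kap L x <= B.
Proof. by move=> B0 H; apply: bigmax_le => // k /andP[ks kt]; exact: H. Qed.

Lemma cF_bnd k : 4 <= cF k <= 8.
Proof. by rewrite /cF; case: ifP => _; apply/andP; split; lra. Qed.

Lemma kap_lip L e x y : 0 < e -> cl e x y -> kap L x <= kap L y + 8 * e.
Proof.
move=> e0 xy; apply: kap_le; first by have := kap_ge0 L y; lra.
move=> k ks kt; apply: le_trans (_ : 1 / 16 + cF k * (`|y ord0 k| - lF L k) + 8 * e <= _).
  have := xy k; have := ler_distD 0 (x ord0 k) (y ord0 k); have := cF_bnd k.
  have := lerB_dist (x ord0 k) (y ord0 k).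
  move: (`|x ord0 k|) (`|y ord0 k|) (`|x ord0 k - y ord0 k|) => a b c A B _ C.
  have : cF k * (a - b) <= 8 * e.
    apply: le_trans (_ : cF k * e <= _); first by apply: ler_wpM2l; lra.
    by apply: ler_wpM2r; lra.
  rewrite !mulrBr; lra.
by rewrite lerD2r; exact: kap_ge.
Qed.

Lemma kap_lip9 L e x y : 0 < e -> cl e x y -> `|kap L x - kap L y| < 9 * e.
Proof.
move=> e0 xy; have := kap_lip L e0 xy; have := kap_lip L e0 (clC xy).
by rewrite ltr_norml => A B; apply/andP; split; lra.
Qed.

Lemma kap_ext L x y : (forall k, k != s -> k != t -> `|x ord0 k| = `|y ord0 k|) -> kap L x = kap L y.
Proof. by move=> H; apply: eq_bigr => k /andP[ks kt]; rewrite H. Qed.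

Lemma kap_s L x v : kap L (upd x s v) = kap L x.
Proof. by apply: kap_ext => k ks kt; rewrite mxE (negbTE ks). Qed.

Let nine0 : 0 < 9 :> R. Proof. by []. Qed.
Definition Bend (L : R) : @hom R d := shom nine0 (@kap_lip9 L) (@kap_s L).

Lemma BendE L x k : Bend L x ord0 k = if k == s then x ord0 s + kap L x else x ord0 k.
Proof. exact: shomE. Qed.

Let m1 : (-1 : R) != 0. Proof. by rewrite oppr_eq0 oner_eq0. Qed.
(** The half turn in the (i, s)-plane. It preserves the frame, swaps the two bowls and swaps the
    ends of the long direction, so the second child and the left hook are obtained by conjugation
    with it. *)
Definition Rot : @hom R d := chom (fun k => if (k == i) || (k == s) then lip_aff 0 m1 else lip_id).

Lemma RotE x k : Rot x ord0 k = if (k == i) || (k == s) then - x ord0 k else x ord0 k.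
Proof. by rewrite chomE; case: ifP => _ //=; rewrite mulN1r addr0. Qed.

Lemma RotK x : Rot (Rot x) = x.
Proof. by apply/rowP => k; rewrite !RotE; case: (_ || _); rewrite ?opprK. Qed.

Lemma kap_Rot L x : kap L (Rot x) = kap L x.
Proof. by apply: kap_ext => k ks kt; rewrite RotE; case: ifP; rewrite ?normrN. Qed.

Lemma Rot_norm x k : `|Rot x ord0 k| = `|x ord0 k|.
Proof. by rewrite RotE; case: ifP; rewrite ?normrN. Qed.

Lemma FL_Rot L x : FL L x -> FL L (Rot x).
Proof.
move=> [A B]; split=> [k|H]; first by rewrite Rot_norm.
by apply: B => k kt; rewrite -Rot_norm; exact: H.
Qed.

(** * Hooks at the ends of the long direction *)

Section Turning.
Context (L : R) (L10 : 10 <= L).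

Ltac lrT := move: L10; lra.

Let two0 : (2 : R) != 0. Proof. by rewrite pnatr_eq0. Qed.
(** In the coordinates u = (x_i - (L - 2)) / 2 and v = x_s the box, where v < u, lies in the unit
    square, and the walls of thickness 1/4 and 1/8 both begin at 7/8. Turning along concentric
    squares therefore preserves the frame. *)
Definition ctr : @hom R d := chom (fun k => if k == i then lip_aff (L - 2) two0 else lip_id).
(* Folding back both ends of the long direction [i] makes a child miss one end of
   its parent, so that after many generations every piece is short. *)
Definition hookR : @hom R d := hcomp ctr (hcomp (turnhom si) (hom_inv ctr)).
Definition uR (x : T) : R := (x ord0 i - (L - 2)) / 2.

Lemma hookRE x k : hookR x ord0 k =
  if k == i then 2 * turn1 3 (uR x) (x ord0 s) + (L - 2) else
  if k == s then turn2 3 (uR x) (x ord0 s) else x ord0 k.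
Proof.
rewrite -[hookR x]/(ctr (turnhom si (hi ctr x))) chomE turnhomE.
have E m : hi ctr x ord0 m = if m == i then uR x else x ord0 m.
  rewrite /= mxE; case: eqP => [->|//] /=; rewrite /uR; by field.
by rewrite !E eqxx (negbTE si); case: eqP => //= _; case: eqP.
Qed.

Lemma hookR_id x : uR x <= x ord0 s -> hookR x = x.
Proof.
have m3 : `|3 : R| <= 3 by rewrite ger0_norm.
move=> H; have [A B] := turn_id m3 H; apply/rowP => k; rewrite hookRE A B.
case: eqP => [->|_]; first by rewrite /uR; field.
by case: eqP => [->|].
Qed.

Lemma hookR_u x : uR (hookR x) = turn1 3 (uR x) (x ord0 s).
Proof. by rewrite {1}/uR hookRE eqxx; field. Qed.

Lemma hookR_v x : hookR x ord0 s = turn2 3 (uR x) (x ord0 s).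
Proof. by rewrite hookRE eqxx (negbTE si). Qed.

Lemma hookR_supn x : supn (uR (hookR x)) (hookR x ord0 s) = supn (uR x) (x ord0 s).
Proof. by rewrite hookR_u hookR_v supn_turn // ger0_norm. Qed.

Lemma hookR_half x : x ord0 s < uR x -> hookR x ord0 s < uR (hookR x).
Proof. by move=> H; rewrite hookR_u hookR_v turn_half // ger0_norm. Qed.

Definition box (x : T) := `|x ord0 i| <= L /\ `|x ord0 s| <= 1.

Lemma FL_box x : FL L x -> box x.
Proof.
move=> [A _]; split; first by have := A i; rewrite /lF eqxx.
by have := A s; rewrite /lF (negbTE si).
Qed.

Lemma box_supn x : box x -> x ord0 s < uR x -> supn (uR x) (x ord0 s) <= 1.
Proof.
move=> [+ B] H; rewrite supn_le B andbT; move: B; rewrite !ler_norml => /andP[b1 b2] /andP[a1 a2].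
by rewrite /uR in H *; apply/andP; split; lrT.
Qed.

Lemma hookR_lo x : box x -> x ord0 s < uR x -> L - 4 <= hookR x ord0 i.
Proof.
move=> bx H; have := box_supn bx H; rewrite -hookR_supn supn_le => /andP[].
by rewrite /uR ler_norml => /andP[A _] _; lrT.
Qed.

Lemma hookR_le x : hookR x ord0 i <= x ord0 i.
Proof.
rewrite hookRE eqxx; have := turn1_le (uR x) (x ord0 s).
by move: (turn1 _ _ _) => w; rewrite /uR; lrT.
Qed.

Lemma hookR_hi x : L - 8 / 5 < x ord0 i -> x ord0 s <= 1 / 8 -> hookR x ord0 i <= L - 2.
Proof.
move=> A B; rewrite hookRE eqxx; have := @turn1_le0 R (uR x) (x ord0 s).
by move: (turn1 _ _ _) => w H; have := H ltac:(rewrite /uR; lrT) B; lrT.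
Qed.

Lemma hookR_FL x : FL L x -> FL L (hookR x).
Proof.
move=> Fx; have bx := FL_box Fx; case: (lerP (uR x) (x ord0 s)) => H; first by rewrite hookR_id.
have N1 := box_supn bx H; have SE := hookR_supn x.
have [A B] := Fx.
have lo := hookR_lo bx H.
have [n1 n2] : `|uR (hookR x)| <= 1 /\ `|hookR x ord0 s| <= 1.
  by move: N1; rewrite -SE supn_le => /andP[].
have o k : k != i -> k != s -> hookR x ord0 k = x ord0 k.
  by move=> ki ks; rewrite hookRE (negbTE ki) (negbTE ks).
split=> [k|Hh].
  case: (eqVneq k i) => [->|ki].
    rewrite /lF eqxx ler_norml; move: n1; rewrite /uR ler_norml => /andP[_ n1].
    by apply/andP; split; lrT.
  case: (eqVneq k s) => [->|ks]; first by rewrite /lF (negbTE si).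
  by rewrite o.
have Hi := Hh i; have Hs := Hh s st.
rewrite /hF eqxx eq_sym ti in Hi; rewrite /hF (negbTE si) in Hs.
have {}Hi := Hi isT.
have half := hookR_half H.
have S7 : supn (uR (hookR x)) (hookR x ord0 s) < 7 / 8.
  rewrite /supn gt_max Hs andbT; move: Hi Hs half; rewrite !ltr_norml /uR.
  by move=> /andP[a1 a2] /andP[b1 b2] C; apply/andP; split; lrT.
rewrite SE /supn gt_max in S7; case/andP: S7 => u7 s7.
apply: B => k kt; case: (eqVneq k i) => [->|ki].
  rewrite /hF eqxx; move: u7; rewrite /uR !ltr_norml => /andP[a1 a2].
  by apply/andP; split; lrT.
case: (eqVneq k s) => [->|ks]; first by rewrite /hF (negbTE si).
by rewrite -(o k) //; exact: Hh.
Qed.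

Definition hookL : @hom R d := hcomp Rot (hcomp hookR Rot).
Definition hook : @hom R d := hcomp hookL hookR.

Lemma hookLE x : hookL x = Rot (hookR (Rot x)). Proof. by []. Qed.
Lemma hookE x : hook x = hookL (hookR x). Proof. by []. Qed.

Lemma hook_FL x : FL L x -> FL L (hook x).
Proof. by move=> Fx; rewrite hookE hookLE; apply/FL_Rot/hookR_FL/FL_Rot/hookR_FL. Qed.

Lemma hookL_id x : 0 <= x ord0 i -> x ord0 s <= 3 -> hookL x = x.
Proof.
move=> A B; rewrite hookLE hookR_id ?RotK // /uR !RotE !eqxx orbT /=; lrT.
Qed.

Lemma hookR_id' x : x ord0 i <= 0 -> -2 <= x ord0 s -> hookR x = x.
Proof. by move=> A B; apply: hookR_id; rewrite /uR; lrT. Qed.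

(** The clasp is studied in the slice x_i = 0, far from both ends, where the hooks change
    nothing. *)
Lemma hook_slice x : x ord0 i = 0 -> `|x ord0 s| <= 3 -> hook x = x.
Proof.
move=> xi; rewrite ler_norml => /andP[A B].
by rewrite hookE hookR_id ?hookL_id ?xi //; rewrite /uR xi; lrT.
Qed.

Lemma hook_slice_inv x : x ord0 i = 0 -> `|x ord0 s| <= 3 -> hi hook x = x.
Proof. by move=> xi xs; rewrite -{1}(hook_slice xi xs) hfK. Qed.

Lemma hookR_s x : box x -> `|hookR x ord0 s| <= 1.
Proof.
move=> bx; case: (lerP (uR x) (x ord0 s)) => H; first by rewrite hookR_id //; case: bx.
by have := box_supn bx H; rewrite -hookR_supn supn_le => /andP[].
Qed.

Lemma box_Rot x : box x -> box (Rot x).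
Proof. by move=> [A B]; split; rewrite Rot_norm. Qed.

Lemma hook_pos x : box x -> 0 <= x ord0 i -> hook x = hookR x.
Proof.
move=> bx x0; rewrite hookE hookL_id //; last by have := hookR_s bx; rewrite ler_norml => /andP[]; lrT.
case: (lerP (uR x) (x ord0 s)) => H; first by rewrite hookR_id //; lrT.
by have := hookR_lo bx H; lrT.
Qed.

Lemma hook_neg x : box x -> x ord0 i <= 0 -> hook x = hookL x.
Proof.
move=> bx x0; rewrite hookE hookR_id' //.
by case: bx => _; rewrite ler_norml => /andP[]; lrT.
Qed.

Lemma hook_Rot x : box x -> hook (Rot x) = Rot (hook x).
Proof.
move=> bx; have bx' := box_Rot bx; have E : Rot x ord0 i = - x ord0 i by rewrite RotE eqxx.
case: (lerP 0 (x ord0 i)) => x0.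
  have x0' : Rot x ord0 i <= 0 by rewrite E; lra.
  by rewrite (hook_pos bx x0) (hook_neg bx' x0') hookLE RotK.
have x0' : 0 <= Rot x ord0 i by rewrite E; lra.
by rewrite (hook_neg bx (ltW x0)) (hook_pos bx' x0') hookLE RotK.
Qed.

End Turning.

(** * Construction and separation of the children *)

Section Children.
Implicit Types (p q : T).
Context (L : R) (L10 : 10 <= L).
Let L' := L - 1 / 2.

Section Rho.
Context (z1 z2 : R) (z10 : 0 <= z1) (z12 : z1 < z2) (z2b : z2 <= 1 / 16).

Definition Rho : @hom R d := chom (fun k => if (k == s) || (k == t) then lip_id else
  if k == i then rhoI L z10 z12 z2b else rhoC z10 z12 z2b).

Lemma Rho_s x : Rho x ord0 s = x ord0 s.
Proof. by rewrite chomE eqxx. Qed.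
Lemma Rho_t x : Rho x ord0 t = x ord0 t.
Proof. by rewrite chomE eqxx orbT. Qed.
Lemma Rho_i x : Rho x ord0 i = rhoI L z10 z12 z2b (x ord0 i).
Proof. by rewrite chomE eq_sym (negbTE si) eq_sym (negbTE ti) eqxx. Qed.
Lemma Rho_k x k : k != s -> k != t -> k != i -> Rho x ord0 k = rhoC z10 z12 z2b (x ord0 k).
Proof. by move=> ks kt ki; rewrite chomE (negbTE ks) (negbTE kt) (negbTE ki). Qed.

Lemma Rho_in p k : k != s -> k != t -> `|p ord0 k| <= lF L' k ->
  cF k * (`|Rho p ord0 k| - lF L k) <= - z1.
Proof.
move=> ks kt; rewrite /lF /cF; case: eqP => [->|/eqP ki] H.
  have := @rhoI_in R z1 z2 L z10 z12 z2b ltac:(move: L10; lra) (p ord0 i) H.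
  by rewrite Rho_i; lra.
have := @rhoC_in R z1 z2 z10 z12 z2b (p ord0 k) H.
by rewrite Rho_k //; lra.
Qed.

Lemma Rho_rim p k : k != s -> k != t -> hF L' k <= `|p ord0 k| ->
  - z2 <= cF k * (`|Rho p ord0 k| - lF L k).
Proof.
move=> ks kt; rewrite /lF /cF /hF; case: eqP => [->|/eqP ki] H.
  have := @rhoI_rim R z1 z2 L z10 z12 z2b ltac:(move: L10; lra) (p ord0 i) H.
  by rewrite Rho_i; lra.
have := @rhoC_rim R z1 z2 z10 z12 z2b (p ord0 k) H.
by rewrite Rho_k //; lra.
Qed.

Lemma kap_Rho_le x p : (forall k, k != s -> k != t -> x ord0 k = Rho p ord0 k) ->
  (forall k, `|p ord0 k| <= lF L' k) -> kap L x <= 1 / 16 - z1.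
Proof.
move=> xE H; apply: kap_le; first by move: z12 z2b; lra.
by move=> k ks kt; have := Rho_in ks kt (H k); rewrite xE //; lra.
Qed.

Lemma kap_Rho_ge x p k : k != s -> k != t -> x ord0 k = Rho p ord0 k ->
  hF L' k <= `|p ord0 k| -> 1 / 16 - z2 <= kap L x.
Proof.
move=> ks kt xE H; apply: le_trans (kap_ge L x ks kt).
by have := Rho_rim ks kt H; rewrite xE; lra.
Qed.

Lemma Rho_box p k : k != s -> k != t -> `|p ord0 k| <= lF L' k -> `|Rho p ord0 k| <= lF L k.
Proof.
move=> ks kt H; have := Rho_in ks kt H; have := cF_bnd k.
move: (`|Rho p ord0 k|) => a A B.
rewrite leNgt; apply/negP => C.
have : 0 < cF k * (a - lF L k) by apply: mulr_gt0; lra.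
by move: z10; lra.
Qed.

End Rho.

(** A point of the hole has [kap] at its minimum -15/16, so near the bowl its x_s is at most -7/8,
    which already lies in the wall in the direction [s]. *)
Lemma FL_bowl x : (forall k, k != s -> k != t -> `|x ord0 k| <= lF L k) -> `|x ord0 t| <= 1 ->
  `|x ord0 s - kap L x| <= 1 / 16 -> kap L x <= 1 / 16 -> FL L x.
Proof.
move=> xk xt; rewrite ler_norml => /andP[A B] C; have K0 := kap_ge0 L x.
split=> [k|H].
  case: (eqVneq k s) => [->|ks].
    by rewrite /lF (negbTE si) ler_norml; apply/andP; split; lra.
  by case: (eqVneq k t) => [->|kt]; [rewrite /lF (negbTE ti)|exact: xk].
have : kap L x <= - (15 / 16).
  apply: kap_le => // k ks kt; have := H k kt.
  by rewrite /hF /cF /lF; case: eqP => _; lra.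
have := H s st; rewrite /hF (negbTE si) ltr_norml => /andP[]; lra.
Qed.

Context (th : R) (th0 : 0 < th) (th16 : th <= 1 / 16).
Let eps := th / 64.
Let eps0 : eps != 0. Proof. by rewrite gt_eqF // divr_gt0. Qed.
Let thN : th != 0. Proof. by rewrite gt_eqF. Qed.
Ltac lrh := move: L10 th0 th16; rewrite ?/eps; lra.

Let zm0 : 0 <= 1 / 16 - th / 4. Proof. lrh. Qed.
Let zm12 : 1 / 16 - th / 4 < 1 / 16 - th / 8. Proof. lrh. Qed.
Let zmb : 1 / 16 - th / 8 <= 1 / 16. Proof. lrh. Qed.
Let zp0 : 0 <= 0 :> R. Proof. by []. Qed.
Let zp12 : 0 < th / 8. Proof. lrh. Qed.
Let zpb : th / 8 <= 1 / 16. Proof. lrh. Qed.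
(** [RhoM] puts the rim of the first child where [kap] is between th/8 and th/4, just beyond the
    crossing of the bowls at 0. [RhoP] puts the rim of the second between 1/16 - th/8 and 1/16, at
    the edge of the bowl. *)
Let RhoM := Rho zm0 zm12 zmb.
Let RhoP := Rho zp0 zp12 zpb.

Definition scl2 (a b : R) (a0 : a != 0) (b0 : b != 0) : @hom R d :=
  chom (fun k => if k == s then lip_aff 0 a0 else if k == t then lip_aff 0 b0 else lip_id).

Lemma scl2E a b a0 b0 x k : @scl2 a b a0 b0 x ord0 k =
  if k == s then a * x ord0 s else if k == t then b * x ord0 t else x ord0 k.
Proof. by rewrite chomE; case: eqP => [->|_] /=; rewrite ?addr0 //; case: eqP => [->|] //=; rewrite addr0. Qed.

(** The swap turns the hole direction of the first child across its bowl: this child becomes two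
    copies of the bowl at x_t near th and -th, joined along the rim. The second child keeps its hole
    direction and is doubled across its bowl instead. This difference lets them clasp. *)
Definition Th1 : @hom R d := hcomp (scl2 eps0 thN) (phom (tperm s t)).
Definition Th2 : @hom R d := scl2 thN eps0.

Lemma Th1E x k : Th1 x ord0 k = if k == s then eps * x ord0 t else if k == t then th * x ord0 s else x ord0 k.
Proof.
rewrite -[Th1 x]/(scl2 eps0 thN (phom (tperm s t) x)) scl2E !phomE tpermL tpermR.
by case: eqVneq => // ks; case: eqVneq => // kt; rewrite tpermD // eq_sym.
Qed.

Lemma Th2E x k : Th2 x ord0 k = if k == s then th * x ord0 s else if k == t then eps * x ord0 t else x ord0 k.
Proof. exact: scl2E. Qed.

Definition coreM : @hom R d := hcomp (Bend L) (hcomp RhoM Th1).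
Definition coreP : @hom R d := hcomp (Bend L) (hcomp RhoP Th2).

Lemma coreM_k p k : k != s -> k != t -> coreM p ord0 k = RhoM p ord0 k.
Proof.
move=> ks kt; rewrite -[coreM p]/(Bend L (RhoM (Th1 p))) BendE (negbTE ks).
rewrite [LHS]chomE [RHS]chomE Th1E (negbTE ks) (negbTE kt) //.
Qed.
Lemma coreP_k p k : k != s -> k != t -> coreP p ord0 k = RhoP p ord0 k.
Proof.
move=> ks kt; rewrite -[coreP p]/(Bend L (RhoP (Th2 p))) BendE (negbTE ks).
rewrite [LHS]chomE [RHS]chomE Th2E (negbTE ks) (negbTE kt) //.
Qed.
Lemma kap_Bend x : kap L (Bend L x) = kap L x.
Proof. by apply: kap_ext => k ks kt; rewrite BendE (negbTE ks). Qed.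
Lemma coreM_s p : coreM p ord0 s = eps * p ord0 t + kap L (coreM p).
Proof. by rewrite kap_Bend -[coreM p]/(Bend L (RhoM (Th1 p))) BendE eqxx Rho_s Th1E eqxx. Qed.
Lemma coreM_t p : coreM p ord0 t = th * p ord0 s.
Proof.
by rewrite -[coreM p]/(Bend L (RhoM (Th1 p))) BendE eq_sym (negbTE st) Rho_t Th1E eqxx eq_sym (negbTE st).
Qed.
Lemma coreP_s p : coreP p ord0 s = th * p ord0 s + kap L (coreP p).
Proof. by rewrite kap_Bend -[coreP p]/(Bend L (RhoP (Th2 p))) BendE eqxx Rho_s Th2E eqxx. Qed.
Lemma coreP_t p : coreP p ord0 t = eps * p ord0 t.
Proof.
by rewrite -[coreP p]/(Bend L (RhoP (Th2 p))) BendE eq_sym (negbTE st) Rho_t Th2E eqxx eq_sym (negbTE st).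
Qed.

(* The children lie along the bowl [x_s = kap] and along its mirror image
   [x_s = - kap]; they clasp where the two bowls meet, near [kap = 0]. *)
Definition UM (x : T) := [/\ `|x ord0 s - kap L x| <= th / 64, `|x ord0 t| <= th, kap L x <= th / 4 &
  th / 8 <= kap L x \/ 7 / 8 * th <= `|x ord0 t|].
Definition UP (x : T) := [/\ `|x ord0 s + kap L x| <= th, `|x ord0 t| <= th / 64, kap L x <= 1 / 16 &
  1 / 16 - th / 8 <= kap L x \/ 7 / 8 * th <= `|x ord0 s + kap L x|].

Lemma FL_s p : FL L' p -> `|p ord0 s| <= 1.
Proof. by move=> [/(_ s)]; rewrite /lF (negbTE si). Qed.
Lemma FL_t p : FL L' p -> `|p ord0 t| <= 1.
Proof. by move=> [/(_ t)]; rewrite /lF (negbTE ti). Qed.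

Lemma coreM_U p : FL L' p -> UM (coreM p).
Proof.
move=> Fp; have [A B] := Fp; have ps := FL_s Fp; have pt := FL_t Fp.
have e0 : 0 < eps by rewrite divr_gt0.
split.
- by rewrite coreM_s addrK normrM gtr0_norm // -[leRHS]mulr1 ler_pM2l.
- by rewrite coreM_t normrM gtr0_norm // -[leRHS]mulr1 ler_pM2l.
- have := @kap_Rho_le _ _ zm0 zm12 zmb (coreM p) p (@coreM_k p) A; lra.
- case: (FL_case Fp) => [H|[k [ks kt H]]].
    by right; rewrite coreM_t normrM gtr0_norm // mulrC ler_pM2l.
  by left; have := kap_Rho_ge ks kt (coreM_k p ks kt) H; lra.
Qed.

Lemma coreM_FL p : FL L' p -> FL L (coreM p).
Proof.
move=> Fp; have [A B C D] := coreM_U Fp; apply: FL_bowl; try by lrh.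
by move=> k ks kt; rewrite coreM_k //; apply: Rho_box => //; case: Fp.
Qed.

Lemma coreP_U0 p : FL L' p -> [/\ `|coreP p ord0 s - kap L (coreP p)| <= th,
   `|coreP p ord0 t| <= th / 64, kap L (coreP p) <= 1 / 16 &
  1 / 16 - th / 8 <= kap L (coreP p) \/ 7 / 8 * th <= `|coreP p ord0 s - kap L (coreP p)|].
Proof.
move=> Fp; have [A B] := Fp; have ps := FL_s Fp; have pt := FL_t Fp.
have e0 : 0 < eps by rewrite divr_gt0.
split.
- by rewrite coreP_s addrK normrM gtr0_norm // -[leRHS]mulr1 ler_pM2l.
- by rewrite coreP_t normrM gtr0_norm // -[leRHS]mulr1 ler_pM2l.
- have := @kap_Rho_le _ _ zp0 zp12 zpb (coreP p) p (@coreP_k p) A; lra.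
- case: (FL_case Fp) => [H|[k [ks kt H]]].
    by right; rewrite coreP_s addrK normrM gtr0_norm // mulrC ler_pM2l.
  by left; have := kap_Rho_ge ks kt (coreP_k p ks kt) H; lra.
Qed.

Lemma coreP_FL p : FL L' p -> FL L (coreP p).
Proof.
move=> Fp; have [A B C D] := coreP_U0 Fp; apply: FL_bowl; try by lrh.
by move=> k ks kt; rewrite coreP_k //; apply: Rho_box => //; case: Fp.
Qed.

Definition corePR : @hom R d := hcomp Rot (hcomp coreP Rot).

Lemma corePR_U p : FL L' p -> UP (corePR p).
Proof.
move=> Fp; have [A B C D] := coreP_U0 (FL_Rot Fp).
rewrite /UP -[corePR p]/(Rot (coreP (Rot p))) kap_Rot !RotE eqxx orbT (negbTE ti) eq_sym (negbTE st) /=.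
have E : - coreP (Rot p) ord0 s + kap L (coreP (Rot p)) =
   - (coreP (Rot p) ord0 s - kap L (coreP (Rot p))) by ring.
by rewrite E normrN.
Qed.

(** On the sheets of the first child |x_t| is near th, and on the second it is at most th/64. On the
    rim of the first, x_s + kap is about 2 kap, at most about th/2, so the rim passes between the
    sheets of the second; the rim of the second is further out. *)
Lemma UM_UP_sep x y : UM x -> UP y -> ~ cl (th / 1000) x y.
Proof.
move=> [a1 a2 a3 a4] [b1 b2 b3 b4] xy.
have e0 : 0 < th / 1000 by apply: divr_gt0 (th0) _; rewrite ltr0n.
have := kap_lip9 L e0 xy; have := xy s; have := xy t; rewrite !ltr_norml.
move=> /andP[t1 t2] /andP[s1 s2] /andP[k1 k2].
move: a1 b1 b2; rewrite !ler_norml => /andP[a11 a12] /andP[b11 b12] /andP[b21 b22].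
case: a4 => a4; last first.
  by move: a4; case: (lerP 0 (x ord0 t)) => x0; [rewrite ger0_norm //|rewrite ltr0_norm //]; lrh.
case: b4 => b4; first by lrh.
by move: b4; case: (lerP 0 (y ord0 s + kap L y)) => x0; [rewrite ger0_norm //|rewrite ltr0_norm //]; lrh.
Qed.

Definition bm : @hom R d := hcomp (hook L) coreM.
Definition bp : @hom R d := hcomp (hook L) corePR.

Lemma bm_FL p : FL L' p -> FL L (bm p).
Proof. by move=> Fp; apply: hook_FL => //; exact: coreM_FL. Qed.
Lemma bp_FL p : FL L' p -> FL L (bp p).
Proof. by move=> Fp; apply: hook_FL => //; apply/FL_Rot/coreP_FL/FL_Rot. Qed.

Lemma FL_cube x : FL L x -> cube L x.
Proof.
move=> [A _] k; apply: le_trans (A k) _; rewrite /lF; case: eqP => // _; lrh.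
Qed.

Lemma children_sep : exists e0 : R, 0 < e0 /\
  forall x y, im bm (FL L') x -> im bp (FL L') y -> ~ cl e0 x y.
Proof.
have [e0 [e00 sep]] : exists e0 : R, 0 < e0 /\ forall x y, UM x -> UP y -> ~ cl e0 x y.
  by exists (th / 1000); split; [apply: divr_gt0 (th0) _; rewrite ltr0n|exact: UM_UP_sep].
have [e1 [e10 H]] := (hiu (hook L)).1 L e0 e00.
exists e1; split=> // x y /imP[p Fp ->] /imP[q Fq ->] xy.
have c u v : u = coreM p -> v = corePR q -> ~ cl e0 u v.
  by move=> -> ->; exact: sep (coreM_U Fp) (corePR_U Fq).
apply: c (H _ _ (FL_cube (bm_FL Fp)) (FL_cube (bp_FL Fq)) xy).
  exact: hfK (hook L) (coreM p).
exact: hfK (hook L) (corePR q).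
Qed.

Lemma bm_slice x : x ord0 i = 0 -> `|x ord0 s| <= 3 -> im bm (FL L') x -> UM x.
Proof.
move=> xi xs /imP[p Fp E]; rewrite -(hook_slice_inv L10 xi xs) E.
by rewrite -[bm p]/(hook L (coreM p)) hfK; exact: coreM_U.
Qed.
Lemma bp_slice x : x ord0 i = 0 -> `|x ord0 s| <= 3 -> im bp (FL L') x -> UP x.
Proof.
move=> xi xs /imP[p Fp E]; rewrite -(hook_slice_inv L10 xi xs) E.
by rewrite -[bp p]/(hook L (corePR p)) hfK; exact: corePR_U.
Qed.

Lemma Rot_i x : Rot x ord0 i = - x ord0 i.
Proof. by rewrite RotE eqxx. Qed.

Lemma hook_k x k : k != i -> k != s -> hook L x ord0 k = x ord0 k.
Proof.
move=> ki ks; have Rk y : Rot y ord0 k = y ord0 k by rewrite RotE (negbTE ki) (negbTE ks).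
have Tk y : hookR L y ord0 k = y ord0 k by rewrite hookRE (negbTE ki) (negbTE ks).
by rewrite hookE hookLE Rk Tk Rk Tk.
Qed.

Lemma bm_k p k : k != i -> k != s -> k != t -> bm p ord0 k = rhoC zm0 zm12 zmb (p ord0 k).
Proof. by move=> ki ks kt; rewrite hook_k // coreM_k // Rho_k. Qed.

Lemma bp_k p k : k != i -> k != s -> k != t -> bp p ord0 k = rhoC zp0 zp12 zpb (p ord0 k).
Proof.
move=> ki ks kt; rewrite hook_k // -[corePR p]/(Rot (coreP (Rot p))) RotE (negbTE ki) (negbTE ks).
by rewrite coreP_k // Rho_k // RotE (negbTE ki) (negbTE ks).
Qed.

(** * How far a child reaches along its parent *)

Section Thresholds.
Context (z1 z2 : R) (z10 : 0 <= z1) (z12 : z1 < z2) (z2b : z2 <= 1 / 16).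
Context (y : T) (q : R) (Fy : FL L y) (yi : y ord0 i = rhoI L z10 z12 z2b q).
Context (ys : y ord0 s <= 1 / 8) (qL : `|q| <= L').

Let L4 : 4 <= L. Proof. lrh. Qed.

(** Beyond L - 8/5 the right hook turns points back to at most L - 2, which undoes the additional
    length. Points moved by the left hook stay within 4 of the left end, hence below [b]. *)
Lemma hook_up (b : R) : 5 <= b -> q + L' <= b -> hook L y ord0 i + L <= b.
Proof.
move=> b5 qb; have bx := FL_box Fy; have E : L' = L - 1 / 2 by [].
have LL := L10; have ys' := ys.
have [y0|y0] := lerP 0 (y ord0 i).
  rewrite hook_pos //; have le : hookR L y ord0 i <= y ord0 i by exact: hookR_le.
  case: (lerP q (L' - 3 / 5)) => q3.
    by case: (rhoI_up z10 z12 z2b L4 qL q3); rewrite -yi; lra.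
  have := rhoI_hi z10 z12 z2b L4 (ltW q3); rewrite -yi le_eqVlt => /orP[/eqP H|H]; first lra.
  by have := hookR_hi L10 H ys; lra.
rewrite (hook_neg L10 bx (ltW y0)) hookLE Rot_i.
have [H|H] := lerP (uR L (Rot y)) (Rot y ord0 s).
  rewrite hookR_id // Rot_i opprK.
  case: (lerP q (L' - 3 / 5)) => q3.
    by case: (rhoI_up z10 z12 z2b L4 qL q3); rewrite -yi; lra.
  by have := rhoI_hi z10 z12 z2b L4 (ltW q3); rewrite -yi; lra.
by have := hookR_lo L10 (box_Rot bx) H; lra.
Qed.

Lemma hook_low (a : nat) : a%:R <= 2 * L - 4 -> a%:R <= q + L' -> a%:R <= hook L y ord0 i + L.
Proof.
case: a => [|a] aL aq.
  by have [/(_ i)] := hook_FL L10 Fy; rewrite /lF eqxx ler_norml => /andP[]; lra.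
have bx := FL_box Fy; have LL := L10.
have lo : a.+1%:R <= y ord0 i + L by rewrite yi; apply: rhoI_low.
have [y0|y0] := lerP 0 (y ord0 i).
  rewrite hook_pos //; have [H|H] := lerP (uR L y) (y ord0 s); first by rewrite hookR_id.
  by have := hookR_lo L10 bx H; lra.
rewrite (hook_neg L10 bx (ltW y0)) hookLE Rot_i.
have : hookR L (Rot y) ord0 i <= Rot y ord0 i by exact: hookR_le.
by rewrite [Rot y ord0 i]Rot_i; lra.
Qed.

End Thresholds.

Lemma bm_thr p : FL L' p ->
  (forall b : R, 5 <= b -> p ord0 i + L' <= b -> bm p ord0 i + L <= b) /\
  (forall a : nat, a%:R <= 2 * L - 4 -> a%:R <= p ord0 i + L' -> a%:R <= bm p ord0 i + L).
Proof.
move=> Fp; have Fy := coreM_FL Fp; have [A _ C _] := coreM_U Fp.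
have yi : coreM p ord0 i = rhoI L zm0 zm12 zmb (p ord0 i).
  by rewrite coreM_k 1?eq_sym // Rho_i.
have ys : coreM p ord0 s <= 1 / 8.
  by move: A; rewrite ler_norml => /andP[_]; lrh.
have qL : `|p ord0 i| <= L' by have [/(_ i)] := Fp; rewrite /lF eqxx.
by split; [exact: hook_up Fy yi ys qL|exact: hook_low Fy yi qL].
Qed.

Lemma bp_thr p : FL L' p ->
  (forall b : R, 5 <= b -> L' - p ord0 i <= b -> L - bp p ord0 i <= b) /\
  (forall a : nat, a%:R <= 2 * L - 4 -> a%:R <= L' - p ord0 i -> a%:R <= L - bp p ord0 i).
Proof.
move=> Fp0; have Fp := FL_Rot Fp0; have Fy := coreP_FL Fp; have [A _ C _] := coreP_U0 Fp.
have yi : coreP (Rot p) ord0 i = rhoI L zp0 zp12 zpb (Rot p ord0 i).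
  by rewrite coreP_k 1?eq_sym // Rho_i.
have ys : coreP (Rot p) ord0 s <= 1 / 8.
  by move: A; rewrite ler_norml => /andP[_]; lrh.
have qL : `|Rot p ord0 i| <= L' by have [/(_ i)] := Fp; rewrite /lF eqxx.
have E : bp p ord0 i = - hook L (coreP (Rot p)) ord0 i.
  by rewrite -[bp p]/(hook L (Rot (coreP (Rot p)))) (hook_Rot L10 (FL_box Fy)) RotE eqxx.
have Ep : Rot p ord0 i = - p ord0 i by rewrite RotE eqxx.
rewrite E; split=> [b b5|a aL]; rewrite opprK [L + _]addrC [L' - _]addrC -Ep.
  exact: hook_up Fy yi ys qL b b5.
exact: hook_low Fy yi qL a aL.
Qed.

(** A child is flat: x_s equals [kap] up to th and |x_t| is at most th. Up to 3 th its points are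
    controlled by the coordinates other than [s] and [t], and shrinking those shrinks everything. *)
Lemma core_ctrl (f : @hom R d) (z1 z2 : R) (z10 : 0 <= z1) (z12 : z1 < z2) (z2b : z2 <= 1 / 16) :
  (forall p, FL L' p -> [/\ forall k, k != s -> k != t -> f p ord0 k = Rho z10 z12 z2b p ord0 k,
     `|f p ord0 s - kap L (f p)| <= th & `|f p ord0 t| <= th]) ->
  exists C : R, 0 < C /\ forall p p' (e : R), FL L' p -> FL L' p' -> 0 < e ->
    (forall k, k != s -> k != t -> `|p ord0 k - p' ord0 k| < e) ->
    cl (C * e + 3 * th) (f p) (f p').
Proof.
move=> H; pose C1 := lC (rhoI L z10 z12 z2b) + lC (rhoC z10 z12 z2b).
have A1 := lC0 (rhoI L z10 z12 z2b); have A2 := lC0 (rhoC z10 z12 z2b).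
have C10 : 0 < C1 by rewrite addr_gt0.
exists (10 * C1); split; first by rewrite mulr_gt0.
move=> p p' e Fp Fp' e0 pp; have [fk fs ft] := H p Fp; have [fk' fs' ft'] := H p' Fp'.
have e1 : 0 < C1 * e by rewrite mulr_gt0.
have dk k : k != s -> k != t -> `|f p ord0 k - f p' ord0 k| < C1 * e.
  move=> ks kt; rewrite fk // fk' //; case: (eqVneq k i) => [->|ki].
    rewrite !Rho_i; apply: le_lt_trans (lfL _ _ _) _.
    apply: le_lt_trans (_ : lC (rhoI L z10 z12 z2b) * e < _).
      by apply: ler_wpM2l; [exact: ltW|apply: ltW; apply: pp; rewrite eq_sym].
    by rewrite ltr_pM2r // ltrDl.
  rewrite !Rho_k //; apply: le_lt_trans (lfL _ _ _) _.
  apply: le_lt_trans (_ : lC (rhoC z10 z12 z2b) * e < _).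
    by apply: ler_wpM2l; [exact: ltW|apply: ltW; exact: pp].
  by rewrite ltr_pM2r // ltrDr.
have dkap : `|kap L (f p) - kap L (f p')| < 9 * (C1 * e).
  pose z (x : T) : T := \row_k (if (k == s) || (k == t) then 0 else x ord0 k).
  have zE x : kap L x = kap L (z x).
    by apply: kap_ext => k ks kt; rewrite mxE (negbTE ks) (negbTE kt).
  rewrite zE [kap L (f p')]zE; apply: kap_lip9 => // k; rewrite !mxE.
  by case: ifPn => [_|]; [rewrite subrr normr0|rewrite negb_or => /andP[ks kt]; exact: dk].
move: (C1 * e) (mulrA 10 C1 e) e1 dk dkap => w <- w0 dk dkap k.
have t0 := th0.
case: (eqVneq k s) => [->|ks].
  move: fs fs' dkap; rewrite !ler_norml !ltr_norml => /andP[? ?] /andP[? ?] /andP[? ?].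
  by apply/andP; split; lra.
case: (eqVneq k t) => [->|kt].
  move: ft ft'; rewrite !ler_norml !ltr_norml => /andP[? ?] /andP[? ?].
  by apply/andP; split; lra.
by have := dk k ks kt; lra.
Qed.

Lemma coreM_ctrl : exists C : R, 0 < C /\ forall p p' (e : R), FL L' p -> FL L' p' -> 0 < e ->
    (forall k, k != s -> k != t -> `|p ord0 k - p' ord0 k| < e) ->
    cl (C * e + 3 * th) (coreM p) (coreM p').
Proof.
apply: (@core_ctrl coreM _ _ zm0 zm12 zmb) => p Fp; have [A B _ _] := coreM_U Fp.
split=> //; [exact: coreM_k|lrh].
Qed.

Lemma corePR_ctrl : exists C : R, 0 < C /\ forall p p' (e : R), FL L' p -> FL L' p' -> 0 < e ->
    (forall k, k != s -> k != t -> `|p ord0 k - p' ord0 k| < e) ->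
    cl (C * e + 3 * th) (corePR p) (corePR p').
Proof.
have [C [C0 H]] : exists C : R, 0 < C /\ forall p p' (e : R), FL L' p -> FL L' p' -> 0 < e ->
    (forall k, k != s -> k != t -> `|p ord0 k - p' ord0 k| < e) ->
    cl (C * e + 3 * th) (coreP p) (coreP p').
  apply: (@core_ctrl coreP _ _ zp0 zp12 zpb) => p Fp; have [A B _ _] := coreP_U0 Fp.
  split=> //; [exact: coreP_k|lrh].
have RD x y k : `|Rot x ord0 k - Rot y ord0 k| = `|x ord0 k - y ord0 k|.
  by rewrite !RotE; case: ifP => // _; rewrite -opprD normrN.
exists C; split=> // p p' e Fp Fp' e0 pp k.
rewrite -[corePR p]/(Rot (coreP (Rot p))) -[corePR p']/(Rot (coreP (Rot p'))) RD.
apply: H => //; try exact: FL_Rot.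
by move=> m ms mt; rewrite RD; exact: pp.
Qed.

(** * The plane through the clasp *)

Section SlicePoints.
Context (j : 'I_d) (ji : j != i) (js : j != s) (jt : j != t).

Definition sp4 (c lam a b : R) : T := \row_k
  if k == i then c else if k == j then lam else if k == s then a else if k == t then b else 0.

Lemma sp4i c lam a b : sp4 c lam a b ord0 i = c.
Proof. by rewrite mxE eqxx. Qed.
Lemma sp4j c lam a b : sp4 c lam a b ord0 j = lam.
Proof. by rewrite mxE (negbTE ji) eqxx. Qed.
Lemma sp4s c lam a b : sp4 c lam a b ord0 s = a.
Proof. by rewrite mxE (negbTE si) eq_sym (negbTE js) eqxx. Qed.
Lemma sp4t c lam a b : sp4 c lam a b ord0 t = b.
Proof. by rewrite mxE (negbTE ti) eq_sym (negbTE jt) eq_sym (negbTE st) eqxx. Qed.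
Lemma sp4o c lam a b k : k != i -> k != j -> k != s -> k != t -> sp4 c lam a b ord0 k = 0.
Proof. by move=> ki kj ks kt; rewrite mxE (negbTE ki) (negbTE kj) (negbTE ks) (negbTE kt). Qed.

Lemma kap_sp4 lam a b : kap L (sp4 0 lam a b) = Num.max (- (15 / 16)) (1 / 16 + 8 * (`|lam| - 1)).
Proof.
apply/eqP; rewrite eq_le; apply/andP; split.
  apply: kap_le; first by rewrite le_max lexx.
  move=> k ks kt; rewrite le_max /cF /lF; case: (eqVneq k i) => [->|ki].
    by apply/orP; left; rewrite sp4i normr0; lrh.
  case: (eqVneq k j) => [->|kj]; first by rewrite sp4j lexx orbT.
  by apply/orP; left; rewrite sp4o // normr0; lrh.
rewrite ge_max kap_ge0 /=; have := kap_ge L (sp4 0 lam a b) js jt.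
by rewrite sp4j /cF /lF (negbTE ji).
Qed.

Lemma kap_wall a b : kap L (sp4 0 (127 / 128) a b) = 0.
Proof. by rewrite kap_sp4 ger0_norm; [rewrite max_r; lra|lra]. Qed.

Let L4 : 4 <= L. Proof. lrh. Qed.

Lemma rhoI_half (z1 z2 : R) (z10 : 0 <= z1) (z12 : z1 < z2) (z2b : z2 <= 1 / 16) :
  rhoI L z10 z12 z2b (1 / 2) = 0.
Proof. by rewrite rhoI_mid // ?subrr //; apply/andP; split; lrh. Qed.

Lemma rhoC0 (z1 z2 : R) (z10 : 0 <= z1) (z12 : z1 < z2) (z2b : z2 <= 1 / 16) :
  rhoC z10 z12 z2b 0 = 0.
Proof. by rewrite rhoC_mid ?mulr0 // normr0; lra. Qed.

(** [c] and [lam] are preimages of x_i = 0 and of the wall x_j = 127/128. There [kap] vanishes and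
    the hook is trivial, so the child map is linear on this plane. The bounds say that the plane
    passes through the hole of the child. *)
Lemma bm_sp4 : exists c lam : R, [/\ `|c| < L' - 1 / 4, `|lam| < 7 / 8 & forall a b : R,
  `|th / 64 * b| <= 3 -> bm (sp4 c lam a b) = sp4 0 (127 / 128) (th / 64 * b) (th * a)].
Proof.
have [lam [l7 lE]] := rhoC_wall zm0 zm12 zmb; have {}lE := lE ltac:(lrh).
exists (1 / 2), lam; split=> //; first by rewrite ger0_norm; rewrite /L'; lrh.
move=> a b b3.
have E k : k != s -> k != t -> coreM (sp4 (1 / 2) lam a b) ord0 k = sp4 0 (127 / 128) 0 0 ord0 k.
  move=> ks kt; rewrite coreM_k //; case: (eqVneq k i) => [->|ki].
    by rewrite Rho_i !sp4i rhoI_half.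
  rewrite Rho_k //; case: (eqVneq k j) => [->|kj]; first by rewrite !sp4j lE.
  by rewrite !sp4o // rhoC0.
have K : kap L (coreM (sp4 (1 / 2) lam a b)) = 0.
  by rewrite -(kap_wall 0 0); apply: kap_ext => k ks kt; rewrite E.
have EE : coreM (sp4 (1 / 2) lam a b) = sp4 0 (127 / 128) (th / 64 * b) (th * a).
  apply/rowP => k; case: (eqVneq k s) => [->|ks]; first by rewrite coreM_s K sp4t sp4s addr0.
  case: (eqVneq k t) => [->|kt]; first by rewrite coreM_t sp4s sp4t.
  rewrite E //; case: (eqVneq k i) => [->|ki]; first by rewrite !sp4i.
  by case: (eqVneq k j) => [->|kj]; [rewrite !sp4j|rewrite !sp4o].
by rewrite -[bm _]/(hook L (coreM _)) EE hook_slice // ?sp4i ?sp4s.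
Qed.

Lemma bp_sp4 : exists c lam : R, [/\ `|c| < L' - 1 / 4, `|lam| < 7 / 8 & forall a b : R,
  `|th * a| <= 3 -> bp (sp4 c lam a b) = sp4 0 (127 / 128) (th * a) (th / 64 * b)].
Proof.
have [lam [l7 lE]] := rhoC_wall zp0 zp12 zpb; have {}lE := lE ltac:(lrh).
exists (- (1 / 2)), lam; split=> //; first by rewrite normrN ger0_norm; rewrite /L'; lrh.
move=> a b b3.
have RE (c l a' b' : R) : Rot (sp4 c l a' b') = sp4 (- c) l (- a') b'.
  apply/rowP => k; rewrite RotE; case: (eqVneq k i) => [->|ki]; first by rewrite !sp4i.
  case: (eqVneq k s) => [->|ks]; first by rewrite !sp4s.
  case: (eqVneq k j) => [->|kj]; first by rewrite !sp4j.
  by case: (eqVneq k t) => [->|kt]; [rewrite !sp4t|rewrite !sp4o].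
have E k : k != s -> k != t -> coreP (sp4 (1 / 2) lam (- a) b) ord0 k = sp4 0 (127 / 128) 0 0 ord0 k.
  move=> ks kt; rewrite coreP_k //; case: (eqVneq k i) => [->|ki].
    by rewrite Rho_i !sp4i rhoI_half.
  rewrite Rho_k //; case: (eqVneq k j) => [->|kj]; first by rewrite !sp4j lE.
  by rewrite !sp4o // rhoC0.
have K : kap L (coreP (sp4 (1 / 2) lam (- a) b)) = 0.
  by rewrite -(kap_wall 0 0); apply: kap_ext => k ks kt; rewrite E.
have EE : coreP (sp4 (1 / 2) lam (- a) b) = sp4 0 (127 / 128) (- (th * a)) (th / 64 * b).
  apply/rowP => k; case: (eqVneq k s) => [->|ks]; first by rewrite coreP_s K !sp4s addr0 mulrN.
  case: (eqVneq k t) => [->|kt]; first by rewrite coreP_t !sp4t.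
  rewrite E //; case: (eqVneq k i) => [->|ki]; first by rewrite !sp4i.
  by case: (eqVneq k j) => [->|kj]; [rewrite !sp4j|rewrite !sp4o].
rewrite -[bp _]/(hook L (Rot (coreP (Rot _)))) RE opprK EE RE oppr0 opprK.
by rewrite hook_slice // ?sp4i ?sp4s.
Qed.

End SlicePoints.
End Children.
End Node.

(** * The clasp *)

(** X and Y are the meridians of the first and the second child at the clasp, np and nm two passages
    past the second child that differ by Y, Xu and Xl loops around the upper and lower strand of the
    first child beyond it, and W a loop around both strands. So W is conjugate to Xu Xl^-1, where Xu
    = np^-1 X np and Xl = nm^-1 X nm, and np = Y nm produces the commutator. *)
Lemma comm_alg (A : unitRingType) (X Y Xu Xl W np nm K : A) : X \is a GRing.unit -> Y \is a GRing.unit ->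
  Xl \is a GRing.unit -> np \is a GRing.unit -> nm \is a GRing.unit -> K \is a GRing.unit ->
  X * nm = nm * Xl -> X * np = np * Xu -> Y * nm = np -> Xu = K * W * K^-1 * Xl ->
  W = (K^-1 * np^-1) * (X * Y * X^-1 * Y^-1) * (K^-1 * np^-1)^-1.
Proof.
move=> uX uY uXl unp unm uK E1 E2 E3 E4.
have EY : Y = np * nm^-1 by rewrite -E3 mulrK.
have EV : X^-1 * Y^-1 * np * Xl = nm.
  by rewrite -[np]E3 mulrA divrK // -mulrA -E1 mulrA mulVr // mul1r.
have E5 : X * Y * X^-1 * Y^-1 * np * Xl = X * Y * nm by rewrite -EV !mulrA.
have E6 : X * Y * X^-1 * Y^-1 * np * Xl = np * (K * W * K^-1) * Xl.
  by rewrite E5 -mulrA E3 E2 E4 !mulrA.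
have {E5 E6} : X * Y * X^-1 * Y^-1 * np = np * (K * W * K^-1) by apply: (mulIr uXl).
move: (X * Y * X^-1 * Y^-1) => c E.
have -> : c = np * (K * W * K^-1) * np^-1 by rewrite -E mulrK.
rewrite invrM ?unitrV // !invrK !mulrA.
by rewrite !(divrK, mulVr, mul1r, mulrK).
Qed.

Section Flat.
Context {R : realType} {d : nat} {n : nat}.
Notation T := 'rV[R]_d.
Implicit Types (S : T -> T -> 'M[bool]_n.+1) (C Z : set T) (x y z : T).

Definition convex C := forall x y (u : R), 0 <= u <= 1 -> C x -> C y -> C (seg x y u).

Definition flat S C := (forall x y, ut (S x y)) /\
  forall x y z, C x -> C y -> C z -> S x y * S y z = S x z.

Lemma qf_flat Z r S C : qf Z r S -> C `<=` Z -> C `<=` cube r -> convex C -> flat S C.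
Proof.
move=> [q1 q2 q3 q4] CZ Cr cC; split=> // x y z Cx Cy Cz.
rewrite (q4 x y x z) ?q2 ?mul1r //; try exact: Cr; try exact: CZ.
by move=> u v u01 v01; apply: CZ; apply: (cC) => //; apply: (cC).
Qed.

Lemma flat_id S C x : flat S C -> C x -> S x x = 1.
Proof. by move=> [u H] Cx; apply: ut_idem => //; rewrite H. Qed.

(** A free homotopy between two polygons in combinatorial form: corresponding edges and the rungs
    between them lie together in cells with trivial transport. *)
Fixpoint ladder S x y (l : seq (T * T)) : Prop :=
  if l is p :: l' then
    (exists C, [/\ flat S C, C x, C y, C p.1 & C p.2]) /\ ladder S p.1 p.2 l'
  else True.

Lemma ladder_tr S x y l : (forall x y, ut (S x y)) -> ladder S x y l ->
  tr S x (unzip1 l) * S (last x (unzip1 l)) (last y (unzip2 l)) = S x y * tr S y (unzip2 l).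
Proof.
move=> uS; elim: l x y => [|[x' y'] l IH] x y /=; first by rewrite mul1r mulr1.
move=> [[C [f Cx Cy Cx' Cy']] /IH E].
by rewrite -mulrA E !mulrA !f.2.
Qed.

Lemma ladder_loop S x y l : (forall x y, ut (S x y)) -> ladder S x y l ->
  last x (unzip1 l) = x -> last y (unzip2 l) = y ->
  tr S y (unzip2 l) = (S x y)^-1 * tr S x (unzip1 l) * S x y.
Proof.
move=> uS lad E1 E2; have := ladder_tr uS lad; rewrite E1 E2 => E.
by rewrite -mulrA E mulKr // ut_unit.
Qed.

End Flat.

Section Clasp.
Context {R : realType} {d : nat} (i j s t : 'I_d).
Context (si : s != i) (ti : t != i) (st : s != t) (ji : j != i) (js : j != s) (jt : j != t).
Context (L : R) (L10 : 10 <= L) (th : R) (th0 : 0 < th) (th16 : th <= 1 / 16).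
Notation T := 'rV[R]_d.
Notation sp := (sp4 i s t j 0).
Notation UMn := (UM i s t L th).
Notation UPn := (UP i s t L th).

Definition freeS : set T := [set x : T | [/\ x ord0 i = 0, `|x ord0 s| <= 3, ~ UMn x & ~ UPn x]].

Lemma seg_sp (l1 a1 b1 l2 a2 b2 u : R) : seg (sp l1 a1 b1) (sp l2 a2 b2) u =
  sp ((1 - u) * l1 + u * l2) ((1 - u) * a1 + u * a2) ((1 - u) * b1 + u * b2).
Proof.
apply/rowP => k; rewrite !mxE.
by case: (k == i); case: (k == j); case: (k == s); case: (k == t); rewrite ?mulr0 ?addr0.
Qed.

Lemma conv_in (x y lo hi u : R) : 0 <= u <= 1 -> lo <= x <= hi -> lo <= y <= hi ->
  lo <= (1 - u) * x + u * y <= hi.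
Proof.
move=> u01 xb yb.
have : 0 <= (1 - u) * (x - lo) by apply: mulr_ge0; lra.
have : 0 <= u * (y - lo) by apply: mulr_ge0; lra.
have : 0 <= (1 - u) * (hi - x) by apply: mulr_ge0; lra.
have : 0 <= u * (hi - y) by apply: mulr_ge0; lra.
by rewrite !mulrBr => *; apply/andP; split; lra.
Qed.

(** The value of [kap] at x_j = lam in the slice, before truncation at the bottom -15/16. *)
Definition vl (lam : R) : R := 1 / 16 + 8 * (lam - 1).

Lemma sp_free (lam a b : R) : 0 <= lam <= 1 -> `|a| <= 3 ->
  let kp := Num.max (- (15 / 16)) (vl lam) in
  (th / 64 < `|a - kp| \/ th < `|b| \/ th / 4 < kp \/ (kp < th / 8 /\ `|b| < 7 / 8 * th)) ->
  (th / 64 < `|b| \/ th < `|a + kp| \/ (`|a + kp| < 7 / 8 * th /\ kp < 1 / 16 - th / 8)) ->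
  freeS (sp lam a b).
Proof.
move=> /andP[l0 l1] a3 kp H1 H2.
have K : kap i s t L (sp lam a b) = kp by rewrite (kap_sp4 L10 th0 th16 ji js jt) ger0_norm.
split; rewrite ?sp4i ?sp4s //.
- rewrite /UM K sp4s // sp4t // => -[A B C [D|D]].
    by case: H1 => [H|[H|[H|[H H']]]]; lra.
  by case: H1 => [H|[H|[H|[H H']]]]; lra.
- rewrite /UP K sp4s // sp4t // => -[A B C [D|D]].
    by case: H2 => [H|[H|[H H']]]; lra.
  by case: H2 => [H|[H|[H H']]]; lra.
Qed.

(* Boxes in the coordinates [a = x_s - kap], [b = x_s + kap] adapted to the two
   bowls near the wall; [sg] is a sign. *)
Definition pw (a b c : R) : T := sp (1 + ((b - a) / 2 - 1 / 16) / 8) ((a + b) / 2) c.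

(** Since kap = (b - a) / 2, the last condition bounds the height on the bowl, which the box alone
    would leave too large. *)
Definition cellW (sg a0 a1 b0 b1 c0 c1 v1 : R) : set T := [set x | exists a b c,
  [/\ x = pw a b (sg * c), a0 <= a <= a1, b0 <= b <= b1, c0 <= c <= c1 & b - a <= v1]].

Lemma cellW_conv sg a0 a1 b0 b1 c0 c1 v1 : convex (cellW sg a0 a1 b0 b1 c0 c1 v1).
Proof.
move=> x y u u01 [a [b [c [-> A B C D]]]] [a' [b' [c' [-> A' B' C' D']]]].
exists ((1 - u) * a + u * a'), ((1 - u) * b + u * b'), ((1 - u) * c + u * c').
split; try exact: conv_in.
  by rewrite /pw seg_sp; congr sp4; field.
have : 0 <= (1 - u) * (v1 - (b - a)) by apply: mulr_ge0; lra.
have : 0 <= u * (v1 - (b' - a')) by apply: mulr_ge0; lra.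
by rewrite !mulrBr; lra.
Qed.

Definition cellB (l0 l1 a0 a1 c0 c1 : R) : set T := [set x | exists lam a c,
  [/\ x = sp lam a c, l0 <= lam <= l1, a0 <= a <= a1 & c0 <= c <= c1]].

Lemma cellB_conv l0 l1 a0 a1 c0 c1 : convex (cellB l0 l1 a0 a1 c0 c1).
Proof.
move=> x y u u01 [a [b [c [-> A B C]]]] [a' [b' [c' [-> A' B' C']]]].
exists ((1 - u) * a + u * a'), ((1 - u) * b + u * b'), ((1 - u) * c + u * c').
by split; try exact: conv_in; rewrite seg_sp.
Qed.

Context (n : nat) (S : T -> T -> 'M[bool]_n.+1) (qS : qf freeS 3 S).
Let uS : forall x y, ut (S x y). Proof. by case: qS. Qed.

Lemma sp_cube (lam a b : R) : `|lam| <= 3 -> `|a| <= 3 -> `|b| <= 3 -> cube 3 (sp lam a b).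
Proof.
move=> l3 a3 b3 k; rewrite !mxE.
by case: (k == i); case: (k == j); case: (k == s); case: (k == t); rewrite ?normr0.
Qed.

Lemma flatB l0 l1 a0 a1 c0 c1 : 0 <= l0 -> l1 <= 1 -> -3 <= a0 -> a1 <= 3 -> -3 <= c0 -> c1 <= 3 ->
  (forall lam a c, l0 <= lam <= l1 -> a0 <= a <= a1 -> c0 <= c <= c1 -> freeS (sp lam a c)) ->
  flat S (cellB l0 l1 a0 a1 c0 c1).
Proof.
move=> L0 L1 A0 A1 C0 C1 H; apply: (qf_flat qS); last exact: cellB_conv.
  by move=> x [lam [a [c [-> A B C]]]]; exact: H.
move=> x [lam [a [c [-> /andP[? ?] /andP[? ?] /andP[? ?]]]]].
by apply: sp_cube; rewrite ler_norml; apply/andP; split; lra.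
Qed.

Lemma flatW sg a0 a1 b0 b1 c0 c1 v1 : `|sg| = 1 ->
  - (3 * th) <= a0 -> a1 <= 3 * th -> - (3 * th) <= b0 -> b1 <= th -> -3 <= c0 -> c1 <= 3 ->
  v1 <= th ->
  (forall a b c, a0 <= a <= a1 -> b0 <= b <= b1 -> c0 <= c <= c1 -> b - a <= v1 ->
    (th / 64 < `|a| \/ th < `|c| \/ th / 2 < b - a \/ (b - a < th / 4 /\ `|c| < 7 / 8 * th)) /\
    (th / 64 < `|c| \/ th < `|b| \/ `|b| < 7 / 8 * th)) ->
  flat S (cellW sg a0 a1 b0 b1 c0 c1 v1).
Proof.
move=> sg1 A0 A1 B0 B1 C0 C1 V1 H; apply: (qf_flat qS); last exact: cellW_conv.
  move=> x [a [b [c [-> A B C D]]]]; have [H1 H2] := H a b c A B C D.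
  have vE : vl (1 + ((b - a) / 2 - 1 / 16) / 8) = (b - a) / 2 by rewrite /vl; field.
  have t16 := th16.
  have kE : Num.max (- (15 / 16)) ((b - a) / 2) = (b - a) / 2 by rewrite max_r //; lra.
  have sc : `|sg * c| = `|c| by rewrite normrM sg1 mul1r.
  have aE : (a + b) / 2 - (b - a) / 2 = a by field.
  have bE : (a + b) / 2 + (b - a) / 2 = b by field.
  apply: sp_free; rewrite ?vE ?kE ?sc ?aE ?bE.
  - by clear H H1 H2; apply/andP; split; lra.
  - by clear H H1 H2; rewrite ler_norml; apply/andP; split; lra.
  - clear H H2; case: H1 => [?|[?|[?|[? ?]]]]; [by left|by right; left|by right; right; left; lra|].
    by right; right; right; split; lra.
  - clear H H1; case: H2 => [?|[?|?]]; [by left|by right; left|right; right].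
    by split=> //; lra.
move=> x [a [b [c [-> /andP[? ?] /andP[? ?] /andP[? ?] ?]]]].
have t16 := th16; have t0 := th0; clear H.
have sc : `|sg * c| <= 3 by rewrite normrM sg1 mul1r ler_norml; apply/andP; split; lra.
by apply: sp_cube => //; rewrite ler_norml; apply/andP; split; lra.
Qed.

Lemma lt_normr (x y : R) : x < y -> x < `|y|.
Proof. by move=> H; apply: lt_le_trans H (ler_norm _). Qed.
Lemma lt_normrN (x y : R) : x < - y -> x < `|y|.
Proof. by move=> H; rewrite -normrN; exact: lt_normr. Qed.

(* The clasp in units of [th / 32]; the conditions on the integer bounds are then
   checked by computation. *)
Notation e := (th / 32).
Definition pI (sg : R) (a b c : int) : T := pw (a%:~R * e) (b%:~R * e) (sg * (c%:~R * e)).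

Definition cellI (sg : R) (a0 a1 b0 b1 c0 c1 v1 : int) : set T :=
  cellW sg (a0%:~R * e) (a1%:~R * e) (b0%:~R * e) (b1%:~R * e) (c0%:~R * e) (c1%:~R * e) (v1%:~R * e).

Let e0 : 0 < e. Proof. by rewrite divr_gt0. Qed.
Let thE : th = 32 * e. Proof. by field. Qed.

Lemma int_le (x y : int) : x <= y -> x%:~R * e <= y%:~R * e.
Proof. by move=> xy; rewrite ler_pM2r // ler_int. Qed.
Lemma int_lt (x y : int) : x < y -> x%:~R * e < y%:~R * e.
Proof. by move=> xy; rewrite ltr_pM2r // ltr_int. Qed.

Lemma inI sg a b c a0 a1 b0 b1 c0 c1 v1 :
  [&& a0 <= a <= a1, b0 <= b <= b1, c0 <= c <= c1 & b - a <= v1] ->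
  cellI sg a0 a1 b0 b1 c0 c1 v1 (pI sg a b c).
Proof.
case/and4P => /andP[A1 A2] /andP[B1 B2] /andP[C1 C2] V.
exists (a%:~R * e), (b%:~R * e), (c%:~R * e).
by rewrite !int_le // -mulrBl -intrB int_le.
Qed.

(** In units of th/32 the first child has |a| <= 1/2, sheets at 28 <= |c| <= 32 and rim at 8 <= b -
    a <= 16; the second has |c| <= 1/2 and sheets at 28 <= |b| <= 32. The alternatives list ways of
    missing each child: past a sheet, past the rim, or through the hole. Nonzero integers clear the
    bound 1/2. *)
Lemma flatI sg a0 a1 b0 b1 c0 c1 v1 : `|sg| = 1 ->
  [&& -96 <= a0, a1 <= 96, -96 <= b0, b1 <= 32, -96 <= c0, c1 <= 96 & v1 <= 32] ->
  [|| 0 < a0, a1 < 0, 32 < c0, c1 < -32 | (16 < b0 - a1) || [&& v1 < 8, -28 < c0 & c1 < 28]] ->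
  [|| 0 < c0, c1 < 0, b1 < -32 | (-28 < b0) && (b1 < 28)] ->
  flat S (cellI sg a0 a1 b0 b1 c0 c1 v1).
Proof.
move=> sg1 /and5P[A0 A1 B0 B1 /and3P[C0 C1 V1]] HA HB.
have t16 := th16; have t0 := th0; have ep := e0.
move: A0 A1 B0 B1 C0 C1 V1 => /int_le A0 /int_le A1 /int_le B0 /int_le B1 /int_le C0 /int_le C1 /int_le V1.
apply: flatW => //; try lra.
clear A0 A1 B0 B1 C0 C1 V1.
move=> a b c /andP[a0' a1'] /andP[b0' b1'] /andP[c0' c1'] v.
have one (x : int) : 0 < x -> e <= x%:~R * e.
  by rewrite gtz0_ge1 => /int_le; rewrite mul1r.
have oneN (x : int) : x < 0 -> x%:~R * e <= - e.
  by rewrite -oppr_gt0 => /one; rewrite intrN mulNr; lra.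
split.
  case/or4P: HA => [/one ?|/oneN ?|/int_lt ?|/or3P[/int_lt ?|/int_lt|/and3P[/int_lt ? /int_lt ? /int_lt ?]]].
  - by left; apply: lt_normr; lra.
  - by left; apply: lt_normrN; lra.
  - by right; left; apply: lt_normr; lra.
  - by right; left; apply: lt_normrN; lra.
  - by rewrite intrB mulrBl => ?; right; right; left; lra.
  - by right; right; right; split; [lra|rewrite ltr_norml; apply/andP; split; lra].
case/or4P: HB => [/one ?|/oneN ?|/int_lt ?|/andP[/int_lt ? /int_lt ?]].
- by left; apply: lt_normr; lra.
- by left; apply: lt_normrN; lra.
- by right; left; apply: lt_normrN; lra.
- by right; right; rewrite ltr_norml; apply/andP; split; lra.
Qed.

Tactic Notation "useI" uconstr(sg) uconstr(a0) uconstr(a1) uconstr(b0) uconstr(b1) uconstr(c0)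
  uconstr(c1) uconstr(v1) := exists (cellI sg a0 a1 b0 b1 c0 c1 v1);
  split; [exact: flatI|exact: inI|exact: inI|exact: inI|exact: inI].

Lemma conj3 (X X1 X2 X3 s1 s2 s3 : 'M[bool]_n.+1) : X * s1 = s1 * X1 -> X1 * s2 = s2 * X2 ->
  X2 * s3 = s3 * X3 -> X * (s1 * s2 * s3) = s1 * s2 * s3 * X3.
Proof.
by move=> E1 E2 E3; rewrite !mulrA E1 -(mulrA s1) E2 mulrA -(mulrA (s1 * s2)) E3 !mulrA.
Qed.

Section Signed.
Context (sg : R) (sg1 : `|sg| = 1).
Notation P a b c := (pI sg a b c).

(* Beyond the rim of the first bowl its two strands have merged, so either strand
   can be encircled by the same loop. *)
Lemma raise : tr S (P 1 1 0) [:: P 1 1 96; P (-1) (-1) 96; P (-1) (-1) 0] =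
  S (P 1 1 0) (P 1 24 0) * S (P 1 24 0) (P (-1) 24 0) * S (P (-1) 24 0) (P (-1) (-1) 0).
Proof.
have lad : ladder S (P 1 1 0) (P 1 24 0) [:: (P 1 1 96, P 1 24 96); (P (-1) (-1) 96, P (-1) 24 96);
    (P (-1) (-1) 0, P (-1) 24 0)].
  split; first by useI sg 1 1 1 24 0 96 32.
  split; first by useI sg (-1) 1 (-1) 24 96 96 32.
  split; first by useI sg (-1) (-1) (-1) 24 0 96 32.
  by [].
have := ladder_tr uS lad; rewrite /= => E.
have f : flat S (cellI sg (-1) 1 24 24 0 96 32) by exact: flatI.
have fF : flat S (cellI sg (-1) (-1) (-1) 24 0 96 32) by exact: flatI.
have E1 : S (P (-1) (-1) 0) (P (-1) 24 0) * S (P (-1) 24 0) (P (-1) (-1) 0) = 1.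
  by rewrite fF.2; [apply: (flat_id fF)| | |]; exact: inI.
have E2 : S (P 1 24 0) (P 1 24 96) * (S (P 1 24 96) (P (-1) 24 96) * (S (P (-1) 24 96) (P (-1) 24 0) * 1)) =
    S (P 1 24 0) (P (-1) 24 0).
  by rewrite mulr1 f.2; [rewrite f.2| | |] => //; exact: inI.
rewrite E2 in E.
have := congr1 (fun X : 'M[bool]_n.+1 => X * S (P (-1) 24 0) (P (-1) (-1) 0)) E.
by rewrite /= -[X in X = _ -> _]mulrA E1 mulr1.
Qed.

(** The passage from the centre of the clasp past the sheet of the second child near b = -32, on the
    side x_t > 0 or x_t < 0 according to the sign [sg]. *)
Definition nn := S (P 0 0 0) (P 0 0 1) * S (P 0 0 1) (P 0 (-96) 1) * S (P 0 (-96) 1) (P 0 (-96) 0).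

Lemma nn_ut : ut nn. Proof. by do 2?apply: utM. Qed.

Lemma carry :
  tr S (P 0 0 0) [:: P 1 1 0; P 1 1 96; P (-1) (-1) 96; P (-1) (-1) 0; P 0 0 0] * nn =
  nn * tr S (P 0 (-96) 0) [:: P 1 (-96) 0; P 1 (-96) 96; P (-1) (-96) 96; P (-1) (-96) 0; P 0 (-96) 0].
Proof.
have lad1 : ladder S (P 0 0 0) (P 0 0 1) [:: (P 1 1 0, P 1 1 1); (P 1 1 96, P 1 1 96);
   (P (-1) (-1) 96, P (-1) (-1) 96); (P (-1) (-1) 0, P (-1) (-1) 1); (P 0 0 0, P 0 0 1)].
  split; first by useI sg 0 1 0 1 0 1 1.
  split; first by useI sg 1 1 1 1 0 96 32.
  split; first by useI sg (-1) 1 (-1) 1 96 96 32.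
  split; first by useI sg (-1) (-1) (-1) (-1) 0 96 32.
  split; first by useI sg (-1) 0 (-1) 0 0 1 1.
  by [].
have lad2 : ladder S (P 0 0 1) (P 0 (-96) 1) [:: (P 1 1 1, P 1 (-96) 1); (P 1 1 96, P 1 (-96) 96);
   (P (-1) (-1) 96, P (-1) (-96) 96); (P (-1) (-1) 1, P (-1) (-96) 1); (P 0 0 1, P 0 (-96) 1)].
  split; first by useI sg 0 1 (-96) 1 1 1 1.
  split; first by useI sg 1 1 (-96) 1 1 96 32.
  split; first by useI sg (-1) 1 (-96) 1 96 96 32.
  split; first by useI sg (-1) (-1) (-96) (-1) 1 96 32.
  split; first by useI sg (-1) 0 (-96) 0 1 1 1.
  by [].
have lad3 : ladder S (P 0 (-96) 1) (P 0 (-96) 0) [:: (P 1 (-96) 1, P 1 (-96) 0); (P 1 (-96) 96, P 1 (-96) 96);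
   (P (-1) (-96) 96, P (-1) (-96) 96); (P (-1) (-96) 1, P (-1) (-96) 0); (P 0 (-96) 1, P 0 (-96) 0)].
  split; first by useI sg 0 1 (-96) (-96) 0 1 1.
  split; first by useI sg 1 1 (-96) (-96) 0 96 32.
  split; first by useI sg (-1) 1 (-96) (-96) 96 96 32.
  split; first by useI sg (-1) (-1) (-96) (-96) 0 96 32.
  split; first by useI sg (-1) 0 (-96) (-96) 0 1 1.
  by [].
have E1 := ladder_tr uS lad1; have E2 := ladder_tr uS lad2; have E3 := ladder_tr uS lad3.
exact: (conj3 E1 E2 E3).
Qed.

End Signed.
Notation Q a b c := (pI 1 a b c).
Let one1 : `|1 : R| = 1. Proof. exact: normr1. Qed.
Let mone1 : `|-1 : R| = 1. Proof. by rewrite normrN normr1. Qed.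

Lemma pt2_sp (a b : R) : pt2 s t a b = sp 0 a b.
Proof.
apply/rowP => k; case: (eqVneq k s) => [->|ks]; first by rewrite sp4s // mxE eqxx.
case: (eqVneq k t) => [->|kt]; first by rewrite sp4t // mxE eq_sym (negbTE st) eqxx.
rewrite mxE (negbTE ks) (negbTE kt); case: (eqVneq k i) => [->|ki]; first by rewrite sp4i.
by case: (eqVneq k j) => [->|kj]; [rewrite sp4j|rewrite sp4o].
Qed.

Let lE : R := 1 + (- (97 / 2) * e - 1 / 16) / 8.
Let lG : R := 1 + (- (95 / 2) * e - 1 / 16) / 8.

Lemma QE c : Q 1 (-96) c = sp lE (- (95 / 2) * e) (c%:~R * e).
Proof. by rewrite /pI /pw /lE mul1r; congr sp4; field. Qed.
Lemma QF c : Q (-1) (-96) c = sp lG (- (97 / 2) * e) (c%:~R * e).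
Proof. by rewrite /pI /pw /lG mul1r; congr sp4; field. Qed.

Ltac inB := cbn [fst snd]; match goal with |- cellB _ _ _ _ _ _ (sp4 _ _ _ _ _ ?l ?a ?c) => exists l, a, c end;
  split; [by []|apply/andP; split; lra|apply/andP; split; lra|apply/andP; split; lra].

Let lEb : [/\ 0 <= lE, lE <= 1 & vl lE = - (97 / 2) * e].
Proof. by rewrite /lE /vl; have t0 := th0; have t16 := th16; split; try lra; field. Qed.
Let lGb : [/\ 0 <= lG, lG <= 1 & vl lG = - (95 / 2) * e].
Proof. by rewrite /lG /vl; have t0 := th0; have t16 := th16; split; try lra; field. Qed.

Lemma kp_mono (l l' : R) : l <= l' -> Num.max (- (15 / 16)) (vl l) <= Num.max (- (15 / 16)) (vl l').
Proof.
move=> ll; rewrite ge_max le_max lexx /= le_max; apply/orP; right; rewrite /vl; lra.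
Qed.

Lemma flat1 : flat S (cellB 0 lE (- (95 / 2) * e) (- (95 / 2) * e) (-2) 2).
Proof.
have t0 := th0; have t16 := th16; have [l0 l1 vE] := lEb.
apply: flatB => //; try lra.
move=> lam a c lb ab cb.
have K := kp_mono (_ : lam <= lE); have {}K := K ltac:(lra).
rewrite vE (max_r (_ : - (15 / 16) <= - (97 / 2) * e)) in K; last lra.
apply: sp_free.
- by lra.
- by rewrite ler_norml; apply/andP; split; lra.
- by left; apply: lt_normr; lra.
- by right; left; apply: lt_normrN; lra.
Qed.

Lemma flat2 (c0 c1 : R) : -3 <= c0 -> c1 <= 3 -> th < c0 \/ c1 < - th -> flat S (cellB 0 1 (-3) 0 c0 c1).
Proof.
have t0 := th0; have t16 := th16 => C0 C1 C.
apply: flatB => //; try lra.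
move=> lam a c lb ab cb.
have N : th < `|c| by case: C => C; [apply: lt_normr; lra|apply: lt_normrN; lra].
apply: sp_free.
- by lra.
- by rewrite ler_norml; apply/andP; split; lra.
- by right; left.
- by left; lra.
Qed.

Lemma flat3 : flat S (cellB lG lG (-3) (- (97 / 2) * e) (-2) 2).
Proof.
have t0 := th0; have t16 := th16; have [l0 l1 vE] := lGb.
apply: flatB => //; try lra.
move=> lam a c lb ab cb.
have lamE : lam = lG by lra.
have K : Num.max (- (15 / 16)) (vl lG) = - (95 / 2) * e by rewrite vE max_r //; lra.
apply: sp_free; rewrite ?lamE ?K.
- by lra.
- by rewrite ler_norml; apply/andP; split; lra.
- by left; apply: lt_normrN; lra.
- by right; left; apply: lt_normrN; lra.
Qed.

Lemma flat4 : flat S (cellB 0 0 (- (95 / 2) * e) 0 (-2) 2).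
Proof.
have t0 := th0; have t16 := th16.
apply: flatB => //; try lra.
move=> lam a c lb ab cb.
have lamE : lam = 0 by lra.
have K : Num.max (- (15 / 16)) (vl 0) = - (15 / 16) by rewrite /vl max_l //; lra.
apply: sp_free; rewrite ?lamE ?K.
- by lra.
- by rewrite ler_norml; apply/andP; split; lra.
- by left; apply: lt_normr; lra.
- by right; left; apply: lt_normrN; lra.
Qed.

Lemma flat5 : flat S (cellB 0 1 (-3) (-3) (-2) 2).
Proof.
have t0 := th0; have t16 := th16.
apply: flatB => //; try lra.
move=> lam a c lb ab cb.
have K := kp_mono (_ : lam <= 1); have {}K := K ltac:(lra).
have V1 : vl 1 = 1 / 16 by rewrite /vl; ring.
rewrite V1 (max_r (_ : - (15 / 16) <= 1 / 16)) in K; last lra.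
have K' : - (15 / 16) <= Num.max (- (15 / 16)) (vl lam) by rewrite le_max lexx.
apply: sp_free.
- by lra.
- by rewrite ler_norml; apply/andP; split; lra.
- by left; apply: lt_normrN; lra.
- by right; left; apply: lt_normrN; lra.
Qed.

Let a1 : R := - (95 / 2) * e.
Let a2 : R := - (97 / 2) * e.

(** The loop around both strands has one side above and one side below the bowl. In the first ladder
    the upper side moves to x_j = 0 and the lower one sinks to x_s = -3. In the second the upper
    side, now above the bottom -15/16, rises to x_s = 0 and the lower one follows to x_j = 0. *)
Lemma mu_strands : exists K, ut K /\ tr S 0 (mu s t) = K^-1 * tr S (Q 1 (-96) 0)
  [:: Q 1 (-96) 96; Q (-1) (-96) 96; Q (-1) (-96) (-96); Q 1 (-96) (-96); Q 1 (-96) 0] * K.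
Proof.
have t0 := th0; have t16 := th16; have [l0 l1 _] := lEb; have [m0 m1 _] := lGb.
have eN : - (95 / 2) * e <= 0 by lra.
have lad1 : ladder S (sp lE a1 0) (sp 0 a1 0) [:: (sp lE a1 (96 * e), sp 0 a1 2);
   (sp lG a2 (96 * e), sp lG (-3) 2); (sp lG a2 (- (96 * e)), sp lG (-3) (-2));
   (sp lE a1 (- (96 * e)), sp 0 a1 (-2)); (sp lE a1 0, sp 0 a1 0)].
  rewrite /a1 /a2.
  split; first by exists (cellB 0 lE (- (95 / 2) * e) (- (95 / 2) * e) (-2) 2); split; [exact: flat1|inB|inB|inB|inB].
  split; first by exists (cellB 0 1 (-3) 0 (96 * e) 2); split; [apply: flat2; lra|inB|inB|inB|inB].
  split; first by exists (cellB lG lG (-3) (- (97 / 2) * e) (-2) 2); split; [exact: flat3|inB|inB|inB|inB].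
  split; first by exists (cellB 0 1 (-3) 0 (-2) (- (96 * e))); split; [apply: flat2; lra|inB|inB|inB|inB].
  split; first by exists (cellB 0 lE (- (95 / 2) * e) (- (95 / 2) * e) (-2) 2); split; [exact: flat1|inB|inB|inB|inB].
  by [].
have lad2 : ladder S (sp 0 a1 0) (sp 0 0 0) [:: (sp 0 a1 2, sp 0 0 2);
   (sp lG (-3) 2, sp 0 (-3) 2); (sp lG (-3) (-2), sp 0 (-3) (-2));
   (sp 0 a1 (-2), sp 0 0 (-2)); (sp 0 a1 0, sp 0 0 0)].
  rewrite /a1 /a2.
  split; first by exists (cellB 0 0 (- (95 / 2) * e) 0 (-2) 2); split; [exact: flat4|inB|inB|inB|inB].
  split; first by exists (cellB 0 1 (-3) 0 2 2); split; [apply: flat2; lra|inB|inB|inB|inB].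
  split; first by exists (cellB 0 1 (-3) (-3) (-2) 2); split; [exact: flat5|inB|inB|inB|inB].
  split; first by exists (cellB 0 1 (-3) 0 (-2) (-2)); split; [apply: flat2; lra|inB|inB|inB|inB].
  split; first by exists (cellB 0 0 (- (95 / 2) * e) 0 (-2) 2); split; [exact: flat4|inB|inB|inB|inB].
  by [].
have E1 := ladder_loop uS lad1 erefl erefl; have E2 := ladder_loop uS lad2 erefl erefl.
rewrite E1 {lad1 lad2 E1} in E2.
have c96 : (96 : int)%:~R = 96 :> R by [].
have n96 : (-96 : int)%:~R = -96 :> R by rewrite intrN.
have EW' : tr S (Q 1 (-96) 0)
  [:: Q 1 (-96) 96; Q (-1) (-96) 96; Q (-1) (-96) (-96); Q 1 (-96) (-96); Q 1 (-96) 0] =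
  tr S (sp lE a1 0) [:: sp lE a1 (96 * e); sp lG a2 (96 * e); sp lG a2 (- (96 * e));
    sp lE a1 (- (96 * e)); sp lE a1 0].
  have z0 : (0 : int)%:~R = 0 :> R by [].
  by rewrite !QE !QF c96 n96 z0 (mulNr 96) mul0r.
have Emu : tr S 0 (mu s t) = tr S (sp 0 0 0) [:: sp 0 0 2; sp 0 (-3) 2; sp 0 (-3) (-2); sp 0 0 (-2); sp 0 0 0].
  by rewrite /mu -(pt2_0 s t) !pt2_sp.
exists (S (sp lE a1 0) (sp 0 a1 0) * S (sp 0 a1 0) (sp 0 0 0)).
split; first by apply: utM.
by rewrite Emu EW' [LHS]E2 invrM ?(ut_unit (uS _ _)) // !mulrA.
Qed.

Lemma pIN a b c : pI (-1) a b c = Q a b (- c).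
Proof. by rewrite /pI intrN; congr pw; ring. Qed.

(** [kloop] and [nloop] are the images of the shifted meridian under the first and the second child
    map: 2 * th/64 is one unit th/32, and 3 * th is 96 units. *)
Definition kloop := [:: Q 1 1 0; Q 1 1 (-96); Q (-1) (-1) (-96); Q (-1) (-1) 0; Q 0 0 0].
Definition nloop := [:: Q 0 0 1; Q (-96) (-96) 1; Q (-96) (-96) (-1); Q 0 0 (-1); Q 0 0 0].

Let np := nn 1.
Let nm := nn (-1).
Let X := tr S (Q 0 0 0) kloop.
Let Y := tr S (Q 0 0 0) nloop.
Let Xu := tr S (Q 0 (-96) 0) [:: Q 1 (-96) 0; Q 1 (-96) 96; Q (-1) (-96) 96; Q (-1) (-96) 0; Q 0 (-96) 0].
Let Xl := tr S (Q 0 (-96) 0) [:: Q 1 (-96) 0; Q 1 (-96) (-96); Q (-1) (-96) (-96); Q (-1) (-96) 0; Q 0 (-96) 0].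
Let W := tr S (Q 1 (-96) 0) [:: Q 1 (-96) 96; Q (-1) (-96) 96; Q (-1) (-96) (-96); Q 1 (-96) (-96); Q 1 (-96) 0].

Lemma tr_mid a x l l' y : last x l = last x l' -> tr S x l = tr S x l' ->
  tr S a (x :: l ++ [:: y]) = tr S a (x :: l' ++ [:: y]).
Proof. by move=> El Et /=; rewrite !tr_cat El Et. Qed.

Lemma kloop_lower : X * nm = nm * Xl.
Proof. by have := carry mone1; rewrite !pIN oppr0. Qed.

(** [kloop] runs around the lower strand. By [raise] for both signs it may be replaced, over the
    rim, by the loop around the upper strand, which [carry] then moves. *)
Lemma kloop_upper : X * np = np * Xu.
Proof.
rewrite -(carry one1); congr (_ * _).
have := raise mone1; rewrite !pIN oppr0 -(raise one1) => E.
exact: (@tr_mid (Q 0 0 0) (Q 1 1 0) [:: Q 1 1 (-96); Q (-1) (-1) (-96); Q (-1) (-1) 0]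
  [:: Q 1 1 96; Q (-1) (-1) 96; Q (-1) (-1) 0] (Q 0 0 0) erefl E).
Qed.

Lemma nloop_alg (s1 s2 s3 s4 s5 m1 m2 m3 p2 p3 q4 q w : 'M[bool]_n.+1) : s5 * m1 = 1 -> s4 * m2 = q4 ->
  s3 * q4 * m3 = q -> q = w * p3 -> s2 * w = p2 ->
  s1 * (s2 * (s3 * (s4 * (s5 * 1)))) * (m1 * m2 * m3) = s1 * p2 * p3.
Proof.
move=> A1 A2 A3 A4 A5.
have -> : s1 * (s2 * (s3 * (s4 * (s5 * 1)))) * (m1 * m2 * m3) = s1 * (s2 * (s3 * (s4 * (s5 * m1) * m2) * m3)).
  by rewrite mulr1 !mulrA.
by rewrite A1 mulr1 A2 A3 A4 [s2 * _]mulrA A5 mulrA.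
Qed.

Lemma strands_alg (k k' g1 g2 g3 g4 b1 b2 b3 b4 b5 : 'M[bool]_n.+1) : k' * k = 1 ->
  b3 * b4 = 1 -> b2 * b5 = 1 -> b1 * g4 = g3 -> forall c,
  k * (g1 * (g2 * (g3 * (c * 1)))) =
  k * (g1 * (g2 * (b1 * (b2 * (b3 * 1))))) * k' * (k * (b4 * (b5 * (g4 * (c * 1))))).
Proof.
move=> A1 A2 A3 A4 c.
have -> : k * (g1 * (g2 * (b1 * (b2 * (b3 * 1))))) * k' * (k * (b4 * (b5 * (g4 * (c * 1))))) =
  k * (g1 * (g2 * (b1 * (b2 * (b3 * (k' * k) * b4) * b5) * g4 * c))) by rewrite !mulr1 !mulrA.
by rewrite A1 !mulr1 A2 !mulr1 A3 !mulr1 A4.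
Qed.

Lemma nloop_split : Y * nm = np.
Proof.
have f1 : flat S (cellI 1 (-96) 0 (-96) 0 1 1 0) by exact: flatI.
have f2 : flat S (cellI 1 (-96) 0 (-96) (-96) (-1) 1 0) by exact: flatI.
have f3 : flat S (cellI 1 (-96) 0 (-96) 0 (-1) (-1) 0) by exact: flatI.
have f4 : flat S (cellI 1 0 0 0 0 (-1) 1 0) by exact: flatI.
rewrite /Y /nloop /nm /np /nn !pIN oppr0.
have A1 : S (Q 0 0 (-1)) (Q 0 0 0) * S (Q 0 0 0) (Q 0 0 (-1)) = 1.
  by rewrite f4.2; [apply: (flat_id f4)| | |]; exact: inI.
have A2 : S (Q (-96) (-96) (-1)) (Q 0 0 (-1)) * S (Q 0 0 (-1)) (Q 0 (-96) (-1)) =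
    S (Q (-96) (-96) (-1)) (Q 0 (-96) (-1)) by rewrite f3.2 //; exact: inI.
have A3 : S (Q (-96) (-96) 1) (Q (-96) (-96) (-1)) * S (Q (-96) (-96) (-1)) (Q 0 (-96) (-1)) *
   S (Q 0 (-96) (-1)) (Q 0 (-96) 0) = S (Q (-96) (-96) 1) (Q 0 (-96) 0).
  by rewrite f2.2; [rewrite f2.2| | |] => //; exact: inI.
have A4 : S (Q (-96) (-96) 1) (Q 0 (-96) 0) = S (Q (-96) (-96) 1) (Q 0 (-96) 1) * S (Q 0 (-96) 1) (Q 0 (-96) 0).
  by rewrite f2.2 //; exact: inI.
have A5 : S (Q 0 0 1) (Q (-96) (-96) 1) * S (Q (-96) (-96) 1) (Q 0 (-96) 1) = S (Q 0 0 1) (Q 0 (-96) 1).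
  by rewrite f1.2 //; exact: inI.
exact: (nloop_alg _ A1 A2 A3 A4 A5).
Qed.

Lemma strands : Xu = S (Q 0 (-96) 0) (Q 1 (-96) 0) * W * (S (Q 0 (-96) 0) (Q 1 (-96) 0))^-1 * Xl.
Proof.
have f1 : flat S (cellI 1 0 1 (-96) (-96) 0 0 0) by exact: flatI.
have f2 : flat S (cellI 1 (-1) (-1) (-96) (-96) (-96) 96 0) by exact: flatI.
have f3 : flat S (cellI 1 1 1 (-96) (-96) (-96) 96 0) by exact: flatI.
have f4 : flat S (cellI 1 (-1) 1 (-96) (-96) (-96) (-96) 0) by exact: flatI.
have A1 : (S (Q 0 (-96) 0) (Q 1 (-96) 0))^-1 * S (Q 0 (-96) 0) (Q 1 (-96) 0) = 1.
  by rewrite mulVr // ut_unit.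
have A2 : S (Q 1 (-96) (-96)) (Q 1 (-96) 0) * S (Q 1 (-96) 0) (Q 1 (-96) (-96)) = 1.
  by rewrite f3.2; [apply: (flat_id f3)| | |]; exact: inI.
have A3 : S (Q (-1) (-96) (-96)) (Q 1 (-96) (-96)) * S (Q 1 (-96) (-96)) (Q (-1) (-96) (-96)) = 1.
  by rewrite f4.2; [apply: (flat_id f4)| | |]; exact: inI.
have A4 : S (Q (-1) (-96) 96) (Q (-1) (-96) (-96)) * S (Q (-1) (-96) (-96)) (Q (-1) (-96) 0) =
   S (Q (-1) (-96) 96) (Q (-1) (-96) 0) by rewrite f2.2 //; exact: inI.
rewrite /Xu /Xl /W; exact: (strands_alg _ _ A1 A2 A3 A4).
Qed.

Lemma clasp_comm : exists U, [/\ U \is a GRing.unit, U * corner n = corner n * U &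
  W = U * (X * Y * X^-1 * Y^-1) * U^-1].
Proof.
have uX : X \is a GRing.unit by apply/ut_unit/tr_ut.
have uY : Y \is a GRing.unit by apply/ut_unit/tr_ut.
have uXl : Xl \is a GRing.unit by apply/ut_unit/tr_ut.
have unp : np \is a GRing.unit by apply/ut_unit/nn_ut.
have unm : nm \is a GRing.unit by apply/ut_unit/nn_ut.
pose K := S (Q 0 (-96) 0) (Q 1 (-96) 0).
have uK : K \is a GRing.unit by apply/ut_unit; exact: uS.
exists (K^-1 * np^-1); split; first by rewrite unitrMl unitrV.
  apply: commr_sym; apply: commrM; apply: commrV; apply: esym; apply: corner_central;
    [exact: uS|exact: nn_ut].
exact: comm_alg kloop_lower kloop_upper nloop_split strands.
Qed.

Lemma clasp_mu : exists U, [/\ U \is a GRing.unit, U * corner n = corner n * U &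
  tr S 0 (mu s t) = U * (tr S (Q 0 0 0) kloop * tr S (Q 0 0 0) nloop *
    (tr S (Q 0 0 0) kloop)^-1 * (tr S (Q 0 0 0) nloop)^-1) * U^-1].
Proof.
have [U [uU cU EW]] := clasp_comm.
have [K [utK E2]] := mu_strands.
have uK := ut_unit utK.
exists (K^-1 * U); split.
- by rewrite unitrMl // unitrV.
- apply: commr_sym; apply: commrM; last by apply: commr_sym.
  by apply: commrV; apply: esym; exact: corner_central.
- by rewrite E2 -/W EW invrM ?unitrV // invrK !mulrA.
Qed.

End Clasp.

(** * Linking of the children *)

Section Loops.
Context {R : realType} {d : nat}.
Notation T := 'rV[R]_d.

Lemma qf_cube n (Z : set T) r (S : T -> T -> 'M[bool]_n.+1) : qf (Z `&` cube r) r S -> qf Z r S.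
Proof.
move=> [q1 q2 q3 q4]; split=> //.
- by move=> a Za ra; apply: q2.
- by move=> a b H ra rb; apply: q3 => // u u01; split; [exact: H|exact: seg_cube].
- move=> a b c c' ra rb rc rc' H; apply: q4; [exact: ra|exact: rb|exact: rc|exact: rc'|].
  by move=> u v u01 v01; split; [exact: H|apply: seg_cube => //; exact: seg_cube].
Qed.

Lemma flat_tr n (S : T -> T -> 'M[bool]_n.+1) C a s : flat S C -> C a ->
  (forall x, List.In x s -> C x) -> tr S a s = S a (last a s).
Proof.
move=> f; elim: s a => [|b s IH] a Ca Cs /=; first by rewrite (flat_id f Ca).
have Cb : C b by apply: Cs; left.
rewrite IH // => [|x xs]; last by apply: Cs; right.
rewrite f.2 //; elim: s b Cb Cs {IH} => [|c s IH] b Cb Cs //=.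
apply: IH; first by apply: Cs; right; left.
by move=> x [<-|xs]; apply: Cs; right; [left|right].
Qed.

Lemma flat_loop n (S : T -> T -> 'M[bool]_n.+1) C a s : flat S C -> C a ->
  (forall x, List.In x s -> C x) -> last a s = a -> tr S a s = 1.
Proof. by move=> f Ca Cs E; rewrite (flat_tr f Ca Cs) E (flat_id f Ca). Qed.

(* Holonomy of a pushed forward local system along the image of a polygon on
   which the homeomorphism is affine. *)
Lemma tr_push n (p : hom) (P : T -> T -> 'M[bool]_n.+1) N a s :
  (forall x y (u : R), List.In x (a :: s) -> List.In y (a :: s) -> 0 <= u <= 1 ->
     p (seg x y u) = seg (p x) (p y) u) ->
  tr (sgh (fun x y => P (hi p x) (hi p y)) N) (p a) (map p s) = tr (sgh P N) a s.
Proof.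
elim: s a => [|b s IH] a H //=.
rewrite IH; last by move=> x y u xs ys; apply: H; right.
congr (_ * _); rewrite -[LHS]/(hol P N (hi p \o seg (p a) (p b))).
apply: hol_ext => u u01 /=; rewrite -H ?hfK //; first by left.
by right; left.
Qed.

End Loops.

Section NodeLinked.
Context {R : realType} {d : nat} (i j s t : 'I_d).
Context (si : s != i) (ti : t != i) (st : s != t) (ji : j != i) (js : j != s) (jt : j != t).
Notation T := 'rV[R]_d.

Definition LinkedL (L : R) (A : set T) := [/\ A `<=` FL i t L, Good A & Det 0 (mu s t) A].

Context (L : R) (L10 : 10 <= L) (th : R) (th0 : 0 < th) (th16 : th <= 1 / 16).
Notation BM := (bm t si L10 th0 th16).
Notation BP := (bp t si L10 th0 th16).
Notation L' := (L - 1 / 2).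
Notation O := (pI i j s t th 1 0 0 0).
Notation kl := (kloop i j s t th).
Notation nl := (nloop i j s t th).
Notation SP := (sp4 i s t j).
Ltac lrn := have := L10; have := th0; have := th16; lra.

Lemma seg_sp4 (c l a1 b1 a2 b2 u : R) : seg (SP c l a1 b1) (SP c l a2 b2) u =
  SP c l ((1 - u) * a1 + u * a2) ((1 - u) * b1 + u * b2).
Proof.
apply/rowP => k; rewrite !mxE.
by case: (k == i); case: (k == j); case: (k == s); case: (k == t); ring.
Qed.

Definition mus (c l : R) := [:: SP c l 0 2; SP c l (-3) 2; SP c l (-3) (-2); SP c l 0 (-2); SP c l 0 0].

(** The meridian is translated to the plane that the child map sends to the wall. During this its
    edges stay in the hole or beyond one side of the box, both convex regions off the frame. The
    conjugation this causes fixes the central corner matrix. *)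
Lemma mu_shift (c l : R) (A : set T) r n e (P : T -> T -> 'M[bool]_n.+1) N0 :
  `|c| < L' - 1 / 4 -> `|l| < 7 / 8 -> A `<=` FL i t L' -> L <= r -> 0 < e ->
  rep (cube r `\` A) e P -> (forall N, (N0 <= N)%N -> tr (sgh P N) 0 (mu s t) = corner n) ->
  exists N1, forall N, (N1 <= N)%N -> tr (sgh P N) (SP c l 0 0) (mus c l) = corner n.
Proof.
move=> c4 l7 AF Lr e0 rP HN.
have [N1 H1] := hol_qf r e0 rP; exists (maxn N0 N1) => N.
rewrite geq_max => /andP[/HN Emu /H1 qS].
have uS x y : ut (sgh P N x y) by apply: hol_ut; exact: rP.1.
have LL := L10.
have fl (C : set T) : C `<=` cube r -> convex C -> (forall x, C x -> ~ FL i t L' x) -> flat (sgh P N) C.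
  by move=> Cr cC CF; apply: (qf_flat qS) => // x Cx; split; [exact: Cr|move=> /AF; exact: CF].
have spc (c' l' a b : R) : `|c'| <= L -> `|l'| <= 3 -> `|a| <= 3 -> `|b| <= 3 -> cube r (SP c' l' a b).
  move=> h1 h2 h3 h4 k; apply: le_trans Lr; rewrite !mxE.
  case: (k == i) => //; case: (k == j); first lra.
  by case: (k == s); first lra; case: (k == t); [lra|rewrite normr0; lra].
pose C1 : set T := [set x | cube r x /\ forall k, k != t -> `|x ord0 k| < hF i L' k].
pose C2 (m : 'I_d) (b : R) : set T := [set x | cube r x /\ 1 < b * x ord0 m].
have cC1 : convex C1.
  move=> x y u u01 [xr xh] [yr yh]; split=> [|k kt]; first exact: seg_cube.
  move: (xh k kt) (yh k kt); rewrite /seg !mxE !ltr_norml => /andP[a1 a2] /andP[b1 b2].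
  move: (hF i L' k) (x ord0 k) (y ord0 k) a1 a2 b1 b2 => h x1 y1 a1 a2 b1 b2.
  have [u1|u1] := ltrP u 1.
    have : 0 < (1 - u) * (h - x1) by apply: mulr_gt0; lra.
    have : 0 < (1 - u) * (x1 + h) by apply: mulr_gt0; lra.
    have : 0 <= u * (h - y1) by apply: mulr_ge0; lra.
    have : 0 <= u * (y1 + h) by apply: mulr_ge0; lra.
    by move=> *; apply/andP; split; lra.
  have -> : u = 1 by lra.
  by apply/andP; split; lra.
have cC2 m b : convex (C2 m b).
  move=> x y u u01 [xr xh] [yr yh]; split; first exact: seg_cube.
  rewrite /seg !mxE mulrDr [b * (_ * x ord0 m)]mulrCA [b * (_ * y ord0 m)]mulrCA.
  move: (b * x ord0 m) (b * y ord0 m) xh yh => x1 y1 xh yh.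
  have [u1|u1] := ltrP u 1.
    have : 0 < (1 - u) * (x1 - 1) by apply: mulr_gt0; lra.
    have : 0 <= u * (y1 - 1) by apply: mulr_ge0; lra.
    by lra.
  have -> : u = 1 by lra.
  lra.
have f1 : flat (sgh P N) C1.
  by apply: fl => // [x []//|x [_ H] [_]]; apply.
have f2 m b : m != i -> `|b| = 1 -> flat (sgh P N) (C2 m b).
  move=> mi b1; apply: fl => // [x []//|x [_ H] [/(_ m) Hm _]].
  move: Hm; rewrite /lF (negbTE mi) => Hm.
  have : `|b * x ord0 m| <= 1 by rewrite normrM b1 mul1r.
  by rewrite leNgt => /negP; apply; apply: lt_le_trans H (ler_norm _).
have SPin1 (c' l' b : R) : `|c'| < L' - 1 / 4 -> `|l'| < 7 / 8 -> `|b| <= 2 -> C1 (SP c' l' 0 b).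
  move=> h1 h2 h3; split; first by apply: spc; rewrite ?normr0; lra.
  move=> k kt; rewrite !mxE /hF; case: (eqVneq k i) => [_|ki]; first by [].
  by case: (k == j); [|case: (k == s); [|rewrite (negbTE kt)]]; rewrite ?normr0 //; lra.
have SPin2 (c' l' a b : R) m (sg : R) : `|c'| <= L -> `|l'| <= 3 -> `|a| <= 3 -> `|b| <= 3 ->
   1 < sg * SP c' l' a b ord0 m -> C2 m sg (SP c' l' a b).
  by move=> *; split=> //; exact: spc.
have n0 : `|0 : R| < L' - 1 / 4 by rewrite normr0; lra.
have n1 : `|0 : R| < 7 / 8 by rewrite normr0; lra.
have n2 : `|2 : R| <= 2 by rewrite ger0_norm.
have n3 : `|-2 : R| <= 2 by rewrite normrN.
have n4 : `|0 : R| <= 2 by rewrite normr0.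
have n5 : `|-3 : R| <= 3 by rewrite normrN ger0_norm.
have n6 : `|0 : R| <= 3 by rewrite normr0.
have lad : ladder (sgh P N) (SP 0 0 0 0) (SP c l 0 0) [:: (SP 0 0 0 2, SP c l 0 2);
    (SP 0 0 (-3) 2, SP c l (-3) 2); (SP 0 0 (-3) (-2), SP c l (-3) (-2));
    (SP 0 0 0 (-2), SP c l 0 (-2)); (SP 0 0 0 0, SP c l 0 0)].
  split; first by exists C1; split=> //; exact: SPin1.
  split; first by exists (C2 t 1); split; [by apply: f2; rewrite ?normr1|..]; apply: SPin2;
     rewrite ?normr0 ?sp4t //; lra.
  split; first by exists (C2 s (-1)); split; [by apply: f2; rewrite ?normrN ?normr1|..]; apply: SPin2;
     rewrite ?normr0 ?sp4s //; lra.
  split; first by exists (C2 t (-1)); split; [by apply: f2; rewrite ?normrN ?normr1|..]; apply: SPin2;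
     rewrite ?normr0 ?sp4t //; lra.
  split; first by exists C1; split=> //; exact: SPin1.
  by [].
have E := ladder_loop uS lad erefl erefl.
have Emu' : tr (sgh P N) 0 (mu s t) = tr (sgh P N) (SP 0 0 0 0)
   [:: SP 0 0 0 2; SP 0 0 (-3) 2; SP 0 0 (-3) (-2); SP 0 0 0 (-2); SP 0 0 0 0].
  by rewrite /mu -(pt2_0 s t) !(pt2_sp si ti st ji js jt).
rewrite [LHS]E -[tr _ _ (unzip1 _)]Emu' Emu -mulrA -corner_central // mulKr //.
exact: ut_unit.
Qed.

Notation e32 := (th / 32).

Lemma pI_diag (a c : int) : pI i j s t th 1 a a c = SP 0 (127 / 128) (a%:~R * e32) (c%:~R * e32).
Proof. by rewrite /pI /pw mul1r; congr sp4; field. Qed.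

Let c96 : (96 : int)%:~R = 96 :> R. Proof. by []. Qed.
Let n96 : (-96 : int)%:~R = -96 :> R. Proof. by rewrite intrN. Qed.
Let n1 : (-1 : int)%:~R = -1 :> R. Proof. by rewrite intrN. Qed.
Let z0 : (0 : int)%:~R = 0 :> R. Proof. by []. Qed.
Let i1 : (1 : int)%:~R = 1 :> R. Proof. by []. Qed.

Lemma O_sp : O = SP 0 (127 / 128) 0 0.
Proof. by rewrite pI_diag z0 mul0r. Qed.

Lemma kl_sp : kl = [:: SP 0 (127 / 128) e32 0; SP 0 (127 / 128) e32 (- (3 * th));
  SP 0 (127 / 128) (- e32) (- (3 * th)); SP 0 (127 / 128) (- e32) 0; SP 0 (127 / 128) 0 0].
Proof.
rewrite /kloop !pI_diag i1 n1 n96 z0 mul1r mulN1r mul0r.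
by rewrite (_ : -96 * e32 = - (3 * th)) //; field.
Qed.

Lemma nl_sp : nl = [:: SP 0 (127 / 128) 0 e32; SP 0 (127 / 128) (- (3 * th)) e32;
  SP 0 (127 / 128) (- (3 * th)) (- e32); SP 0 (127 / 128) 0 (- e32); SP 0 (127 / 128) 0 0].
Proof.
rewrite /nloop !pI_diag i1 n1 n96 z0 mul1r mulN1r mul0r.
by rewrite (_ : -96 * e32 = - (3 * th)) //; field.
Qed.

(** On the wall kap = 0. A rectangle thin in the direction [t] lies in the hole of the first child
    and contains [nloop]; one thin in the direction [s] lies in the hole of the second and contains
    [kloop]. *)
Definition wallB (A B : R) : set T := [set x | exists a b, [/\ x = SP 0 (127 / 128) a b, `|a| <= A & `|b| <= B]].

Lemma wallB_conv A B : convex (wallB A B).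
Proof.
move=> x y u u01 [a [b [-> aA bB]]] [a' [b' [-> aA' bB']]]; rewrite seg_sp4.
by exists ((1 - u) * a + u * a'), ((1 - u) * b + u * b'); split=> //; exact: conv_le.
Qed.

Lemma wallB_cube A B : A <= 3 -> B <= 3 -> wallB A B `<=` cube 3.
Proof.
move=> A3 B3 x [a [b [-> aA bB]]] k; rewrite !mxE.
case: (k == i); first by rewrite normr0.
case: (k == j); first by rewrite ger0_norm; lra.
by case: (k == s); first lra; case: (k == t); [lra|rewrite normr0].
Qed.

Lemma wallB_M x A1 : A1 `<=` FL i t L' -> wallB 3 (th / 2) x -> ~ im BM A1 x.
Proof.
move=> AF [a [b [xE a3 bb]]] /(imS AF) H.
have xi : x ord0 i = 0 by rewrite xE sp4i.
have xs : `|x ord0 s| <= 3 by rewrite xE sp4s.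
have [_ _ _] := bm_slice ti st xi xs H.
rewrite xE (kap_wall L10 th0 th16 ji js jt) sp4t // => -[]; lrn.
Qed.

Lemma wallB_P x A2 : A2 `<=` FL i t L' -> wallB (th / 2) 3 x -> ~ im BP A2 x.
Proof.
move=> AF [a [b [xE aa b3]]] /(imS AF) H.
have xi : x ord0 i = 0 by rewrite xE sp4i.
have xs : `|x ord0 s| <= 3 by rewrite xE sp4s //; lrn.
have [_ _ _] := bp_slice ti st xi xs H.
rewrite xE (kap_wall L10 th0 th16 ji js jt) sp4s // addr0 => -[]; lrn.
Qed.

Section Push.
Context (p : @hom R d) (c l : R) (f : R -> R -> T) (A : set T) (lp lq : seq T) (A0 B0 : R).
Hypothesis pE : forall a b : R, `|a| <= 3 -> `|b| <= 2 -> p (SP c l a b) = f a b.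
Hypothesis fseg : forall a1 b1 a2 b2 u : R,
  seg (f a1 b1) (f a2 b2) u = f ((1 - u) * a1 + u * a2) ((1 - u) * b1 + u * b2).
Hypothesis cb : `|c| < L' - 1 / 4.
Hypothesis lb : `|l| < 7 / 8.
Hypothesis AF : A `<=` FL i t L'.
Hypothesis fO : f 0 0 = O.
Hypothesis lpE : [:: f 0 2; f (-3) 2; f (-3) (-2); f 0 (-2); f 0 0] = lp.
Hypothesis A03 : A0 <= 3.
Hypothesis B03 : B0 <= 3.
Hypothesis wall : forall x, wallB A0 B0 x -> ~ im p A x.
Hypothesis wO : wallB A0 B0 O.
Hypothesis wq : forall x, List.In x lq -> wallB A0 B0 x.
Hypothesis lastq : last O lq = O.

(** [lp] is the image of the meridian of the child and inherits its holonomy, while [lq] bounds in a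
    convex rectangle that misses the child. Treating both children at once, the map is described
    only by its values [f] on the plane. *)
Lemma Det2_push : Det 0 (mu s t) A -> Det2 O lp lq (im p A).
Proof.
move=> [n [n0 dA]]; exists n; split=> // r.
pose r1 := Num.max r 3.
have [r' Hr] := @rep_im R d n p A r1.
pose r2 := Num.max r' L.
have [e [P [N0 [e0 rP HN]]]] := dA r2.
have L2 : L <= r2 by rewrite le_max lexx orbT.
have [N1 H1] := mu_shift cb lb AF L2 e0 rP HN.
have [e' [e'0 rP']] : exists e', 0 < e' /\ rep (cube r1 `\` im p A) e' (fun x y => P (hi p x) (hi p y)).
  apply: Hr e0 _; apply: rep_sub rP => // x [xr nx]; split=> //.
  by apply: cube_le xr; rewrite le_max lexx.
have [N2 H2] := hol_qf r1 e'0 rP'.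
exists e', (fun x y => P (hi p x) (hi p y)), (maxn N1 N2); split=> //.
  apply: rep_sub rP' => // x [xr nx]; split=> //.
  by apply: cube_le xr; rewrite le_max lexx.
move=> N; rewrite geq_max => /andP[/H1 E1 /H2 q2]; split.
  have inS x : List.In x (SP c l 0 0 :: mus c l) -> exists a b, [/\ x = SP c l a b, `|a| <= 3 & `|b| <= 2].
    have m3 : `|-3 : R| <= 3 by rewrite normrN ger0_norm.
    have m2 : `|-2 : R| <= 2 by rewrite normrN ger0_norm.
    have p2 : `|2 : R| <= 2 by rewrite ger0_norm.
    have p0 (B : R) : 0 <= B -> `|0 : R| <= B by rewrite normr0.
    by move=> /= [<-|[<-|[<-|[<-|[<-|[<-|[]]]]]]]; do 2 eexists; split; try reflexivity; rewrite ?p0.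
  rewrite -E1 -(@tr_push _ _ n p P N (SP c l 0 0) (mus c l)); last first.
    move=> x y u /inS[a1 [b1 [-> h1 h2]]] /inS[a2 [b2 [-> h3 h4]]] u01.
    by rewrite seg_sp4 !pE // ?fseg //; exact: conv_le.
  have m3 : `|-3 : R| <= 3 by rewrite normrN ger0_norm.
  have m2 : `|-2 : R| <= 2 by rewrite normrN ger0_norm.
  have p2 : `|2 : R| <= 2 by rewrite ger0_norm.
  have p0 (B : R) : 0 <= B -> `|0 : R| <= B by rewrite normr0.
  by rewrite /mus /= !pE ?p0 // fO -lpE /= fO.
apply: flat_loop wO wq lastq; apply: (qf_flat q2); last exact: wallB_conv.
  move=> x wx; split; last exact: wall.
  by apply: cube_le (wallB_cube A03 B03 wx); rewrite le_max lexx orbT.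
by move=> x wx; apply: cube_le (wallB_cube A03 B03 wx); rewrite le_max lexx orbT.
Qed.

End Push.

Lemma in_wallB A B a b : `|a| <= A -> `|b| <= B -> wallB A B (SP 0 (127 / 128) a b).
Proof. by move=> aA bB; exists a, b. Qed.

Lemma Det2_M A1 : LinkedL L' A1 -> Det2 O kl nl (im BM A1).
Proof.
move=> [AF _ dA]; have [c [l [cb lb HM]]] := bm_sp4 si ti st L10 th0 th16 ji js jt.
have t0 := th0; have t16 := th16.
have e3 : `|e32| <= th / 2 by rewrite ger0_norm; lra.
have h3 : `|3 * th| <= 3 by rewrite ger0_norm; lra.
apply: (@Det2_push BM c l (fun a b => SP 0 (127 / 128) (th / 64 * b) (th * a)) A1 kl nl 3 (th / 2)) => //.
- move=> a b a3 b2; apply: HM; rewrite normrM ger0_norm; last lra.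
  apply: le_trans (_ : th / 64 * 2 <= _); last lra.
  by apply: ler_wpM2l; lra.
- by move=> *; rewrite seg_sp4; congr sp4; ring.
- by rewrite O_sp !mulr0.
- by rewrite kl_sp; do ![congr cons]; congr sp4; field.
- lra.
- by move=> x; apply: wallB_M AF.
- by rewrite O_sp; apply: in_wallB; rewrite normr0; lra.
- by move=> x; rewrite nl_sp /= => -[<-|[<-|[<-|[<-|[<-|[]]]]]]; apply: in_wallB; rewrite ?normrN ?normr0 //; lra.
Qed.

Lemma Det2_P A2 : LinkedL L' A2 -> Det2 O nl kl (im BP A2).
Proof.
move=> [AF _ dA]; have [c [l [cb lb HM]]] := bp_sp4 si ti st L10 th0 th16 ji js jt.
have t0 := th0; have t16 := th16.
have e3 : `|e32| <= th / 2 by rewrite ger0_norm; lra.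
have h3 : `|3 * th| <= 3 by rewrite ger0_norm; lra.
apply: (@Det2_push BP c l (fun a b => SP 0 (127 / 128) (th * a) (th / 64 * b)) A2 nl kl (th / 2) 3) => //.
- move=> a b a3 b2; apply: HM; rewrite normrM ger0_norm; last lra.
  apply: le_trans (_ : th * 3 <= _); last lra.
  by apply: ler_wpM2l; lra.
- by move=> *; rewrite seg_sp4; congr sp4; ring.
- by rewrite O_sp !mulr0.
- by rewrite nl_sp; do ![congr cons]; congr sp4; field.
- lra.
- by move=> x; apply: wallB_P AF.
- by rewrite O_sp; apply: in_wallB; rewrite normr0; lra.
- by move=> x; rewrite kl_sp /= => -[<-|[<-|[<-|[<-|[<-|[]]]]]]; apply: in_wallB; rewrite ?normrN ?normr0 //; lra.
Qed.

Theorem node_linked A1 A2 : LinkedL L' A1 -> LinkedL L' A2 -> LinkedL L (im BM A1 `|` im BP A2).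
Proof.
move=> l1 l2; have [F1 g1 d1] := l1; have [F2 g2 d2] := l2.
have [e0 [e0p sep]] := children_sep si ti st L10 th0 th16.
have sep' x y : im BM A1 x -> im BP A2 y -> ~ cl e0 x y.
  by move=> /(imS F1) H1 /(imS F2) H2; exact: sep.
split.
- by move=> x [/imP[y /F1 Fy ->]|/imP[y /F2 Fy ->]]; [exact: bm_FL|exact: bp_FL].
- by apply: GoodU sep' _ _ => //; exact: Good_im.
- apply: (comm_Det (r0 := 3) e0p sep' _ _ (Det2_M l1) (Det2_P l2)); try exact: Good_im.
  move=> n S qS.
  have qS' : qf (freeS i s t L th) 3 S.
    apply: qf_cube; apply: qf_sub qS => x [[xi xs nM nP] x3]; split=> // -[/(imS F1)|/(imS F2)] H.
      by apply: nM; exact: (bm_slice ti st xi xs H).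
    by apply: nP; exact: (bp_slice ti st xi xs H).
  exact: (clasp_mu si ti st ji js jt L10 th0 th16 qS').
Qed.

End NodeLinked.

(** * Trees of frames *)

Section Stretch.
Context {R : realType} (L : R) (L2 : 2 <= L).
Let al := (L - 1 / 4) / (7 / 8).
Let al0 : 0 < al. Proof. by rewrite /al; apply: divr_gt0; move: L2; lra. Qed.
Let alN : al != 0. Proof. by rewrite gt_eqF. Qed.
Let ba0 : 0 < 2 / al. Proof. by rewrite divr_gt0. Qed.

Definition stretch : @lip R := lip_comp (lip_aff 0 alN)
  (lip_comp (lip_kinkR (7 / 8) ba0) (lip_kinkL (- (7 / 8)) ba0)).

Lemma stretch_mid (x : R) : `|x| <= 7 / 8 -> stretch x = (L - 1 / 4) / (7 / 8) * x.
Proof.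
rewrite ler_norml => /andP[A B].
by rewrite /= (kinkL_ge _ A) kinkR_le // addr0.
Qed.

Lemma stretch_r (x : R) : 7 / 8 <= x -> stretch x = L - 1 / 4 + 2 * (x - 7 / 8).
Proof.
move=> A; rewrite /= kinkL_ge; last lra.
rewrite kinkR_ge // addr0 mulrDr; congr (_ + _); first by rewrite /al; field.
by field; exact: alN.
Qed.

Lemma stretch_l (x : R) : x <= - (7 / 8) -> stretch x = - (L - 1 / 4) + 2 * (x + 7 / 8).
Proof.
move=> A; rewrite /= kinkL_le //.
have N : 2 / al * (x - - (7 / 8)) <= 0 by apply: mulr_ge0_le0; [exact: ltW|lra].
rewrite kinkR_le; last lra.
rewrite addr0 mulrDr opprK; congr (_ + _); first by rewrite /al; field.
by field; exact: alN.
Qed.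

Lemma stretch0 : stretch 0 = 0.
Proof. by rewrite stretch_mid ?mulr0 // normr0; lra. Qed.

Lemma stretch_in (x : R) : (`|stretch x| <= L) = (`|x| <= 1).
Proof.
have LL := L2.
case: (lerP `|x| (7 / 8)) => H.
  have H1 : `|stretch x| <= L - 1 / 4.
    rewrite stretch_mid // normrM ger0_norm; last by apply: divr_ge0; lra.
    apply: le_trans (_ : (L - 1 / 4) / (7 / 8) * (7 / 8) <= _).
      by rewrite ler_wpM2l //; apply: divr_ge0; lra.
    by rewrite divfK; lra.
  by apply/idP/idP => _; lra.
move: H; case: (lerP 0 x) => x0; [rewrite ger0_norm // => A|rewrite ltr0_norm // => A].
  rewrite stretch_r ?(ltW A) // ger0_norm; last lra.
  by apply/idP/idP; lra.
rewrite stretch_l; last lra.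
by rewrite ler0_norm; last lra; apply/idP/idP; lra.
Qed.

Lemma stretch_hole (x : R) : (`|stretch x| < L - 1 / 4) = (`|x| < 7 / 8).
Proof.
have LL := L2.
case: (ltrP `|x| (7 / 8)) => H.
  rewrite stretch_mid ?(ltW H) // normrM ger0_norm; last by apply: divr_ge0; lra.
  apply: lt_le_trans (_ : (L - 1 / 4) / (7 / 8) * (7 / 8) <= _).
    by rewrite ltr_pM2l //; apply: divr_gt0; lra.
  by rewrite divfK; lra.
apply/negbTE; rewrite -leNgt; move: H.
case: (lerP 0 x) => x0; [rewrite ger0_norm // => A|rewrite ltr0_norm // => A].
  rewrite stretch_r // ger0_norm; lra.
rewrite stretch_l; last lra.
by rewrite ler0_norm; lra.
Qed.

End Stretch.

Section Trees.
Context {R : realType} {d : nat} (d4 : (4 <= d)%N) (s t : 'I_d) (st : s != t).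
Notation T := 'rV[R]_d.
Notation homT := (@hom R d).
Implicit Types (x y : T) (A : set T).

Definition Fr0 : set T := Fr t (fun=> 1) (fun=> 7 / 8).
Definition Linked (A : set T) := [/\ A `<=` Fr0, Good A & Det 0 (mu s t) A].

Lemma Fr0_linked : Linked Fr0.
Proof.
split=> //; first by apply: Good_frame => // k; lra.
by apply: Det_frame => // [k||]; lra.
Qed.

Definition in_plane x := forall k, k != s -> k != t -> x ord0 k = 0.

Lemma Det_fix (p : homT) (A : set T) : (forall x, in_plane x -> p x = x) ->
  Det 0 (mu s t) A -> Det 0 (mu s t) (im p A).
Proof.
move=> pf [n [n0 dA]]; exists n; split=> // r.
have [r' Hr] := @rep_im R d n p A r.
have [e [P [N0 [e0 rP HN]]]] := dA r'.
have [e' [e'0 rP']] := Hr e P e0 rP.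
exists e', (fun x y => P (hi p x) (hi p y)), N0; split=> // N /HN <-.
have m0 x : List.In x (0 :: mu s t) -> in_plane x.
  rewrite /= => -[<-|[<-|[<-|[<-|[<-|[<-|[]]]]]]] k ks kt; rewrite !mxE //;
  by rewrite (negbTE ks) (negbTE kt).
have -> : tr (sgh P N) 0 (mu s t) =
    tr (sgh (fun x y => P (hi p x) (hi p y)) N) (p 0) (map p (mu s t)).
  rewrite tr_push // => x y u /m0 x0 /m0 y0 u01.
  by rewrite !pf // => k ks kt; rewrite /seg !mxE x0 // y0 // !mulr0 addr0.
rewrite pf; last by move=> k _ _; rewrite mxE.
congr (tr _ _ _).
have : forall x, List.In x (mu s t) -> in_plane x by move=> x xs; apply: m0; right.
elim: (mu s t) => //= x l IH H; rewrite pf; last by apply: H; left.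
by congr (_ :: _); apply: IH => y yl; apply: H; right.
Qed.

(** A tree is kept as the list of its leaves, a leaf [p] standing for the piece p(Fr0). The closure
    conditions speak of arbitrary linked subsets of the frame, not of the frame alone, so that the
    property passes from the leaves to the root. [tincl] admits changes of shape such as a
    rescaling. *)
Inductive tree : seq homT -> Prop :=
| tleaf : tree [:: hom_id]
| tincl (c : homT) l : (forall A, Linked A -> Linked (im c A)) -> tree l -> tree (map (hcomp c) l)
| tnode (b1 b2 : homT) l1 l2 :
    (forall A1 A2, Linked A1 -> Linked A2 -> Linked (im b1 A1 `|` im b2 A2)) ->
    (forall x, im b1 Fr0 x -> im b2 Fr0 x -> False) ->
    tree l1 -> tree l2 -> tree (map (hcomp b1) l1 ++ map (hcomp b2) l2).

Definition un (l : seq homT) : set T := [set x | exists2 p, List.In p l & im p Fr0 x].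

Lemma un_map (c : homT) l : un (map (hcomp c) l) = im c (un l).
Proof.
apply/seteqP; split=> x.
  by move=> [p /List.in_map_iff[q [<- ql]] H]; exists q.
by move=> [q ql H]; exists (hcomp c q) => //; apply/List.in_map_iff; exists q.
Qed.

Lemma un_cat l1 l2 : un (l1 ++ l2) = un l1 `|` un l2.
Proof.
apply/seteqP; split=> x.
  by move=> [p /(@List.in_app_or _ _ _ _)[pl|pl] H]; [left|right]; exists p.
by move=> [[p pl H]|[p pl H]]; exists p => //; apply: List.in_or_app; [left|right].
Qed.

Lemma tree_linked l : tree l -> Linked (un l).
Proof.
elim=> [|c l' H _ IH|b1 b2 l1 l2 H _ _ IH1 _ IH2].
- have -> : un [:: hom_id] = Fr0.
    by apply/seteqP; split=> x; [move=> [p [<-|[]]]|move=> H; exists hom_id => //; left].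
  exact: Fr0_linked.
- by rewrite un_map; exact: H.
- by rewrite un_cat !un_map; exact: H.
Qed.

Lemma tree_nonempty l : tree l -> exists p, List.In p l.
Proof.
elim=> [|c l' _ _ [p pl]|b1 b2 l1 l2 _ _ _ [p pl] _ _].
- by exists hom_id; left.
- by exists (hcomp c p); apply/List.in_map_iff; exists p.
- by exists (hcomp b1 p); apply: List.in_or_app; left; apply/List.in_map_iff; exists p.
Qed.

Lemma tree_sub l p x : tree l -> List.In p l -> im p Fr0 x -> Fr0 x.
Proof. by move=> /tree_linked[H _ _] pl px; apply: H; exists p. Qed.

Lemma tree_disj l p q x : tree l -> List.In p l -> List.In q l -> im p Fr0 x -> im q Fr0 x -> p = q.
Proof.
move=> tl; elim: tl p q x => {l} [|c l _ tl IH|b1 b2 l1 l2 _ D t1 IH1 t2 IH2] p q x.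
- by move=> [<-|[]] [<-|[]].
- move=> /List.in_map_iff[p' [<- pl]] /List.in_map_iff[q' [<- ql]] Hp Hq.
  by rewrite (IH p' q' (hi c x)).
- move=> /(@List.in_app_or _ _ _ _)[] /List.in_map_iff[p' [<- pl]];
    move=> /(@List.in_app_or _ _ _ _)[] /List.in_map_iff[q' [<- ql]] Hp Hq.
  + by rewrite (IH1 p' q' (hi b1 x)).
  + by case: (D x); [exact: (tree_sub t1 pl Hp)|exact: (tree_sub t2 ql Hq)].
  + by case: (D x); [exact: (tree_sub t1 ql Hq)|exact: (tree_sub t2 pl Hp)].
  + by rewrite (IH2 p' q' (hi b2 x)).
Qed.

(** Stated pointwise, so that no equality of records with proof fields is needed when compositions
    are regrouped. *)
Definition is_comp (r p q : homT) := forall x, r x = p (q x).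

Lemma is_comp_im r p q A : is_comp r p q -> im r A = im p (im q A).
Proof.
move=> E; apply/seteqP; split=> x.
  by move=> /imP[y Ay ->]; rewrite E; do 2 apply: im_f.
by move=> /imP[y /imP[z Az ->] ->]; rewrite -E; apply: im_f.
Qed.

(** The subtree depends on the leaf, because the precision needed below a leaf is set by the modulus
    of continuity of the map leading to it. *)
Lemma graft l : tree l -> forall F : homT -> seq homT -> Prop,
  (forall p, List.In p l -> exists l', tree l' /\ F p l') ->
  exists l'', [/\ tree l'',
    forall r, List.In r l'' -> exists p l' q, [/\ List.In p l, F p l', List.In q l' & is_comp r p q] &
    forall p, List.In p l -> exists2 l', F p l' & forall q, List.In q l' ->
      exists2 r, List.In r l'' & is_comp r p q].
Proof.
elim=> {l} [|c l H tl IH|b1 b2 l1 l2 H D t1 IH1 t2 IH2] F HF.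
- have [l' [tl' Fl']] := HF hom_id (or_introl erefl).
  exists l'; split=> // [r rl|p [<-|[]]]; last by exists l' => // q ql; exists q.
  by exists hom_id, l', r; split=> //; left.
- have [|l'' [tl'' A B]] := IH (fun p l' => F (hcomp c p) l').
    by move=> p pl; apply: HF; apply/List.in_map_iff; exists p.
  exists (map (hcomp c) l''); split; first exact: tincl.
    move=> r /List.in_map_iff[r' [<- /A[p [l' [q [pl Fp ql E]]]]]].
    exists (hcomp c p), l', q; split=> //; first by apply/List.in_map_iff; exists p.
    by move=> x /=; rewrite E.
  move=> p /List.in_map_iff[p' [<- /B[l' Fl' Hq]]]; exists l' => // q /Hq[r rl E].
  exists (hcomp c r); first by apply/List.in_map_iff; exists r.
  by move=> x /=; rewrite E.
- have [|l1'' [tl1'' A1 B1]] := IH1 (fun p l' => F (hcomp b1 p) l').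
    by move=> p pl; apply: HF; apply: List.in_or_app; left; apply/List.in_map_iff; exists p.
  have [|l2'' [tl2'' A2 B2]] := IH2 (fun p l' => F (hcomp b2 p) l').
    by move=> p pl; apply: HF; apply: List.in_or_app; right; apply/List.in_map_iff; exists p.
  exists (map (hcomp b1) l1'' ++ map (hcomp b2) l2''); split; first exact: tnode.
    move=> r /(@List.in_app_or _ _ _ _)[] /List.in_map_iff[r' [<-]].
      move=> /A1[p [l' [q [pl Fp ql E]]]]; exists (hcomp b1 p), l', q; split=> //.
        by apply: List.in_or_app; left; apply/List.in_map_iff; exists p.
      by move=> x /=; rewrite E.
    move=> /A2[p [l' [q [pl Fp ql E]]]]; exists (hcomp b2 p), l', q; split=> //.
      by apply: List.in_or_app; right; apply/List.in_map_iff; exists p.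
    by move=> x /=; rewrite E.
  move=> p /(@List.in_app_or _ _ _ _)[] /List.in_map_iff[p' [<-]].
    move=> /B1[l' Fl' Hq]; exists l' => // q /Hq[r rl E]; exists (hcomp b1 r).
      by apply: List.in_or_app; left; apply/List.in_map_iff; exists r.
    by move=> x /=; rewrite E.
  move=> /B2[l' Fl' Hq]; exists l' => // q /Hq[r rl E]; exists (hcomp b2 r).
    by apply: List.in_or_app; right; apply/List.in_map_iff; exists r.
  by move=> x /=; rewrite E.
Qed.

(** * Shrinking in one direction *)

Section Stretching.
Context (i : 'I_d) (si : s != i) (ti : t != i).

Lemma two_le (L : R) : 10 <= L -> 2 <= L. Proof. lra. Qed.

Definition EL (L : R) (L2 : 2 <= L) : homT := chom (fun k => if k == i then stretch L2 else lip_id).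

Lemma EL_i L (L2 : 2 <= L) x : EL L2 x ord0 i = stretch L2 (x ord0 i).
Proof. by rewrite chomE eqxx. Qed.
Lemma EL_k L (L2 : 2 <= L) x k : k != i -> EL L2 x ord0 k = x ord0 k.
Proof. by move=> ki; rewrite chomE (negbTE ki). Qed.

Lemma EL_fix L (L2 : 2 <= L) (x : T) : x ord0 i = 0 -> EL L2 x = x.
Proof.
move=> xi; apply/rowP => k; case: (eqVneq k i) => [->|ki]; last by rewrite EL_k.
by rewrite EL_i xi stretch0.
Qed.

Lemma EL_FL L (L2 : 2 <= L) (x : T) : Fr0 x <-> FL i t L (EL L2 x).
Proof.
have A k : (`|EL L2 x ord0 k| <= lF i L k) = (`|x ord0 k| <= 1).
  rewrite /lF; case: (eqVneq k i) => [->|ki]; last by rewrite EL_k.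
  by rewrite EL_i stretch_in.
have B k : (`|EL L2 x ord0 k| < hF i L k) = (`|x ord0 k| < 7 / 8).
  rewrite /hF; case: (eqVneq k i) => [->|ki]; last by rewrite EL_k.
  by rewrite EL_i stretch_hole.
split=> -[H1 H2]; split.
- by move=> k; rewrite A.
- by move=> H; apply: H2 => k kt; rewrite -B; exact: H.
- by move=> k; rewrite -A.
- by move=> H; apply: H2 => k kt; rewrite B; exact: H.
Qed.

Lemma EL_linked L (L2 : 2 <= L) A : Linked A -> LinkedL i s t L (im (EL L2) A).
Proof.
move=> [A0 gA dA]; split.
- by move=> x /imP[y /A0 Fy ->]; apply/EL_FL.
- exact: Good_im.
- by apply: Det_fix dA => x x0; apply: EL_fix; apply: x0; rewrite eq_sym.
Qed.

Lemma EL_linkedV L (L2 : 2 <= L) A : LinkedL i s t L A -> Linked (im (hom_inv (EL L2)) A).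
Proof.
move=> [A0 gA dA]; split.
- by move=> x /imP[y /A0 Fy ->]; apply/(EL_FL L2); rewrite -[hf (hom_inv _) y]/(hi (EL L2) y) hiK.
- exact: Good_im.
- apply: Det_fix dA => x x0; have xi : x ord0 i = 0 by apply: x0; rewrite eq_sym.
  by rewrite -{1}(EL_fix L2 xi) -[LHS]/(hi (EL L2) (EL L2 x)) hfK.
Qed.

Let one0 (L : R) (L2 : 2 <= L) : L^-1 != 0. Proof. by rewrite invr_eq0 gt_eqF //; lra. Qed.

Definition scale (L : R) (L2 : 2 <= L) : homT :=
  hcomp (chom (fun k => if k == i then lip_aff 0 (one0 L2) else lip_id)) (EL L2).

Lemma scale_i L (L2 : 2 <= L) x : scale L2 x ord0 i = EL L2 x ord0 i / L.
Proof. by rewrite [LHS]chomE eqxx /= addr0 mulrC. Qed.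
Lemma scale_k L (L2 : 2 <= L) x k : k != i -> scale L2 x ord0 k = x ord0 k.
Proof. by move=> ki; rewrite [LHS]chomE (negbTE ki) /= EL_k. Qed.

Lemma scale_linked L (L2 : 2 <= L) A : Linked A -> Linked (im (scale L2) A).
Proof.
move=> [A0 gA dA]; have L0 : 0 < L by lra.
split.
- move=> x /imP[y /A0 [H1 H2] ->]; split=> [k|H].
    case: (eqVneq k i) => [->|ki]; last by rewrite scale_k.
    by rewrite scale_i normrM normfV (gtr0_norm L0) ler_pdivrMr // mul1r EL_i stretch_in.
  apply: H2 => k kt; have := H k kt.
  case: (eqVneq k i) => [->|ki]; last by rewrite scale_k.
  rewrite scale_i normrM normfV (gtr0_norm L0) ltr_pdivrMr // EL_i => Hk.
  by rewrite -(stretch_hole L2); apply: lt_le_trans Hk _; lra.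
- exact: Good_im.
- apply: Det_fix dA => x x0; have xi : x ord0 i = 0 by apply: x0; rewrite eq_sym.
  apply/rowP => k.
  case: (eqVneq k i) => [->|ki]; last by rewrite scale_k.
  by rewrite scale_i EL_fix // xi mul0r.
Qed.

Lemma two_le' (L : R) : 10 <= L -> 2 <= L - 1 / 2. Proof. lra. Qed.

(** The direction [j] carries the wall at which the two bowls cross. *)
Lemma fourth_index : exists j : 'I_d, [/\ j != i, j != s & j != t].
Proof.
have H : (#|[:: i; s; t]| <= 3)%N by exact: card_size.
have := cardC (mem [:: i; s; t]); rewrite card_ord => E.
have : (0 < #|predC (mem [:: i; s; t])|)%N.
  by rewrite lt0n; apply/eqP => E0; move: d4; rewrite -E E0 addn0 ltnNge H.
move=> /card_gt0P[j]; rewrite !inE !negb_or => /and3P[ji js jt].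
by exists j.
Qed.

Section Beta.
Context (L : R) (L10 : 10 <= L) (th : R) (th0 : 0 < th) (th16 : th <= 1 / 16).
Notation L2 := (two_le L10).
Notation L'2 := (two_le' L10).
Notation BM := (bm t si L10 th0 th16).
Notation BP := (bp t si L10 th0 th16).

Definition betaM : homT := hcomp (hom_inv (EL L2)) (hcomp BM (EL L'2)).
Definition betaP : homT := hcomp (hom_inv (EL L2)) (hcomp BP (EL L'2)).

Lemma betaME x : EL L2 (betaM x) = BM (EL L'2 x).
Proof. by rewrite -[betaM x]/(hi (EL L2) (BM (EL L'2 x))) hiK. Qed.
Lemma betaPE x : EL L2 (betaP x) = BP (EL L'2 x).
Proof. by rewrite -[betaP x]/(hi (EL L2) (BP (EL L'2 x))) hiK. Qed.

Lemma beta_linked A1 A2 : Linked A1 -> Linked A2 -> Linked (im betaM A1 `|` im betaP A2).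
Proof.
move=> l1 l2; have [j [ji js jt]] := fourth_index.
have := node_linked si ti st ji js jt L10 th0 th16 (EL_linked L'2 l1) (EL_linked L'2 l2).
by move=> /(EL_linkedV L2).
Qed.

Lemma beta_disj x : im betaM Fr0 x -> im betaP Fr0 x -> False.
Proof.
have [e0 [e0p sep]] := children_sep si ti st L10 th0 th16.
move=> /imP[p Fp xE] /imP[q Fq xE'].
apply: (sep (EL L2 x) (EL L2 x)); last exact: cl_refl.
  by rewrite xE betaME; apply: im_f; apply/EL_FL.
by rewrite xE' betaPE; apply: im_f; apply/EL_FL.
Qed.

Lemma beta_tree l1 l2 : tree l1 -> tree l2 -> tree (map (hcomp betaM) l1 ++ map (hcomp betaP) l2).
Proof. by apply: tnode; [exact: beta_linked|exact: beta_disj]. Qed.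

Lemma betaM_k k : k != i -> k != s -> k != t -> exists g : @lip R, forall x, betaM x ord0 k = g (x ord0 k).
Proof.
move=> ki ks kt; eexists => x.
rewrite -(EL_k L2 _ ki) betaME bm_k // EL_k //; reflexivity.
Qed.
Lemma betaP_k k : k != i -> k != s -> k != t -> exists g : @lip R, forall x, betaP x ord0 k = g (x ord0 k).
Proof.
move=> ki ks kt; eexists => x.
rewrite -(EL_k L2 _ ki) betaPE bp_k // EL_k //; reflexivity.
Qed.

End Beta.

(** The hooks in one direction act on each remaining direction, [s] and [t] excepted, by a Lipschitz
    map of that coordinate alone. Smallness in such a coordinate therefore survives composition. *)
Definition separable_off (K : seq 'I_d) (p : homT) := forall k, k \notin K -> k != s -> k != t ->
  exists g : @lip R, forall x, p x ord0 k = g (x ord0 k).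

Lemma sixteenth_pos : 0 < 1 / 16 :> R. Proof. lra. Qed.

Lemma EL_eq L L1 (L2 : 2 <= L) (L12 : 2 <= L1) x : L = L1 -> EL L2 x = EL L12 x.
Proof. by move=> E; subst L1; rewrite (Prop_irrelevance L2 L12). Qed.

(** Positions are counted from the left end of a frame of length 20 + N. The first child keeps
    distances from the left end and the second those from the right, while the length grows by 1
    from child to parent. So [a] is kept in the first case and becomes a + 1 in the second. *)
Lemma phase_steps (N : nat) (L : R) (L2 : 2 <= L) : L = (20 + N)%:R / 2 ->
  exists l, tree l /\ forall p, List.In p l -> separable_off [:: i] p /\
    exists a : nat, (a + 20 <= 20 + N)%N /\
      forall x, Fr0 x -> a%:R <= EL L2 (p x) ord0 i + L <= (a + 20)%:R.
Proof.
elim: N L L2 => [|N IH] L L2 LE.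
  exists [:: hom_id]; split; first exact: tleaf.
  move=> p [<-|[]]; split; first by move=> k _ _ _; exists lip_id.
  exists 0%N; split=> // x Fx; have [/(_ i)] : FL i t L (EL L2 x) by apply/EL_FL.
  have L10 : L = 10 by rewrite LE addn0; field.
  rewrite /lF eqxx ler_norml -[hf hom_id x]/x add0n => /andP[A B] _.
  by apply/andP; split; lra.
have LE' : L = 1 / 2 + (20 + N)%:R / 2 by rewrite LE addnS -[in LHS]natr1; field.
have N0 : 20 <= (20 + N)%:R :> R by rewrite ler_nat leq_addr.
have L10 : 10 <= L by lra.
have L'2 : 2 <= L - 1 / 2 by lra.
have [l [tl Hl]] := IH (L - 1 / 2) L'2 ltac:(lra).
have t16 : 1 / 16 <= 1 / 16 :> R by [].
exists (map (hcomp (betaM L10 sixteenth_pos t16)) l ++ map (hcomp (betaP L10 sixteenth_pos t16)) l).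
split; first exact: beta_tree.
move=> r /(@List.in_app_or _ _ _ _)[] /List.in_map_iff[p [<- pl]]; have [sp [a [aN Ha]]] := Hl p pl.
  split.
    move=> k kn ks kt; have ki : k != i by rewrite inE in kn.
    have [g Hg] := sp k kn ks kt.
    have [g' Hg'] := betaM_k L10 sixteenth_pos t16 ki ks kt.
    by exists (lip_comp g' g) => x; rewrite [LHS]Hg' Hg.
  exists a; split; first by apply: leq_trans aN _; rewrite leq_add2l.
  move=> x Fx; have /andP[A B] := Ha x Fx.
  have Fp : FL i t (L - 1 / 2) (EL L'2 (p x)).
    by apply/EL_FL; apply: (tree_sub tl pl); exact: im_f.
  have [T1 T2] := bm_thr si ti st L10 sixteenth_pos t16 Fp.
  have E : EL L2 (hcomp (betaM L10 sixteenth_pos t16) p x) = bm t si L10 sixteenth_pos t16 (EL L'2 (p x)).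
    rewrite -[hcomp _ p x]/(betaM L10 sixteenth_pos t16 (p x)) (EL_eq _ (two_le L10)) // betaME.
    by rewrite (EL_eq _ L'2).
  rewrite E; apply/andP; split.
    apply: T2 => //; have : a%:R + 20 <= (20 + N)%:R :> R by rewrite -natrD ler_nat.
    lra.
  by apply: T1 => //; rewrite natrD; have : 0 <= a%:R :> R; [exact: ler0n|lra].
split.
  move=> k kn ks kt; have ki : k != i by rewrite inE in kn.
  have [g Hg] := sp k kn ks kt.
  have [g' Hg'] := betaP_k L10 sixteenth_pos t16 ki ks kt.
  by exists (lip_comp g' g) => x; rewrite [LHS]Hg' Hg.
exists a.+1; split; first by rewrite addSn [(20 + N.+1)%N]addnS ltnS.
move=> x Fx; have /andP[A B] := Ha x Fx.
have Fp : FL i t (L - 1 / 2) (EL L'2 (p x)).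
  by apply/EL_FL; apply: (tree_sub tl pl); exact: im_f.
have [T1 T2] := bp_thr si ti st L10 sixteenth_pos t16 Fp.
have E : EL L2 (hcomp (betaP L10 sixteenth_pos t16) p x) = bp t si L10 sixteenth_pos t16 (EL L'2 (p x)).
  rewrite -[hcomp _ p x]/(betaP L10 sixteenth_pos t16 (p x)) (EL_eq _ (two_le L10)) // betaPE.
  by rewrite (EL_eq _ L'2).
rewrite E.
have aN' : a%:R + 20 <= (20 + N)%:R :> R by rewrite -natrD ler_nat.
have bE : (20 + N - (a + 20))%:R = (20 + N)%:R - (a%:R + 20) :> R by rewrite natrB // (natrD _ a).
have a0 : 0 <= a%:R :> R by exact: ler0n.
have := T2 (20 + N - (a + 20))%N; rewrite bE => /(_ ltac:(lra)) T2'.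
have T1' := T1 ((20 + N)%:R - a%:R) ltac:(lra).
rewrite (natrD _ a) in B; have {}T1' := T1' ltac:(lra); have {}T2' := T2' ltac:(lra).
rewrite (natrD _ a.+1) -natr1; apply/andP; split; lra.
Qed.

Lemma phase (dl : R) : 0 < dl -> exists l, tree l /\ forall p, List.In p l -> separable_off [:: i] p /\
  forall x y, Fr0 x -> Fr0 y -> `|p x ord0 i - p y ord0 i| < dl.
Proof.
move=> dl0; pose N := (Num.truncn (80 / dl)).+1.
have NL : 80 / dl < N%:R by exact: truncnS_gt.
have N20 : 20 <= (20 + N)%:R :> R by rewrite ler_nat leq_addr.
have L2 : 2 <= (20 + N)%:R / 2 :> R by lra.
have [l [tl Hl]] := phase_steps L2 erefl.
exists (map (hcomp (scale L2)) l); split; first by apply: tincl => // A; exact: scale_linked.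
move=> r /List.in_map_iff[p [<- pl]]; have [sp [a [aN Ha]]] := Hl p pl; split.
  move=> k kn ks kt; have ki : k != i by rewrite inE in kn.
  have [g Hg] := sp k kn ks kt.
  by exists g => x; rewrite -Hg [LHS]scale_k.
move=> x y Fx Fy.
rewrite -[hcomp _ p x]/(scale L2 (p x)) -[hcomp _ p y]/(scale L2 (p y)) !scale_i -mulrBl.
have /andP[A B] := Ha x Fx; have /andP[A' B'] := Ha y Fy.
rewrite (natrD _ a) in B B'.
have H : `|EL L2 (p x) ord0 i - EL L2 (p y) ord0 i| <= 20.
  by rewrite ler_norml; apply/andP; split; lra.
have L0 : 0 < (20 + N)%:R / 2 :> R by lra.
rewrite normrM normfV (gtr0_norm L0) ltr_pdivrMr //.
apply: le_lt_trans H _.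
have : 80 < N%:R * dl by rewrite -ltr_pdivrMr.
rewrite natrD; have : 0 < dl * 20 by rewrite mulr_gt0.
lra.
Qed.

End Stretching.

Lemma multiphase (K : seq 'I_d) : (forall k, k \in K -> (s != k) && (t != k)) -> uniq K ->
  forall dl : R, 0 < dl -> exists l, tree l /\ forall p, List.In p l -> separable_off K p /\
  forall k x y, k \in K -> Fr0 x -> Fr0 y -> `|p x ord0 k - p y ord0 k| < dl.
Proof.
elim: K => [|i K IH] HK uK dl dl0.
  exists [:: hom_id]; split; first exact: tleaf.
  by move=> p [<-|[]]; split=> // k _ _ _; exists lip_id.
move: uK => /= /andP[iK uK].
have HK' k : k \in K -> (s != k) && (t != k) by move=> kK; apply: HK; rewrite inE kK orbT.
have [l [tl Hl]] := IH HK' uK dl dl0.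
have /andP[si ti] : (s != i) && (t != i) by apply: HK; rewrite inE eqxx.
have [|l'' [tl'' A _]] := @graft l tl (fun p l' => forall q, List.In q l' -> [/\ separable_off [:: i] q,
   forall x, Fr0 x -> Fr0 (q x) &
   forall x y, Fr0 x -> Fr0 y -> `|p (q x) ord0 i - p (q y) ord0 i| < dl]).
  move=> p pl; have [sp Hp] := Hl p pl.
  have is_ : i != s by rewrite eq_sym.
  have it : i != t by rewrite eq_sym.
  have [g Hg] := sp i iK is_ it.
  have g0 := lC0 g.
  (* The Lipschitz constant of the leaf in the direction [i] determines the precision of the phase
     grafted below it. *)
  have [l' [tl' Hl']] := phase si ti (divr_gt0 dl0 g0).
  exists l'; split=> // q ql; have [sq Hq] := Hl' q ql; split=> //.
    by move=> x Fx; apply: (tree_sub tl' ql); exact: im_f.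
  move=> x y Fx Fy; rewrite !Hg; apply: le_lt_trans (lfL _ _ _) _.
  by rewrite mulrC -ltr_pdivlMr //; exact: Hq.
exists l''; split=> // r /A[p [l' [q [pl Fq ql E]]]].
have [sq qF Hq] := Fq q ql; have [sp Hp] := Hl p pl; split.
  move=> k; rewrite inE negb_or => /andP[ki kK] ks kt.
  have kn : k \notin [:: i] by rewrite inE.
  have [g Hg] := sp k kK ks kt; have [g' Hg'] := sq k kn ks kt.
  by exists (lip_comp g g') => x; rewrite E Hg Hg'.
move=> k x y; rewrite !E inE => /orP[/eqP->|kK] Fx Fy; first exact: Hq.
by apply: Hp => //; exact: qF.
Qed.

(** The phases make the pieces small in all directions but [s] and [t]; a generation of thickness
    [th] around them then makes all coordinates small. The order of choices matters: the modulus
    [dl] of the outer maps, then [th], then the constants [C1] and [C2], which depend on [th], and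
    last the precision of the phases. *)
Lemma shrink (p : homT) (ep : R) : 0 < ep -> exists l, [/\ tree l,
  forall q, List.In q l -> forall x y, Fr0 x -> Fr0 y -> cl ep (p (q x)) (p (q y)) &
  exists q1 q2, [/\ List.In q1 l, List.In q2 l & forall x, im q1 Fr0 x -> im q2 Fr0 x -> False]].
Proof.
move=> ep0.
have [i [_ is_ it]] := fourth_index s.
have si : s != i by rewrite eq_sym.
have ti : t != i by rewrite eq_sym.
have [L L10] : exists L : R, 10 <= L by exists 10.
pose L2 := two_le L10; pose L'2 := two_le' L10.
pose f : homT := hcomp p (hcomp (hom_inv (EL i L2)) (hook si L)).
have [dl [dl0 Hf]] := (hfu f).1 L ep ep0.
pose th := Num.min (1 / 16) (dl / 12).
have th0 : 0 < th by rewrite lt_min; apply/andP; split; [lra|rewrite divr_gt0].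
have th16 : th <= 1 / 16 by rewrite ge_min lexx.
have thd : 3 * th <= dl / 4.
  have : th <= dl / 12 by rewrite ge_min lexx orbT.
  lra.
have [C1 [C10 HC1]] := coreM_ctrl si ti st L10 th0 th16.
have [C2 [C20 HC2]] := corePR_ctrl si ti st L10 th0 th16.
pose C := C1 + C2.
have C0 : 0 < C by rewrite addr_gt0.
pose e := dl / 4 / C.
have e0 : 0 < e by rewrite !divr_gt0.
have Ce (D : R) : 0 < D -> D <= C -> D * e + 3 * th <= dl.
  move=> D0 DC; have : D * e <= C * e by rewrite ler_wpM2r // ltW.
  by rewrite /e [C * _]mulrC divfK ?gt_eqF //; lra.
pose CE := lC (stretch L'2) + 1.
have CE0 : 0 < CE by have := lC0 (stretch L'2); rewrite /CE; lra.
pose K := [seq k <- enum 'I_d | (s != k) && (t != k)].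
have [|l [tl Hl]] := @multiphase K _ (filter_uniq _ (enum_uniq _)) (e / CE) (divr_gt0 e0 CE0).
  by move=> k; rewrite mem_filter => /andP[].
exists (map (hcomp (betaM si L10 th0 th16)) l ++ map (hcomp (betaP si L10 th0 th16)) l).
have Fq q x : List.In q l -> Fr0 x -> FL i t (L - 1 / 2) (EL i L'2 (q x)).
  by move=> ql Fx; apply/EL_FL; apply: (tree_sub tl ql); exact: im_f.
have dE q x y k : List.In q l -> Fr0 x -> Fr0 y -> k != s -> k != t ->
    `|EL i L'2 (q x) ord0 k - EL i L'2 (q y) ord0 k| < e.
  move=> ql Fx Fy ks kt; have [_ H] := Hl q ql.
  have H1 : `|q x ord0 k - q y ord0 k| < e / CE.
    by apply: H => //; rewrite mem_filter mem_enum inE !(eq_sym _ k) ks kt.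
  rewrite ltr_pdivlMr // in H1.
  apply: le_lt_trans H1; case: (eqVneq k i) => [->|ki].
    rewrite !EL_i; apply: le_trans (lfL _ _ _) _; rewrite mulrC ler_wpM2l //.
    by rewrite /CE lerDl.
  rewrite !EL_k // -[leLHS]mulr1 ler_wpM2l // /CE lerDr.
  exact: ltW (lC0 _).
split.
- exact: beta_tree.
- have cc x : FL i t L x -> cube L x.
    by move=> [A _] k; apply: le_trans (A k) _; rewrite /lF; case: eqP => // _; lra.
  move=> r /(@List.in_app_or _ _ _ _)[] /List.in_map_iff[q [<- ql]] x y Fx Fy.
    have key : cl ep (f (coreM i s t L10 th0 th16 (EL i L'2 (q x))))
                     (f (coreM i s t L10 th0 th16 (EL i L'2 (q y)))).
      apply: Hf.
      - by apply: cc; apply: coreM_FL => //; exact: Fq.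
      - by apply: cc; apply: coreM_FL => //; exact: Fq.
      - apply: cl_le (Ce C1 C10 _) _; first by rewrite /C lerDl ltW.
        by apply: HC1 => //; [exact: Fq|exact: Fq|move=> k ks kt; exact: dE].
    exact key.
  have FP z : Fr0 z -> FL i t L (corePR i s t L10 th0 th16 (EL i L'2 (q z))).
    by move=> Fz; apply/FL_Rot; apply: coreP_FL => //; apply/FL_Rot; exact: Fq.
  have key : cl ep (f (corePR i s t L10 th0 th16 (EL i L'2 (q x))))
                   (f (corePR i s t L10 th0 th16 (EL i L'2 (q y)))).
    apply: Hf.
    - by apply: cc; exact: FP.
    - by apply: cc; exact: FP.
    - apply: cl_le (Ce C2 C20 _) _; first by rewrite /C lerDr ltW.
      by apply: HC2 => //; [exact: Fq|exact: Fq|move=> k ks kt; exact: dE].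
  exact key.
- have [q ql] := tree_nonempty tl.
  exists (hcomp (betaM si L10 th0 th16) q), (hcomp (betaP si L10 th0 th16) q); split.
  + by apply: List.in_or_app; left; apply/List.in_map_iff; exists q.
  + by apply: List.in_or_app; right; apply/List.in_map_iff; exists q.
  + move=> x H1 H2; apply: (@beta_disj i si ti L L10 th th0 th16 x).
      exact: (tree_sub tl ql H1).
    exact: (tree_sub tl ql H2).
Qed.

End Trees.

(** * The torus *)

Section Torus.
Context {R : realType} {d : nat}.
Notation T := 'rV[R]_d.
Implicit Types (x y p q : T) (s t : 'I_d).

(* A neighbourhood of the frame with hole direction [t], long in all the
   directions other than [s] and [t]. *)
Definition longfr s t x := [/\ `|x ord0 t| <= 9 / 8, `|x ord0 s| <= 9 / 8 &
  3 / 4 <= `|x ord0 s| \/ exists k, [/\ k != s, k != t & 86 <= `|x ord0 k|]].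

(** Points of the meridian, sorted by what keeps them off the frame: being on the axis, being above
    or below it, or being beyond its wall. *)
Definition side s t p := [/\ forall k, k != s -> k != t -> p ord0 k = 0, cube 3 p &
  [\/ p ord0 s = 0, `|p ord0 t| = 2 | p ord0 s = -3]].

Fixpoint sides s t p (l : seq T) : Prop :=
  if l is q :: l' then (forall u, 0 <= u <= 1 -> side s t (seg p q u)) /\ sides s t q l' else True.

Lemma seg_pt2 s t (a b a' b' u : R) : seg (pt2 s t a b) (pt2 s t a' b') u =
  pt2 s t ((1 - u) * a + u * a') ((1 - u) * b + u * b').
Proof. by apply/rowP => k; rewrite !mxE; case: (k == s); case: (k == t); ring. Qed.

Lemma pt2_s s t (a b : R) : pt2 s t a b ord0 s = a.
Proof. by rewrite mxE eqxx. Qed.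
Lemma pt2_t s t (a b : R) : s != t -> pt2 s t a b ord0 t = b.
Proof. by move=> st; rewrite mxE eq_sym (negbTE st) eqxx. Qed.
Lemma pt2_k s t (a b : R) k : k != s -> k != t -> pt2 s t a b ord0 k = 0.
Proof. by move=> ks kt; rewrite mxE (negbTE ks) (negbTE kt). Qed.

Lemma pt2_cube s t (a b r : R) : `|a| <= r -> `|b| <= r -> cube r (pt2 s t a b).
Proof.
move=> ar br k; rewrite mxE; case: (k == s) => //; case: (k == t) => //.
by rewrite normr0; apply: le_trans ar.
Qed.

Lemma mu_sides s t : s != t -> sides s t 0 (mu s t).
Proof.
move=> st; rewrite -(pt2_0 s t) /=.
have sd (a b a' b' : R) : `|a| <= 3 -> `|b| <= 3 -> `|a'| <= 3 -> `|b'| <= 3 ->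
    (a = 0 /\ a' = 0) \/ (b = b' /\ `|b| = 2) \/ (a = -3 /\ a' = -3) ->
    forall u, 0 <= u <= 1 -> side s t (seg (pt2 s t a b) (pt2 s t a' b') u).
  move=> h1 h2 h3 h4 H u u01; rewrite seg_pt2; split.
  - by move=> k ks kt; rewrite pt2_k.
  - by apply: pt2_cube; exact: conv_le.
  - rewrite pt2_s pt2_t //; case: H => [[-> ->]|[[-> E]|[-> ->]]].
    + by apply: Or31; rewrite !mulr0 addr0.
    + by apply: Or32; rewrite -mulrDl subrK mul1r -E.
    + by apply: Or33; rewrite -mulrDl subrK mul1r.
have n0 : `|0 : R| <= 3 by rewrite normr0.
have n2 : `|2 : R| <= 3 by rewrite ger0_norm //; lra.
have n2' : `|-2 : R| <= 3 by rewrite normrN ger0_norm //; lra.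
have n3 : `|-3 : R| <= 3 by rewrite normrN ger0_norm.
have e2 : `|2 : R| = 2 by rewrite ger0_norm.
have e2' : `|-2 : R| = 2 by rewrite normrN ger0_norm.
by split; [|split; [|split; [|split; [|split=> //]]]]; apply: sd => //; tauto.
Qed.

Lemma mu_last s t x : last x (mu s t) = 0.
Proof. by rewrite /= pt2_0. Qed.

Section Commute.
Context (s t s' t' : 'I_d) (st : s != t) (st' : s' != t').
Context (ss : s' != s) (ts : s' != t) (ss' : t' != s) (ts' : t' != t).
Context (A B : set T) (fA : A `<=` longfr s t) (fB : B `<=` longfr s' t').

(** All coordinates of p + q are at most 3, so the distant walls are out of reach. In the plane of A
    the sum has the coordinates of [p], which avoid the near walls of A; likewise for [q] and B. *)
Lemma torus_free p q : side s t p -> side s' t' q -> ~ (A `|` B) (p + q).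
Proof.
move=> [p0 p3 pc] [q0 q3 qc].
have c3 k : `|(p + q) ord0 k| <= 3.
  rewrite mxE; case: (eqVneq k s) => [->|ks]; first by rewrite q0 1?eq_sym // addr0.
  case: (eqVneq k t) => [->|kt]; first by rewrite q0 1?eq_sym // addr0.
  by rewrite p0 // add0r.
have es : (p + q) ord0 s = p ord0 s by rewrite mxE q0 1?eq_sym // addr0.
have et : (p + q) ord0 t = p ord0 t by rewrite mxE q0 1?eq_sym // addr0.
have es' : (p + q) ord0 s' = q ord0 s' by rewrite mxE p0 // add0r.
have et' : (p + q) ord0 t' = q ord0 t' by rewrite mxE p0 // add0r.
have n3 : `|-3 : R| = 3 by rewrite normrN ger0_norm.
case=> [/fA|/fB] [h1 h2 h3].
  rewrite et in h1; rewrite es in h2 h3.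
  case: pc => [E|E|E]; rewrite E ?normr0 ?n3 in h1 h2 h3; try lra.
  by case: h3 => [|[k [_ _ H]]]; [lra|have := c3 k; lra].
rewrite et' in h1; rewrite es' in h2 h3.
case: qc => [E|E|E]; rewrite E ?normr0 ?n3 in h1 h2 h3; try lra.
by case: h3 => [|[k [_ _ H]]]; [lra|have := c3 k; lra].
Qed.

Context (n : nat) (S : T -> T -> 'M[bool]_n.+1) (qS : qf (cube 6 `\` (A `|` B)) 6 S).
Let uS : forall x y, ut (S x y). Proof. by case: qS. Qed.

Definition patch (a a' q q' : T) : set T := [set x | exists u v,
  [/\ 0 <= u <= 1, 0 <= v <= 1 & x = seg a a' u + seg q q' v]].

Lemma patch_conv a a' q q' : convex (patch a a' q q').
Proof.
move=> x y w w01 [u [v [u01 v01 ->]]] [u' [v' [u01' v01' ->]]].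
exists ((1 - w) * u + w * u'), ((1 - w) * v + w * v').
split; try by apply: conv_in.
by apply/rowP => k; rewrite !mxE; ring.
Qed.

Lemma patch_flat a a' q q' : (forall u, 0 <= u <= 1 -> side s t (seg a a' u)) ->
  (forall u, 0 <= u <= 1 -> side s' t' (seg q q' u)) -> flat S (patch a a' q q').
Proof.
move=> sa sq.
have c6 x : patch a a' q q' x -> cube 6 x.
  move=> [u [v [u01 v01 ->]]] k; have [_ A1 _] := sa u u01; have [_ A2 _] := sq v v01.
  by rewrite mxE; apply: le_trans (ler_normD _ _) _; have := A1 k; have := A2 k; lra.
apply: (qf_flat qS) => //; last exact: patch_conv.
move=> x px; split; first exact: c6.
by case: px => [u [v [u01 v01 ->]]]; apply: torus_free; [exact: sa|exact: sq].
Qed.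

Lemma patch_in a a' q q' : [/\ patch a a' q q' (a + q), patch a a' q q' (a + q'),
  patch a a' q q' (a' + q) & patch a a' q q' (a' + q')].
Proof.
have z0 : 0 <= (0 : R) <= 1 by rewrite lexx ler01.
have z1 : 0 <= (1 : R) <= 1 by rewrite lexx ler01.
by split; [exists 0, 0|exists 0, 1|exists 1, 0|exists 1, 1]; split; rewrite ?seg0 ?seg1.
Qed.

Lemma torus_step q q' a l : (forall u, 0 <= u <= 1 -> side s' t' (seg q q' u)) -> sides s t a l ->
  tr S (a + q) (map (+%R^~ q) l) * S (last a l + q) (last a l + q') =
  S (a + q) (a + q') * tr S (a + q') (map (+%R^~ q') l).
Proof.
move=> sq; elim: l a => [|b l IH] a /=; first by rewrite mulr1 mul1r.
move=> [sa /IH E]; rewrite -mulrA E !mulrA.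
have f := patch_flat sa sq; have [i1 i2 i3 i4] := patch_in a b q q'.
by rewrite !f.2.
Qed.

Lemma torus_commute q l : sides s' t' q l ->
  tr S q (map (+%R^~ q) (mu s t)) * tr S q l =
  tr S q l * tr S (last q l) (map (+%R^~ (last q l)) (mu s t)).
Proof.
elim: l q => [|q' l IH] q; first by rewrite /= mulr1 mul1r.
move=> [sq /IH E]; have := torus_step sq (mu_sides st).
rewrite mu_last !add0r => E1.
by rewrite [tr S q (q' :: l)]/= mulrA E1 -mulrA E mulrA.
Qed.

End Commute.

Lemma convex_slab s (r c : R) : convex [set x : T | cube r x /\ `|x ord0 s| <= c].
Proof.
move=> x y u u01 [xr xc] [yr yc]; split; first exact: seg_cube.
by rewrite /seg !mxE; exact: conv_le.
Qed.

(** The other meridian has x_s = 0. It lies in the convex slab |x_s| <= 1/2 of the cube of radius 3,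
    which A does not meet. *)
Lemma Det2_slab s t s' t' (A : set T) : s != t -> s' != t' -> s != s' -> s != t' ->
  A `<=` longfr s t -> Det 0 (mu s t) A ->
  Det2 0 (mu s t) (mu s' t') A.
Proof.
move=> st st' ss st2 fA [n [n0 dA]]; exists n; split=> // r.
pose r1 := Num.max r 3.
have [e [P [N0 [e0 rP HN]]]] := dA r1.
have [N1 H1] := hol_qf r1 e0 rP.
exists e, P, (maxn N0 N1); split=> //.
  by apply: rep_sub rP => // x [xr nx]; split=> //; apply: cube_le xr; rewrite le_max lexx.
move=> N; rewrite geq_max => /andP[/HN -> /H1 q1]; split=> //.
pose C : set T := [set x | cube 3 x /\ `|x ord0 s| <= 1 / 2].
have f : flat (sgh P N) C.
  apply: (qf_flat q1); last exact: convex_slab.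
    move=> x [x3 xs]; split; first by apply: cube_le x3; rewrite le_max lexx orbT.
    move=> /fA[_ _ [H|[k [_ _ H]]]]; first lra.
    by have := x3 k; lra.
  by move=> x [x3 _]; apply: cube_le x3; rewrite le_max lexx orbT.
have C0 (a b : R) : `|a| <= 3 -> `|b| <= 3 -> C (pt2 s' t' a b).
  by move=> ha hb; split; [exact: pt2_cube|rewrite pt2_k // normr0; lra].
have n0' : `|0 : R| <= 3 by rewrite normr0.
have n2 : `|2 : R| <= 3 by rewrite ger0_norm //; lra.
have n2' : `|-2 : R| <= 3 by rewrite normrN ger0_norm //; lra.
have n3 : `|-3 : R| <= 3 by rewrite normrN ger0_norm.
apply: (flat_loop f); last exact: mu_last.
  by rewrite -(pt2_0 s' t'); exact: C0.
by move=> x /= [<-|[<-|[<-|[<-|[<-|[]]]]]]; exact: C0.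
Qed.

Theorem torus_contra s t s' t' (A B : set T) (e0 : R) : s != t -> s' != t' ->
  s' != s -> s' != t -> t' != s -> t' != t -> 0 < e0 ->
  (forall x y, A x -> B y -> ~ cl e0 x y) -> Good A -> Good B ->
  A `<=` longfr s t -> B `<=` longfr s' t' -> Det 0 (mu s t) A -> Det 0 (mu s' t') B -> False.
Proof.
move=> st st' ss ts ss' ts' e0p sep gA gB fA fB dA dB.
have dA2 : Det2 0 (mu s t) (mu s' t') A by apply: Det2_slab => //; rewrite eq_sym.
have dB2 : Det2 0 (mu s' t') (mu s t) B by apply: Det2_slab.
have [n [n0 H]] := comm_detect e0p sep gA gB dA2 dB2.
have [e [P [N0 [ep rP HN]]]] := H 6.
have [N1 H1] := hol_qf 6 ep rP.
pose N := maxn N0 N1.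
have := HN N (leq_maxl _ _); have qS := H1 N (leq_maxr _ _).
have := torus_commute st ss ts ss' ts' fA fB qS (mu_sides st').
rewrite mu_last.
have mapE (l : seq T) : map (+%R^~ 0) l = l by elim: l => //= a l ->; rewrite addr0.
rewrite mapE.
(* The two holonomies commute and yet differ from commuting by the corner unit, so the corner unit
   would vanish. *)
move=> -> /eqP; rewrite addrC -subr_eq0 opprD addrCA subrr addr0 oppr_eq0.
move=> /eqP/matrixP/(_ ord0 ord_max); rewrite !mxE !eqxx.
by [].
Qed.

(* The straight line homotopy from the pulled back loop to the loop avoids [A]. *)
Lemma Det_push s t (h : @hom R d) (A : set T) : s != t ->
  (forall x, cl (1 / 8) (h x) x) ->
  (forall x, A x -> [/\ `|x ord0 t| <= 1, `|x ord0 s| <= 1 &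
     7 / 8 <= `|x ord0 s| \/ exists k, [/\ k != s, k != t & 87 <= `|x ord0 k|]]) ->
  Det 0 (mu s t) A -> Det 0 (mu s t) (im h A).
Proof.
move=> st hs fA [n [n0 dA]]; exists n; split=> // r.
have his x : cl (1 / 8) (hi h x) x by have := hs (hi h x); rewrite hiK => /clC.
have [r' Hr] := @rep_im R d n h A r.
pose r1 := Num.max r' 4.
have [e [P [N0 [e0 rP HN]]]] := dA r1.
have [e' [e'0 rP']] : exists e', 0 < e' /\ rep (cube r `\` im h A) e' (fun x y => P (hi h x) (hi h y)).
  apply: Hr e0 _; apply: rep_sub rP => // x [xr nx]; split=> //.
  by apply: cube_le xr; rewrite le_max lexx.
have uP := rP.1.
have [d1 [d10 Hd1]] := (hiu h).1 3 (e / 4) ltac:(by rewrite divr_gt0).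
(* Segments in the cubes of radius 3 and 4 have speed at most 6 along the loop and 8 along the
   homotopy; both motions then stay below [d1] and [e] / 4. *)
pose dl := Num.min (Num.min (d1 / 8) (e / 32)) 1.
have dl0 : 0 < dl by rewrite !lt_min !divr_gt0 // ltr01.
exists e', (fun x y => P (hi h x) (hi h y)), (maxn N0 (Num.truncn dl^-1).+1); split=> // N.
rewrite geq_max => /andP[/HN E NN].
have HNR : dl^-1 < N%:R by apply: lt_le_trans (truncnS_gt _) _; rewrite ler_nat.
pose c x := hol P N (seg (hi h x) x).
have step a b : (forall u, 0 <= u <= 1 -> side s t (seg a b u)) ->
    sgh (fun x y => P (hi h x) (hi h y)) N a b * c b = c a * sgh P N a b.
  move=> sd.
  have c3 u : 0 <= u <= 1 -> cube 3 (seg a b u) by move=> /sd[].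
  have a3 : cube 3 a by have := c3 0; rewrite seg0; apply; rewrite lexx ler01.
  have b3 : cube 3 b by have := c3 1; rewrite seg1; apply; rewrite lexx ler01.
  pose F (u v : R) : T := seg (hi h (seg a b u)) (seg a b u) v.
  have near u v k : 0 <= u <= 1 -> 0 <= v <= 1 -> `|F u v ord0 k - seg a b u ord0 k| <= 1 / 8.
    move=> u01 v01; rewrite /F; move: (seg a b u) => y; have := his y k; move: (hi h y) => z.
    rewrite (_ : seg z y v ord0 k - _ = (1 - v) * (z ord0 k - y ord0 k)); last by rewrite /seg !mxE; ring.
    rewrite normrM (@ger0_norm _ (1 - v)); last lra.
    move: (`|_ - _|) (normr_ge0 (z ord0 k - y ord0 k)) => w w0 w8.
    have : 0 <= v * w by apply: mulr_ge0; lra.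
    by rewrite mulrBl mul1r; lra.
  have := @square_hol R d n (cube r1 `\` A) e P F dl N e0 dl0 rP.
  have -> : F^~ 0 = hi h \o seg a b by apply/funext => u; rewrite /F seg0.
  have -> : F^~ 1 = seg a b by apply/funext => u; rewrite /F seg1.
  have -> : F 1 = seg (hi h b) b by apply/funext => v; rewrite /F !seg1.
  have -> : F 0 = seg (hi h a) a by apply/funext => v; rewrite /F !seg0.
  apply=> //.
    move=> u v u01 v01; have nr k := near u v k u01 v01.
    have [p0 p3 pc] := sd u u01; split.
      apply: (@cube_le _ _ 4); first by rewrite le_max lexx orbT.
      by move=> k; have := nr k; have := p3 k; have := ler_normD (F u v ord0 k - seg a b u ord0 k) (seg a b u ord0 k);
        rewrite subrK; lra.
    move=> /fA[h1 h2 h3].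
    have nt := nr t; have ns := nr s.
    move: nt ns; rewrite !ler_norml => /andP[t1 t2] /andP[s1 s2].
    move: h1 h2; rewrite !ler_norml => /andP[h11 h12] /andP[h21 h22].
    case: pc => Ec.
    - rewrite Ec in s1 s2; case: h3 => [|[k [ks kt hk]]].
        by case: (lerP 0 (F u v ord0 s)) => H0; [rewrite ger0_norm //|rewrite ltr0_norm //]; lra.
      have := nr k; rewrite p0 // subr0; lra.
    - move: Ec; case: (lerP 0 (seg a b u ord0 t)) => H0; [rewrite ger0_norm //|rewrite ltr0_norm //]; lra.
    - rewrite Ec in s1 s2; lra.
  move=> u v u' v' u01 v01 u01' v01' uu vv.
  have dl1 : dl <= d1 / 8 by rewrite !ge_min lexx.
  have dl2 : dl <= e / 32 by rewrite !ge_min lexx orbT.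
  have dl3 : dl <= 1 by rewrite ge_min lexx orbT.
  have cc : cl (6 * dl) (seg a b u) (seg a b u').
    apply: seg_cl a3 b3 _; rewrite (_ : 3 + 3 = 6); last by ring.
    by rewrite mulrC ltr_pM2l.
  have cc1 : cl d1 (seg a b u) (seg a b u') by apply: cl_le cc; lra.
  have cc2 : cl (e / 4) (seg a b u) (seg a b u') by apply: cl_le cc; lra.
  have cc3 := Hd1 _ _ (c3 u u01) (c3 u' u01') cc1.
  have e4 : 0 < e / 4 by rewrite divr_gt0.
  apply: (@cl_le _ _ (e / 4 + e / 4)); first lra.
  apply: (@cl_trans _ _ _ _ _ (F u' v)); first exact: seg_mono.
  apply: (@seg_cl _ _ _ _ 4).
  - move=> k; have := his (seg a b u') k; have := c3 u' u01' k.
    have := ler_normD (hi h (seg a b u') ord0 k - seg a b u' ord0 k) (seg a b u' ord0 k).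
    by rewrite subrK; lra.
  - by apply: cube_le (c3 u' u01'); lra.
  - rewrite (_ : 4 + 4 = 8); last by ring.
    by have : `|v - v'| * 8 < dl * 8; [rewrite ltr_pM2r|lra].
have chain a l : sides s t a l ->
    tr (sgh (fun x y => P (hi h x) (hi h y)) N) a l * c (last a l) = c a * tr (sgh P N) a l.
  elim: l a => [|b l IH] a /=; first by rewrite mulr1 mul1r.
  by move=> [sa /IH E1]; rewrite -mulrA E1 mulrA step // mulrA.
have uc x : ut (c x) by exact: hol_ut.
have := chain 0 (mu s t) (mu_sides st); rewrite mu_last E corner_central // => E2.
exact: (mulIr (ut_unit (uc 0)) E2).
Qed.

End Torus.

(** * Characterisation of Cantor sets *)

(** The intrinsic characterisation of Cantor space (nonempty, compact, perfect, zero-dimensional) in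
    metric form. The last clause asks for separation by a set that is clopen in A with a uniform
    gap, so that no subspace topology is mentioned. *)
Definition cantor_subset {R : realType} {M : pseudoMetricType R} (A : set M) : Prop :=
  [/\ A !=set0, compact A, forall x (e : R), A x -> 0 < e -> exists y, [/\ A y, y <> x & ball x e y] &
  forall x y, A x -> A y -> x <> y -> exists (Q : set M) (dl : R), [/\ 0 < dl, Q x, ~ Q y &
    forall z z', A z -> A z' -> ball z dl z' -> Q z -> Q z']].

Section CantorSubset.
Context {R : realType} {M : pseudoMetricType R} (A : set M) (hM : hausdorff_space M).

Lemma nbhs_set_type (x : A) (U : set A) :
  nbhs x U <-> exists e : R, 0 < e /\ forall y : A, ball (val x) e (val y) -> U y.
Proof.
split.
  move=> [_ [/= [W oW <-] Wx WU]].
  have : nbhs (val x) W by apply: open_nbhs_nbhs; split.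
  by move=> /nbhs_ballP[e /= e0 eW]; exists e; split=> // y /eW Wy; apply: WU.
move=> [e [e0 H]].
exists (val @^-1` (ball (val x) e)°); split.
- by exists (ball (val x) e)° => //; exact: open_interior.
- rewrite /=; exact: nbhsx_ballx.
- by move=> y /= /interior_subset /H.
Qed.

Lemma compact_set_type : compact A -> compact [set: A].
Proof.
move=> cA F FF _; pose G : set_system M := [set B | F (val @^-1` B)].
have FG : ProperFilter G by exact: (fmap_proper_filter (fun z : A => val z) FF).
have GA : G A.
  rewrite /G /=; apply: filterS filterT => z _ /=; exact: set_valP.
have [x [Ax xG]] := cA G FG GA.
exists (SigSub (mem_set Ax) : A); split=> // B U FB /nbhs_set_type[e [e0 H]].
have GB : G (val @` B) by apply: (@filterS _ F _ B) FB => z Bz; exists z.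
have [_ [[z Bz <-] zU]] := xG _ _ GB (nbhsx_ballx x e e0).
by exists z; split=> //; apply: H.
Qed.

Context (a0 : A) (cA : cantor_subset A).

#[local] HB.instance Definition _ := isPointed.Build (set_type A) a0.

Lemma cantor_like_set_type : cantor_like (set_type A).
Proof.
have [_ cptA perfA zdA] := cA.
have nbhs_clopen (Q : set A) (dl : R) : 0 < dl ->
    (forall z z' : A, ball (val z) dl (val z') -> Q z -> Q z') -> clopen Q.
  move=> dl0 H; split.
    rewrite openE => z Qz; apply/nbhs_set_type; exists dl; split=> // y zy.
    exact: H zy Qz.
  rewrite -openC openE => z nQz; apply/nbhs_set_type; exists dl; split=> // y zy Qy.
  by apply: nQz; apply: H Qy; exact: ball_sym.
split.
- apply/perfectTP => x; rewrite openE => /(_ x erefl)/nbhs_set_type[e [e0 H]].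
  have [y [Ay yx xy]] := perfA (val x) e (set_valP x) e0.
  by apply: yx; rewrite -(H (SigSub (mem_set Ay)) xy).
- exact: compact_set_type.
- move=> x y xy; apply/val_inj/hM => U V xU yV.
  have xU' : nbhs x (val @^-1` U).
    by apply/nbhs_set_type; move/nbhs_ballP: xU => [e e0 eU]; exists e; split=> // z /eU.
  have yV' : nbhs y (val @^-1` V).
    by apply/nbhs_set_type; move/nbhs_ballP: yV => [e e0 eU]; exists e; split=> // z /eU.
  by have [z [Uz Vz]] := xy _ _ xU' yV'; exists (val z).
- move=> x y /eqP xy.
  have vxy : val x <> val y by move=> /val_inj.
  have [Q [dl [dl0 Qx nQy HQ]]] := zdA _ _ (set_valP x) (set_valP y) vxy.
  exists (val @^-1` Q); split=> //; apply: nbhs_clopen dl0 _ => z z' zz /=.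
  by apply: HQ zz; exact: set_valP.
Qed.

Lemma cantor_param : exists (f : cantor_space -> A) (g : A -> cantor_space),
  [/\ continuous f, continuous g, cancel f g & cancel g f].
Proof.
have [f [cf clf]] := homeomorphism_cantor_like cantor_like_set_type.
have fK x : f^-1%FUN (f x) = x by rewrite funK ?inE.
have gK x : f (f^-1%FUN x) = x by rewrite invK ?inE.
exists f, (f^-1%FUN); split=> //.
apply/continuous_closedP => B clB.
have -> : f^-1%FUN @^-1` B = f @` B; last exact: clf.
apply/seteqP; split=> x /=; first by move=> Bx; exists (f^-1%FUN x).
by move=> [y By <-]; rewrite fK.
Qed.

End CantorSubset.

Lemma cantor_subset_homeo {R : realType} {M N : pseudoMetricType R} (A : set M) (B : set N) :
  hausdorff_space M -> hausdorff_space N -> cantor_subset A -> cantor_subset B ->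
  homeomorphic_sets A B.
Proof.
move=> hM hN cA cB.
have [[a Aa] _ _ _] := cA; have [[b Bb] _ _ _] := cB.
pose a0 : A := SigSub (mem_set Aa); pose b0 : B := SigSub (mem_set Bb).
have [fA [gA [cfA cgA fgA gfA]]] := cantor_param hM a0 cA.
have [fB [gB [cfB cgB fgB gfB]]] := cantor_param hN b0 cB.
have cval (K : pseudoMetricType R) (D : set K) : continuous (val : D -> K).
  by move=> x U /= xU; apply/nbhs_set_type; move/nbhs_ballP: xU => [e e0 eU]; exists e; split=> // z /eU.
pose u : A -> N := fun x => val (fB (gA x)).
pose v : B -> M := fun x => val (fA (gB x)).
(* [valL_] extends the map from the subtype to the whole space with the default value [b] off A. The
   claims are relative to A and do not see it. *)
have uE x (Ax : A x) : valL_ b u x = u (SigSub (mem_set Ax)).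
  exact: (congr1 (fun k => k (SigSub (mem_set Ax))) (valLK b u)).
have vE x (Bx : B x) : valL_ a v x = v (SigSub (mem_set Bx)).
  exact: (congr1 (fun k => k (SigSub (mem_set Bx))) (valLK a v)).
have vu x : A x -> valL_ a v (valL_ b u x) = x.
  move=> Ax; rewrite uE.
  have Bu : B (u (SigSub (mem_set Ax))) by exact: set_valP.
  rewrite (vE _ Bu) /v (_ : SigSub _ = fB (gA (SigSub (mem_set Ax)))); last exact: val_inj.
  by rewrite fgB gfA.
have uv x : B x -> valL_ b u (valL_ a v x) = x.
  move=> Bx; rewrite vE.
  have Av : A (v (SigSub (mem_set Bx))) by exact: set_valP.
  rewrite (uE _ Av) /u (_ : SigSub _ = fA (gB (SigSub (mem_set Bx)))); last exact: val_inj.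
  by rewrite fgA gfB.
have uB x : A x -> B (valL_ b u x) by move=> Ax; rewrite uE; exact: set_valP.
have vA x : B x -> A (valL_ a v x) by move=> Bx; rewrite vE; exact: set_valP.
exists (valL_ b u), (valL_ a v); split; [|split; [|split; [|split; [|split]]]] => //.
- apply/seteqP; split=> y; first by move=> [x /uB H <-].
  by move=> By; exists (valL_ a v y); [exact: vA|exact: uv].
- apply/seteqP; split=> y; first by move=> [x /vA H <-].
  by move=> By; exists (valL_ b u y); [exact: uB|exact: vu].
- apply/subspace_valL_continuousP' => x.
  apply: (@continuous_comp _ _ _ (fB \o gA) val); last exact: cval.
  by apply: continuous_comp; [exact: cgA|exact: cfB].
- apply/subspace_valL_continuousP' => x.
  apply: (@continuous_comp _ _ _ (fA \o gB) val); last exact: cval.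
  by apply: continuous_comp; [exact: cgB|exact: cfA].
Qed.

(** * The middle thirds set *)

Section MiddleThirds.
Context {R : realType}.
Notation K := (@middle_thirds_cantor R).
Implicit Types (x y z : R) (n : nat).

Lemma cantor_stage01 n x : cantor_stage n x -> 0 <= x <= 1.
Proof.
elim: n x => [|n IH] x; first by rewrite /= in_itv.
by move=> [[y /IH H <-]|[y /IH H <-]]; lra.
Qed.

Lemma middle_thirds01 x : K x -> 0 <= x <= 1.
Proof. by move=> /(_ 0%N) /cantor_stage01. Qed.

Lemma middle_thirds_left x : K x -> K (x / 3).
Proof.
move=> Kx [|n]; last by left; exists x.
by have := middle_thirds01 Kx; rewrite /= in_itv /=; lra.
Qed.

Lemma middle_thirds_right x : K x -> K (2 / 3 + x / 3).
Proof.
move=> Kx [|n]; last by right; exists x.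
by have := middle_thirds01 Kx; rewrite /= in_itv /=; lra.
Qed.

Lemma middle_thirds_split x : K x ->
  (exists2 y, K y & x = y / 3) \/ (exists2 y, K y & x = 2 / 3 + y / 3).
Proof.
move=> Kx.
(* The position of [x] is recorded too, because it forces the same alternative for all [n]. *)
have S n : (cantor_stage n (3 * x) /\ x <= 1 / 3) \/ (cantor_stage n (3 * x - 2) /\ 2 / 3 <= x).
  case: (Kx n.+1) => [[y Sy <-]|[y Sy <-]]; have := cantor_stage01 Sy; [left|right].
    by rewrite (_ : 3 * (y / 3) = y); [split=> //; lra|field].
  by rewrite (_ : 3 * (2 / 3 + y / 3) - 2 = y); [split=> //; lra|field].
case: (S 0%N) => [[_ x13]|[_ x13]]; [left|right].
  exists (3 * x); last by field.
  by move=> n; case: (S n) => [[]//|[_]]; lra.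
exists (3 * x - 2); last by field.
by move=> n; case: (S n) => [[_]|[]//]; lra.
Qed.

Lemma middle_thirds0 : K 0.
Proof.
move=> n; elim: n => [|n IH]; first by rewrite /= in_itv /= lexx ler01.
by left; exists 0 => //; rewrite mul0r.
Qed.

Lemma middle_thirds1 : K 1.
Proof.
move=> n; elim: n => [|n IH]; first by rewrite /= in_itv /= lexx ler01.
by right; exists 1 => //; field.
Qed.

Lemma middle_thirds_perfect n x : K x -> exists y, [/\ K y, y <> x & `|x - y| <= 3^-1 ^+ n].
Proof.
elim: n x => [|n IH] x Kx.
  have x01 := middle_thirds01 Kx.
  have [->|x0] := eqVneq x 0.
    exists 1; split; [exact: middle_thirds1|by apply/eqP; rewrite oner_eq0|].
    by rewrite sub0r normrN normr1 expr0.
  exists 0; split; [exact: middle_thirds0|by apply/eqP; rewrite eq_sym|].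
  by rewrite subr0 expr0 ger0_norm; lra.
have sc (a b : R) : `|a - b| <= 3^-1 ^+ n -> `|a / 3 - b / 3| <= 3^-1 ^+ n.+1.
  by rewrite -mulrBl normrM [in X in _ * X]ger0_norm ?invr_ge0 // exprSr => H; apply: ler_wpM2r; rewrite ?invr_ge0.
case: (middle_thirds_split Kx) => [[x' Kx' ->]|[x' Kx' ->]]; have [y [Ky yx xy]] := IH x' Kx'.
  exists (y / 3); split; [exact: middle_thirds_left|by move=> E; apply: yx; lra|exact: sc].
exists (2 / 3 + y / 3); split; [exact: middle_thirds_right|by move=> E; apply: yx; lra|].
by rewrite opprD addrACA subrr add0r; exact: sc.
Qed.

(** Self-similarity: points in different thirds are separated at 1/2, and points in the same third
    are separated after magnification by 3. The middle gap of width 1/3 keeps the pulled back set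
    clopen. *)
Lemma middle_thirds_zd n x y : K x -> K y -> 3^-1 ^+ n < `|x - y| ->
  exists (Q : set R) (dl : R), [/\ 0 < dl, Q x, ~ Q y &
    forall z z', K z -> K z' -> ball z dl z' -> Q z -> Q z'].
Proof.
have gap z : K z -> z <= 1 / 3 \/ 2 / 3 <= z.
  by move=> /middle_thirds_split[[w /middle_thirds01 Kw ->]|[w /middle_thirds01 Kw ->]]; [left|right]; lra.
have ballE z e z' : ball z e z' -> - e < z - z' < e.
  by rewrite /ball /= -ltr_norml.
elim: n x y => [|n IH] x y Kx Ky.
  have := middle_thirds01 Kx; have := middle_thirds01 Ky.
  by rewrite expr0; case: (lerP 0 (x - y)) => H; [rewrite ger0_norm //|rewrite ltr0_norm //]; lra.
have sc (a b : R) : 3^-1 ^+ n.+1 < `|a / 3 - b / 3| -> 3^-1 ^+ n < `|a - b|.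
  by rewrite -mulrBl normrM [in X in _ * X]ger0_norm ?invr_ge0 // exprSr ltr_pM2r // invr_gt0.
case: (middle_thirds_split Kx) => [[x' Kx' ->]|[x' Kx' ->]];
  case: (middle_thirds_split Ky) => [[y' Ky' ->]|[y' Ky' ->]];
  have x01 := middle_thirds01 Kx'; have y01 := middle_thirds01 Ky'.
- move=> /sc /(IH _ _ Kx' Ky')[Q [dl [dl0 Qx nQy HQ]]].
  exists [set z | z < 1 / 2 /\ Q (3 * z)], (Num.min (dl / 3) (1 / 3)).
  have fE (w : R) : 3 * (w / 3) = w by field.
  split.
  + by rewrite lt_min !divr_gt0.
  + by split; [lra|rewrite fE].
  + by rewrite /= fE; move=> [_ /nQy].
  + move=> z z' Kz Kz' /ballE zz /= [z2 Qz].
    have h1 : Num.min (dl / 3) (1 / 3) <= dl / 3 by rewrite ge_min lexx.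
    have h2 : Num.min (dl / 3) (1 / 3) <= 1 / 3 by rewrite ge_min lexx orbT.
    case: (middle_thirds_split Kz) => [[w Kw zE]|[w /middle_thirds01 Kw zE]]; last lra.
    case: (middle_thirds_split Kz') => [[w' Kw' zE']|[w' /middle_thirds01 Kw' zE']]; last first.
      by have := middle_thirds01 Kw; lra.
    subst z z'; rewrite fE in Qz; split; first by have := middle_thirds01 Kw'; lra.
    by rewrite fE; apply: HQ Kw Kw' _ Qz; rewrite /ball /= ltr_norml; lra.
- move=> _; exists [set z | z < 1 / 2], (1 / 3); split=> /=; try lra.
  by move=> z z' /gap Kz /gap Kz' /ballE zz H; lra.
- move=> _; exists [set z | 1 / 2 < z], (1 / 3); split=> /=; try lra.
  by move=> z z' /gap Kz /gap Kz' /ballE zz H; lra.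
- rewrite opprD addrACA subrr add0r => /sc /(IH _ _ Kx' Ky')[Q [dl [dl0 Qx nQy HQ]]].
  exists [set z | 1 / 2 < z /\ Q (3 * z - 2)], (Num.min (dl / 3) (1 / 3)).
  have fE (w : R) : 3 * (2 / 3 + w / 3) - 2 = w by field.
  split.
  + by rewrite lt_min !divr_gt0.
  + by split; [lra|rewrite fE].
  + by rewrite /= fE; move=> [_ /nQy].
  + move=> z z' Kz Kz' /ballE zz /= [z2 Qz].
    have h1 : Num.min (dl / 3) (1 / 3) <= dl / 3 by rewrite ge_min lexx.
    have h2 : Num.min (dl / 3) (1 / 3) <= 1 / 3 by rewrite ge_min lexx orbT.
    case: (middle_thirds_split Kz) => [[w /middle_thirds01 Kw zE]|[w Kw zE]]; first lra.
    case: (middle_thirds_split Kz') => [[w' /middle_thirds01 Kw' zE']|[w' Kw' zE']].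
      by have := middle_thirds01 Kw; lra.
    subst z z'; rewrite fE in Qz; split; first by have := middle_thirds01 Kw'; lra.
    by rewrite fE; apply: HQ Kw Kw' _ Qz; rewrite /ball /= ltr_norml; lra.
Qed.

Lemma third_pow_small (e : R) : 0 < e -> exists n, 3^-1 ^+ n < e.
Proof.
move=> e0; pose n := (Num.truncn e^-1).+1; exists n.
have H : e^-1 < n%:R by exact: truncnS_gt.
have H3 : n%:R <= 3 ^+ n :> R.
  rewrite -natrX ler_nat; exact: ltnW (ltn_expl _ _).
rewrite exprVn invf_plt ?posrE ?exprn_gt0 //; exact: lt_le_trans H H3.
Qed.

Lemma cantor_stage_compact n : compact (@cantor_stage R n).
Proof.
elim: n => [|n IH] /=; first exact: segment_compact.
apply: compactU; apply: continuous_compact => //; apply: continuous_subspaceT => x.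
  by apply: cvgM; [exact: cvg_id|exact: cvg_cst].
by apply: cvgD; [exact: cvg_cst|apply: cvgM; [exact: cvg_id|exact: cvg_cst]].
Qed.

Lemma middle_thirds_cantor_subset : cantor_subset K.
Proof.
split.
- by exists 0; exact: middle_thirds0.
- apply: (@subclosed_compact _ _ (@cantor_stage R 0)).
  + have -> : K = \bigcap_n cantor_stage n.
      by apply/seteqP; split=> x H; [move=> n _; exact: H|move=> n; exact: H].
    by apply: closed_bigI => n _; apply: compact_closed; [exact: Rhausdorff|exact: cantor_stage_compact].
  + exact: cantor_stage_compact.
  + by move=> x /(_ 0%N).
- move=> x e Kx e0; have [n ne] := third_pow_small e0.
  have [y [Ky yx xy]] := middle_thirds_perfect n Kx.
  by exists y; split=> //; rewrite /ball /=; exact: le_lt_trans xy ne.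
- move=> x y Kx Ky xy.
  have e0 : 0 < `|x - y| by rewrite normr_gt0 subr_eq0; apply/eqP.
  have [n ne] := third_pow_small e0; exact: middle_thirds_zd Kx Ky ne.
Qed.

End MiddleThirds.

(** * Compactness and Cantor schemes *)

Section Compactness.
Context {R : realType} {d : nat}.
Notation T := 'rV[R]_d.
Implicit Types (x y z : T) (e r : R) (A B X Y : set T).

Lemma ball_cl x e y : ball x e y <-> 0 < e /\ cl e x y.
Proof.
split; first by move=> [e0 H]; split=> // k; exact: H.
by move=> [e0 H]; split=> // i k; rewrite ord1; exact: H.
Qed.

Lemma cl_ball x e y : 0 < e -> cl e x y -> ball x e y.
Proof. by move=> e0 H; apply/ball_cl. Qed.

Lemma cube_compact r : compact (cube r : set T).
Proof.
have -> : cube r = [set v : T | forall i, `[- r, r]%classic (v ord0 i)].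
  by apply/seteqP; split=> v H k; have := H k; rewrite /= in_itv /= ler_norml.
exact: (@rV_compact R d (fun=> `[- r, r]%classic) (fun=> @segment_compact R (- r) r)).
Qed.

Lemma seq_cluster (u : nat -> T) r : (forall n, cube r (u n)) ->
  exists x, forall e m, 0 < e -> exists2 n, (m <= n)%N & cl e (u n) x.
Proof.
move=> ur; have Fu : (u @ \oo) (cube r) by exists 0%N => // n _; exact: ur.
have [x [_ xF]] := cube_compact _ Fu; exists x => e m e0.
have Fm : (u @ \oo) [set u n | n in [set n | (m <= n)%N]].
  by exists m => // n mn; exists n.
have [_ [[n mn <-] /ball_cl[_ xe]]] := xF _ _ Fm (nbhsx_ballx x e e0).
by exists n => //; exact: clC.
Qed.

Lemma inv_small e : 0 < e -> exists m, forall n, (m <= n)%N -> n.+1%:R^-1 < e.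
Proof.
move=> e0; exists (Num.truncn e^-1) => n mn.
rewrite invf_plt ?posrE ?ltr0n //; apply: lt_le_trans (truncnS_gt _) _.
by rewrite ler_nat.
Qed.

Lemma continuous_cl (f : T -> T) x e : continuous f -> 0 < e ->
  exists dl, 0 < dl /\ forall y, cl dl x y -> cl e (f x) (f y).
Proof.
move=> cf e0; have /nbhs_ballP[dl dl0 H] := cf x _ (nbhsx_ballx (f x) e e0).
by exists dl; split=> // y xy; have /ball_cl[] := H y (cl_ball dl0 xy).
Qed.

Lemma cube_point x : exists r, cube r x.
Proof.
exists (\sum_k `|x ord0 k|) => k; rewrite (bigD1 k) //= lerDl.
exact: sumr_ge0.
Qed.

Lemma continuous_ucb (f : T -> T) : continuous f -> ucb f.
Proof.
move=> cf; split=> [r e e0|r]; apply: contrapT.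
  move=> H.
  have /choice[u Hu] : forall n : nat, exists z : T * T,
      [/\ cube r z.1, cl n.+1%:R^-1 z.1 z.2 & ~ cl e (f z.1) (f z.2)].
    move=> n; apply: contrapT => Hn; apply: H; exists n.+1%:R^-1.
    split; first by rewrite invr_gt0 ltr0n.
    by move=> x y xr yr xy; apply: contrapT => nxy; apply: Hn; exists (x, y).
  have [x Hx] := @seq_cluster (fun n => (u n).1) r (fun n => let: And3 h _ _ := Hu n in h).
  have e2 : 0 < e / 2 by rewrite divr_gt0.
  have [dl [dl0 Hdl]] := continuous_cl x cf e2.
  have dl2 : 0 < dl / 2 by rewrite divr_gt0.
  have [m Hm] := inv_small dl2.
  have [n mn nx] := Hx _ m dl2; have [_ c1 nc] := Hu n.
  apply: nc; rewrite (splitr e); apply: (@cl_trans _ _ _ _ _ (f x)).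
    by apply/clC/Hdl/clC; apply: cl_le nx; lra.
  apply: Hdl; rewrite (splitr dl); apply: (@cl_trans _ _ _ _ _ (u n).1); first exact: clC.
  by apply: cl_le c1; exact: ltW (Hm n mn).
move=> H.
have /choice[u Hu] : forall n : nat, exists x, cube r x /\ ~ cube n%:R (f x).
  move=> n; apply: contrapT => Hn; apply: H; exists n%:R => x xr.
  by apply: contrapT => nx; apply: Hn; exists x.
have [x Hx] := @seq_cluster u r (fun n => (Hu n).1).
have [r0 Hr0] := cube_point (f x).
have [dl [dl0 Hdl]] := continuous_cl x cf (@ltr01 R).
have [n mn nx] := Hx _ (Num.truncn (r0 + 1)).+1 dl0; apply: (Hu n).2 => k.
have := Hdl _ (clC nx) k; have := Hr0 k.
have : r0 + 1 < n%:R by apply: lt_le_trans (truncnS_gt _) _; rewrite ler_nat.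
have := ler_normD (f x ord0 k) (f (u n) ord0 k - f x ord0 k).
by rewrite addrC subrK distrC; lra.
Qed.

Lemma hom_of_homeo (h g : T -> T) : continuous h -> continuous g -> cancel h g -> cancel g h ->
  exists p : @hom R d, hf p = h.
Proof. by move=> ch cg hK gK; exists (Hom (continuous_ucb ch) (continuous_ucb cg) hK gK). Qed.

Definition cclosed A := forall x, (forall e, 0 < e -> exists2 y, A y & cl e x y) -> A x.

Lemma cclosed_seq A (u : nat -> T) x m : cclosed A -> (forall n, (m <= n)%N -> A (u n)) ->
  (forall e k, 0 < e -> exists2 n, (k <= n)%N & cl e (u n) x) -> A x.
Proof.
move=> cA Au Hx; apply: cA => e e0; have [n mn nx] := Hx e m e0.
by exists (u n); [exact: Au|exact: clC].
Qed.

Lemma cclosed_im (p : @hom R d) A : cclosed A -> cclosed (im p A).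
Proof.
move=> cA x Hx; apply: cA => e e0.
have [r xr] := cube_point x.
have [dl [dl0 H]] := (hiu p).1 (r + 1) e e0.
have dl1 : 0 < Num.min dl 1 by rewrite lt_min dl0 ltr01.
have [y Ay xy] := Hx _ dl1; exists (hi p y) => //; apply: H.
- by move=> k; have := xr k; lra.
- move=> k; have := xr k; have := xy k; rewrite lt_min => /andP[_ h1].
  have := ler_normD (x ord0 k) (y ord0 k - x ord0 k).
  by rewrite addrC subrK distrC; lra.
- by apply: cl_le xy; rewrite ge_min lexx.
Qed.

Lemma cclosed_union (l : seq (set T)) : (forall A, List.In A l -> cclosed A) ->
  cclosed [set x | exists2 A, List.In A l & A x].
Proof.
elim: l => [|A l IH] cl_ x Hx; first by have [y [B []]] := Hx 1 ltr01.
have [Ax|nAx] := pselect (A x); first by exists A => //; left.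
have [e [e0 He]] : exists e, 0 < e /\ forall y, A y -> ~ cl e x y.
  apply: contrapT => H; apply: nAx; apply: cl_ => [|e e0]; first by left.
  apply: contrapT => H'; apply: H; exists e; split=> // y Ay xy.
  by apply: H'; exists y.
have [B Bl Bx] : [set x | exists2 A, List.In A l & A x] x.
  apply: IH => [B Bl|e' e'0]; first by apply: cl_; right.
  have m0 : 0 < Num.min e e' by rewrite lt_min e0.
  have [y [B [<-|Bl] By] xy] := Hx _ m0.
    by case: (He y By); apply: cl_le xy; rewrite ge_min lexx.
  by exists y; [exists B|apply: cl_le xy; rewrite ge_min lexx orbT].
by exists B => //; right.
Qed.

Lemma cclosed_compact A r : A `<=` cube r -> cclosed A -> compact A.
Proof.
move=> Ar cA; apply: (subclosed_compact _ (@cube_compact r) Ar) => x Hx.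
apply: cA => e e0; have [y [Ay /ball_cl[_ xy]]] := Hx _ (nbhsx_ballx x e e0).
by exists y.
Qed.

Lemma cclosed_sep A B r : A `<=` cube r -> cclosed A -> cclosed B -> (forall x, A x -> B x -> False) ->
  exists e, 0 < e /\ forall x y, A x -> B y -> ~ cl e x y.
Proof.
move=> Ar cA cB AB; apply: contrapT => H.
have /choice[u Hu] : forall n : nat, exists z : T * T, [/\ A z.1, B z.2 & cl n.+1%:R^-1 z.1 z.2].
  move=> n; apply: contrapT => Hn; apply: H; exists n.+1%:R^-1.
  split; first by rewrite invr_gt0 ltr0n.
  by move=> x y Ax By xy; apply: Hn; exists (x, y).
have [x Hx] := @seq_cluster (fun n => (u n).1) r (fun n => let: And3 h _ _ := Hu n in Ar _ h).
apply: (AB x); first by apply: (@cclosed_seq _ (fun n => (u n).1) x 0 cA) => // n _; have [] := Hu n.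
apply: cB => e e0; have e2 : 0 < e / 2 by rewrite divr_gt0.
have [m Hm] := inv_small e2; have [n mn nx] := Hx _ m e2; have [_ Bn un] := Hu n.
exists (u n).2 => //; rewrite (splitr e); apply: cl_trans (clC nx) _.
by apply: cl_le un; exact: ltW (Hm n mn).
Qed.

Lemma list_uniform (I : Type) (l : seq I) (P : I -> R -> Prop) :
  (forall i e e', P i e -> 0 < e' -> e' <= e -> P i e') ->
  (forall i, List.In i l -> exists e, 0 < e /\ P i e) -> exists e, 0 < e /\ forall i, List.In i l -> P i e.
Proof.
move=> mono; elim: l => [|i l IH] H; first by exists 1.
have [e1 [e10 H1]] := H i (or_introl erefl).
have [e2 [e20 H2]] := IH (fun j jl => H j (or_intror jl)).
have m0 : 0 < Num.min e1 e2 by rewrite lt_min e10.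
exists (Num.min e1 e2); split=> // j [<-|jl].
  by apply: mono H1 m0 _; rewrite ge_min lexx.
by apply: mono (H2 j jl) m0 _; rewrite ge_min lexx orbT.
Qed.

(** Uniform zero-dimensionality: [E] relates points of the same cluster, clusters are smaller than
    [eta], and points of X closer than [dl] share a cluster. *)
Definition chain_zd X := forall eta : R, 0 < eta -> exists (E : T -> T -> Prop) (dl : R), [/\ 0 < dl,
  forall x y z, E x y -> E y z -> E x z, forall x y, E x y -> cl eta x y &
  forall x y, X x -> X y -> cl dl x y -> E x y].

(** A case of the sum theorem of dimension theory; X and Y may meet. [XU] collects the clusters of X
    near [x], and [YU] the clusters of Y near [x] or near [XU]. The latter are far smaller than the
    gap [dl] of X, so they lead to no new clusters of X away from [x]. *)
Lemma chain_zd_union X Y x y : chain_zd X -> chain_zd Y -> (X `|` Y) x -> x <> y ->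
  exists (Q : set T) dl, [/\ 0 < dl, Q x, ~ Q y &
    forall z z', (X `|` Y) z -> (X `|` Y) z' -> cl dl z z' -> Q z -> Q z'].
Proof.
move=> zX zY Cx xy.
have [eta [eta0 neta]] : exists eta, 0 < eta /\ ~ cl eta x y.
  have [k /eqP xk] : exists k, x ord0 k <> y ord0 k.
    by apply: contrapT => H; apply: xy; apply/rowP => k; apply: contrapT => nk; apply: H; exists k.
  exists `|x ord0 k - y ord0 k|; split; first by rewrite normr_gt0 subr_eq0.
  by move=> /(_ k); rewrite ltxx.
have [E [dl1 [dl10 Et Ecl clE]]] := zX (eta / 4) ltac:(by rewrite divr_gt0).
pose dl := Num.min dl1 (eta / 4).
have dl0 : 0 < dl by rewrite lt_min dl10 divr_gt0.
have dlE : dl <= dl1 by rewrite ge_min lexx.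
have dle : dl <= eta / 4 by rewrite ge_min lexx orbT.
pose XU z := X z /\ exists w, [/\ X w, E z w & cl (eta / 4) w x].
have XUcl z : XU z -> cl (eta / 2) z x.
  move=> [_ [w [_ /Ecl zw wx]]]; rewrite (_ : eta / 2 = eta / 4 + eta / 4); last by field.
  exact: cl_trans zw wx.
have XUs z z' : X z' -> cl dl z' z -> XU z -> XU z'.
  move=> Xz' zz [Xz [w [Xw zw wx]]]; split=> //; exists w; split=> //.
  by apply: Et zw; apply: clE => //; apply: cl_le zz.
have XUx z : X z -> cl (eta / 4) z x -> XU z.
  by move=> Xz zx; split=> //; exists z; split=> //; apply: clE => //; exact: cl_refl.
pose et := Num.min (dl / 3) (eta / 16).
have et0 : 0 < et by rewrite lt_min !divr_gt0.
have et1 : et <= dl / 3 by rewrite ge_min lexx.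
have et2 : et <= eta / 16 by rewrite ge_min lexx orbT.
have [E' [dl2 [dl20 E't E'cl clE']]] := zY et et0.
pose YU z := Y z /\ exists w, [/\ Y w, E' z w &
  (exists2 u, XU u & cl (dl / 3) w u) \/ cl (eta / 8) w x].
have YUcl z : YU z -> (exists2 u, XU u & cl (dl * 2 / 3) z u) \/ cl (eta * 3 / 16) z x.
  move=> [_ [w [_ /E'cl zw [[u Uu wu]|wx]]]]; [left; exists u => //|right].
    by apply: cl_le (cl_trans zw wu); lra.
  by apply: cl_le (cl_trans zw wx); lra.
have YUs z z' : Y z' -> cl dl2 z' z -> YU z -> YU z'.
  move=> Yz' zz [Yz [w [Yw zw H]]]; split=> //; exists w; split=> //.
  by apply: E't zw; apply: clE'.
have YUr z : Y z -> (exists2 u, XU u & cl (dl / 3) z u) \/ cl (eta / 8) z x -> YU z.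
  by move=> Yz H; split=> //; exists z; split=> //; apply: clE' => //; exact: cl_refl.
pose D := Num.min dl2 et.
have D0 : 0 < D by rewrite lt_min dl20.
have D1 : D <= dl2 by rewrite ge_min lexx.
have D2 : D <= et by rewrite ge_min lexx orbT.
exists (XU `|` YU), D; split=> //.
- have e4 : 0 < eta / 4 by rewrite divr_gt0.
  have e8 : 0 < eta / 8 by rewrite divr_gt0.
  case: Cx => [Xx|Yx]; first by left; apply: XUx Xx _; exact: cl_refl.
  by right; apply: YUr Yx _; right; exact: cl_refl.
- move=> [/XUcl yx|/YUcl[[u /XUcl ux yu]|yx]]; apply: neta; apply: clC.
  + by apply: cl_le yx; lra.
  + by apply: cl_le (cl_trans yu ux); lra.
  + by apply: cl_le yx; lra.
- move=> z z' Cz Cz' /clC zz [Uz|Uz]; case: Cz' => [Xz'|Yz'].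
  + by left; apply: XUs Uz => //; apply: cl_le zz; lra.
  + by right; apply: YUr Yz' _; left; exists z => //; apply: cl_le zz; lra.
  + left; case: (YUcl z Uz) => [[u Uu zu]|zx].
      by apply: XUs Uu => //; apply: cl_le (cl_trans zz zu); lra.
    by apply: XUx Xz' _; apply: cl_le (cl_trans zz zx); lra.
  + by right; apply: YUs Uz => //; apply: cl_le zz; lra.
Qed.

(** * Cantor schemes and their limit sets *)

Record scheme (r : R) (pc : nat -> seq (set T)) : Prop := Scheme {
  scheme_nest : forall n B, List.In B (pc n.+1) -> exists2 B', List.In B' (pc n) & B `<=` B';
  scheme_diam : forall n B x y, List.In B (pc n.+1) -> B x -> B y -> cl n.+1%:R^-1 x y;
  scheme_two : forall n B, List.In B (pc n) -> exists B1 B2, [/\ List.In B1 (pc n.+1), List.In B2 (pc n.+1),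
    B1 `<=` B, B2 `<=` B & forall x, B1 x -> B2 x -> False];
  scheme_ne : forall n B, List.In B (pc n) -> B !=set0;
  scheme_closed : forall n B, List.In B (pc n) -> cclosed B;
  scheme_disj : forall n B B' x, List.In B (pc n) -> List.In B' (pc n) -> B x -> B' x -> B = B';
  scheme_cube : forall n B, List.In B (pc n) -> B `<=` cube r;
  scheme_top : exists B, List.In B (pc 0%N) }.

Section Scheme.
Context (r : R) (pc : nat -> seq (set T)) (sch : scheme r pc).

Definition level n : set T := [set x | exists2 B, List.In B (pc n) & B x].
Definition attractor : set T := [set x | forall n, level n x].

Lemma level_closed n : cclosed (level n).
Proof. by apply: cclosed_union => B; exact: (scheme_closed sch). Qed.

Lemma level_cube n : level n `<=` cube r.
Proof. by move=> x [B /(scheme_cube sch) H /H]. Qed.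

Lemma level_le m n : (m <= n)%N -> level n `<=` level m.
Proof.
move=> /subnKC <-; elim: (n - m)%N => [|k IH] x; first by rewrite addn0.
rewrite addnS => -[B Bl Bx]; apply: IH.
by have [B' B'l BB] := scheme_nest sch Bl; exists B' => //; exact: BB.
Qed.

Lemma attractor_closed : cclosed attractor.
Proof.
move=> x Hx n; apply: level_closed => e e0.
by have [y Xy xy] := Hx e e0; exists y.
Qed.

Lemma attractor_piece n B : List.In B (pc n) -> exists2 x, attractor x & B x.
Proof.
move=> Bl.
pose P (a b : nat * set T) := List.In a.2 (pc a.1) ->
  [/\ b.1 = a.1.+1, List.In b.2 (pc b.1) & b.2 `<=` a.2].
have /choice[nx Hnx] : forall a, exists b, P a b.
  (* Off the scheme the successor is a default value, for which [P] holds vacuously. *)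
  move=> [k D]; have [Dl|nD] := pselect (List.In D (pc k)); last by exists (k, D).
  have [B1 [_ [B1l _ BD _ _]]] := scheme_two sch Dl.
  by exists (k.+1, B1).
pose sq := fun k => iter k nx (n, B).
have sqP k : (sq k).1 = (n + k)%N /\ List.In (sq k).2 (pc (sq k).1).
  elim: k => [|k [IH1 IH2]]; first by rewrite addn0.
  by have [E El _] := Hnx _ IH2; split=> //; rewrite /sq iterS -/(sq k) E IH1 addnS.
have sqS k j : (sq (k + j)%N).2 `<=` (sq k).2.
  elim: j => [|j IH]; first by rewrite addn0.
  by rewrite addnS => x /= Hx; apply: IH; have [_ _] := Hnx _ (sqP (k + j)%N).2; apply.
have /choice[u Hu] : forall k, exists x, (sq k).2 x by move=> k; exact: (scheme_ne sch (sqP k).2).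
have ur k : cube r (u k) by exact: (scheme_cube sch (sqP k).2).
have [x Hx] := seq_cluster ur.
have xk k : (sq k).2 x.
  apply: (@cclosed_seq _ u x k) Hx; first exact: (scheme_closed sch (sqP k).2).
  by move=> j kj; have := sqS k (j - k)%N (u j); rewrite subnKC //; apply.
exists x; last exact: (xk 0%N).
move=> m; apply: (level_le (leq_addl n m)); exists (sq m).2; last exact: xk.
by have [<-] := sqP m.
Qed.

Lemma attractor_ne : attractor !=set0.
Proof. by have [B /attractor_piece[x Xx _]] := scheme_top sch; exists x. Qed.

Lemma attractor_perfect x e : attractor x -> 0 < e -> exists y, [/\ attractor y, y <> x & cl e x y].
Proof.
move=> Xx e0; have [n /(_ n (leqnn _)) ne] := inv_small e0.
have [B Bl Bx] := Xx n.+1.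
have [B1 [B2 [B1l B2l B1B B2B dis]]] := scheme_two sch Bl.
have [y1 Xy1 By1] := attractor_piece B1l; have [y2 Xy2 By2] := attractor_piece B2l.
have near y : B y -> cl e x y by move=> By; apply: cl_le (scheme_diam sch Bl Bx By); exact: ltW.
have [E|ne1] := pselect (y1 = x); last by exists y1; split=> //; apply: near; exact: B1B.
exists y2; split=> //; last by apply: near; exact: B2B.
by move=> E2; apply: (dis x); [rewrite -E|rewrite -E2].
Qed.

Lemma pieces_gap n : exists e, 0 < e /\ forall B B' x y, List.In B (pc n) -> List.In B' (pc n) ->
  B x -> B' y -> cl e x y -> B = B'.
Proof.
have [e [e0 H]] : exists e, 0 < e /\ forall B, List.In B (pc n) -> forall B', List.In B' (pc n) ->
    forall x y, B x -> B' y -> cl e x y -> B = B'.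
  apply: (@list_uniform _ (pc n) (fun B e => forall B', List.In B' (pc n) ->
    forall x y, B x -> B' y -> cl e x y -> B = B')).
    by move=> B e e' H e'0 ee B' B'l x y Bx By xy; apply: (H B' B'l x y Bx By); exact: cl_le xy.
  move=> B Bl.
  apply: (@list_uniform _ (pc n) (fun B' e => forall x y, B x -> B' y -> cl e x y -> B = B')).
    by move=> B' e e' H e'0 ee x y Bx By xy; apply: (H x y Bx By); exact: cl_le xy.
  move=> B' B'l; have [->|BB] := pselect (B = B'); first by exists 1.
  have [e [e0 He]] := @cclosed_sep B B' r (scheme_cube sch Bl) (scheme_closed sch Bl)
    (scheme_closed sch B'l) (fun x h1 h2 => BB (scheme_disj sch Bl B'l h1 h2)).
  by exists e; split=> // x y Bx By /(He x y Bx By).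
by exists e; split=> // B B' x y Bl B'l; exact: H.
Qed.

Lemma attractor_zd : chain_zd attractor.
Proof.
move=> eta eta0; have [n /(_ n (leqnn _)) ne] := inv_small eta0.
have [dl [dl0 gap]] := pieces_gap n.+1.
exists (fun x y => exists B, [/\ List.In B (pc n.+1), B x & B y]), dl; split=> //.
- move=> x y z [B [Bl Bx By]] [B' [B'l By' Bz]]; exists B; split=> //.
  by rewrite (scheme_disj sch Bl B'l By By').
- by move=> x y [B [Bl Bx By]]; apply: cl_le (scheme_diam sch Bl Bx By); exact: ltW.
- move=> x y /(_ n.+1)[B Bl Bx] /(_ n.+1)[B' B'l By] xy; exists B; split=> //.
  by rewrite (gap B B' x y).
Qed.

End Scheme.

Lemma attractors_cantor r r' pc pc' : scheme r pc -> scheme r' pc' ->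
  cantor_subset (attractor pc `|` attractor pc').
Proof.
move=> sc sc'.
have cpt r0 pc0 : scheme r0 pc0 -> compact (attractor pc0).
  move=> sc0; apply: (@cclosed_compact _ r0); last exact: (attractor_closed sc0).
  by move=> x /(_ 0%N) /(level_cube sc0).
split.
- by have [x Xx] := attractor_ne sc; exists x; left.
- by apply: compactU; [exact: cpt sc|exact: cpt sc'].
- move=> x e [Xx|Xx] e0.
    by have [y [Xy yx xy]] := attractor_perfect sc Xx e0; exists y; split=> //; [left|exact: cl_ball].
  by have [y [Xy yx xy]] := attractor_perfect sc' Xx e0; exists y; split=> //; [right|exact: cl_ball].
- move=> x y Cx _ xy.
  have [Q [dl [dl0 Qx nQy HQ]]] := chain_zd_union (attractor_zd sc) (attractor_zd sc') Cx xy.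
  by exists Q, dl; split=> // z z' Cz Cz' /ball_cl[_ zz]; exact: HQ.
Qed.

(** By compactness, points common to all pairs of stages would cluster at a common point of the
    limit sets. Disjoint compact stages then have positive distance. *)
Lemma attractors_sep (h : @hom R d) r r' pc pc' : scheme r pc -> scheme r' pc' ->
  (forall x, attractor pc x -> attractor pc' (h x) -> False) ->
  exists n e, 0 < e /\ forall x y, level pc n x -> level pc' n y -> ~ cl e (h x) y.
Proof.
move=> sc sc' dis.
have [n Hn] : exists n, forall x, level pc n x -> level pc' n (h x) -> False.
  apply: contrapT => H.
  have /choice[u Hu] : forall n : nat, exists x, level pc n x /\ level pc' n (h x).
    move=> n; apply: contrapT => Hn; apply: H; exists n => x h1 h2.
    by apply: Hn; exists x.
  have ur n : cube r (u n) by apply: (level_cube sc (n := n)); exact: (Hu n).1.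
  have [x Hx] := seq_cluster ur.
  apply: (dis x) => m.
    apply: (@cclosed_seq _ u x m) Hx; first exact: (level_closed sc).
    by move=> n mn; apply: (level_le sc mn); exact: (Hu n).1.
  rewrite -[h x]/(hi (hom_inv h) x).
  apply: (@cclosed_seq (im (hom_inv h) (level pc' m)) u x m) Hx.
    by apply: cclosed_im; exact: (level_closed sc').
  by move=> n mn; apply: (level_le sc' mn); exact: (Hu n).2.
have [r1 Hr1] := (hfu h).2 r.
have [e [e0 He]] := @cclosed_sep (im h (level pc n)) (level pc' n) r1
  ltac:(by move=> x /imP[y Ly ->]; apply: Hr1; exact: (level_cube sc (n := n)))
  (cclosed_im (@level_closed _ _ sc n)) (@level_closed _ _ sc' n)
  ltac:(by move=> x /imP[y Ly ->]; exact: Hn).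
exists n, e; split=> // x y Lx Ly; apply: He => //; exact: im_f.
Qed.

End Compactness.

(** * The sticky set *)

Section Necklace.
Context {R : realType} {d : nat} (d4 : (4 <= d)%N) (s t : 'I_d) (st : s != t).
Notation T := 'rV[R]_d.
Notation homT := (@hom R d).
Notation Fr0 := (@Fr0 R d t).
Notation tree := (@tree R d s t).
Notation un := (@un R d t).
Implicit Types (x y : T) (p q : homT).

Let n100 : (100 : R) != 0. Proof. by rewrite pnatr_eq0. Qed.

(** The walls outside the (s, t)-plane, at distance 7/8, move beyond 87, out of reach of the torus.
    The plane itself, which contains the meridian, is fixed. *)
Definition spread : homT :=
  chom (fun k => if (k == s) || (k == t) then lip_id else lip_aff 0 n100).

Lemma spreadE x k : spread x ord0 k = if (k == s) || (k == t) then x ord0 k else 100 * x ord0 k.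
Proof. by rewrite chomE; case: ifP => //= _; rewrite addr0. Qed.

Definition tight x := [/\ `|x ord0 t| <= 1, `|x ord0 s| <= 1 &
  7 / 8 <= `|x ord0 s| \/ exists k, [/\ k != s, k != t & 87 <= `|x ord0 k|]].

Lemma spread_tight x : Fr0 x -> tight (spread x).
Proof.
move=> [x1 xh]; rewrite /tight !spreadE !eqxx orbT /=; split=> //.
have [k [kt xk]] : exists k, k != t /\ 7 / 8 <= `|x ord0 k|.
  apply: contrapT => H; apply: xh => k kt; rewrite ltNge; apply/negP => xk.
  by apply: H; exists k.
have [E|ks] := eqVneq k s; first by left; rewrite -E.
right; exists k; split=> //; rewrite spreadE (negbTE ks) (negbTE kt) /= normrM ger0_norm //.
lra.
Qed.

Lemma spread_cube x : Fr0 x -> cube 100 (spread x).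
Proof.
move=> [x1 _] k; rewrite spreadE; have := x1 k; case: ifP => _; first lra.
by rewrite normrM ger0_norm //; lra.
Qed.

Lemma tight_near x y : cl (1 / 8) y x -> tight x -> longfr s t y.
Proof.
have tri k : cl (1 / 8) y x -> `|x ord0 k| - 1 / 8 <= `|y ord0 k| <= `|x ord0 k| + 1 / 8.
  move=> /(_ k) H.
  have := ler_normD (x ord0 k) (y ord0 k - x ord0 k); rewrite addrC subrK => h1.
  have := ler_normD (y ord0 k) (x ord0 k - y ord0 k); rewrite addrC subrK distrC => h2.
  lra.
move=> yx [xt xs H]; have := tri t yx; have := tri s yx => h1 h2; split; try lra.
case: H => [H|[k [ks kt H]]]; [left; lra|right; exists k; split=> //].
by have := tri k yx; lra.
Qed.

Lemma mem_In (I : eqType) (i : I) (l : seq I) : i \in l -> List.In i l.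
Proof. by elim: l => //= j l IH; rewrite inE => /orP[/eqP ->|/IH]; [left|right]. Qed.

Lemma Fr0_closed : cclosed Fr0.
Proof.
move=> x Hx; split=> [k|H].
  rewrite leNgt; apply/negP => xk.
  have e0 : 0 < `|x ord0 k| - 1 by rewrite subr_gt0.
  have [y [y1 _] /(_ k) xy] := Hx _ e0.
  have := ler_normD (y ord0 k) (x ord0 k - y ord0 k); rewrite addrC subrK.
  by have := y1 k; lra.
have [e [e0 He]] : exists e : R, 0 < e /\ forall k, List.In k (enum 'I_d) -> k != t -> `|x ord0 k| + e <= 7 / 8.
  apply: (@list_uniform R _ _ (fun k e => k != t -> `|x ord0 k| + e <= 7 / 8)).
    by move=> k e e' H1 e'0 ee /H1; lra.
  move=> k _; have [->|kt] := eqVneq k t; first by exists 1.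
  by exists (7 / 8 - `|x ord0 k|); have := H k kt; split=> [|_]; lra.
have [y [_ yh] xy] := Hx _ e0; apply: yh => k kt.
have := He k (mem_In (mem_enum _ k)) kt; have := xy k; rewrite distrC.
have := ler_normD (x ord0 k) (y ord0 k - x ord0 k); rewrite addrC subrK; lra.
Qed.

Lemma Fr0_point : Fr0 (const_mx 1).
Proof.
split=> [k|/(_ s st)]; first by rewrite mxE normr1.
by rewrite mxE normr1; lra.
Qed.

Definition refines (n : nat) (l l' : seq homT) := [/\ tree l',
  forall q, List.In q l' -> exists2 p, List.In p l & im q Fr0 `<=` im p Fr0,
  forall q, List.In q l' -> forall x y, Fr0 x -> Fr0 y -> cl n.+1%:R^-1 (spread (q x)) (spread (q y)) &
  forall p, List.In p l -> exists q1 q2, [/\ List.In q1 l', List.In q2 l', im q1 Fr0 `<=` im p Fr0,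
    im q2 Fr0 `<=` im p Fr0 & forall x, im q1 Fr0 x -> im q2 Fr0 x -> False]].

Lemma refines_exists n l : tree l -> exists l', refines n l l'.
Proof.
move=> tl; have n0 : 0 < n.+1%:R^-1 :> R by rewrite invr_gt0 ltr0n.
pose F p l' := [/\ tree l',
  forall q, List.In q l' -> forall x y, Fr0 x -> Fr0 y -> cl n.+1%:R^-1 (spread (p (q x))) (spread (p (q y))) &
  exists q1 q2, [/\ List.In q1 l', List.In q2 l' & forall x, im q1 Fr0 x -> im q2 Fr0 x -> False]].
have FE p : List.In p l -> exists l', tree l' /\ F p l'.
  by move=> _; have [l' [t' h1 h2]] := shrink d4 st (hcomp spread p) n0; exists l'.
have sub l' p q r : tree l' -> List.In q l' -> is_comp r p q -> im r Fr0 `<=` im p Fr0.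
  move=> t' ql' rE; rewrite (is_comp_im _ rE); apply: imS => x; exact: (tree_sub d4 st t' ql').
have [l'' [tl'' H1 H2]] := graft tl FE.
exists l''; split=> //.
- move=> r /H1[p [l' [q [pl [t' _ _] ql' rE]]]]; exists p => //; exact: sub t' ql' rE.
- move=> r /H1[p [l' [q [pl [_ D _] ql' rE]]]] x y Fx Fy; rewrite !rE; exact: D.
- move=> p /H2[l' [t' _ [q1 [q2 [q1l q2l dis]]]] Hq].
  have [r1 r1l rE1] := Hq _ q1l; have [r2 r2l rE2] := Hq _ q2l.
  exists r1, r2; split=> //; [exact: sub t' q1l rE1|exact: sub t' q2l rE2|].
  by move=> x; rewrite (is_comp_im _ rE1) (is_comp_im _ rE2); exact: dis.
Qed.

Definition pieces (l : seq homT) : seq (set T) := map (fun p => im spread (im p Fr0)) l.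

Lemma piecesP l B : List.In B (pieces l) -> exists2 p, List.In p l & B = im spread (im p Fr0).
Proof. by move=> /List.in_map_iff[p [<- pl]]; exists p. Qed.

Lemma In_pieces l p : List.In p l -> List.In (im spread (im p Fr0)) (pieces l).
Proof. by move=> pl; apply/List.in_map_iff; exists p. Qed.

Lemma level_pieces (ls : nat -> seq homT) n : level (fun m => pieces (ls m)) n = im spread (un (ls n)).
Proof.
apply/seteqP; split=> x; first by move=> [B /piecesP[p pl ->] Bx]; exists p.
by move=> [p pl px]; exists (im spread (im p Fr0)) => //; exact: In_pieces.
Qed.

Lemma necklace : exists ls : nat -> seq homT, (forall n, tree (ls n)) /\ scheme 100 (fun n => pieces (ls n)).
Proof.
have /choice[nx Hnx] : forall a : nat * seq homT, exists l', tree a.2 -> refines a.1 a.2 l'.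
  move=> [n l]; have [tl|nt] := pselect (tree l); last by exists [::].
  by have [l' Hl] := refines_exists n tl; exists l'.
pose ls := fix ls n := if n is m.+1 then nx (m, ls m) else [:: hom_id].
have tls n : tree (ls n).
  by elim: n => [|n IH]; [exact: tleaf|have [] := Hnx (n, ls n) IH].
have ref n : refines n (ls n) (ls n.+1) by exact: (Hnx (n, ls n) (tls n)).
exists ls; split=> //; split.
- move=> n B /piecesP[q ql ->]; have [_ H _ _] := ref n.
  by have [p pl qp] := H q ql; exists (im spread (im p Fr0)); [exact: In_pieces|exact: imS].
- move=> n B x y /piecesP[q ql ->] /imP[_ /imP[a Fa ->] ->] /imP[_ /imP[b Fb ->] ->].
  by have [_ _ H _] := ref n; exact: H.
- move=> n B /piecesP[p pl ->]; have [_ _ _ H] := ref n.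
  have [q1 [q2 [q1l q2l s1 s2 dis]]] := H p pl.
  exists (im spread (im q1 Fr0)), (im spread (im q2 Fr0)).
  split; [exact: In_pieces|exact: In_pieces|exact: imS|exact: imS|].
  by move=> x; exact: dis.
- move=> n B /piecesP[p pl ->]; exists (spread (p (const_mx 1))).
  by do 2 apply: im_f; exact: Fr0_point.
- by move=> n B /piecesP[p pl ->]; do 2 apply: cclosed_im; exact: Fr0_closed.
- move=> n B B' x /piecesP[p pl ->] /piecesP[q ql ->] Bx Bx'.
  by rewrite (tree_disj d4 st (tls n) pl ql Bx Bx').
- move=> n B /piecesP[p pl ->] x /imP[y py ->]; apply: spread_cube.
  exact: (tree_sub d4 st (tls n) pl py).
- by have [p pl] := tree_nonempty (tls 0%N); exists (im spread (im p Fr0)); exact: In_pieces.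
Qed.

Lemma spread_linked l : tree l -> [/\ Good (im spread (un l)), Det 0 (mu s t) (im spread (un l)) &
  forall x, im spread (un l) x -> tight x].
Proof.
move=> /(tree_linked d4 st)[uF gu du]; split; first exact: Good_im.
  apply: Det_fix du => x x0; apply/rowP => k; rewrite spreadE.
  case: ifP => // /negbT; rewrite negb_or => /andP[ks kt].
  by rewrite x0 // mulr0.
by move=> x /imP[y /uF Fy ->]; exact: spread_tight.
Qed.

End Necklace.

Lemma rV_hausdorff {R : realType} {d : nat} : hausdorff_space 'rV[R]_d.
Proof.
move=> x y xy; apply/rowP => k; apply: contrapT => /eqP nk.
have e0 : 0 < `|x ord0 k - y ord0 k| / 2 by rewrite divr_gt0 // normr_gt0 subr_eq0.
have [z [/ball_cl[_ /(_ k) xz] /ball_cl[_ /(_ k) yz]]] := xy _ _ (nbhsx_ballx x _ e0) (nbhsx_ballx y _ e0).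
have := ler_distD (z ord0 k) (x ord0 k) (y ord0 k).
by rewrite [`|z ord0 k - _|]distrC; lra.
Qed.

Lemma enorm_cl {R : realType} {d : nat} (x y : 'rV[R]_d) (e : R) : enorm (x - y) < e -> cl e x y.
Proof.
move=> H k; apply: le_lt_trans H.
rewrite (_ : x ord0 k - y ord0 k = (x - y) ord0 k); last by rewrite !mxE.
rewrite -sqrtr_sqr; apply: ler_wsqrtr; rewrite (bigD1 k) //= lerDl.
by apply: sumr_ge0 => i _; exact: sqr_ge0.
Qed.

Theorem theorem1 (R : realType) (d : nat) (hd : (4 <= d)%N) :
  exists C : set 'rV[R]_d, is_cantor_set C /\ sticky C.
Proof.
pose s : 'I_d := Ordinal (leq_trans (isT : (0 < 4)%N) hd).
pose t : 'I_d := Ordinal (leq_trans (isT : (1 < 4)%N) hd).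
pose s' : 'I_d := Ordinal (leq_trans (isT : (2 < 4)%N) hd).
pose t' : 'I_d := Ordinal (leq_trans (isT : (3 < 4)%N) hd).
have st : s != t by []. have st' : s' != t' by [].
have [ls [tls sc]] := @necklace R d hd s t st.
have [ls' [tls' sc']] := @necklace R d hd s' t' st'.
exists (attractor (fun n => pieces s t (ls n)) `|` attractor (fun n => pieces s' t' (ls' n))); split.
  apply: cantor_subset_homeo; [exact: Rhausdorff|exact: rV_hausdorff| |].
    exact: middle_thirds_cantor_subset.
  exact: attractors_cantor sc sc'.
(* A motion below 1/8 turns [tight] sets into [longfr] sets, and the segments from the pulled back
   meridian to the meridian still miss the tight ones. *)
exists (1 / 8); split; first lra.
move=> [H [[_ [_ iH]] [Hs dis]]].
have i1 : 0 <= (1 : R) <= 1 by rewrite lexx ler01.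
have [g [cH [cg [Hg gH]]]] := iH 1 i1.
have [h hE] := hom_of_homeo cH cg Hg gH.
have hs x : cl (1 / 8) (h x) x by rewrite hE; apply: enorm_cl; exact: Hs.
have [n [e [e0 sep]]] : exists n e, 0 < e /\ forall x y,
    level (fun n => pieces s t (ls n)) n x -> level (fun n => pieces s' t' (ls' n)) n y -> ~ cl e (h x) y.
  apply: attractors_sep sc sc' _ => x Xx Yx.
  suff : (H 1 @` (attractor (fun n => pieces s t (ls n)) `|` attractor (fun n => pieces s' t' (ls' n)))
    `&` (attractor (fun n => pieces s t (ls n)) `|` attractor (fun n => pieces s' t' (ls' n)))) (h x).
    by rewrite dis.
  by split; [exists x; [left|rewrite hE]|right].
rewrite !level_pieces in sep.
have [gA dA tA] := spread_linked hd st (tls n).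
have [gB dB tB] := spread_linked hd st' (tls' n).
apply: (torus_contra (s := s) (t := t) (s' := s') (t' := t') _ _ _ _ _ _ e0 _ (Good_im h gA) gB _ _ _ dB) => //.
- by move=> x y /imP[z Az ->]; exact: sep.
- by move=> x /imP[z Az ->]; apply: tight_near (hs z) (tA z Az).
- by move=> x /tB; apply: tight_near; apply: cl_refl; lra.
- exact: Det_push hs tA dA.
Qed.
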